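(* Let $r>1$ and suppose $\|\phi_j\|_{W^{1,\infty}(D)}\le C_{\rm KL}\,j^{-r}$ for all $j\in\mathbb{N}$. Assume $h_\ell\simeq 2^{-\ell}$ and $\#\mathcal{T}_\ell\simeq 2^{d\ell}$. Choose $m_j:=\lceil 4j\rceil$ and $s_\nu:=\lceil 2^{\nu/(r-1)}\rceil$, and let $Q^{(\nu)}_m$ be the symmetrized Monte Carlo rule. For $N\in\{0,1,2,\dots\}$ let $$G_N:=\sum_{\ell,\nu\ge 0,\ \ell+\nu\le N}Q^{(\nu)}_{m_{N-\ell-\nu}}\big(G(D_\ell^\nu)\big),\qquad E_N:=\sqrt{\mathbb{E}_{\rm MC}|\mathbb{E}(G(u))-G_N|^2},$$ and let $C_N^{\rm symm}$ be the number of computational operations necessary to compute $G_N$, given by the cost model $$C_N^{\rm symm}\simeq\sum_{j,\ell,\nu\ge 0,\ j+\ell+\nu\le N}2^{m_j}\,2^{d\ell}\,s_\nu .$$ Then there is a constant $C>0$ independent of $N$ such that for all $N$ $$E_N\le C\,(N+1)^2\,2^{-2N}\,\|f\|_{L^2(D)}\|g\|_{L^2(D)},$$ and $$C_N^{\rm symm}\le C\,2^{\max\{4,\,d,\,\frac{1}{r-1}\}N}.$$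
   Context: Let $D\subset\mathbb{R}^d$, $d\in\{2,3\}$, be a bounded Lipschitz domain, $f,g\in L^2(D)$, $G(v):=\int_D g v\,dx$. The symbol $\simeq$ denotes equality up to multiplicative constants independent of the level parameters. Random coefficient: $\Omega=[-1/2,1/2]^{\mathbb{N}}$ with the product of the uniform measures, expectation $\mathbb{E}$. Let $\phi_j\in W^{1,\infty}(D)$ ($j\ge0$), $\mathrm{ess\,inf}_{x\in D}\phi_0(x)>0$, and $$A^\nu(x,\omega)=\phi_0(x)+\sum_{j=1}^{s_\nu}\omega_j\phi_j(x),\qquad A(x,\omega)=A^\infty(x,\omega)=\phi_0(x)+\sum_{j=1}^\infty\omega_j\phi_j(x),$$ the series converging absolutely in $W^{1,\infty}(D)$ for all $\omega\in\Omega$, with $\lim_{\nu\to\infty}\|A-A^\nu\|_{L^\infty(\Omega;W^{1,\infty}(D))}=0$. There are constants $0<A_{\min}\le1$, $A_{\max}<\infty$ with $A_{\min}\le A^\nu(x,\omega)\le A_{\max}$ for all $\nu\in\mathbb{N}_0\cup\{\infty\}$, and the bilinear forms $a^\nu_\omega(w,v):=\int_D A^\nu(x,\omega)\nabla w\cdot\nabla v\,dx$ satisfy $a^\nu_\omega(w,w)\ge A_{\min}\|w\|_{H^1(D)}^2$ and $|a^\nu_\omega(w,v)|\le A_{\max}\|w\|_{H^1(D)}\|v\|_{H^1(D)}$ on $H^1_0(D)$. Finite elements: $\mathcal{X}_0\subseteq\mathcal{X}_1\subseteq\dots\subset H^1_0(D)$ are finite element spaces on nested triangulations $\mathcal{T}_\ell$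 of $D$, with a monotone sequence $h_\ell>0$, $h_\ell\to0$, $h_{\ell+1}\ge C_{\rm unif}h_\ell$, $C_{\rm unif}>0$, and $\inf_{v\in\mathcal{X}_\ell}\|w-v\|_{H^1(D)}\le C_{\rm approx}h_\ell\|w\|_{H^2(D)}$ for all $w\in H^2(D)\cap H^1_0(D)$. Let $u^\nu(\omega)\in H^1_0(D)$ and $u^\nu_\ell(\omega)\in\mathcal{X}_\ell$ be the solutions of $a^\nu_\omega(u^\nu,v)=\int_D fv\,dx$ for all $v\in H^1_0(D)$, and $a^\nu_\omega(u^\nu_\ell,v)=\int_D fv\,dx$ for all $v\in\mathcal{X}_\ell$; $u=u^\infty$ is the solution for the coefficient $A$. $H^2$-regularity is assumed: for every right-hand side $\tilde f\in L^2(D)$ in place of $f$, the corresponding exact solution $\tilde u^\nu$ satisfies $\|\tilde u^\nu(\omega)\|_{H^2(D)}\le C_{\rm reg}A_{\min}^{-2}(1+\|A^\nu(\omega)\|_{W^{1,\infty}(D)})\|\tilde f\|_{L^2(D)}$ for all $\nu,\omega$. Double differences: $D^\nu_\ell:=(u^\nu_\ell-u^\nu_{\ell-1})-(u^{\nu-1}_\ell-u^{\nu-1}_{\ell-1})$ for $\ell,\nu\ge0$, where terms with index $-1$ are $0$. Sampling: for a function $F$ depending on $\omega_1,\dots,\omega_{s_\nu}$ only, the symmetrized Monte Carlo rule with $M=2^m$ is $$Q^{(\nu)}_m(F):=\frac1{2M}\sum_{i=1}^M\Big(F(X^i_1,\dots,X^i_{s_\nu})+F(X^i_1,\dots,X^i_{s_{\nu-1}},-X^i_{s_{\nu-1}+1},\dots,-X^i_{s_\nu})\Big),$$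 with $X^1,\dots,X^M$ i.i.d. uniform in $[-1/2,1/2]^{s_\nu}$ (for $\nu=0$, $s_{-1}:=\lceil 2^{-1/(r-1)}\rceil=1=s_0$, so no sign is flipped). $\mathbb{E}_{\rm MC}$ is the expectation over all samples used. Cost model: a linear iterative solver solves the sparse finite element system on level $\ell$ at cost $O(2^{d\ell})$; each bilinear form $\int_D\phi_j\nabla v\cdot\nabla w\,dx$ on $\mathcal{X}_\ell$ is computed exactly at cost $O(\#\mathcal{T}_\ell)$, so that assembling the system matrix from $s_\nu$ such forms costs $O(2^{d\ell}s_\nu)$.
   Formalization: The cost bound is asserted only for 1/(r-1) ≠ 4: for r = 5/4 the N+1 terms with ℓ = 0, j+ν = N each equal 2^{4N}, so C_N ≥ c(N+1)2^{4N} and the printed bound fails; the error bound is kept for all r > 1. *)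

(* Defs.v *)
From HB Require Import structures.
From mathcomp Require Import all_boot all_order all_algebra.
From mathcomp Require Import all_classical all_reals all_analysis.
From mathcomp Require Import ess_sup_inf.

Set Implicit Arguments.
Unset Strict Implicit.
Unset Printing Implicit Defensive.
Import Order.TTheory GRing.Theory Num.Theory.
Import numFieldNormedType.Exports.
Local Open Scope classical_set_scope.
Local Open Scope ring_scope.

Definition mx_coord_sets (R : realType) m n : set (set 'M[R]_(m, n)) :=
  [set A | exists i j, exists2 B : set R, measurable B &
     A = (fun M : 'M[R]_(m, n) => M i j) @^-1` B].

Fact mx_display : measure_display. Proof. exact: default_measure_display. Qed.

Section measurable_matrix.
Variables (R : realType) (m n : nat).

Let mx_set0 : <<s @mx_coord_sets R m n >> set0.
Proof. exact: sigma_algebra0. Qed.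

Let mx_setC A : <<s @mx_coord_sets R m n >> A ->
  <<s @mx_coord_sets R m n >> (~` A).
Proof. exact: sigma_algebraC. Qed.

Let mx_bigcup (F : _^nat) : (forall i, <<s @mx_coord_sets R m n >> (F i)) ->
  <<s @mx_coord_sets R m n >> (\bigcup_i F i).
Proof. exact: sigma_algebra_bigcup. Qed.

HB.instance Definition _ := @isMeasurable.Build mx_display 'M[R]_(m, n)
  <<s @mx_coord_sets R m n >> mx_set0 mx_setC mx_bigcup.

End measurable_matrix.

Lemma measurable_mx_coord (R : realType) m n i j :
  measurable_fun setT (fun M : 'M[R]_(m, n) => M i j).
Proof.
move=> _ B mB; rewrite setTI; apply: sub_sigma_algebra.
by exists i, j, B.
Qed.

Lemma measurable_fun_mx d (T : measurableType d) (R : realType) m n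
    (f : T -> 'M[R]_(m, n)) :
  (forall i j, measurable_fun setT (fun x => f x i j)) ->
  measurable_fun setT f.
Proof.
move=> mf; apply: (measurability (@mx_coord_sets R m n)) => //.
move=> _ [_ [i [j [B mB ->]] <-]]; rewrite setTI.
by have := mf i j measurableT B mB; rewrite setTI.
Qed.

Section lebesgue_rV_succ.
Variables (R : realType) (n : nat).

Definition rV_cons (p : measurableTypeR R * 'rV[R]_n) : 'rV[R]_n.+1 :=
  \row_j (if unlift ord0 j is Some k then p.2 ord0 k else p.1).

Let rV_uncons (v : 'rV[R]_n.+1) : measurableTypeR R * 'rV[R]_n :=
  (v ord0 ord0, \row_k v ord0 (lift ord0 k)).

Lemma measurable_rV_cons : measurable_fun setT rV_cons.
Proof.
apply: measurable_fun_mx => i j; under eq_fun do rewrite mxE.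
case: (unlift ord0 j) => [k|]; last exact: measurable_fst.
apply: (@measurableT_comp _ _ _ _ _ _ (fun M : 'rV[R]_n => M ord0 k)) => //.
exact: measurable_mx_coord.
Qed.

Variable mu : {sigma_finite_measure set 'rV[R]_n -> \bar R}.

Definition lebesgue_rV_succ : set 'rV[R]_n.+1 -> \bar R :=
  pushforward (lebesgue_measure \x mu)%E rV_cons.

HB.instance Definition _ := Measure.copy lebesgue_rV_succ
  (measure_function_pushforward__canonical__measure_function_Measure
    (lebesgue_measure \x mu)%E measurable_rV_cons).

Let lebesgue_rV_succ_sigma_finite : sigma_finite setT lebesgue_rV_succ.
Proof.
have mg : measurable_fun setT rV_uncons.
  apply/measurable_fun_pairP; split; first exact: measurable_mx_coord.
  apply: measurable_fun_mx => i j; under eq_fun do rewrite /= mxE.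
  exact: measurable_mx_coord.
have gK : cancel rV_cons rV_uncons.
  move=> [x v]; congr pair; first by rewrite mxE unlift_none.
  by apply/rowP => k; rewrite !mxE liftK.
have /sigma_finiteP[F [TF ndF Foo]] :=
  sigma_finiteT (@lebesgue_measure R : {sigma_finite_measure set _ -> \bar R}).
have /sigma_finiteP[G [TG ndG Goo]] := sigma_finiteT mu.
exists (fun k => rV_uncons @^-1` (F k `*` G k)).
  rewrite -preimage_bigcup [X in _ @^-1` X](_ : _ = setT) ?preimage_setT//.
  apply/seteqP; split => // -[x v] _.
  have [i _ Fix] : (\bigcup_k F k) x by rewrite -TF.
  have [j _ Gjv] : (\bigcup_k G k) v by rewrite -TG.
  exists (maxn i j) => //; split => /=.
    by move: x Fix; exact/subsetPset/ndF/leq_maxl.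
  by move: v Gjv; exact/subsetPset/ndG/leq_maxr.
move=> k; have [mFk Fkoo] := Foo k; have [mGk Gkoo] := Goo k.
have mFG : measurable (F k `*` G k) by exact: measurableX.
split; first by rewrite -[X in measurable X]setTI; exact: mg.
rewrite /lebesgue_rV_succ /pushforward -comp_preimage.
rewrite [X in product_measure1 _ _ X](_ : _ = F k `*` G k); last first.
  by apply/seteqP; split => p; rewrite /preimage /mkset /comp gK.
by rewrite product_measure1E// lte_mul_pinfty// ge0_fin_numE.
Qed.

HB.instance Definition _ := Measure_isSigmaFinite.Build _ _ _ lebesgue_rV_succ
  lebesgue_rV_succ_sigma_finite.

End lebesgue_rV_succ.

Fixpoint lebesgue_rV (R : realType) (n : nat) :
    {sigma_finite_measure set 'rV[R]_n -> \bar R} :=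
  if n is k.+1 then lebesgue_rV_succ (lebesgue_rV R k) else \d_(0 : 'rV[R]_0).

Section domains.
Variables (R : realType) (d : nat).
Implicit Types D : set 'rV[R]_d.

(* Near each boundary point, after a rigid motion [Q], the set is the part of
   space lying strictly above the graph of a Lipschitz function of the other
   [d - 1] coordinates. *)
Definition lipschitz_boundary D : Prop :=
  forall x0, (closure D `\` D°) x0 ->
  exists (Q : 'M[R]_d) (i : 'I_d) (gamma : 'rV[R]_d.-1 -> R) (L rho : R),
    [/\ Q *m Q^T = 1%:M, L.-lipschitz gamma, 0 < rho &
        forall x, `|x - x0| < rho ->
          D x <-> gamma (col' i (x *m Q)) < (x *m Q) ord0 i].

Definition bounded_lipschitz_domain D : Prop :=
  [/\ D !=set0, open D, connected D, bounded_set D & lipschitz_boundary D].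

(* Elements of function spaces are represented by functions on the whole space,
   of which only the values in [D] matter. *)
Local Notation F := ('rV[R]_d -> R).

Definition Lp_norm D (p : \bar R) (v : F) : \bar R :=
  Lnorm (lebesgue_rV R d) p (EFin \o (v \_ D)).

Definition Lp D (p : \bar R) (v : F) : Prop :=
  measurable_fun D v /\ (Lp_norm D p v < +oo)%E.

Definition normL2 D (v : F) : R := fine (Lp_norm D 2%:E v).
Definition normLoo D (v : F) : R := fine (Lp_norm D +oo%E v).

Definition ess_inf_on D (v : F) : \bar R :=
  ess_inf (lebesgue_rV R d) (patch (cst +oo%E) D (EFin \o v)).

Definition partial (i : 'I_d) (v : F) : F :=
  fun x => 'D_(delta_mx ord0 i : 'rV[R]_d) v x.

Fixpoint Ck (k : nat) (v : F) : Prop :=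
  continuous v /\
  if k is k'.+1 then
    forall i, (forall x, derivable v x (delta_mx ord0 i : 'rV[R]_d)) /\
              Ck k' (partial i v)
  else True.

Definition test_function D (v : F) : Prop :=
  (forall k, Ck k v) /\
  exists K, [/\ compact K, K `<=` D & forall x, ~ K x -> v x = 0].

Definition is_weak_partial D (i : 'I_d) (v w : F) : Prop :=
  forall phi, test_function D phi ->
    \int[lebesgue_rV R d]_(x in D) (v x * partial i phi x) =
    - \int[lebesgue_rV R d]_(x in D) (w x * phi x).

Definition L1loc D (v : F) : Prop :=
  measurable_fun D v /\
  forall K, compact K -> K `<=` D ->
    (lebesgue_rV R d).-integrable K (EFin \o v).

(* A representative of the weak derivative, which is unique almost everywhere;
   [0] if there is none. *)
Definition weak_partial D (i : 'I_d) (v : F) : F :=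
  xget (cst 0) [set w | L1loc D w /\ is_weak_partial D i v w].

Fixpoint Sobolev D (k : nat) (p : \bar R) (v : F) : Prop :=
  Lp D p v /\
  if k is k'.+1 then
    forall i, exists2 w, Sobolev D k' p w & is_weak_partial D i v w
  else True.

Definition normH1 D (v : F) : R :=
  Num.sqrt (normL2 D v ^+ 2 + \sum_(i < d) normL2 D (weak_partial D i v) ^+ 2).

Definition normH2 D (v : F) : R :=
  Num.sqrt (normH1 D v ^+ 2 +
    \sum_(i < d) \sum_(j < d | (i <= j)%N)
      normL2 D (weak_partial D j (weak_partial D i v)) ^+ 2).

Definition normW1oo D (v : F) : R :=
  \big[Num.max/normLoo D v]_(i < d) normLoo D (weak_partial D i v).

Definition H10 D : set F :=
  [set v | Sobolev D 1 2%:E v /\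
    forall e, 0 < e -> exists2 phi, test_function D phi &
      normH1 D (v \- phi) < e].

Definition diffusion_form D (A w v : F) : R :=
  \int[lebesgue_rV R d]_(x in D)
    (A x * \sum_(i < d) weak_partial D i w x * weak_partial D i v x).

Definition pairing D (f v : F) : R :=
  \int[lebesgue_rV R d]_(x in D) (f x * v x).

Definition galerkin_solution D (A f : F) (X : set F) (u : F) : Prop :=
  X u /\ forall v, X v -> diffusion_form D A u v = pairing D f v.

(* The cells may be curved, as [D] is not assumed to be polyhedral. *)
Definition triangulation D (T : seq (set 'rV[R]_d)) : Prop :=
  [/\ forall i, (i < size T)%N ->
        [/\ compact (nth set0 T i), (nth set0 T i)° !=set0 &
            nth set0 T i `<=` closure (nth set0 T i)°],
      forall i j, (i < j < size T)%N ->
        (nth set0 T i)° `&` (nth set0 T j)° = set0 &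
      \bigcup_(i in `I_(size T)) nth set0 T i = closure D].

Definition refines (T' T : seq (set 'rV[R]_d)) : Prop :=
  forall i, (i < size T')%N ->
    exists2 j, (j < size T)%N & nth set0 T' i `<=` nth set0 T j.

(* On each cell, the functions belong to the span of a finite family of shape
   functions. *)
Definition finite_element_space D (T : seq (set 'rV[R]_d)) (X : set F) : Prop :=
  [/\ X `<=` H10 D,
      X (cst 0),
      forall a v w, X v -> X w -> X (fun x => a * v x + w x) &
      forall i, (i < size T)%N -> exists (n : nat) (P : 'I_n -> F),
        forall v, X v -> exists c : 'I_n -> R,
          {ae lebesgue_rV R d, forall x, nth set0 T i x ->
             v x = \sum_(k < n) c k * P k x}].

Definition double_difference (U : nat -> nat -> F) (nu l : nat) : F :=
  let V a b := if a is a'.+1 then if b is b'.+1 then U a' b' else cst 0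
               else cst 0 in
  (V nu.+1 l.+1 \- V nu.+1 l) \- (V nu l.+1 \- V nu l).

End domains.

(* [w j] stands for the parameter with the one-based index [j + 1]. *)
Definition param (R : realType) : Type :=
  g_sigma_algebraType [set A : set (nat -> R) |
    exists j, exists2 B : set R, measurable B & A = [set w | B (w j)]].
HB.instance Definition _ (R : realType) := Measurable.on (param R).

Definition Omega (R : realType) : set (param R) :=
  [set w | forall j : nat, - 2^-1 <= w j <= 2^-1].

Lemma half_interval (R : realType) : - 2^-1 < 2^-1 :> R.
Proof. by rewrite gtrN// invr_gt0. Qed.

Definition uniform_half (R : realType) : set R -> \bar R :=
  uniform_prob (half_interval R).

(* By uniqueness of measures extending a product premeasure, this says that [P]
   is the countable product of the uniform measures on [[-1/2, 1/2]]. *)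
Definition product_uniform (R : realType) (P : probability (param R) R) : Prop :=
  forall (n : nat) (B : 'I_n -> set R), (forall j, measurable (B j)) ->
    P [set w : param R | forall j : 'I_n, B j (w j)] =
    (\prod_(j < n) uniform_half (B j))%E.

(* The index is an integer because the quadrature rule refers to level [-1]. *)
Definition dimension (R : realType) (r : R) (nu : int) : nat :=
  `|Num.ceil (2 `^ (nu%:~R / (r - 1)))|%N.

Section coefficient.
Variables (R : realType) (d : nat).
Local Notation F := ('rV[R]_d -> R).

Definition partial_coefficient (phi : nat -> F) (n : nat) (w : param R) : F :=
  fun x => phi 0%N x + \sum_(j < n) w j * phi j.+1 x.

(* The level [None] stands for infinity. *)
Definition coefficient (phi : nat -> F) (r : R) (A : param R -> F)
    (nu : option nat) (w : param R) : F :=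
  if nu is Some n then partial_coefficient phi (dimension r n%:Z) w else A w.

Definition is_coefficient_series (D : set 'rV[R]_d) (phi : nat -> F)
    (A : param R -> F) : Prop :=
  forall w, Omega w ->
    [/\ cvgn (series (fun j => normW1oo D (fun x => w j * phi j.+1 x))),
        Sobolev D 1 +oo%E (A w) &
        normW1oo D (A w \- partial_coefficient phi n w) @[n --> \oo] --> 0].

End coefficient.

Definition samples (j : nat) : nat := (4 * j)%N.

Section sampling.
Variable R : realType.

(* The points [X 0, ..., X (M - 1)] are independent and uniformly distributed
   in the cube of dimension [s]: their [M * s] coordinates are independent and
   uniformly distributed in [[-1/2, 1/2]]. *)
Definition iid_uniform d (T : measurableType d) (P : probability T R) (M s : nat)
    (X : nat -> nat -> {RV P >-> R}) : Prop :=
  (forall i j t, - 2^-1 <= X i j t <= 2^-1) /\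
  forall B : 'I_M -> 'I_s -> set R, (forall i j, measurable (B i j)) ->
    P [set t | forall i j, B i j (X i j t)] =
    (\prod_(i < M) \prod_(j < s) uniform_half (B i j))%E.

(* The function [G] is meant to depend on the first [s] parameters only; the
   remaining ones are set to [0]. *)
Definition extend (s : nat) (x : nat -> R) : param R :=
  fun j => if (j < s)%N then x j else 0.

Definition flip (s' : nat) (x : nat -> R) : nat -> R :=
  fun j => if (j < s')%N then x j else - x j.

Definition symmetrized_rule (s' s M : nat) (x : nat -> nat -> R)
    (G : param R -> R) : R :=
  (2 * M%:R)^-1 *
  \sum_(i < M) (G (extend s (x i)) + G (extend s (flip s' (x i)))).

Definition asymp_equiv (a b : nat -> R) : Prop :=
  exists c1 c2, [/\ 0 < c1, 0 < c2 & forall n, c1 * b n <= a n <= c2 * b n].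

Definition cost_model (d : nat) (r : R) (N : nat) : R :=
  \sum_(j < N.+1) \sum_(l < N.+1) \sum_(nu < N.+1 | (j + l + nu <= N)%N)
    2 ^+ samples j * 2 ^+ (d * l) * (dimension r nu%:Z)%:R.

(* [U nu l w] is the Galerkin solution, and [x nu m i j] is the [j]-th
   coordinate of the [i]-th sample point of the rule of level [nu] with [2 ^ m]
   points. *)
Definition multi_index_estimator (d : nat) (D : set 'rV[R]_d) (r : R)
    (g : 'rV[R]_d -> R) (U : nat -> nat -> param R -> 'rV[R]_d -> R)
    (x : nat -> nat -> nat -> nat -> R) (N : nat) : R :=
  \sum_(l < N.+1) \sum_(nu < N.+1 | (l + nu <= N)%N)
    let m := samples (N - l - nu) in
    symmetrized_rule (dimension r (nu%:Z - 1)) (dimension r nu%:Z) (2 ^ m)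
      (x nu m)
      (fun w => pairing D g (double_difference (fun a b => U a b w) nu l)).

End sampling.

(* Main.v *)
Require Import Defs.
From HB Require Import structures.
From mathcomp Require Import all_boot all_order all_algebra.
From mathcomp Require Import all_classical all_reals all_analysis.
From mathcomp Require Import measurable_realfun ess_sup_inf.
From mathcomp Require finmap.
From mathcomp Require Import ring lra.

Set Implicit Arguments.
Unset Strict Implicit.
Unset Printing Implicit Defensive.
Import Order.TTheory GRing.Theory Num.Theory.
Import numFieldNormedType.Exports.
Import HBSimple.
Local Open Scope classical_set_scope.
Local Open Scope ring_scope.

(* The error is split into the truncation bias of the sparse sum, which
   telescopes to the error at level [N] and to differences along the diagonal
   [l + nu = N], and the Monte Carlo error. The variance of the symmetrized rule
   with [M] points is [O(K^2 / M)], where [K] bounds the symmetrized integrand, so both parts follow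
   from [K = O(2^(-2 nu) 2^(-2 l))]. As the rule is even in the coordinates
   between [s_(nu-1)] and [s_nu], the double difference becomes a difference on
   the levels [l - 1] and [l] of a second difference
   [E(a_0 + b) + E(a_0 - b) - 2 E(a_0)] of the finite element error [E(a)], where
   [b] collects these coordinates and has norm [O(2^(-nu))] in [W^(1,oo)].

   The second difference is quadratic in [b] by repeating an Aubin-Nitsche
   argument for the solution, its first and its second difference. The
   right-hand sides [v |-> - int b grad w . grad v] that arise lie in [L^2] with
   norm [O(|b|_(W^(1,oo)) |w|_(H^2))], by integration by parts; the product rule
   for weak derivatives behind this is obtained by mollifying [grad w].

   The values of the functional are Lipschitz in finitely many coordinates, so
   their expectations are limits of Riemann sums over grids of midpoints. This
   identifies the expectation under [P] with that at a sample point, gives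
   invariance under flips, and shows that distinct sample points are
   uncorrelated. *)

(** The choice [m_j = 4 j] balances the variances: with [K = O(2^(-2 nu) 2^(-2 l))] and
    [2^(4 (N - l - nu))] points, every pair [(l, nu)] contributes [O(2^(-4 N))]. Only independence
    within one rule is available, so the [O(N^2)] sampling errors are added by Cauchy-Schwarz; this
    is the source of the factor [(N + 1)^2], while the bias costs only [N + 1]. The choice of [s_nu]
    turns the tail [s^(1 - r)] of the series into [2^(-nu)].

    Pointwise in the parameter, truncation at level [N] is controlled only to order [2^(-N)]. The
    square is gained in the mean, which the flip of the omitted coordinates preserves.

    Three obstacles shape the details. A weak derivative is a chosen representative, hence linear
    only almost everywhere, so identities of forms pass through almost everywhere equalities.
    Measurability in the parameter is not given and is derived from Lipschitz continuity.
    Differences of Galerkin errors are orthogonal only up to a term in the difference of lower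
    order, so each duality step carries an energy bound together with a bound on all [L^2]
    functionals. *)

Section integrable_real.
Context d (T : measurableType d) (R : realType) (mu : {measure set T -> \bar R}).
Implicit Types (D : set T) (f g : T -> R).

Lemma integrable_le_norm D f g : measurable D -> measurable_fun D f ->
  mu.-integrable D (EFin \o g) -> (forall x, D x -> `|f x| <= `|g x|) ->
  mu.-integrable D (EFin \o f).
Proof.
move=> mD mf ig fg; apply: le_integrable ig => //.
by apply/measurable_EFinP.
Qed.

Lemma measurable_abse_EFin D f : measurable_fun D f ->
  measurable_fun D (fun x => `|(f x)%:E|%E).
Proof. by move=> mf; apply: measurableT_comp => //; apply/measurable_EFinP. Qed.

End integrable_real.

(** * Lebesgue measure on row vectors *)

Section rV_measure.
Context {R : realType}.

Local Notation mu n := (lebesgue_rV R n).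

Lemma measurable_coord n (i : 'I_n) :
  measurable_fun setT (fun x : 'rV[R]_n => x ord0 i).
Proof. exact: measurable_mx_coord. Qed.

(** The measure is a pushforward of a product measure under [rV_cons], so a change of variables and
    Tonelli split off the first coordinate. *)
Lemma ge0_integral_rV_succ n (F : 'rV[R]_n.+1 -> \bar R) :
  measurable_fun setT F -> (forall x, 0 <= F x)%E ->
  (\int[mu n.+1]_x F x =
   \int[lebesgue_measure]_t \int[mu n]_v F (rV_cons (t, v)))%E.
Proof.
move=> mF F0.
transitivity (\int[pushforward (lebesgue_measure \x mu n)%E (@rV_cons R n)]_x F x)%E.
  by [].
rewrite ge0_integral_pushforward//; [|exact: measurable_rV_cons].
rewrite preimage_setT fubini_tonelli1//=.
exact: (measurableT_comp mF (@measurable_rV_cons R n)).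
Qed.

Lemma rV_cons0 n (p : R * 'rV[R]_n) : rV_cons p ord0 ord0 = p.1.
Proof. by rewrite mxE unlift_none. Qed.

Lemma rV_consS n (p : R * 'rV[R]_n) j : rV_cons p ord0 (lift ord0 j) = p.2 ord0 j.
Proof. by rewrite mxE liftK. Qed.

(** Induction on the dimension by splitting off one coordinate. It yields both the volume of boxes
    and the unit mass of tensor product mollifiers. *)
Lemma ge0_integral_prod_coord n (f : 'I_n -> R -> R) :
  (forall j, measurable_fun setT (f j)) -> (forall j t, 0 <= f j t) ->
  (\int[mu n]_x (\prod_(j < n) f j (x ord0 j))%:E =
   \prod_(j < n) \int[lebesgue_measure]_t (f j t)%:E)%E.
Proof.
elim: n f => [|n IH] f mf f0.
  rewrite big_ord0 /=; under eq_integral do rewrite big_ord0.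
  by rewrite integral_cst//= diracT mul1e.
have mfx m (g : 'I_m -> R -> R) : (forall j, measurable_fun setT (g j)) ->
    measurable_fun setT (fun x : 'rV[R]_m => (\prod_(j < m) g j (x ord0 j))).
  move=> mg; apply: measurable_prod => j _.
  exact: (measurableT_comp (mg j) (measurable_coord j)).
rewrite ge0_integral_rV_succ; last 2 first.
- by apply/measurable_EFinP; exact: mfx.
- by move=> x; rewrite lee_fin prodr_ge0.
under eq_integral => t _.
  under eq_integral => v _.
    rewrite big_ord_recl rV_cons0/= EFinM.
    under eq_bigr do rewrite rV_consS/=.
    over.
  rewrite ge0_integralZl//; last 3 first.
  - by apply/measurable_EFinP; apply: (mfx _ (fun j => f (lift ord0 j))).
  - by move=> x _; rewrite lee_fin prodr_ge0.
  - by rewrite lee_fin.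
  rewrite (IH (fun j => f (lift ord0 j)))//.
  over.
rewrite ge0_integralZr//.
- by rewrite big_ord_recl.
- by apply/measurable_EFinP; exact: mf.
- by move=> x _; rewrite lee_fin.
- by apply: prode_ge0 => j _; apply: integral_ge0 => t _; rewrite lee_fin.
Qed.

Definition rV_box n (B : 'I_n -> set R) : set 'rV[R]_n :=
  [set x | forall j, B j (x ord0 j)].

Lemma measurable_rV_box n (B : 'I_n -> set R) :
  (forall j, measurable (B j)) -> measurable (rV_box B).
Proof.
move=> mB; rewrite (_ : rV_box B = \bigcap_(j in [set: 'I_n]) (fun x : 'rV[R]_n => x ord0 j) @^-1` B j).
  apply: fin_bigcap_measurable => // j _.
  by rewrite -[X in measurable X]setTI; apply: measurable_coord.
by apply/seteqP; split=> [x Bx j _|x Bx j]; [exact: Bx|exact: Bx].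
Qed.

Lemma lebesgue_rV_box n (B : 'I_n -> set R) : (forall j, measurable (B j)) ->
  (mu n (rV_box B) = \prod_(j < n) lebesgue_measure (B j))%E.
Proof.
move=> mB.
have B0 (j : 'I_n) (t : R) : 0 <= \1_(B j) t :> R by rewrite indicE ler0n.
have := @ge0_integral_prod_coord n (fun j => \1_(B j)) (fun j => measurable_indic (mB j)) B0.
rewrite (eq_bigr (fun j => lebesgue_measure (B j))); last first.
  move=> j _; rewrite integral_indic; [|exact: measurableT|exact: mB].
  by congr (lebesgue_measure _); exact: setIT.
move=> <-; rewrite -[rV_box B in LHS]setIT -integral_indic//; last exact: measurable_rV_box.
apply: eq_integral => x _; congr EFin; rewrite indicE.
have [xB|xB] := boolP (x \in rV_box B).
  by rewrite big1// => j _; rewrite indicE mem_set//; move/set_mem: xB; exact.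
have [j Hj] : exists j, x ord0 j \notin B j.
  apply: contrapT => h; move/negP: xB; apply; apply/mem_set => j.
  by apply: contrapT => nB; apply: h; exists j; apply/negP => /set_mem.
by rewrite (bigD1 j)//= indicE (negbTE Hj) mul0r.
Qed.

Lemma ball_rV_box n (x : 'rV[R]_n) (e : R) : 0 < e ->
  ball x e = rV_box (fun j => `]x ord0 j - e, x ord0 j + e[%classic).
Proof.
move=> e0; apply/seteqP; split => y.
  by move=> xy j; have := xy.2 ord0 j; rewrite /ball/= ltr_distlC in_itv.
move=> h; split => // i j; rewrite ord1; have := h j.
by rewrite /= in_itv /ball/= ltr_distlC.
Qed.

Lemma ball_rVP n (x y : 'rV[R]_n) (e : R) : 0 < e ->
  ball x e y <-> forall j, `|x ord0 j - y ord0 j| < e.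
Proof.
move=> e0; split => [[_ xy] j|xy]; first exact: (xy ord0 j).
by split => // i j; rewrite ord1; exact: xy.
Qed.

Lemma measurable_ball_rV n (x : 'rV[R]_n) (e : R) : measurable (ball x e).
Proof.
have [e0|e0] := ltP 0 e.
  by rewrite ball_rV_box//; apply: measurable_rV_box => j; exact: measurable_itv.
by rewrite (_ : ball x e = set0)//; apply/seteqP; split => // y [/lt_geF]; rewrite e0.
Qed.

(** The sigma-algebra on row vectors is generated by the coordinates, not by the topology. Countably
    many rational balls, which are boxes for the maximum norm, make open sets measurable. *)
Lemma open_rV_bigcup n (D : set 'rV[R]_n) : open D ->
  D = \bigcup_(qk in [set qk : 'rV[rat]_n * nat |
        ball (map_mx ratr qk.1 : 'rV[R]_n) qk.2.+1%:R^-1 `<=` D])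
      ball (map_mx ratr qk.1 : 'rV[R]_n) qk.2.+1%:R^-1.
Proof.
move=> oD; apply/seteqP; split => [x Dx|x [qk /= + xqk]]; last exact.
have /nbhs_ballP[e /= e0 xeD] : nbhs x D by exact: open_nbhs_nbhs.
have [k ke] : exists k : nat, k.+1%:R^-1 < e / 2 :> R.
  have e20 : 0 < e / 2 by rewrite divr_gt0.
  by have [k _ /(_ k (leqnn _))] := near_infty_natSinv_lt (PosNum e20); exists k.
have k0 : 0 < k.+1%:R^-1 :> R by rewrite invr_gt0.
have /choice[q qP] (j : 'I_n) : exists q : rat, `|ratr q - x ord0 j| < k.+1%:R^-1 :> R.
  have /rat_in_itvoo[q] : x ord0 j - k.+1%:R^-1 < x ord0 j + k.+1%:R^-1 by rewrite ltrD2l gtrN.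
  by rewrite in_itv/= => qx; exists q; rewrite distrC ltr_distlC.
exists (\row_j q j, k) => /=.
  move=> y /(ball_rVP _ _ k0) qy; apply: xeD; apply/ball_rVP => // j.
  have := qy j; have := qP j; rewrite !mxE => h1 h2.
  rewrite (le_lt_trans (ler_distD (ratr (q j)) _ _))// (splitr e) ltrD//.
    by rewrite distrC (lt_trans h1).
  by rewrite (lt_trans h2).
by apply/ball_rVP => // j; rewrite !mxE.
Qed.

Lemma open_rV_measurable n (D : set 'rV[R]_n) : open D -> measurable D.
Proof.
move=> /open_rV_bigcup ->; rewrite bigcup_mkcond; apply: countable_bigcupT_measurable => [|i].
  exact: countableP.
by case: ifPn => // _; exact: measurable_ball_rV.
Qed.

Lemma closed_rV_measurable n (D : set 'rV[R]_n) : closed D -> measurable D.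
Proof.
by move=> cD; rewrite -[D]setCK; apply: measurableC; apply: open_rV_measurable; exact: closed_openC.
Qed.

Lemma compact_rV_measurable n (K : set 'rV[R]_n) : compact K -> measurable K.
Proof.
by move=> cK; apply: closed_rV_measurable; apply: compact_closed => //; exact: norm_hausdorff.
Qed.

Lemma lebesgue_rV_ball_lty n (x : 'rV[R]_n) e : (mu n (ball x e) < +oo)%E.
Proof.
have [e0|e0] := ltP 0 e; last first.
  rewrite (_ : ball x e = set0) ?measure0//.
  by apply/seteqP; split => // y [/lt_geF]; rewrite e0.
rewrite ball_rV_box// lebesgue_rV_box; last by move=> j; exact: measurable_itv.
under eq_bigr do rewrite /= lebesgue_measure_itv/= lte_fin ltrD2l gtrN// -EFinB.
by rewrite prodEFin ltry.
Qed.

Lemma bounded_rV_ball n (D : set 'rV[R]_n) : bounded_set D ->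
  exists2 M : R, 0 < M & D `<=` ball (0 : 'rV[R]_n) M.
Proof.
move=> [M [_ MD]]; exists (Num.max 0 M + 2); first by rewrite ltr_wpDl// le_max lexx.
move=> x Dx; rewrite -ball_normE /= sub0r normrN.
rewrite (@le_lt_trans _ _ (Num.max 0 M + 1))//; last by rewrite ltrD2l ltr1n.
by apply: MD => //; rewrite ltr_pwDr// le_max lexx orbT.
Qed.

Lemma bounded_rV_lty n (D : set 'rV[R]_n) : measurable D -> bounded_set D -> (mu n D < +oo)%E.
Proof.
move=> mD /bounded_rV_ball[M M0 DM]; apply: le_lt_trans (lebesgue_rV_ball_lty 0 M).
by apply: le_measure => //; rewrite inE//; exact: measurable_ball_rV.
Qed.

Lemma open_rV_gt0 n (D : set 'rV[R]_n) : open D -> D !=set0 -> (0 < mu n D)%E.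
Proof.
move=> oD [x Dx]; have /nbhs_ballP[e /= e0 xeD] : nbhs x D by exact: open_nbhs_nbhs.
apply: (@lt_le_trans _ _ (mu n (ball x e))); last first.
  by apply: le_measure => //; rewrite inE; [exact: measurable_ball_rV|exact: open_rV_measurable].
rewrite ball_rV_box// lebesgue_rV_box; last by move=> j; exact: measurable_itv.
elim/big_ind: _ => [||j _]; rewrite ?lte01//.
  by move=> a b a0 b0; exact: mule_gt0.
by rewrite /= lebesgue_measure_itv/= lte_fin ltrD2l gtrN// -EFinB lte_fin; lra.
Qed.

End rV_measure.

(** * Smooth bump functions *)

Section smooth.
Context {R : realType}.

(** Reduces a directional derivative to one real variable, where the chain rule is applied. *)
Lemma is_derive_line (V : normedModType R) (f : V -> R) (x v : V) (df : R) :
  is_derive x v f df <-> is_derive (0 : R) 1 (fun h : R => f (h *: v + x)) df.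
Proof.
have E : 'D_v f x = 'D_1 (fun h : R => f (h *: v + x)) (0 : R).
  rewrite /derive; set g1 := (fun h => _ ); set g2 := (fun h => _).
  suff -> : g1 = g2 by [].
  by rewrite /g1 /g2; apply/funext => h /=; rewrite addr0 scale0r add0r [_%:A]mulr1.
split => -[d e].
  by apply: DeriveDef; [exact: (proj1 (derivable1P f x v) d)|rewrite -E].
by apply: DeriveDef; [exact: (proj2 (derivable1P f x v) d)|rewrite E].
Qed.

Lemma is_derive_affine (a s x : R) : is_derive x (1 : R) (fun t => a + s * t) s.
Proof.
have H := is_deriveD (is_derive_cst a x 1) (is_deriveZ s (is_derive_id x (1 : R))).
by apply: (is_derive_eq H); rewrite add0r [_%:A]mulr1.
Qed.

(* A sequence of functions each of which is the derivative of the previous one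
   stands for a smooth function with all its derivatives. *)
Definition smooth_seq (g : nat -> R -> R) :=
  forall k x, is_derive x (1 : R) (g k) (g k.+1 x).

Lemma smooth_seq_affine (g : nat -> R -> R) (a s : R) : smooth_seq g ->
  smooth_seq (fun k t => s ^+ k * g k (a + s * t)).
Proof.
move=> sg k x.
have h := is_derive_affine a s x.
have := @is_derive1_comp _ (g k) (fun t => a + s * t) x _ _ (sg k _) h => h2.
have H := is_deriveZ (s ^+ k) h2.
apply: (is_derive_eq H).
by rewrite /GRing.scale/= exprSr; ring.
Qed.

(** For [q = 1] this is the classical flat function [e^(-1/x)]. The polynomial factor in [1/x] makes
    the family closed under differentiation. *)
Definition bump_exp (q : {poly R}) (x : R) : R :=
  if 0 < x then q.[x^-1] * expR (- x^-1) else 0.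

(** The Taylor term of degree [n + 1] of the exponential has one power of [y] to spare, which
    becomes the decay [1 / y]. *)
Lemma expR_pow_bound n (y : R) : 0 < y -> y ^+ n * expR (- y) <= n.+1`!%:R / y.
Proof.
move=> y0; rewrite expRN ler_pdivlMr// mulrAC -exprSr ler_pdivrMr ?expR_gt0//.
have := expR_ge1Dxn n (ltW y0); rewrite -ler_pdivrMl ?ltr0n ?fact_gt0// mulrC.
by apply: le_trans; rewrite lerDr.
Qed.

Lemma horner_expR_bound (q : {poly R}) :
  exists2 C : R, 0 <= C & forall y, 0 < y -> `|q.[y]| * expR (- y) <= C / y.
Proof.
exists (\sum_(i < size q) `|q`_i| * i.+1`!%:R).
  by apply: sumr_ge0 => i _; rewrite mulr_ge0.
move=> y y0; rewrite horner_coef.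
apply: (@le_trans _ _ (\sum_(i < size q) `|q`_i| * (y ^+ i * expR (- y)))).
  apply: (@le_trans _ _ (\sum_(i < size q) `|q`_i * y ^+ i| * expR (- y))).
    by rewrite -mulr_suml ler_wpM2r ?expR_ge0// ler_norm_sum.
  by apply: ler_sum => i _; rewrite normrM (ger0_norm (exprn_ge0 _ (ltW y0))) mulrA.
rewrite mulr_suml; apply: ler_sum => i _.
by rewrite -mulrA ler_wpM2l// expR_pow_bound.
Qed.

Lemma bump_exp_bound (q : {poly R}) :
  exists2 C : R, 0 <= C & forall x, `|bump_exp q x| <= C * `|x|.
Proof.
have [C C0 qC] := horner_expR_bound q; exists C => // x.
rewrite /bump_exp; case: ifPn => x0; last by rewrite normr0 mulr_ge0.
rewrite normrM (ger0_norm (expR_ge0 _)) (gtr0_norm x0).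
by have := qC x^-1; rewrite invr_gt0 invrK => /(_ x0).
Qed.

(** The derivative of [q(1/x) e^(-1/x)] is [x^(-2) (q - q')(1/x) e^(-1/x)]. *)
Definition bump_deriv (q : {poly R}) : {poly R} := 'X^2 * (q - q^`()).

Lemma is_derive_bump_exp (q : {poly R}) (x : R) :
  is_derive x (1 : R) (bump_exp q) (bump_exp (bump_deriv q) x).
Proof.
have [x0|x0|->] := ltgtP x 0.
- rewrite {2}/bump_exp ltNge ltW//=.
  apply: (@near_eq_is_derive _ _ _ (cst 0)).
  near=> y; rewrite /bump_exp ifN//= -leNgt ltW//.
  near: y; exact: lt_nbhsl.
- rewrite {2}/bump_exp x0.
  apply: (@near_eq_is_derive _ _ _ (fun y : R => q.[y^-1] * expR (- y^-1) : R)).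
    near=> y; rewrite /bump_exp ifT//.
    by near: y; exact: lt_nbhsr.
  have xn0 : x != 0 by rewrite gt_eqF.
  have hi : is_derive x (1 : R) (fun y : R => y^-1) (- x ^- 2).
    have H := @is_deriveV _ id x 1 1 xn0 (is_derive_id _ _).
    by apply: (is_derive_eq H); rewrite [_%:A]mulr1.
  have hq := @is_derive1_comp _ (horner q) (fun y : R => y^-1) x _ _ (is_derive_poly q _) hi.
  have hN := is_deriveN hi.
  have he := @is_derive1_comp _ expR (fun y : R => - y^-1) x _ _ (is_derive_expR _) hN.
  have H := is_deriveM hq he; apply: (is_derive_eq H).
  rewrite /bump_deriv !hornerE /= opprK /GRing.scale/= exprVn.
  ring.
- rewrite {2}/bump_exp ltxx.
  (* At the origin, dividing by [h] multiplies the polynomial in [h^-1] by ['X]; the difference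
     quotient is thus again of the form [bump_exp] and tends to [0] by the linear bound. *)
  have [C C0 CP] := bump_exp_bound ('X * q).
  have cv : (fun h : R => h^-1 *: ((bump_exp q \o shift 0) (h *: 1) - bump_exp q 0)) @ 0^' --> (0 : R).
    apply/cvgrPdist_le => /= e e0; near=> h.
    have h0 : h != 0 by near: h; exact: nbhs_dnbhs_neq.
    rewrite sub0r normrN addr0 {2}/bump_exp ltxx subr0 [_%:A]mulr1.
    rewrite (_ : h^-1 *: bump_exp q h = bump_exp ('X * q) h); last first.
      by rewrite /bump_exp; case: ifPn => _; rewrite ?scaler0// !hornerE [LHS]mulrA.
    rewrite (le_trans (CP h))//.
    rewrite (@le_trans _ _ ((C + 1) * `|h|))//.
      by rewrite ler_wpM2r// lerDl.
    rewrite -ler_pdivlMl ?ltr_wpDl//.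
    near: h; apply: dnbhs0_le.
    by rewrite mulr_gt0// invr_gt0 ltr_wpDl.
  apply: DeriveDef; first by apply/cvg_ex; exists 0.
  exact/cvg_lim.
Unshelve. all: by end_near. Qed.

Lemma smooth_seq_bump : smooth_seq (fun k => bump_exp (iter k bump_deriv 1)).
Proof. by move=> k x; exact: is_derive_bump_exp. Qed.

(** * Calculus of functions with continuous partial derivatives *)

Section Ck_theory.
Variable n : nat.
Local Notation F := ('rV[R]_n -> R).
Local Notation e i := (delta_mx ord0 i : 'rV[R]_n).

Lemma Ck_continuous k (v : F) : Ck k v -> continuous v.
Proof. by case: k => [|k] []. Qed.

Lemma CkS k (v : F) : Ck k.+1 v -> Ck k v.
Proof.
elim: k v => [|k IH] v; first by case.
move=> [cv H]; split => // i; have [dv Cv] := H i.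
by split => //; exact: IH.
Qed.

Lemma CkD k (v w : F) : Ck k v -> Ck k w -> Ck k (fun x => v x + w x).
Proof.
elim: k v w => [|k IH] v w [cv Hv] [cw Hw].
  by split => // x; exact: (cvgD (cv x) (cw x)).
split; first by move=> x; exact: (cvgD (cv x) (cw x)).
move=> i; have [dv Cv] := Hv i; have [dw Cw] := Hw i; split.
  by move=> x; exact: derivableD.
rewrite (_ : partial i _ = fun x => partial i v x + partial i w x); first exact: IH.
by apply/funext => x; rewrite /partial -deriveD.
Qed.

Lemma CkM k (v w : F) : Ck k v -> Ck k w -> Ck k (fun x => v x * w x).
Proof.
elim: k v w => [|k IH] v w Cv Cw.
  by split => // x; exact: (cvgM (@Ck_continuous _ _ Cv x) (@Ck_continuous _ _ Cw x)).
have Cv' := CkS Cv; have Cw' := CkS Cw.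
split; first by move=> x; exact: (cvgM (@Ck_continuous _ _ Cv x) (@Ck_continuous _ _ Cw x)).
move=> i; have [_ /(_ i)[dv pv]] := Cv; have [_ /(_ i)[dw pw]] := Cw.
split; first by move=> x; exact: derivableM.
rewrite (_ : partial i _ = fun x => v x * partial i w x + w x * partial i v x).
  by apply: CkD; exact: IH.
by apply/funext => x; rewrite /partial -deriveM.
Qed.

Lemma Ck_cst k (c : R) : Ck k (fun _ : 'rV[R]_n => c).
Proof.
elim: k c => [|k IH] c; split => //; try exact: cst_continuous.
move=> i; split; first by move=> x; exact: derivable_cst.
rewrite (_ : partial i _ = fun=> 0); first exact: IH.
by apply/funext => x; rewrite /partial; exact: derive_cst.
Qed.

Lemma Ck_prod k m (f : 'I_m -> F) : (forall j, Ck k (f j)) ->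
  Ck k (fun x => \prod_(j < m) f j x).
Proof.
elim: m f => [|m IH] f Cf.
  have -> : (fun x => \prod_(j < 0) f j x) = fun=> 1 by apply/funext => x; rewrite big_ord0.
  exact: Ck_cst.
have -> : (fun x => \prod_(j < m.+1) f j x) = fun x => f ord0 x * \prod_(j < m) f (lift ord0 j) x.
  by apply/funext => x; rewrite big_ord_recl.
by apply: CkM => //; apply: IH.
Qed.

Lemma is_derive_coord (g g' : R -> R) (j i : 'I_n) (x : 'rV[R]_n) :
  (forall t, is_derive t (1 : R) g (g' t)) ->
  is_derive x (e i) (fun x => g (x ord0 j)) ((i == j)%:R * g' (x ord0 j)).
Proof.
move=> dg; apply/is_derive_line.
have -> : (fun h : R => g ((h *: e i + x) ord0 j)) = (fun h : R => g (x ord0 j + (i == j)%:R * h)).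
  by apply/funext => h; rewrite !mxE eqxx/= addrC mulrC (eq_sym j).
have h := is_derive_affine (x ord0 j) (i == j)%:R 0.
have H := @is_derive1_comp _ g _ (0:R) _ _ (dg _) h.
by apply: (is_derive_eq H); rewrite mulr0 addr0 mulrC.
Qed.

Lemma Ck_coord k (g : nat -> R -> R) m (j : 'I_n) : smooth_seq g ->
  Ck k (fun x : 'rV[R]_n => g m (x ord0 j)).
Proof.
move=> sg; have cg l : continuous (fun x : 'rV[R]_n => g l (x ord0 j)).
  move=> x; apply: (@continuous_comp _ _ _ (fun x : 'rV[R]_n => x ord0 j) (g l)).
    exact: coord_continuous.
  by apply: differentiable_continuous; apply/derivable1_diffP; have [] := sg l (x ord0 j).
elim: k m => [|k IH] m; split => // i.
have pE x := is_derive_coord j i x (sg m).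
split; first by move=> x; have [] := pE x.
rewrite (_ : partial i _ = fun x => (i == j)%:R * g m.+1 (x ord0 j)).
  by apply: CkM; [exact: Ck_cst|exact: IH].
by apply/funext => x; rewrite /partial; have [] := pE x.
Qed.

Lemma Ck_shift k (v : F) (y : 'rV[R]_n) : Ck k v -> Ck k (fun x => v (x - y)).
Proof.
have cs (w : F) : continuous w -> continuous (fun x : 'rV[R]_n => w (x - y)).
  move=> cw x; apply: (@continuous_comp _ _ _ (fun x : 'rV[R]_n => x - y) w); last exact: cw.
  have ci : {for x, continuous (@id 'rV[R]_n)} by exact: cvg_id.
  have cc : {for x, continuous (@cst 'rV[R]_n 'rV[R]_n y)} by exact: cst_continuous.
  exact: (continuousB ci cc).
elim: k v => [|k IH] v Cv; first by split => //; exact: cs (Ck_continuous Cv).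
split; first exact: cs (Ck_continuous Cv).
move=> i; have [_ /(_ i)[dv pv]] := Cv.
have E x : is_derive x (e i) (fun x => v (x - y)) (partial i v (x - y)).
  apply/is_derive_line; have := @derivableP _ _ _ _ _ _ (dv (x - y)).
  by move=> /is_derive_line; under eq_fun do rewrite addrA.
split; first by move=> x; have [] := E x.
rewrite (_ : partial i _ = fun x => partial i v (x - y)); first exact: IH.
by apply/funext => x; rewrite {1}/partial; have [] := E x.
Qed.

Lemma partial_shift (v : F) (y x : 'rV[R]_n) i : Ck 1 v ->
  partial i (fun x => v (x - y)) x = partial i v (x - y).
Proof.
move=> [_ /(_ i)[dv _]]; rewrite {1}/partial.
apply: derive_val; apply/is_derive_line; have := @derivableP _ _ _ _ _ _ (dv (x - y)).
by move=> /is_derive_line; under eq_fun do rewrite addrA.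
Qed.

Lemma partial_even (v : F) x i : Ck 1 v -> (forall x, v (- x) = v x) ->
  partial i v (- x) = - partial i v x.
Proof.
move=> [_ /(_ i)[dv _]] ev; rewrite {1}/partial.
apply: derive_val; apply/is_derive_line.
have -> : (fun h : R => v (h *: e i - x)) = (fun h => (fun h => v (h *: e i + x)) (- h)).
  by apply/funext => h /=; rewrite -ev opprD opprK scaleNr.
have h : is_derive (0 : R) (1 : R) (fun t : R => - t) (- 1) by exact: is_deriveNid.
have := @derivableP _ _ _ _ _ _ (dv x) => /is_derive_line.
rewrite -{1}[0 : R]oppr0 => h2.
have := @is_derive1_comp _ _ (fun t : R => - t) 0 _ _ h2 h.
by rewrite mulrN1.
Qed.

End Ck_theory.
End smooth.

(** * Mollification *)

Section mollifier1.
Context {R : realType}.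
Variable a : R.
Hypothesis a0 : 0 < a.
Local Notation leb := (@lebesgue_measure R).

Let integral_indic_itv (c e : R) : c < e ->
  (\int[leb]_t (\1_(`[c, e]%classic) t)%:E = (e - c)%:E)%E.
Proof.
move=> ce; rewrite integral_indic//.
rewrite (_ : _ `&` _ = `[c, e]%classic) ?setIT//.
by have := lebesgue_measure_itv `[c, e]; rewrite /= lte_fin ce -EFinB.
Qed.

(** A product of two one-sided functions, so that smoothness follows from affine substitution and
    the product rule; it is even and vanishes off [[-a, a]]. *)
Definition bump1 (t : R) : R := bump_exp 1 (a + t) * bump_exp 1 (a - t).

Lemma bump_exp1_ge0 t : 0 <= bump_exp 1 t :> R.
Proof. by rewrite /bump_exp; case: ifPn => // _; rewrite hornerE mul1r expR_ge0. Qed.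

Lemma bump_exp1_le1 t : bump_exp 1 t <= 1 :> R.
Proof.
rewrite /bump_exp; case: ifPn => // t0; rewrite hornerE mul1r.
by rewrite expR_le1 oppr_le0 invr_ge0 ltW.
Qed.

Lemma bump1_ge0 t : 0 <= bump1 t.
Proof. by rewrite mulr_ge0// bump_exp1_ge0. Qed.

Lemma bump1_le1 t : bump1 t <= 1.
Proof. by rewrite -(mulr1 1) ler_pM// ?bump_exp1_ge0// bump_exp1_le1. Qed.

Lemma bump1N t : bump1 (- t) = bump1 t.
Proof. by rewrite /bump1 opprK mulrC. Qed.

Lemma bump1_eq0 t : a <= `|t| -> bump1 t = 0.
Proof.
rewrite ler_normr /bump1 /bump_exp => /orP[h|h].
  by rewrite [in X in _ * X]ifN ?mulr0// -leNgt subr_le0.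
by rewrite ifN ?mul0r// -leNgt -lerBrDl sub0r lerNr.
Qed.

Lemma bump1_continuous : continuous bump1.
Proof.
have cb : continuous (@bump_exp R 1).
  move=> x; apply: differentiable_continuous; apply/derivable1_diffP.
  by have [] := is_derive_bump_exp 1 x.
move=> x; apply: (@cvgM _ _ _ _ (fun t => bump_exp 1 (a + t)) (fun t => bump_exp 1 (a - t))).
  apply: (@continuous_comp _ _ _ (fun t => a + t)); last exact: cb.
  by apply: (@continuousD _ _ _ (cst a) id); [exact: cst_continuous|exact: cvg_id].
apply: (@continuous_comp _ _ _ (fun t => a - t)); last exact: cb.
by apply: (@continuousB _ _ _ (cst a) id); [exact: cst_continuous|exact: cvg_id].
Qed.

Lemma measurable_bump1 : measurable_fun setT bump1.
Proof. exact: continuous_measurable_fun bump1_continuous. Qed.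

Lemma integral_bump1_shift s :
  (\int[leb]_t (bump1 (t - s))%:E = \int[leb]_t (bump1 t)%:E)%E.
Proof.
pose F : R -> R := fun t => t - s.
have F' : derive1 F = cst 1.
  by apply/funext => t; rewrite /F derive1E deriveB// derive_id derive_cst subr0.
rewrite [RHS](@increasing_ge0_integration_by_substitutionT _ F); first last.
- exact: bump1_ge0.
- exact: bump1_continuous.
- exact: cvg_addrr.
- exact: cvg_addrr_Ny.
- by move=> x; exact: derivableB.
- by rewrite F'; exact: is_cvg_cst.
- by rewrite F'; exact: is_cvg_cst.
- by rewrite F'; exact: cst_continuous.
- by move=> x y xy; rewrite /F ltrD2r.
apply: eq_integral => t _; rewrite F'; congr EFin.
by rewrite -[LHS]mulr1.
Qed.

Definition bump1_mass : R := \int[leb]_t bump1 t.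

Lemma integral_bump1 : (\int[leb]_t (bump1 t)%:E = bump1_mass%:E)%E.
Proof.
rewrite /bump1_mass /Rintegral fineK// ge0_fin_numE; last first.
  by apply: integral_ge0 => t _; rewrite lee_fin bump1_ge0.
apply: (@le_lt_trans _ _ (\int[leb]_t (\1_(`[(- a), a]%classic) t)%:E)%E).
  apply: ge0_le_integral => //=.
  - by move=> t _; rewrite lee_fin bump1_ge0.
  - by apply/measurable_EFinP; exact: measurable_bump1.
  - by apply/measurable_EFinP; exact: measurable_indic.
  move=> t _; rewrite lee_fin indicE; have [_|] := boolP (t \in _).
    exact: bump1_le1.
  move/negP => ta; rewrite bump1_eq0// leNgt; apply/negP => h; apply: ta.
  by apply/mem_set; rewrite /= in_itv/= -ler_norml ltW.
have aa : - a < a by rewrite gtrN.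
by rewrite integral_indic_itv ?ltry.
Qed.

Lemma bump1_mass_gt0 : 0 < bump1_mass.
Proof.
rewrite -lte_fin -integral_bump1.
(* On the middle half [[-a/2, a/2]] both factors have an argument of at least [a / 2], so each is at
   least [e^(-2/a)]. *)
pose c := expR (- (a / 2)^-1) ^+ 2.
have c0 : 0 < c by rewrite exprn_gt0// expR_gt0.
apply: (@lt_le_trans _ _ (\int[leb]_t (c%:E * (\1_(`[(- (a / 2)), (a / 2)]%classic) t)%:E))%E).
  rewrite ge0_integralZl//; last 2 first.
  - by apply/measurable_EFinP; exact: measurable_indic.
  - by rewrite lee_fin ltW.
  have aa : - (a / 2) < a / 2 by rewrite gtrN// divr_gt0.
  by rewrite integral_indic_itv// -EFinM lte_fin mulr_gt0// subr_gt0.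
apply: ge0_le_integral => //=.
- by move=> t _; rewrite -EFinM lee_fin mulr_ge0// ltW.
- by apply/measurable_EFinP; apply: measurable_funM => //; exact: measurable_indic.
- by apply/measurable_EFinP; exact: measurable_bump1.
move=> t _; rewrite -EFinM lee_fin indicE; have [|_] := boolP (t \in _); last first.
  by rewrite mulr0 bump1_ge0.
move=> /set_mem; rewrite /= in_itv/= => /andP[t1 t2]; rewrite mulr1.
have h u : a / 2 <= u -> expR (- (a / 2)^-1) <= bump_exp 1 u.
  move=> au; have u0 : 0 < u by apply: lt_le_trans au; rewrite divr_gt0.
  rewrite /bump_exp u0 hornerE mul1r ler_expR lerN2 lef_pV2// posrE//.
  by rewrite divr_gt0.
by rewrite /c expr2 ler_pM ?expR_ge0// h//; lra.
Qed.

Definition mollif (t : R) : R := bump1 t / bump1_mass.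

Lemma mollif_ge0 t : 0 <= mollif t.
Proof. by rewrite divr_ge0 ?bump1_ge0// ltW// bump1_mass_gt0. Qed.

Lemma mollif_le t : mollif t <= bump1_mass^-1.
Proof.
by rewrite /mollif -[leRHS]mul1r ler_wpM2r ?bump1_le1// invr_ge0 ltW// bump1_mass_gt0.
Qed.

Lemma mollifN t : mollif (- t) = mollif t. Proof. by rewrite /mollif bump1N. Qed.

Lemma mollif_eq0 t : a <= `|t| -> mollif t = 0.
Proof. by move=> /bump1_eq0 h; rewrite /mollif h mul0r. Qed.

Lemma measurable_mollif : measurable_fun setT mollif.
Proof. by apply: measurable_funM => //; exact: measurable_bump1. Qed.

Lemma integral_mollif s : (\int[leb]_t (mollif (t - s))%:E = 1)%E.
Proof.
under eq_integral do rewrite EFinM.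
rewrite ge0_integralZr//.
- rewrite integral_bump1_shift integral_bump1 -EFinM divff//.
  by rewrite gt_eqF// bump1_mass_gt0.
- apply/measurable_EFinP; apply: (measurableT_comp measurable_bump1).
  exact: measurable_funB.
- by move=> x _; rewrite lee_fin bump1_ge0.
- by rewrite lee_fin invr_ge0 ltW// bump1_mass_gt0.
Qed.

Section mollifier_rV.
Variable n : nat.
Local Notation mu := (lebesgue_rV R n).

(** Row vectors carry the maximum norm, so a tensor product is supported in a ball, and its integral
    is a product of integrals in one variable. *)
Definition moll_rV (z : 'rV[R]_n) : R := \prod_(j < n) mollif (z ord0 j).

Lemma moll_rV_ge0 z : 0 <= moll_rV z.
Proof. by apply: prodr_ge0 => j _; exact: mollif_ge0. Qed.

Lemma moll_rV_le z : moll_rV z <= bump1_mass^-1 ^+ n.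
Proof.
rewrite -[X in _ ^+ X](card_ord n) -prodr_const; apply: ler_prod => j _.
by rewrite mollif_ge0 mollif_le.
Qed.

Lemma moll_rVN z : moll_rV (- z) = moll_rV z.
Proof. by apply: eq_bigr => j _; rewrite mxE mollifN. Qed.

Lemma moll_rV_eq0 (z : 'rV[R]_n) j : a <= `|z ord0 j| -> moll_rV z = 0.
Proof. by move=> h; rewrite /moll_rV (bigD1 j)//= mollif_eq0// mul0r. Qed.

Lemma moll_rV_supp x y : moll_rV (x - y) != 0 -> ball y a x.
Proof.
move=> h; apply/ball_rVP => // j; rewrite distrC ltNge; apply: contraNN h => h.
by rewrite (@moll_rV_eq0 _ j)// !mxE.
Qed.

Lemma measurable_moll_rV2 :
  measurable_fun setT (fun z : 'rV[R]_n * 'rV[R]_n => moll_rV (z.1 - z.2)).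
Proof.
apply: measurable_prod => j _.
apply: (@measurableT_comp _ _ _ _ _ _ mollif); first exact: measurable_mollif.
rewrite (_ : (fun _ => _) = fun z : 'rV[R]_n * 'rV[R]_n => z.1 ord0 j - z.2 ord0 j); last first.
  by apply/funext => z; rewrite !mxE.
apply: measurable_funB.
  exact: (measurableT_comp (measurable_coord j) measurable_fst).
exact: (measurableT_comp (measurable_coord j) measurable_snd).
Qed.

Lemma measurable_moll_rV y : measurable_fun setT (fun x : 'rV[R]_n => moll_rV (x - y)).
Proof.
have := measurableT_comp measurable_moll_rV2 (@measurable_pair2 _ _ 'rV[R]_n 'rV[R]_n y).
exact.
Qed.

Lemma integral_moll_rV y : (\int[mu]_x (moll_rV (x - y))%:E = 1)%E.
Proof.
have := @ge0_integral_prod_coord R n (fun j t => mollif (t - y ord0 j)).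
rewrite big1 => [|j _]; last exact: integral_mollif.
move=> <-; last 2 first.
- by move=> j; apply: (measurableT_comp measurable_mollif); exact: measurable_funB.
- by move=> j t; exact: mollif_ge0.
apply: eq_integral => x _; congr EFin.
by apply: eq_bigr => j _; rewrite !mxE.
Qed.

Lemma moll_rVC x y : moll_rV (x - y) = moll_rV (y - x).
Proof. by rewrite -moll_rVN opprB. Qed.

Lemma integral_moll_rV2 x : (\int[mu]_y (moll_rV (x - y))%:E = 1)%E.
Proof. by under eq_integral do rewrite moll_rVC; exact: integral_moll_rV. Qed.

Lemma Ck_moll_rV k : Ck k moll_rV.
Proof.
apply: Ck_prod => j.
have sp : smooth_seq (fun k t => 1 ^+ k * bump_exp (iter k bump_deriv 1) (a + 1 * t)).
  by apply: (smooth_seq_affine _ _ (@smooth_seq_bump R)).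
have sm : smooth_seq (fun k t => (- 1) ^+ k * bump_exp (iter k bump_deriv 1) (a + (- 1) * t)).
  by apply: (smooth_seq_affine _ _ (@smooth_seq_bump R)).
have := CkM (CkM (Ck_coord k 0 j sp) (Ck_coord k 0 j sm)) (Ck_cst n k bump1_mass^-1).
congr Ck; apply/funext => z.
by rewrite /mollif /bump1 !expr0 !mul1r mulN1r.
Qed.

Lemma test_moll_rV (D : set 'rV[R]_n) y b : a < b -> ball y b `<=` D ->
  test_function D (fun x => moll_rV (x - y)).
Proof.
move=> ab yD; split; first by move=> k; apply: Ck_shift; exact: Ck_moll_rV.
have b0 : 0 < b by exact: lt_trans ab.
exists (closed_ball y a); split.
- apply: bounded_closed_compact; last exact: closed_ball_closed.
  exists (`|y| + a); split; first exact: num_real.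
  move=> M aM x; rewrite closed_ballE// /closed_ball_/= => yx.
  by rewrite ltW// (le_lt_trans _ aM)// -(subrK y x) addrC (le_trans (ler_normD _ _))// lerD2l distrC.
- move=> x; rewrite closed_ballE// /closed_ball_/= => xy; apply: yD.
  by rewrite -ball_normE /=; exact: le_lt_trans ab.
- move=> x xy; apply/eqP; apply/negP => /negP/moll_rV_supp h; apply: xy.
  exact: subset_closed_ball.
Qed.

End mollifier_rV.
End mollifier1.

(** * Mollification of integrable functions *)

Section convolution.
Context {R : realType} {n : nat}.
Local Notation mu := (lebesgue_rV R n).
Implicit Types p q : 'rV[R]_n -> R.
Local Notation L1 p := (mu.-integrable setT (EFin \o p)).

Definition mollify (a : R) p (y : 'rV[R]_n) : R :=
  \int[mu]_x (p x * moll_rV a (x - y)).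

Section conv_a.
Variable a : R.
Hypothesis a0 : 0 < a.

Lemma measurable_conv_kernel p : L1 p ->
  measurable_fun setT (fun z : 'rV[R]_n * 'rV[R]_n => p z.1 * moll_rV a (z.1 - z.2)).
Proof.
move=> /measurable_int/measurable_EFinP mp.
apply: measurable_funM; last exact: measurable_moll_rV2.
exact: (measurableT_comp mp measurable_fst).
Qed.

Lemma conv_integrable2 p : L1 p ->
  (mu \x mu)%E.-integrable setT (fun z => (p z.1 * moll_rV a (z.1 - z.2))%:E).
Proof.
move=> ip; have mp := measurable_conv_kernel ip.
apply/integrable12ltyP; first exact/measurable_EFinP.
have /integrableP[/measurable_EFinP mp1 ip1] := ip.
rewrite (eq_integral (fun x => `|(p x)%:E|%E)); first exact: ip1.
move=> x _ /=; under eq_integral.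
  move=> y _; rewrite normrM (ger0_norm (moll_rV_ge0 a0 _)) EFinM.
  over.
rewrite ge0_integralZl//.
- by rewrite integral_moll_rV2// mule1.
- under eq_fun do rewrite (moll_rVC a).
  by apply/measurable_EFinP; exact: measurable_moll_rV.
- by move=> y _; rewrite lee_fin moll_rV_ge0.
Qed.

Lemma conv_integrable1 p y : L1 p -> L1 (fun x => p x * moll_rV a (x - y)).
Proof.
move=> ip; pose C := (bump1_mass a)^-1 ^+ n.
apply: (@integrable_le_norm _ _ _ _ setT _ (fun x => C * p x)) => //.
- apply: measurable_funM; last exact: measurable_moll_rV.
  by have /measurable_int/measurable_EFinP := ip.
- exact: (integrableZl _ C ip).
move=> x _; rewrite mulrC !normrM ler_wpM2r//.
rewrite ger0_norm ?moll_rV_ge0// ger0_norm ?moll_rV_le//.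
by rewrite exprn_ge0// invr_ge0 ltW// bump1_mass_gt0.
Qed.

Lemma conv_EFin p y : L1 p ->
  (\int[mu]_x (p x * moll_rV a (x - y))%:E = (mollify a p y)%:E)%E.
Proof.
move=> ip; rewrite /mollify /Rintegral fineK//.
by apply: integrable_fin_num => //; exact: conv_integrable1.
Qed.

Lemma measurable_conv p : L1 p -> measurable_fun setT (mollify a p).
Proof.
move=> ip; apply/measurable_EFinP.
rewrite (_ : _ \o _ = fubini_G mu (fun z : 'rV[R]_n * 'rV[R]_n => (p z.1 * moll_rV a (z.1 - z.2))%:E)).
  exact: (measurable_fubini_G (conv_integrable2 ip)).
by apply/funext => y; rewrite /fubini_G /= conv_EFin.
Qed.

Lemma convB p q : L1 p -> L1 q -> mollify a (fun x => p x - q x) = fun y => mollify a p y - mollify a q y.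
Proof.
move=> ip iq; apply/funext => y; rewrite /mollify -RintegralB//; try exact: conv_integrable1.
by apply: eq_Rintegral => x _; rewrite mulrBl.
Qed.

Lemma convZ c p : L1 p -> mollify a (fun x => c * p x) = fun y => c * mollify a p y.
Proof.
move=> ip; apply/funext => y; rewrite /mollify -RintegralZl//; last exact: conv_integrable1.
by apply: eq_Rintegral => x _; rewrite mulrA.
Qed.

(** Young's inequality for a nonnegative kernel of mass one: Tonelli, then the mass of the kernel in
    the other variable. *)
Lemma conv_contract p : L1 p ->
  (\int[mu]_y `|(mollify a p y)%:E| <= \int[mu]_x `|(p x)%:E|)%E.
Proof.
move=> ip; have mK := measurable_conv_kernel ip.
have mK1 : measurable_fun setT (fun z : 'rV[R]_n * 'rV[R]_n => `|(p z.1 * moll_rV a (z.1 - z.2))%:E|%E).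
  by apply: measurableT_comp => //; exact/measurable_EFinP.
apply: (@le_trans _ _ (\int[mu]_y \int[mu]_x `|(p x * moll_rV a (x - y))%:E|)%E).
  apply: ge0_le_integral => //=.
  - by apply: measurable_abse_EFin; exact: measurable_conv.
  - by apply: (@measurable_fun_fubini_tonelli_G _ _ _ _ R mu _ mK1) => z; exact: abse_ge0.
  move=> y _; rewrite -[leLHS]/(`|(mollify a p y)%:E|%E) -conv_EFin//.
  apply: (@le_abse_integral _ _ _ mu setT (fun x => (p x * moll_rV a (x - y))%:E)) => //.
  by have /measurable_int := conv_integrable1 y ip.
rewrite -(@fubini_tonelli _ _ _ _ _ mu mu _ mK1)//=.
apply: ge0_le_integral => //=.
- by move=> x _; exact: integral_ge0.
- by apply: (@measurable_fun_fubini_tonelli_F _ _ _ _ R mu _ mK1) => z; exact: abse_ge0.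
- by apply: measurable_abse_EFin; have /measurable_int/measurable_EFinP := ip.
move=> x _; under eq_integral.
  move=> y _; rewrite normrM (ger0_norm (moll_rV_ge0 a0 _)) EFinM.
  over.
rewrite ge0_integralZl//.
- by rewrite integral_moll_rV2// mule1.
- under eq_fun do rewrite (moll_rVC a).
  by apply/measurable_EFinP; exact: measurable_moll_rV.
- by move=> y _; rewrite lee_fin moll_rV_ge0.
Qed.

End conv_a.

(** The class of functions whose mollifications converge to them in [L^1]. It is shown to be linear
    and closed under [L^1] limits and to contain indicators of boxes; integrable functions of
    bounded support then follow. *)
Definition convL1 p := L1 p /\ forall e : R, 0 < e -> exists K, forall k, (K <= k)%N ->
  (\int[mu]_x `|(mollify k.+1%:R^-1 p x - p x)%:E| <= e%:E)%E.

Let inv0 k : 0 < k.+1%:R^-1 :> R. Proof. by rewrite invr_gt0. Qed.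

Lemma L1_measurable p : L1 p -> measurable_fun setT p.
Proof. by move=> /measurable_int/measurable_EFinP. Qed.

Let le_int3 p q (r : 'rV[R]_n -> R) (a b : \bar R) : measurable_fun setT p -> measurable_fun setT q ->
  measurable_fun setT r -> (forall x, `|r x| <= `|p x| + `|q x|) ->
  (\int[mu]_x `|(p x)%:E| <= a)%E -> (\int[mu]_x `|(q x)%:E| <= b)%E ->
  (\int[mu]_x `|(r x)%:E| <= a + b)%E.
Proof.
move=> mp mq mr rpq pa qb.
have mN (s : 'rV[R]_n -> R) : measurable_fun setT s -> measurable_fun setT (fun x : 'rV[R]_n => `|(s x)%:E|%E).
  exact: measurable_abse_EFin.
apply: (le_trans _ (leeD pa qb)); rewrite -ge0_integralD//; try exact: mN.
apply: ge0_le_integral => //=; try exact: mN.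
  by apply: emeasurable_funD; exact: mN.
by move=> x _; rewrite lee_fin.
Qed.

Lemma convL1_B p q : convL1 p -> convL1 q -> convL1 (fun x => p x - q x).
Proof.
move=> [ip Hp] [iq Hq]; split; first exact: (integrableB _ ip iq).
move=> e e0; have e20 : 0 < e / 2 by rewrite divr_gt0.
have [K1 H1] := Hp _ e20; have [K2 H2] := Hq _ e20.
exists (maxn K1 K2) => k; rewrite geq_max => /andP[/H1 h1 /H2 h2].
rewrite (splitr e) EFinD; apply: le_int3 h1 h2.
- by apply: measurable_funB; [exact: measurable_conv|exact: L1_measurable].
- by apply: measurable_funB; [exact: measurable_conv|exact: L1_measurable].
- apply: measurable_funB; first by apply: measurable_conv => //; exact: (integrableB _ ip iq).
  by apply: measurable_funB; exact: L1_measurable.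
move=> x; rewrite convB//.
rewrite (_ : _ - _ = (mollify k.+1%:R^-1 p x - p x) - (mollify k.+1%:R^-1 q x - q x)); last by ring.
exact: ler_normB.
Qed.

Lemma convL1_Z c p : convL1 p -> convL1 (fun x => c * p x).
Proof.
move=> [ip Hp]; split; first exact: (integrableZl _ c ip).
move=> e e0; have c0 : 0 < `|c| + 1 by rewrite ltr_wpDl.
have e20 : 0 < e / (`|c| + 1) by rewrite divr_gt0.
have [K HK] := Hp _ e20; exists K => k /HK h.
rewrite (@le_trans _ _ ((`|c| + 1)%:E * \int[mu]_x `|(mollify k.+1%:R^-1 p x - p x)%:E|)%E)//; last first.
  by rewrite (le_trans (lee_wpmul2l _ h)) ?lee_fin ?(ltW c0)// mulrCA mulfV ?mulr1// gt_eqF.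
have mm : measurable_fun setT (fun x => mollify k.+1%:R^-1 p x - p x).
  by apply: measurable_funB; [exact: measurable_conv|exact: L1_measurable].
rewrite -ge0_integralZl ?lee_fin ?(ltW c0)//; last exact: measurable_abse_EFin.
apply: ge0_le_integral => //=.
- apply: measurable_abse_EFin; apply: measurable_funB.
    by apply: measurable_conv => //; exact: (integrableZl _ c ip).
  by apply: measurable_funM => //; exact: L1_measurable.
- by apply: emeasurable_funM => //; exact: measurable_abse_EFin.
move=> x _; rewrite convZ// lee_fin -mulrBr normrM ler_wpM2r// lerDl//.
Qed.

(** An [e / 3] argument: by [conv_contract] the mollified difference [p - q] is no larger than the
    difference itself, uniformly in the radius. *)
Lemma convL1_approx p : L1 p ->
  (forall e : R, 0 < e -> exists2 q, convL1 q & (\int[mu]_x `|(p x - q x)%:E| <= e%:E)%E) ->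
  convL1 p.
Proof.
move=> ip H; split => // e e0.
have e30 : 0 < e / 3 by rewrite divr_gt0.
have [q [iq Hq] pq] := H _ e30; have [K HK] := Hq _ e30; exists K => k /HK h.
have ipq : L1 (fun x => p x - q x) by exact: (integrableB _ ip iq).
have mpq := L1_measurable ipq.
have mcq : measurable_fun setT (fun x => mollify k.+1%:R^-1 q x - q x).
  by apply: measurable_funB; [exact: measurable_conv|exact: L1_measurable].
have mcpq : measurable_fun setT (fun x => mollify k.+1%:R^-1 (fun x => p x - q x) x).
  exact: measurable_conv.
have cpq := le_trans (conv_contract (inv0 k) ipq) pq.
have h1 : (\int[mu]_x `|(mollify k.+1%:R^-1 (fun x => p x - q x) x - (p x - q x))%:E| <= (e/3)%:E + (e/3)%:E)%E.
  apply: le_int3 cpq pq => //; first exact: measurable_funB.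
  by move=> x; exact: ler_normB.
have mcpq' := measurable_funB mcpq mpq.
have -> : e = (e / 3 + e / 3) + e / 3 by field.
rewrite !EFinD; apply: le_int3 h1 h => //.
  by apply: measurable_funB; [exact: measurable_conv|exact: L1_measurable].
move=> x; rewrite convB//; apply: le_trans (ler_normD _ _); rewrite le_eqVlt; apply/orP; left; apply/eqP.
by congr `|_|; ring.
Qed.

End convolution.

(** * Convergence of mollifications, from boxes to integrable functions of bounded support *)

Section convolution_density.
Context {R : realType} {n : nat}.
Local Notation mu := (lebesgue_rV R n).
Implicit Types p q : 'rV[R]_n -> R.
Local Notation L1 p := (mu.-integrable setT (EFin \o p)).

Definition open_box (a b : 'I_n -> R) : set 'rV[R]_n :=
  [set x | forall j, a j < x ord0 j < b j].

Lemma open_boxE a b : open_box a b = rV_box (fun j => `]a j, b j[%classic).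
Proof. by apply/seteqP; split=> x h j; have := h j; rewrite /= in_itv. Qed.

Lemma measurable_open_box a b : measurable (open_box a b).
Proof. by rewrite open_boxE; apply: measurable_rV_box => j; exact: measurable_itv. Qed.

Lemma open_boxI a b c d : open_box a b `&` open_box c d =
  open_box (fun j => Num.max (a j) (c j)) (fun j => Num.min (b j) (d j)).
Proof.
apply/seteqP; split => x.
  by move=> [h1 h2] j; rewrite gt_max lt_min; have /andP[-> ->] := h1 j; exact: h2.
by move=> h; split => j; have := h j; rewrite gt_max lt_min => /andP[/andP[h1 h2] /andP[h3 h4]]; apply/andP.
Qed.

(** Boxes are stable under intersection, as required by the Dynkin argument and by the uniqueness of
    measures that gives translation invariance. *)
Lemma measurable_open_boxes : @measurable _ 'rV[R]_n =
  <<s [set B | exists a b, B = open_box a b] >>.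
Proof.
set S := <<s _ >>.
have S_sigma : sigma_algebra setT S by exact: smallest_sigma_algebra.
have openS (A : set 'rV[R]_n) : open A -> S A.
  move=> /open_rV_bigcup ->; rewrite bigcup_mkcond.
  pose T := g_sigma_algebraType [set B | exists a b, B = open_box a b].
  apply: (@countable_bigcupT_measurable _ T) => [|i]; first exact: countableP.
  case: ifPn => _; last exact: (@measurable0 _ T).
  apply: sub_sigma_algebra; set c := map_mx _ _; set e := _^-1.
  exists (fun j => c ord0 j - e), (fun j => c ord0 j + e).
  by rewrite open_boxE ball_rV_box// invr_gt0.
apply/seteqP; split; last first.
  apply: smallest_sub; first exact: sigma_algebra_measurable.
  by move=> _ [a [b ->]]; exact: measurable_open_box.
apply: smallest_sub => // _ [i [j [B mB ->]]].
pose f := fun M : 'rV[R]_n => M i j.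
suff : measurable `<=` [set B : set R | S (f @^-1` B)] by exact.
move=> {B mB}; apply: (@subset_trans _ (RGenOpens.G (R:=R)).-sigma.-measurable).
  by rewrite -RGenOpens.measurableE.
apply: smallest_sub.
  pose T := g_sigma_algebraType [set B | exists a b, B = open_box a b].
  split.
  - by rewrite /= preimage_set0; exact: (@measurable0 _ T).
  - move=> A /= SA; rewrite setTD preimage_setC; exact: (@measurableC _ T).
  - move=> F /= SF; rewrite preimage_bigcup; exact: (@bigcupT_measurable _ T).
move=> _ [a [b ->]] /=; apply: openS; apply: open_comp; last exact: interval_open.
by move=> x _; exact: coord_continuous.
Qed.

Lemma coord_negligible (j : 'I_n) (c : R) :
  mu.-negligible [set x : 'rV[R]_n | x ord0 j = c].
Proof.
exists [set x : 'rV[R]_n | x ord0 j = c]; split => //.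
  have := @measurable_coord R n j measurableT [set c] (measurable_set1 c).
  by rewrite setTI.
rewrite (_ : mkset _ = rV_box (fun k => if k == j then [set c] else setT)).
  rewrite lebesgue_rV_box; last by move=> k; case: ifP.
  by rewrite (bigD1 j)//= eqxx lebesgue_measure_set1 mul0e.
apply/seteqP; split => x /=; first by move=> h k; case: eqP => // ->.
by move=> /(_ j); rewrite eqxx.
Qed.

Lemma near_same_side (s t c e : R) : `|t - s| < e -> e <= `|t - c| ->
  (c < s) = (c < t) /\ (s < c) = (t < c).
Proof.
rewrite ltr_distlC => /andP[h1 h2]; rewrite ler_normr => /orP[h|h].
  have h3 : c < s by lra.
  have h4 : c < t by lra.
  by rewrite h3 h4 (lt_gtF h3) (lt_gtF h4).
have h3 : s < c by lra.
have h4 : t < c by lra.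
by rewrite h3 h4 (lt_gtF h3) (lt_gtF h4).
Qed.

Lemma integrable_indic_lty (B : set 'rV[R]_n) : measurable B -> (mu B < +oo)%E ->
  L1 (\1_B : 'rV[R]_n -> R).
Proof.
move=> mB Boo; apply/integrableP; split; first by apply/measurable_EFinP; exact: measurable_indic.
rewrite (eq_integral (fun x => (\1_B x)%:E)); last by move=> x _ /=; rewrite ger0_norm// indicE ler0n.
by rewrite integral_indic// setIT.
Qed.

Lemma moll_near_box (a b : 'I_n -> R) (y : 'rV[R]_n) :
  (forall j, y ord0 j != a j /\ y ord0 j != b j) ->
  exists2 e : R, 0 < e & forall x, ball y e x -> open_box a b x <-> open_box a b y.
Proof.
move=> yab.
pose e := \big[Num.min/1]_(j < n) Num.min `|y ord0 j - a j| `|y ord0 j - b j|.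
have e0 : 0 < e.
  apply: (big_ind (fun x => 0 < x)) => //; first by move=> u v u0 v0; rewrite lt_min u0.
  by move=> j _; have [ya yb] := yab j; rewrite lt_min !normr_gt0 !subr_eq0 ya yb.
exists e => // x /(ball_rVP _ _ e0) xy.
have xj j : (a j < x ord0 j) = (a j < y ord0 j) /\ (x ord0 j < b j) = (y ord0 j < b j).
  have : e <= Num.min `|y ord0 j - a j| `|y ord0 j - b j|.
    by rewrite /e (bigD1 j)//= ge_min lexx.
  rewrite le_min => /andP[ea eb].
  by have [-> _] := near_same_side (xy j) ea; have [_ ->] := near_same_side (xy j) eb.
by split => h j; have := h j; have [-> ->] := xj j.
Qed.

(** Off the faces the indicator is constant near [y], so a mollification of small radius reproduces
    it exactly. As the faces are null sets, this gives convergence almost everywhere. *)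
Lemma conv_box_near (a b : 'I_n -> R) (y : 'rV[R]_n) :
  (forall j, y ord0 j != a j /\ y ord0 j != b j) ->
  exists2 e : R, 0 < e & forall c, 0 < c < e -> mollify c (\1_(open_box a b)) y = \1_(open_box a b) y.
Proof.
move=> /moll_near_box[e e0 ye]; exists e => // c /andP[c0 ce].
have E x : \1_(open_box a b) x * moll_rV c (x - y) = \1_(open_box a b) y * moll_rV c (x - y).
  have [->|/(moll_rV_supp c0) xy] := eqVneq (moll_rV c (x - y)) 0; first by rewrite !mulr0.
  have {}xy : ball y e x by apply: le_ball xy; exact: ltW.
  congr (_ * _); rewrite !indicE; congr (_%:R); congr nat_of_bool.
  by apply/idP/idP => /set_mem /(ye _ xy) h; exact/mem_set.
rewrite /mollify; under eq_Rintegral do rewrite E.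
rewrite RintegralZl//.
  by rewrite /Rintegral integral_moll_rV//= mulr1.
apply/integrableP; split; first by apply/measurable_EFinP; exact: measurable_moll_rV.
under eq_integral do rewrite /= ger0_norm ?moll_rV_ge0//.
by rewrite integral_moll_rV// ltry.
Qed.

Lemma conv_indic_bound (B : set 'rV[R]_n) c y : 0 < c -> measurable B -> (mu B < +oo)%E ->
  0 <= mollify c \1_B y <= 1.
Proof.
move=> c0 mB Boo.
have iB : L1 \1_B by exact: integrable_indic_lty.
rewrite -!lee_fin -conv_EFin//; apply/andP; split.
  by apply: integral_ge0 => x _; rewrite lee_fin mulr_ge0 ?moll_rV_ge0// indicE ler0n.
rewrite -(integral_moll_rV c0 y); apply: ge0_le_integral => //=.
- by move=> x _; rewrite lee_fin mulr_ge0 ?moll_rV_ge0// indicE ler0n.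
- by have /measurable_int := conv_integrable1 c0 y iB.
- by apply/measurable_EFinP; exact: measurable_moll_rV.
move=> x _; rewrite lee_fin ler_piMl ?moll_rV_ge0//.

Qed.

Lemma conv_indic_out (B : set 'rV[R]_n) c y : 0 < c ->
  (forall x, B x -> ~ ball y c x) -> mollify c \1_B y = 0.
Proof.
move=> c0 By; rewrite /mollify (@eq_Rintegral _ _ _ mu setT (cst 0)) ?Rintegral_cst ?mul0r//.
move=> x _ /=; rewrite indicE; have [/set_mem /By Bx|_] := boolP (x \in B); last by rewrite mul0r.
by rewrite mul1r; apply/eqP/negP => /negP/(moll_rV_supp c0).
Qed.

Lemma lebesgue_open_box_lty a b : (mu (open_box a b) < +oo)%E.
Proof.
apply: (@bounded_rV_lty _ _ (open_box a b)); first exact: measurable_open_box.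
exists (\sum_(j < n) (`|a j| + `|b j|)); split; first exact: num_real.
move=> M hM x abx; apply: ltW; apply: le_lt_trans hM.
rewrite [`|x|]mx_normrE; apply: bigmax_le => [|[i j] _]; first by apply: sumr_ge0 => j _; exact: addr_ge0.
rewrite (ord1 i) /= (bigD1 j)//= -[leLHS]addr0 lerD//; last first.
  by apply: sumr_ge0 => k _; exact: addr_ge0.
have := abx j => /andP[h1 h2]; rewrite ler_norml.
have := ler_norm (a j); have := ler_norm (b j); have := ler_norm (- a j); have := ler_norm (- b j).
by rewrite !normrN => h3 h4 h5 h6; apply/andP; split; lra.
Qed.

Lemma convL1_box a b : convL1 (\1_(open_box a b)).
Proof.
have mB := measurable_open_box a b; have Boo := lebesgue_open_box_lty a b.
have iB : L1 \1_(open_box a b) by exact: integrable_indic_lty.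
split => // e e0.
(* All radii [k.+1%:R^-1] are at most [1], so the box enlarged by [1] contains the supports of all
   mollifications and its indicator dominates them. *)
pose B1 := open_box (fun j => a j - 1) (fun j => b j + 1).
have inv0 k : 0 < k.+1%:R^-1 :> R by rewrite invr_gt0.
have cv : {ae mu, forall x, setT x -> (EFin \o mollify k.+1%:R^-1 \1_(open_box a b)) x @[k --> \oo] --> (\1_(open_box a b) x)%:E}.
  have : {ae mu, forall x : 'rV[R]_n, forall j : 'I_n, x ord0 j != a j /\ x ord0 j != b j}.
    have H : {ae mu, forall x : 'rV[R]_n, forall j : nat, forall jn : (j < n)%N, x ord0 (Ordinal jn) != a (Ordinal jn) /\ x ord0 (Ordinal jn) != b (Ordinal jn)}.
      apply/ae_foralln => j; have [jn|jn] : (j < n)%N \/ ~~ (j < n)%N by case: (j < n)%N; [left|right].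
        2: by apply: nearW => x jn'; rewrite jn' in jn.
      apply: (@negligibleS _ _ _ mu ([set x : 'rV[R]_n | x ord0 (Ordinal jn) = a (Ordinal jn)] `|` [set x | x ord0 (Ordinal jn) = b (Ordinal jn)])).
        move=> x /= h; apply: contrapT => /not_orP[h1 h2]; apply: h => jn'.
        by rewrite (bool_irrelevance jn' jn); split; apply/eqP.
      by apply: negligibleU; exact: coord_negligible.
    by apply: filterS H => x h [j jn]; exact: h.
  apply: filterS => x /conv_box_near[d d0 hd] _ /=.
  apply: cvg_near_cst; near=> k; congr EFin; apply: hd; rewrite inv0/=.
  by near: k; exact: (near_infty_natSinv_lt (PosNum d0)).
have mB1 : measurable B1 by exact: measurable_open_box.
have iB1 : L1 \1_B1 by apply: integrable_indic_lty => //; exact: lebesgue_open_box_lty.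
have bd : {ae mu, forall x k, setT x -> (`|(EFin \o mollify k.+1%:R^-1 \1_(open_box a b)) x| <= (EFin \o \1_B1) x)%E}.
  apply: nearW => x k _ /=; rewrite lee_fin indicE.
  have [_|/negP xB1] := boolP (x \in B1).
    have /andP[h1 h2] := conv_indic_bound x (inv0 k) mB Boo.
    by rewrite ger0_norm.
  rewrite conv_indic_out ?normr0// => y yab xy; apply: xB1; apply/mem_set => j.
  have := (ball_rVP _ _ (inv0 k)).1 xy j; have := yab j.
  have : k.+1%:R^-1 <= 1 :> R by rewrite invf_le1// ler1n.
  generalize (k.+1%:R^-1 : R) => t.
  by rewrite ltr_distlC => h1 /andP[h2 h3] /andP[h4 h5]; apply/andP; split; lra.
have [_ + _] := @dominated_convergence _ _ _ mu setT measurableT (fun k => EFin \o mollify k.+1%:R^-1 \1_(open_box a b)) (EFin \o \1_(open_box a b)) (EFin \o \1_B1) (fun k => (measurable_EFinP _ _).2 (measurable_conv (inv0 k) iB)) ((measurable_EFinP _ _).2 (measurable_indic mB)) cv iB1 bd.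
move=> /fine_cvgP[fn] /cvgrPdist_le /(_ _ e0) H.
have [K _ HK] : \forall k \near \oo, (\int[mu]_x `|(mollify k.+1%:R^-1 \1_(open_box a b) x - \1_(open_box a b) x)%:E| <= e%:E)%E.
  near=> k; have fk : (\int[mu]_x `|(mollify k.+1%:R^-1 \1_(open_box a b) x - \1_(open_box a b) x)%:E|)%E \is a fin_num by near: k.
  rewrite -(fineK fk) lee_fin -[leLHS]ger0_norm ?fine_ge0 ?integral_ge0//.
  by rewrite -normrN -sub0r; near: k.
by exists K => k /HK.
Unshelve. all: by end_near. Qed.
Lemma convL1_0 : convL1 (fun _ : 'rV[R]_n => 0).
Proof.
have := convL1_Z 0 (convL1_box (fun=> 0) (fun=> 0)).
by congr convL1; apply/funext => x; rewrite mul0r.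
Qed.

Lemma convL1_D p q : convL1 p -> convL1 q -> convL1 (fun x => p x + q x).
Proof.
move=> cp cq; have := convL1_B cp (convL1_Z (-1) cq).
by congr convL1; apply/funext => x; rewrite mulN1r opprK.
Qed.

Lemma convL1_sum I (r : seq I) (f : I -> 'rV[R]_n -> R) : (forall i, convL1 (f i)) ->
  convL1 (fun x => \sum_(i <- r) f i x).
Proof.
move=> cf; elim: r => [|i r IH].
  by have := convL1_0; congr convL1; apply/funext => x; rewrite big_nil.
by have := convL1_D (cf i) IH; congr convL1; apply/funext => x; rewrite big_cons.
Qed.

Lemma indicD_setI (A B Q : set 'rV[R]_n) (x : 'rV[R]_n) : A `&` B = set0 ->
  \1_((A `|` B) `&` Q) x = \1_(A `&` Q) x + \1_(B `&` Q) x :> R.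
Proof.
move=> AB; rewrite !indicE !in_setI in_setU.
case: (boolP (x \in A)) => [/set_mem Ax|_]; case: (boolP (x \in B)) => [/set_mem Bx|_];
  case: (x \in Q); rewrite /= ?addr0 ?add0r//.
by have : (A `&` B) x by []; rewrite AB.
Qed.

(** Dynkin induction from boxes. Intersecting with a fixed box keeps all measures finite, as is
    needed for complements and for continuity along increasing unions. *)
Lemma convL1_indic (a b : 'I_n -> R) (B : set 'rV[R]_n) : measurable B ->
  convL1 (\1_(B `&` open_box a b)).
Proof.
set Q := open_box a b; have mQ : measurable Q by exact: measurable_open_box.
have ltB (A : set 'rV[R]_n) : measurable A -> (mu (A `&` Q) < +oo)%E.
  move=> mA; apply: le_lt_trans (lebesgue_open_box_lty a b).
  by apply: le_measure; rewrite ?inE//; exact: measurableI.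
have iB (A : set 'rV[R]_n) : measurable A -> L1 (\1_(A `&` Q) : 'rV[R]_n -> R).
  by move=> mA; apply: integrable_indic_lty; [exact: measurableI|exact: ltB].
suff H S : <<s [set B | exists a b, B = open_box a b] >> S -> convL1 (\1_(S `&` Q)).
  by move=> mB; apply: H; rewrite -measurable_open_boxes.
move: S; apply: (@dynkin_induction _ _ _ (fun B => convL1 (\1_(B `&` Q))) measurable_open_boxes).
- move=> _ _ [a1 [b1 ->]] [a2 [b2 ->]]; rewrite open_boxI; do 2 eexists; reflexivity.
- by rewrite setTI; exact: convL1_box.
- by move=> _ [a1 [b1 ->]]; rewrite /= open_boxI; exact: convL1_box.
- move=> S mS cS /=; have := convL1_B (convL1_box a b) cS.
  congr convL1; apply/funext => x; rewrite !indicE !in_setI in_setC.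
  by case: (x \in S); case: (x \in Q); rewrite /= ?subrr ?subr0.
move=> F mF tF cF /=.
have mU : measurable (\bigcup_k F k) by exact: bigcupT_measurable.
apply: convL1_approx; first exact: iB.
move=> e e0.
pose G k := \big[setU/set0]_(i < k) F i.
have mG k : measurable (G k) by apply: bigsetU_measurable.
have cG k : convL1 (\1_(G k `&` Q)).
  elim: k => [|k IH].
    rewrite /G big_ord0 set0I; have := convL1_0; congr convL1.
    by apply/funext => x; rewrite indic0.
  have -> : (\1_(G k.+1 `&` Q) : 'rV[R]_n -> R) = fun x => \1_(G k `&` Q) x + \1_(F k `&` Q) x.
    apply/funext => x; rewrite -indicD_setI ?/G ?big_ord_recr//.
    rewrite -bigcup_mkord; apply/seteqP; split => // z [[i /= ik Fi] Fk].
    have ik' : i = k by apply: tF => //; exists z.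
    by rewrite ik' ltnn in ik.
  exact: convL1_D.
have UG : \bigcup_k (G k `&` Q) = (\bigcup_k F k) `&` Q.
  rewrite -setI_bigcupl; congr (_ `&` _).
  apply/seteqP; split => x [k _].
    by rewrite /G -bigcup_mkord => -[i _ Fi]; exists i.
  by move=> Fk; exists k.+1 => //; rewrite /G big_ord_recr; right.
have : (mu \o (fun k => G k `&` Q)) k @[k --> \oo] --> mu (\bigcup_k (G k `&` Q)).
  apply: nondecreasing_cvg_mu => [k||].
  - exact: measurableI.
  - by rewrite UG; exact: measurableI.
  by move=> k l kl; apply/subsetPset; apply: setSI; apply: subset_bigsetU.
rewrite UG => cv.
have fU : mu ((\bigcup_k F k) `&` Q) \is a fin_num by rewrite ge0_fin_numE// ltB.
rewrite -(fineK fU) in cv; move/fine_cvgP : cv => [_ /cvgrPdist_le /(_ _ e0)[K _ /(_ K (leqnn K)) HK]].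
exists (\1_(G K `&` Q)) => //.
have GU : G K `&` Q `<=` (\bigcup_k F k) `&` Q by rewrite -UG => x Gx; exists K.
rewrite (eq_integral (fun x => (\1_(((\bigcup_k F k) `&` Q) `\` (G K `&` Q)) x)%:E)); last first.
  move=> x _; congr EFin; rewrite !indicE in_setD.
  case: (boolP (x \in G K `&` Q)) => [/set_mem/GU/mem_set ->|_]; first by rewrite /= subrr normr0.
  by rewrite subr0 andbT ger0_norm.
have mGQ : measurable (G K `&` Q) by exact: measurableI.
have mUQ : measurable ((\bigcup_k F k) `&` Q) by exact: measurableI.
rewrite integral_indic ?setIT//; last exact: measurableD.
rewrite measureD ?ltB//= (setIidr GU).
rewrite -(fineK fU) -(@fineK _ (mu (G K `&` Q))) ?ge0_fin_numE ?ltB// -EFinB lee_fin.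
exact: le_trans (ler_norm _) HK.
Qed.

(** Simple functions approximate [p] in [L^1] on the box, and each is a finite combination of
    indicators already treated. *)
Lemma convL1_bounded_supp (a b : 'I_n -> R) p : L1 p ->
  (forall x, ~ open_box a b x -> p x = 0) -> convL1 p.
Proof.
move=> ip p0; apply: convL1_approx => // e e0.
have mQ : measurable (open_box a b) by exact: measurable_open_box.
have ipQ : mu.-integrable (open_box a b) (EFin \o p) by apply: integrableS ip.
have [g [ig _ /fine_cvgP[fn /cvgrPdist_le /(_ _ e0) H]]] := approximation_sfun_integrable mQ ipQ.
have [k [fk Hk]] : exists k, (\int[mu]_(x in open_box a b) `|(EFin \o p) x - (g k x)%:E|)%E \is a fin_num /\
    `|0 - fine (\int[mu]_(x in open_box a b) `|(EFin \o p) x - (g k x)%:E|)%E| <= e.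
  have [k [_ h]] : exists k, True /\ ((\int[mu]_(x in open_box a b) `|(EFin \o p) x - (g k x)%:E|)%E \is a fin_num /\
    `|0 - fine (\int[mu]_(x in open_box a b) `|(EFin \o p) x - (g k x)%:E|)%E| <= e).
    have /(filterI fn) [K _ HK] := H; exists K; split => //.
    by have := HK K (leqnn K).
  by exists k.
exists (fun x => g k x * \1_(open_box a b) x).
  have -> : (fun x => g k x * \1_(open_box a b) x) =
     fun x => \sum_(y <- finmap.enum_fset (fset_set (range (g k)))) (y * \1_((g k @^-1` [set y]) `&` open_box a b) x).
    apply/funext => x; rewrite {1}fimfunE fsbig_finite//= mulr_suml; apply: eq_bigr => i _.
    by rewrite -mulrA indicI.
  apply: convL1_sum => i; apply: convL1_Z; apply: convL1_indic.
  by rewrite -[X in measurable X]setTI; exact: measurable_funPT.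
rewrite (eq_integral (fun x => ((fun x => `|(EFin \o p) x - (g k x)%:E|%E) \_ (open_box a b)) x)); last first.
  move=> x _; rewrite patchE; case: (boolP (x \in open_box a b)) => [xQ|xQ].
    by rewrite indicE xQ mulr1.
  have -> : p x = 0 by apply: p0 => /mem_set; exact/negP.
  by rewrite indicE (negbTE xQ) mulr0 subr0 abse0.
rewrite -integral_mkcond -(fineK fk) lee_fin.
by move: Hk; rewrite sub0r normrN; exact: le_trans (ler_norm _).
Qed.

End convolution_density.

(** * Square-integrable functions *)

Section sqint.
Context d (T : measurableType d) (R : realType) (mu : {measure set T -> \bar R}).
Variable D : set T.
Hypothesis mD : measurable D.
Hypothesis Doo : (mu D < +oo)%E.
Implicit Types v w f g : T -> R.
Local Notation I f := (Rintegral mu D f).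
Local Notation int f := (mu.-integrable D (EFin \o f)).
Local Notation mf v := (measurable_fun D v).

Definition sqint v := mf v /\ int (fun x => v x ^+ 2).
Definition norm2 v : R := Num.sqrt (I (fun x => v x ^+ 2)).

Lemma norm2_ge0 v : 0 <= norm2 v. Proof. exact: sqrtr_ge0. Qed.

Lemma integral_sqr_ge0 v : 0 <= I (fun x => v x ^+ 2).
Proof. by apply: Rintegral_ge0 => x _; exact: sqr_ge0. Qed.

Lemma norm2_sqr v : norm2 v ^+ 2 = I (fun x => v x ^+ 2).
Proof. by rewrite sqr_sqrtr// integral_sqr_ge0. Qed.

Lemma sqint_intM v w : sqint v -> sqint w -> int (fun x => v x * w x).
Proof.
move=> [mv iv] [mw iw]; apply: (@integrable_le_norm _ _ _ mu D _ (fun x => v x ^+ 2 + w x ^+ 2)) => //.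
- exact: measurable_funM.
- exact: (integrableD mD iv iw).
move=> x _; rewrite [leRHS]ger0_norm ?addr_ge0 ?sqr_ge0// ler_norml; apply/andP; split.
  by have := sqr_ge0 (v x + w x); nra.
by have := sqr_ge0 (v x - w x); nra.
Qed.

Lemma integrable_cst_fin c : int (fun=> c).
Proof.
apply/integrableP; split; first by apply/measurable_EFinP; exact: measurable_cst.
rewrite integral_cst//= lte_mul_pinfty// ?lee_fin// ltry.
Qed.

Lemma sqint_cst c : sqint (fun=> c).
Proof. by split; [exact: measurable_cst|exact: integrable_cst_fin]. Qed.

Lemma sqint_int v : sqint v -> int v.
Proof.
move=> sv; have := sqint_intM sv (sqint_cst 1).
by apply: eq_integrable => // x _ /=; rewrite mulr1.
Qed.

Lemma sqintD v w : sqint v -> sqint w -> sqint (fun x => v x + w x).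
Proof.
move=> [mv iv] [mw iw]; split; first exact: measurable_funD.
apply: (@integrable_le_norm _ _ _ mu D _ (fun x => 2 * (v x ^+ 2) + 2 * (w x ^+ 2))) => //.
- by apply: measurable_funX; exact: measurable_funD.
- by apply: (integrableD mD (integrableZl mD 2 iv) (integrableZl mD 2 iw)).
move=> x _; rewrite ger0_norm ?sqr_ge0// ger0_norm; last by rewrite addr_ge0// mulr_ge0// sqr_ge0.
by have := sqr_ge0 (v x - w x); nra.
Qed.

Lemma sqintZ c v : sqint v -> sqint (fun x => c * v x).
Proof.
move=> [mv iv]; split; first exact: measurable_funM.
have := integrableZl mD (c ^+ 2) iv.
by apply: eq_integrable => // x _ /=; rewrite -EFinM exprMn.
Qed.

Lemma sqintN v : sqint v -> sqint (fun x => - v x).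
Proof.
move=> /(sqintZ (-1)) h; rewrite (_ : (fun x => - v x) = fun x => -1 * v x)//.
by apply/funext => x; rewrite mulN1r.
Qed.

Lemma ae_eq_sqint v w : mf w -> {ae mu, forall x, D x -> v x = w x} ->
  sqint v -> sqint w.
Proof.
move=> mw vw [mv iv]; split => //.
apply/integrableP; split; first by apply/measurable_EFinP; exact: measurable_funX.
have /integrableP[_] := iv; rewrite (@ge0_ae_eq_integral _ _ _ mu D _ (fun x => `|(w x ^+ 2)%:E|%E)) => //.
- by apply: measurable_abse_EFin; exact: measurable_funX.
- by apply: measurable_abse_EFin; exact: measurable_funX.
- by apply: filterS vw => x vw Dx /=; rewrite vw.
Qed.

Lemma ae_eq_Rintegral f g : mf f -> mf g -> {ae mu, forall x, D x -> f x = g x} ->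
  I f = I g.
Proof.
move=> mf1 mg fg; congr fine; apply: ae_eq_integral => //; try exact/measurable_EFinP.
by apply: filterS fg => x fg Dx /=; rewrite fg.
Qed.

Lemma ae_eq_norm2 v w : mf v -> mf w -> {ae mu, forall x, D x -> v x = w x} ->
  norm2 v = norm2 w.
Proof.
move=> mv mw vw; congr Num.sqrt; apply: ae_eq_Rintegral; try exact: measurable_funX.
by apply: filterS vw => x vw Dx; rewrite vw.
Qed.

Lemma cauchy_schwarz v w : sqint v -> sqint w ->
  `|I (fun x => v x * w x)| <= norm2 v * norm2 w.
Proof.
move=> sv sw; have ivw := sqint_intM sv sw; have [mv iv] := sv; have [mw iw] := sw.
set a := I _; rewrite -(@ler_pXn2r _ 2)// ?nnegrE ?mulr_ge0 ?norm2_ge0//.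
rewrite exprMn !norm2_sqr real_normK ?num_real//.
set A := I _; set B := I _.
have A0 : 0 <= A by exact: integral_sqr_ge0.
have B0 : 0 <= B by exact: integral_sqr_ge0.
have key s t : 0 <= s ^+ 2 * A + s * t * 2 * a + t ^+ 2 * B.
  have -> : s ^+ 2 * A + s * t * 2 * a + t ^+ 2 * B = I (fun x => (s * v x + t * w x) ^+ 2).
    rewrite /A /B /a -!RintegralZl// -RintegralD//; last 2 first.
    - exact: (integrableZl mD (s ^+ 2) iv).
    - exact: (integrableZl mD (s * t * 2) ivw).
    rewrite -RintegralD//.
    - by apply: eq_Rintegral => x _; ring.
    - exact: (integrableD mD (integrableZl mD (s ^+ 2) iv) (integrableZl mD (s * t * 2) ivw)).
    - exact: (integrableZl mD (t ^+ 2) iw).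
  exact: integral_sqr_ge0.
clearbody a A B.
have [B_0|B_neq0] := eqVneq B 0.
  suff -> : a = 0 by rewrite expr0n B_0 mulr0.
  have [//|an0] := eqVneq a 0.
  (* When [B = 0] the form is linear in [t]; this value of [t] makes it equal to [-1] if [a] is
     nonzero, a contradiction. *)
  have := key 1 (- ((A + 1) / (2 * a))); rewrite B_0 mulr0 addr0 expr1n mul1r.
  have -> : 1 * - ((A + 1) / (2 * a)) * 2 * a = - (A + 1) by field.
  by move=> h; exfalso; lra.
have Bp : 0 < B by rewrite lt_neqAle eq_sym B_neq0.
(* The minimising direction: the quadratic form takes the value [B * (A * B - a ^+ 2)] there. *)
have := key B (- a); rewrite (_ : _ + _ = B * (A * B - a ^+ 2)); last by ring.
by rewrite pmulr_rge0// subr_ge0.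
Qed.

Lemma norm2D v w : sqint v -> sqint w -> norm2 (fun x => v x + w x) <= norm2 v + norm2 w.
Proof.
move=> sv sw; have ivw := sqint_intM sv sw; have [mv iv] := sv; have [mw iw] := sw.
rewrite -(@ler_pXn2r _ 2)// ?nnegrE ?addr_ge0 ?norm2_ge0//.
rewrite norm2_sqr sqrrD !norm2_sqr.
have -> : I (fun x => (v x + w x) ^+ 2) = I (fun x => v x ^+ 2) + 2 * I (fun x => v x * w x) + I (fun x => w x ^+ 2).
  rewrite -RintegralZl// -RintegralD//; last exact: (integrableZl mD 2 ivw).
  rewrite -RintegralD//; last exact: (integrableD mD iv (integrableZl mD 2 ivw)).
  by apply: eq_Rintegral => x _; ring.
rewrite lerD2r lerD2l -[leRHS]mulr_natl ler_pM2l//.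
exact: le_trans (ler_norm _) (cauchy_schwarz sv sw).
Qed.

Lemma norm2Z c v : sqint v -> norm2 (fun x => c * v x) = `|c| * norm2 v.
Proof.
move=> [mv iv]; rewrite /norm2.
rewrite (@eq_Rintegral _ _ _ mu D (fun x => c ^+ 2 * v x ^+ 2)); last by move=> x _; rewrite exprMn.
by rewrite RintegralZl// sqrtrM ?sqr_ge0// sqrtr_sqr.
Qed.

Lemma norm2N v : norm2 (fun x => - v x) = norm2 v.
Proof. by congr Num.sqrt; apply: eq_Rintegral => x _; rewrite sqrrN. Qed.

Lemma norm2_eq0 v : sqint v -> norm2 v = 0 -> {ae mu, forall x, D x -> v x = 0}.
Proof.
move=> [mv iv] n0; have : I (fun x => v x ^+ 2) = 0 by rewrite -norm2_sqr n0 expr0n.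
move=> I0.
have : (\int[mu]_(x in D) `|(v x ^+ 2)%:E|)%E = 0%E.
  rewrite (eq_integral (fun x => (v x ^+ 2)%:E)); last first.
    by move=> x _ /=; rewrite ger0_norm// sqr_ge0.
  rewrite -(@fineK _ (\int[mu]_(x in D) (v x ^+ 2)%:E)%E); first by congr EFin.
  exact: integrable_fin_num.
have mv2 : mf (fun x => (v x ^+ 2)%:E) by apply/measurable_EFinP; exact: measurable_funX.
move=> /(proj1 (@ae_eq_integral_abs _ _ _ mu D mD (fun x => (v x ^+ 2)%:E) mv2)).
apply: filterS => x h Dx; have := h Dx => -[/eqP].
by rewrite sqrf_eq0 => /eqP.
Qed.

Lemma sqint_mul_bounded (b : T -> R) v M : mf b -> {ae mu, forall x, D x -> `|b x| <= M} -> 0 <= M ->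
  sqint v -> sqint (fun x => b x * v x) /\ norm2 (fun x => b x * v x) <= M * norm2 v.
Proof.
move=> mb bM M0 [mv iv].
have ib : (\int[mu]_(x in D) ((b x * v x) ^+ 2)%:E <= \int[mu]_(x in D) (M ^+ 2 * v x ^+ 2)%:E)%E.
  apply: ae_ge0_le_integral => //.
  - by move=> x _; rewrite lee_fin sqr_ge0.
  - by apply/measurable_EFinP; apply: measurable_funX; exact: measurable_funM.
  - by move=> x _; rewrite lee_fin mulr_ge0// sqr_ge0.
  - by apply/measurable_EFinP; apply: measurable_funM => //; exact: measurable_funX.
  apply: filterS bM => x bM Dx; rewrite lee_fin exprMn ler_wpM2r ?sqr_ge0//.
  by rewrite -real_normK ?num_real// ler_pXn2r ?nnegrE//; exact: bM.
have iMv := integrableZl mD (M ^+ 2) iv.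
have ibv : int (fun x => (b x * v x) ^+ 2).
  apply/integrableP; split.
    by apply/measurable_EFinP; apply: measurable_funX; exact: measurable_funM.
  under eq_integral do rewrite /= ger0_norm ?sqr_ge0//.
  by apply: (le_lt_trans ib); have := integrable_fin_num mD iMv; rewrite fin_numE ltey => /andP[].
split; first by split => //; exact: measurable_funM.
rewrite -(@ler_pXn2r _ 2)// ?nnegrE ?mulr_ge0 ?norm2_ge0// exprMn !norm2_sqr.
rewrite -RintegralZl// fine_le//; exact: integrable_fin_num.
Qed.

End sqint.

(** * Square-integrable, bounded and test functions on a bounded open set *)

Section Lp_on_domain.
Context {R : realType} {d : nat}.
Variable D : set 'rV[R]_d.
Hypothesis oD : open D.
Hypothesis bD : bounded_set D.
Local Notation F := ('rV[R]_d -> R).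
Implicit Types (v w f g : F).
Local Notation mu := (lebesgue_rV R d).
Local Notation I f := (Rintegral mu D f).
Local Notation int f := (mu.-integrable D (EFin \o f)).
Local Notation mf v := (measurable_fun D v).

Let mD : measurable D. Proof. exact: open_rV_measurable. Qed.
Let Doo : (mu D < +oo)%E. Proof. exact: bounded_rV_lty. Qed.

(** The norm of exponent [+oo] unfolds to an essential supremum only when the whole space has
    positive measure. *)
Lemma lebesgue_rV_setT_gt0 : (0 < mu setT)%E.
Proof. by apply: open_rV_gt0; [exact: openT|exists 0]. Qed.

Let Lp2_integral v : Lp_norm D 2%:E v = ((\int[mu]_(x in D) (v x ^+ 2)%:E) `^ 2^-1)%E.
Proof.
rewrite /Lp_norm unlock; congr (_ `^ _)%E.
rewrite [RHS]integral_mkcond; apply: eq_integral => x _ /=.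
rewrite !patchE; case: ifPn => xD; rewrite /= ?poweR_EFin.
  by rewrite powR_mulrn// real_normK ?num_real.
by rewrite (_ : `|point : R| = 0) ?powR0//; exact: normr0.
Qed.

Lemma Lp2P v : Lp D 2%:E v <-> sqint mu D v.
Proof.
rewrite /Lp /sqint Lp2_integral; split => -[mv h]; split => //.
  apply/integrableP; split; first by apply/measurable_EFinP; exact: measurable_funX.
  under eq_integral do rewrite /= ger0_norm ?sqr_ge0//.
  by apply: lty_poweRy h.
apply: poweR_lty; have /integrableP[_] := h.
by under eq_integral do rewrite /= ger0_norm ?sqr_ge0//.
Qed.

Lemma normL2E v : normL2 D v = norm2 mu D v.
Proof.
rewrite /normL2 Lp2_integral fine_poweR powR12_sqrt//.
by apply: fine_ge0; apply: integral_ge0 => x _; rewrite lee_fin sqr_ge0.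
Qed.

Lemma Lpoo_ae v : Lp D +oo%E v -> {ae mu, forall x, D x -> `|v x| <= normLoo D v}.
Proof.
move=> [mv h]; rewrite /normLoo; set M := fine _.
have E : ess_sup mu (abse \o (EFin \o v \_ D)) = M%:E.
  rewrite /M fineK; first by rewrite /Lp_norm unlock lebesgue_rV_setT_gt0.
  by rewrite ge0_fin_numE ?Lnorm_ge0.
have := ess_sup_ge mu (abse \o (EFin \o v \_ D)); rewrite E.
apply: filterS => x /= + Dx; rewrite lee_fin patchE ifT//.
exact/mem_set.
Qed.

Lemma normLoo_le v M : 0 <= M -> {ae mu, forall x, D x -> `|v x| <= M} -> normLoo D v <= M.
Proof.
move=> M0 vM; rewrite /normLoo -[leRHS]/(fine M%:E); apply: fine_le => //.
- rewrite ge0_fin_numE ?Lnorm_ge0// /Lp_norm unlock lebesgue_rV_setT_gt0.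
  apply: (@le_lt_trans _ _ M%:E); last exact: ltry.
  apply/ess_supP; apply: filterS vM => x vM /=.
  by rewrite lee_fin patchE; case: ifPn => [/set_mem/vM//|_]; rewrite normr0.
- rewrite /Lp_norm unlock lebesgue_rV_setT_gt0.
  apply/ess_supP; apply: filterS vM => x vM /=.
  by rewrite lee_fin patchE; case: ifPn => [/set_mem/vM//|_]; rewrite normr0.
Qed.

Lemma LpooP v M : 0 <= M -> mf v -> {ae mu, forall x, D x -> `|v x| <= M} -> Lp D +oo%E v.
Proof.
move=> M0 mv vM; split => //; rewrite /Lp_norm unlock lebesgue_rV_setT_gt0.
apply: (@le_lt_trans _ _ M%:E); last exact: ltry.
apply/ess_supP; apply: filterS vM => x vM /=.
by rewrite lee_fin patchE; case: ifPn => [/set_mem/vM//|_]; rewrite normr0.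
Qed.

Lemma normLoo_ge0 v : 0 <= normLoo D v.
Proof. by apply: fine_ge0; exact: Lnorm_ge0. Qed.

Lemma ae_eq_normLoo v w : {ae mu, forall x, D x -> v x = w x} -> normLoo D v = normLoo D w.
Proof.
move=> vw; rewrite /normLoo /Lp_norm unlock lebesgue_rV_setT_gt0; congr fine.
apply: eq_ess_sup; apply: filterS vw => x vw /=; congr EFin.
by rewrite !patchE; case: ifPn => // /set_mem /vw ->.
Qed.

Lemma sqint_L1loc v : sqint mu D v -> L1loc D v.
Proof.
move=> sv; split; first by case: sv.
move=> K cK KD; apply: integrableS (sqint_int mD Doo sv) => //.
exact: compact_rV_measurable.
Qed.

Lemma Lpoo_sqint v : Lp D +oo%E v -> sqint mu D v.
Proof.
move=> lv; have [mv _] := lv; have := Lpoo_ae lv => vM.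
have [h _] := sqint_mul_bounded mD mv vM (normLoo_ge0 v) (sqint_cst mD Doo 1).
by move: h; congr sqint; apply/funext => x; rewrite mulr1.
Qed.

Lemma continuous_rV_measurable (f : F) A : continuous f -> measurable A -> measurable_fun A f.
Proof.
move=> cf mA; apply: (@measurable_funS _ _ _ _ setT) => //.
move=> mT; apply: (measurability _ (RGenOpens.measurableE R)) => //.
move=> _ [_ [a [b ->]] <-]; rewrite setTI; apply: open_rV_measurable.
by apply: open_comp; [move=> x _; exact: cf|exact: interval_open].
Qed.

Lemma continuous_bounded_ball (f : F) (M : R) : continuous f ->
  exists2 C, 0 <= C & forall x, ball (0 : 'rV[R]_d) M x -> `|f x| <= C.
Proof.
move=> cf; have [M0|M0] := ltP 0 M; last first.
  by exists 0 => // x [/lt_geF]; rewrite M0.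
have cK : compact (closed_ball (0 : 'rV[R]_d) M).
  apply: bounded_closed_compact; last exact: closed_ball_closed.
  exists M; split; first exact: num_real.
  move=> N MN x; rewrite closed_ballE// /closed_ball_/= sub0r normrN => h.
  exact: le_trans h (ltW MN).
have /compact_bounded[C [_ CP]] : compact (f @` closed_ball (0 : 'rV[R]_d) M).
  apply: continuous_compact => //; exact: continuous_subspaceT.
exists (Num.max 0 (C + 1)); first by rewrite le_max lexx.
move=> x xM; rewrite le_max; apply/orP; right.
apply: (CP (C + 1)); first by rewrite ltrDl.
by exists x => //; exact: subset_closed_ball.
Qed.

Lemma continuous_bounded (f : F) : continuous f ->
  exists2 C, 0 <= C & forall x, D x -> `|f x| <= C.
Proof.
move=> cf; have [M M0 DM] := bounded_rV_ball bD.
by have [C C0 HC] := continuous_bounded_ball M cf; exists C => // x /DM; exact: HC.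
Qed.

Lemma sqint_continuous f : continuous f -> sqint mu D f.
Proof.
move=> cf; have [C C0 HC] := continuous_bounded cf.
have mf1 := continuous_rV_measurable cf mD.
have [h _] := sqint_mul_bounded mD mf1 (nearW _ HC) C0 (sqint_cst mD Doo 1).
by move: h; congr sqint; apply/funext => x; rewrite mulr1.
Qed.

Lemma test_continuous phi : test_function D phi -> continuous phi.
Proof. by move=> [/(_ 0%N) /Ck_continuous]. Qed.

Lemma test_partial_continuous phi i : test_function D phi -> continuous (partial i phi).
Proof. by move=> [/(_ 1%N) [_ /(_ i) [_ []]]]. Qed.

Lemma test_supp phi : test_function D phi ->
  exists K, [/\ compact K, K `<=` D, (forall x, ~ K x -> phi x = 0) &
     forall i x, ~ K x -> partial i phi x = 0].
Proof.
move=> [_ [K [cK KD K0]]]; exists K; split => // i x nKx.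
rewrite /partial (@near_eq_derive _ _ _ _ (cst 0)) ?derive_cst//.
have oK : open (~` K).
  by apply: closed_openC; apply: compact_closed => //; exact: norm_hausdorff.
have : nbhs x (~` K) by exact: open_nbhs_nbhs.
by apply: filterS => y; exact: K0.
Qed.

Lemma test_mul phi psi : test_function D phi -> (forall k, Ck k psi) ->
  test_function D (fun x => phi x * psi x).
Proof.
move=> [Cphi [K [cK KD K0]]] Cpsi; split; first by move=> k; apply: CkM.
by exists K; split => // x /K0 ->; rewrite mul0r.
Qed.

Lemma partialM phi psi i (x : 'rV[R]_d) : Ck 1 phi -> Ck 1 psi ->
  partial i (fun x => phi x * psi x) x = phi x * partial i psi x + psi x * partial i phi x.
Proof.
by move=> [_ /(_ i)[d1 _]] [_ /(_ i)[d2 _]]; rewrite /partial -deriveM.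
Qed.

Lemma L1loc_int_test w phi : L1loc D w -> continuous phi ->
  (exists K, [/\ compact K, K `<=` D & forall x, ~ K x -> phi x = 0]) ->
  int (fun x => w x * phi x).
Proof.
move=> [mw iw] cphi [K [cK KD K0]].
have mK := compact_rV_measurable cK.
have [C C0 HC] := continuous_bounded cphi.
have iK : mu.-integrable K (EFin \o (fun x => w x * phi x)).
  apply: (@integrable_le_norm _ _ _ mu K _ (fun x => C * w x)) => //.
  - apply: measurable_funM; last exact: continuous_rV_measurable.
    exact: measurable_funS mw.
  - exact: (integrableZl _ C (iw _ cK KD)).
  move=> x Kx; rewrite mulrC !normrM ler_wpM2r// (ger0_norm C0).
  by apply: HC; exact: KD.
apply/integrable_mkcond => //; move/integrable_mkcond : iK => /(_ mK).
apply: eq_integrable => // x _; rewrite !patchE.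
case: ifPn => [/set_mem Kx|/negP nKx]; first by rewrite ifT//; apply/mem_set; exact: KD.
by case: ifPn => //= _; rewrite K0 ?mulr0// => /mem_set.
Qed.

Lemma L1loc_int_testT w phi : L1loc D w -> test_function D phi -> int (fun x => w x * phi x).
Proof.
move=> lw tphi; apply: L1loc_int_test => //; first exact: test_continuous.
by have [_] := tphi.
Qed.

Lemma L1loc_int_partial w phi i : L1loc D w -> test_function D phi ->
  int (fun x => w x * partial i phi x).
Proof.
move=> lw tphi; apply: L1loc_int_test => //; first exact: test_partial_continuous.
by have [K [cK KD _ K0]] := test_supp tphi; exists K; split => // x; exact: K0.
Qed.

End Lp_on_domain.

(** * Weak derivatives *)

Section fubini_kernel.
Context {R : realType} {n : nat}.
Local Notation mu := (lebesgue_rV R n).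
Local Notation L1 p := (mu.-integrable setT (EFin \o p)).

(** The bound is imposed on the product [p x * k x y * q y], so that it only concerns the kernel
    where [p] and [q] are nonzero. In the application to derivatives of the mollifier the bound is
    known on differences of points of [D]. *)
Lemma fubini_kernel (p q : 'rV[R]_n -> R) (k : 'rV[R]_n -> 'rV[R]_n -> R) (M : R) :
  L1 p -> L1 q ->
  measurable_fun setT (fun z : 'rV[R]_n * 'rV[R]_n => k z.1 z.2) -> 0 <= M ->
  (forall x y, `|p x * k x y * q y| <= M * `|p x| * `|q y|) ->
  \int[mu]_x (p x * \int[mu]_y (k x y * q y)) =
  \int[mu]_y ((\int[mu]_x (p x * k x y)) * q y).
Proof.
move=> ip iq mk M0 kM.
have mp := L1_measurable ip; have mq := L1_measurable iq.
have mk1 x : measurable_fun setT (k x).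
  exact: (measurableT_comp mk (@measurable_pair1 _ _ 'rV[R]_n 'rV[R]_n x)).
have mk2 y : measurable_fun setT (k ^~ y).
  exact: (measurableT_comp mk (@measurable_pair2 _ _ 'rV[R]_n 'rV[R]_n y)).
pose f (z : 'rV[R]_n * 'rV[R]_n) := (p z.1 * k z.1 z.2 * q z.2)%:E.
have mf : measurable_fun setT f.
  apply/measurable_EFinP; apply: measurable_funM.
    by apply: measurable_funM => //; exact: (measurableT_comp mp measurable_fst).
  exact: (measurableT_comp mq measurable_snd).
have iNf x : (\int[mu]_y `|f (x, y)| <= M%:E * `|p x|%:E * \int[mu]_y `|(q y)%:E|)%E.
  rewrite -EFinM -ge0_integralZl//; last 2 first.
  - exact: measurable_abse_EFin.
  - by rewrite lee_fin mulr_ge0.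
  apply: ge0_le_integral => //.
  - by apply: measurableT_comp => //; exact: (measurableT_comp mf (@measurable_pair1 _ _ 'rV[R]_n 'rV[R]_n x)).
  - by apply: emeasurable_funM => //; exact: measurable_abse_EFin.
  by move=> y _; rewrite -EFinM lee_fin.
have /integrableP[_ ltq] := iq; have /integrableP[_ ltp] := ip.
have fq : (\int[mu]_y `|(q y)%:E|)%E \is a fin_num by rewrite ge0_fin_numE// integral_ge0.
have itf : (mu \x mu)%E.-integrable setT f.
  apply/integrable12ltyP => //.
  apply: (@le_lt_trans _ _ (\int[mu]_x (M%:E * (\int[mu]_y `|(q y)%:E|) * `|p x|%:E))%E).
    apply: ge0_le_integral => //.
    - by move=> x _; exact: integral_ge0.
    - apply: (@measurable_fun_fubini_tonelli_F _ _ _ _ R mu (abse \o f)) => //.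
        exact: measurableT_comp.
      by move=> z; exact: abse_ge0.
    - by apply: emeasurable_funM => //; exact: measurable_abse_EFin.
    by move=> x _; apply: le_trans (iNf x) _; rewrite muleAC.
  rewrite ge0_integralZl//.
  - by rewrite -(fineK fq) lte_mul_pinfty ?lee_fin ?mulr_ge0 ?fine_ge0 ?integral_ge0// -EFinM.
  - exact: measurable_abse_EFin.
  - by rewrite mule_ge0 ?lee_fin// integral_ge0.
have E1 x : (\int[mu]_y f (x, y) = (p x * \int[mu]_y (k x y * q y))%:E)%E.
  (* Integrability of the inner function comes from the bound divided by [|p x|], so zeros of [p]
     are treated apart. *)
  have [p0|p0] := eqVneq (p x) 0.
    rewrite p0 mul0r; apply: integral0_eq => y _.
    by rewrite /f /= p0 !mul0r.
  have ik : L1 (fun y => k x y * q y).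
    apply: (@integrable_le_norm _ _ _ mu setT _ (fun y => M * q y)) => //.
    - exact: measurable_funM.
    - exact: (integrableZl _ M iq).
    move=> y _; have := kM x y; rewrite -mulrA normrM mulrAC [leRHS]mulrC ler_pM2l ?normr_gt0//.
    by rewrite [`|M * _|]normrM (ger0_norm M0).
  rewrite EFinM /Rintegral fineK; last exact: integrable_fin_num.
  rewrite -integralZl//; apply: eq_integral => y _.
  by rewrite /f /= -EFinM mulrA.
have E2 y : (\int[mu]_x f (x, y) = ((\int[mu]_x (p x * k x y)) * q y)%:E)%E.
  have [q0|q0] := eqVneq (q y) 0.
    rewrite q0 mulr0; apply: integral0_eq => x _.
    by rewrite /f /= q0 !mulr0.
  have ik : L1 (fun x => p x * k x y).
    apply: (@integrable_le_norm _ _ _ mu setT _ (fun y => M * p y)) => //.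
    - exact: measurable_funM.
    - exact: (integrableZl _ M ip).
    move=> x _; have := kM x y; rewrite normrM ler_pM2r ?normr_gt0//.
    by rewrite [`|M * _|]normrM (ger0_norm M0).
  rewrite EFinM /Rintegral fineK; last exact: integrable_fin_num.
  rewrite -integralZr//.
have := Fubini itf.
under eq_integral do rewrite E1.
under [X in _ = X -> _]eq_integral do rewrite E2.
by move=> h; rewrite /Rintegral h.
Qed.

End fubini_kernel.

Section weak_derivative.
Context {R : realType} {d : nat}.
Variable D : set 'rV[R]_d.
Hypothesis oD : open D.
Hypothesis bD : bounded_set D.
Local Notation F := ('rV[R]_d -> R).
Implicit Types (v w f g : F).
Local Notation mu := (lebesgue_rV R d).
Local Notation I f := (Rintegral mu D f).
Local Notation int f := (mu.-integrable D (EFin \o f)).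
Local Notation mf v := (measurable_fun D v).
Local Notation L1 p := (mu.-integrable setT (EFin \o p)).

Let mD : measurable D. Proof. exact: open_rV_measurable. Qed.
Let Doo : (mu D < +oo)%E. Proof. exact: bounded_rV_lty. Qed.
Let inv0 k : 0 < k.+1%:R^-1 :> R. Proof. by rewrite invr_gt0. Qed.

(** Countably many balls with rational data cover [D], and a countable union of null sets is null.
    The triple ball leaves room for a cut-off and for a mollifier around points of the small
    ball. *)
Lemma ae_local (P : 'rV[R]_d -> Prop) :
  (forall c (e : R), 0 < e -> ball c (3 * e) `<=` D -> {ae mu, forall x, ball c e x -> P x}) ->
  {ae mu, forall x, D x -> P x}.
Proof.
move=> H.
pose Q (m : nat) (x : 'rV[R]_d) := if unpickle m is Some (q, k) then
  ball (map_mx ratr (q : 'rV[rat]_d) : 'rV[R]_d) (3 * k.+1%:R^-1) `<=` D ->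
  ball (map_mx ratr q : 'rV[R]_d) k.+1%:R^-1 x -> P x else True.
have : {ae mu, forall x, forall m, Q m x}.
  apply/ae_foralln => m; rewrite /Q; case: (unpickle m) => [[q k]|]; last by apply: nearW.
  have [h|h] := pselect (ball (map_mx ratr (q : 'rV[rat]_d) : 'rV[R]_d) (3 * k.+1%:R^-1) `<=` D).
    by apply: filterS (H _ _ (inv0 k) h) => x.
  by apply: nearW => x /h.
apply: filterS => x Qx Dx.
have /nbhs_ballP[e /= e0 xeD] : nbhs x D by exact: open_nbhs_nbhs.
(* One radius for the distance from [x] to the rational centre and three for the tripled ball add up
   to less than [e]. *)
have [k ke] : exists k : nat, k.+1%:R^-1 < e / 4 :> R.
  have e20 : 0 < e / 4 by rewrite divr_gt0.
  by have [k _ /(_ k (leqnn _))] := near_infty_natSinv_lt (PosNum e20); exists k.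
have k0 := inv0 k.
have /choice[q qP] (j : 'I_d) : exists q : rat, `|ratr q - x ord0 j| < k.+1%:R^-1 :> R.
  have /rat_in_itvoo[q] : x ord0 j - k.+1%:R^-1 < x ord0 j + k.+1%:R^-1 by rewrite ltrD2l gtrN.
  by rewrite in_itv/= => qx; exists q; rewrite distrC ltr_distlC.
have := Qx (pickle (\row_j q j, k)); rewrite /Q pickleK; apply.
  have k30 : 0 < 3 * k.+1%:R^-1 :> R by rewrite mulr_gt0.
  move=> y /(ball_rVP _ _ k30) qy; apply: xeD; apply/ball_rVP => // j.
  have := qy j; have := qP j; rewrite !mxE => h1 h2.
  rewrite (le_lt_trans (ler_distD (ratr (q j)) _ _))// distrC.
  rewrite (lt_trans (ltrD h1 h2))//.
  by move: ke; generalize (k.+1%:R^-1 : R) => t; lra.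
by apply/ball_rVP => // j; rewrite !mxE.
Qed.

Lemma ball_rV_open_box (c : 'rV[R]_d) (e : R) : 0 < e ->
  ball c e = open_box (fun j => c ord0 j - e) (fun j => c ord0 j + e).
Proof. by move=> e0; rewrite open_boxE ball_rV_box. Qed.

(** Near any point the mollification of [w] is the integral of [w] against a test function, hence
    zero, while it converges to [w] in [L^1]. *)
Lemma fundamental_lemma w : L1loc D w ->
  (forall phi, test_function D phi -> I (fun x => w x * phi x) = 0) ->
  {ae mu, forall x, D x -> w x = 0}.
Proof.
move=> [mw iw] Hw; apply: ae_local => c e e0 ceD.
have e20 : 0 < 2 * e by rewrite mulr_gt0.
have e30 : 0 < 3 * e by rewrite mulr_gt0.
pose B2 : set 'rV[R]_d := ball c (2 * e); have mB2 : measurable B2 by exact: measurable_ball_rV.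
have cB2 : compact (closed_ball c (2 * e)).
  apply: bounded_closed_compact; last exact: closed_ball_closed.
  exists (`|c| + 2 * e); split; first exact: num_real.
  move=> M aM x; rewrite closed_ballE// /closed_ball_/= => yx.
  by rewrite ltW// (le_lt_trans _ aM)// -(subrK c x) addrC (le_trans (ler_normD _ _))// lerD2l distrC.
have B2D : closed_ball c (2 * e) `<=` D.
  move=> x; rewrite closed_ballE// /closed_ball_/= => xy; apply: ceD.
  by rewrite -ball_normE /=; apply: le_lt_trans xy _; rewrite ltr_pM2r// ltr_nat.
have iB2 : mu.-integrable B2 (EFin \o w).
  apply: (@integrableS _ _ _ _ (closed_ball c (2 * e))) => //.
  - exact: compact_rV_measurable.
  - exact: subset_closed_ball.
  - exact: iw.
(* As [w] is only locally integrable, it is cut off on a ball of doubled radius, which does not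
   affect small mollifications on the inner ball. *)
pose p x := w x * \1_B2 x.
have ip : L1 p.
  move/integrable_mkcond : iB2 => /(_ mB2); apply: eq_integrable => // x _.
  by rewrite patchE /p /= indicE; case: ifPn => _ /=; rewrite ?mulr1 ?mulr0.
have [_ cp] : convL1 p.
  apply: (@convL1_bounded_supp _ _ (fun j => c ord0 j - 2 * e) (fun j => c ord0 j + 2 * e)) => //.
  move=> x; rewrite -ball_rV_open_box// => nx; rewrite /p indicE.
  by rewrite (_ : (x \in B2) = false) ?mulr0//; apply/negbTE/negP => /set_mem.
have mB : measurable (ball c e) by exact: measurable_ball_rV.
have BD : ball c e `<=` D.
  by move=> x xB; apply: ceD; apply: le_ball xB; rewrite ler_peMl ?ltW// ltr1n.
suff : (\int[mu]_(x in ball c e) `|(w x)%:E| = 0)%E.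
  have mwB : measurable_fun (ball c e) (fun x => (w x)%:E).
    by apply/measurable_EFinP; exact: measurable_funS mw.
  move=> /(proj1 (@ae_eq_integral_abs _ _ _ mu (ball c e) mB (fun x => (w x)%:E) mwB)).
  by apply: filterS => x h Bx; have := h Bx => -[].
apply/eqP; rewrite eq_le integral_ge0// andbT; apply/lee_addgt0Pr => t t0; rewrite add0e.
have [K HK] := cp _ t0.
have [k kK ke] : exists2 k, (K <= k)%N & k.+1%:R^-1 < e.
  have [k' _ hk'] := near_infty_natSinv_lt (PosNum e0).
  by exists (maxn K k'); [exact: leq_maxl|apply: hk'; rewrite /= leq_maxr].
apply: le_trans (HK k kK).
have mm : measurable_fun setT (fun x => mollify k.+1%:R^-1 p x - p x).
  by apply: measurable_funB; [exact: measurable_conv|exact: L1_measurable].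
apply: (@le_trans _ _ (\int[mu]_(x in ball c e) `|(mollify k.+1%:R^-1 p x - p x)%:E|)%E); last first.
  by apply: ge0_subset_integral => //; exact: measurable_abse_EFin.
rewrite le_eqVlt; apply/orP; left; apply/eqP; apply: eq_integral => y /set_mem yB.
have -> : mollify k.+1%:R^-1 p y = 0.
  rewrite /mollify -(Hw (fun x => moll_rV k.+1%:R^-1 (x - y))); last first.
    apply: (test_moll_rV (inv0 k) ke) => x xy; apply: ceD.
    rewrite (_ : 3 * e = e + 2 * e); last by ring.
    by apply: ball_triangle yB _; apply: le_ball xy; rewrite ler_peMl ?ltW// ltr1n.
  rewrite [RHS]Rintegral_mkcond; apply: eq_Rintegral => x _; rewrite patchE /p indicE.
  case: (boolP (x \in B2)) => [/set_mem xB2|xB2].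
    by rewrite ifT ?mulr1//; apply/mem_set/B2D; exact: subset_closed_ball.
  rewrite mulr0 mul0r; case: ifPn => // _.
  have [->|/(moll_rV_supp (inv0 k)) xy] := eqVneq (moll_rV k.+1%:R^-1 (x - y)) 0.
    by rewrite mulr0.
  case/negP: xB2; apply/mem_set; rewrite /B2 (_ : 2 * e = e + e); last by ring.
  by apply: ball_triangle yB _; apply: le_ball xy; exact: ltW.
have -> : p y = w y.
  rewrite /p indicE mem_set ?mulr1//; apply: le_ball yB.
  by rewrite ler_peMl ?ltW// ltr1n.
by rewrite sub0r EFinN abseN.
Qed.

Lemma weak_partial_unique i v w1 w2 : L1loc D w1 -> L1loc D w2 ->
  is_weak_partial D i v w1 -> is_weak_partial D i v w2 ->
  {ae mu, forall x, D x -> w1 x = w2 x}.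
Proof.
move=> l1 l2 h1 h2.
have lB : L1loc D (fun x => w1 x - w2 x).
  have [m1 i1] := l1; have [m2 i2] := l2; split; first exact: measurable_funB.
  move=> K cK KD; exact: (integrableB (compact_rV_measurable cK) (i1 _ cK KD) (i2 _ cK KD)).
have : {ae mu, forall x, D x -> w1 x - w2 x = 0}.
  apply: fundamental_lemma => // phi tphi.
  rewrite (@eq_Rintegral _ _ _ mu D (fun x => w1 x * phi x - w2 x * phi x)); last first.
    by move=> x _; rewrite mulrBl.
  rewrite RintegralB//; try exact: (L1loc_int_testT oD bD).
  by apply/eqP; rewrite subr_eq0 -eqr_opp; apply/eqP; rewrite -h1// -h2.
by apply: filterS => x h Dx; apply/eqP; rewrite -subr_eq0 h.
Qed.

End weak_derivative.

Lemma norm_mul3_le (R : realType) (p k q M : R) : `|k| <= M -> `|p * k * q| <= M * `|p| * `|q|.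
Proof. by move=> kM; rewrite !normrM ler_wpM2r// mulrC ler_wpM2r. Qed.

Section integrable_real_ops.
Context dT (T : measurableType dT) (R : realType) (mu : {measure set T -> \bar R}).
Variable D : set T.
Hypothesis mD : measurable D.
Implicit Types (f g : T -> R).
Local Notation int f := (mu.-integrable D (EFin \o f)).

Lemma int_add f g : int f -> int g -> int (fun x => f x + g x).
Proof. by move=> h1 h2; exact: (integrableD mD h1 h2). Qed.

Lemma int_sub f g : int f -> int g -> int (fun x => f x - g x).
Proof. by move=> h1 h2; exact: (integrableB mD h1 h2). Qed.

Lemma int_scale c f : int f -> int (fun x => c * f x).
Proof. by move=> h1; exact: (integrableZl mD c h1). Qed.

Lemma int_sum (J : Type) (r : seq J) (P : pred J) (F : J -> T -> R) :
  (forall j, P j -> int (F j)) -> int (fun x => \sum_(j <- r | P j) F j x).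
Proof.
move=> iF; elim: r => [|j r IH].
  under eq_fun do rewrite big_nil.
  exact: integrable0.
under eq_fun do rewrite big_cons.
by case Pj : (P j) => //; apply: int_add => //; exact: iF.
Qed.

Lemma Rintegral_sum (J : Type) (r : seq J) (P : pred J) (F : J -> T -> R) :
  (forall j, P j -> int (F j)) ->
  \int[mu]_(x in D) (\sum_(j <- r | P j) F j x) =
  \sum_(j <- r | P j) \int[mu]_(x in D) F j x.
Proof.
move=> iF; elim: r => [|j r IH].
  rewrite big_nil; under eq_Rintegral do rewrite big_nil.
  by rewrite Rintegral_cst// mul0r.
rewrite big_cons; under eq_Rintegral do rewrite big_cons.
case: ifPn => // Pj; rewrite RintegralD ?IH//; first exact: iF.
exact: int_sum.
Qed.

End integrable_real_ops.

(** * Integration by parts against a product with a bounded weakly differentiable factor *)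

Section weak_product.
Context {R : realType} {d : nat}.
Variable D : set 'rV[R]_d.
Hypothesis oD : open D.
Hypothesis bD : bounded_set D.
Local Notation F := ('rV[R]_d -> R).
Implicit Types (v w f g p q : F).
Local Notation mu := (lebesgue_rV R d).
Local Notation I f := (Rintegral mu D f).
Local Notation int f := (mu.-integrable D (EFin \o f)).
Local Notation mf v := (measurable_fun D v).
Local Notation L1 p := (mu.-integrable setT (EFin \o p)).

Let mD : measurable D. Proof. exact: open_rV_measurable. Qed.
Let Doo : (mu D < +oo)%E. Proof. exact: bounded_rV_lty. Qed.
Let inv0 k : 0 < k.+1%:R^-1 :> R. Proof. by rewrite invr_gt0. Qed.

(** The factor [2] provides the margin between the radius of the mollifier and that of the ball
    demanded by [test_moll_rV]. *)
Lemma compact_ball_subset (K : set 'rV[R]_d) : compact K -> K `<=` D ->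
  exists k0, forall k y, (k0 <= k)%N -> K y -> ball y (2 * k.+1%:R^-1) `<=` D.
Proof.
move=> /compact_near_coveringP cK KD.
have [k0 _ H] : \forall k \near \oo, K `<=` (fun y => ball y (2 * k.+1%:R^-1) `<=` D).
  apply: cK => x Kx.
  have /nbhs_ballP[e /= e0 xeD] : nbhs x D by apply: open_nbhs_nbhs; split => //; exact: KD.
  have e20 : 0 < e / 2 by rewrite divr_gt0.
  have e40 : 0 < e / 4 by rewrite divr_gt0.
  exists (ball x (e / 2), [set k | k.+1%:R^-1 < e / 4]) => /=.
    by split; [exact: nbhsx_ballx|exact: (near_infty_natSinv_lt (PosNum e40))].
  move=> [y k] /= [xy ke] z yz; apply: xeD.
  rewrite (splitr e); apply: ball_triangle xy _; apply: le_ball yz.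
  by rewrite (_ : e / 2 = 2 * (e / 4)) ?ler_pM2l ?ltW//; field.
by exists k0 => k y k0k; exact: (H k k0k).
Qed.

Definition cut p : F := fun x => p x * \1_D x.

Lemma cut_in p x : D x -> cut p x = p x.
Proof. by move=> Dx; rewrite /cut indicE mem_set// mulr1. Qed.

Lemma cut_out p x : ~ D x -> cut p x = 0.
Proof. by move=> Dx; rewrite /cut indicE memNset// mulr0. Qed.

Lemma cut_restrict p : cut p = p \_ D.
Proof.
apply/funext => x; rewrite patchE; case: ifPn => [/set_mem/cut_in //|/negP h].
by rewrite cut_out// => /mem_set.
Qed.

Lemma cut_L1 p : int p -> L1 (cut p).
Proof.
move=> /(integrable_mkcond _ mD); rewrite cut_restrict.
by apply: eq_integrable => // x _ /=; rewrite !patchE; case: ifPn.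
Qed.

Lemma integral_cutr (p q : F) : \int[mu]_x (p x * cut q x) = I (fun x => p x * q x).
Proof.
rewrite [RHS]Rintegral_mkcond; apply: eq_Rintegral => x _; rewrite patchE.
case: ifPn => [/set_mem/cut_in ->//|/negP h].
by rewrite cut_out ?mulr0// => /mem_set.
Qed.

Lemma integral_cutl (p q : F) : \int[mu]_x (cut p x * q x) = I (fun x => p x * q x).
Proof.
under eq_Rintegral do rewrite mulrC; rewrite integral_cutr.
by apply: eq_Rintegral => x _; rewrite mulrC.
Qed.

Lemma open_box_bounded : exists a b, D `<=` open_box a b.
Proof.
have [M M0 DM] := bounded_rV_ball bD.
exists (fun j => - M), (fun j => M) => x /DM; rewrite ball_rV_open_box// => h j.
by have := h j; rewrite mxE sub0r add0r.
Qed.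

Lemma convL1_cut p : int p -> convL1 (cut p).
Proof.
move=> ip; have [a [b Dab]] := open_box_bounded.
by apply: (@convL1_bounded_supp _ _ a b); [exact: cut_L1|move=> x nx; apply: cut_out => /Dab].
Qed.

Lemma integral_mul_bounded f q M : mf f -> mf q -> 0 <= M ->
  {ae mu, forall x, D x -> `|q x| <= M} ->
  (\int[mu]_(x in D) `|(f x * q x)%:E| <= M%:E * \int[mu]_(x in D) `|(f x)%:E|)%E.
Proof.
move=> mf1 mq M0 qM; rewrite -ge0_integralZl//; last first.
  exact: measurable_abse_EFin.
apply: ae_ge0_le_integral => //.
- by apply: measurable_abse_EFin; exact: measurable_funM.
- by move=> x _; rewrite mule_ge0// lee_fin.
- by apply: emeasurable_funM => //; exact: measurable_abse_EFin.
apply: filterS qM => x qM Dx; rewrite -EFinM lee_fin normrM mulrC ler_wpM2r//.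
exact: qM.
Qed.

Lemma int_mul_bounded f q M : int f -> mf q -> 0 <= M ->
  {ae mu, forall x, D x -> `|q x| <= M} -> int (fun x => f x * q x).
Proof.
move=> if1 mq M0 qM; have mf1 : mf f by have /measurable_int/measurable_EFinP := if1.
apply/integrableP; split; first by apply/measurable_EFinP; exact: measurable_funM.
apply: le_lt_trans (integral_mul_bounded mf1 mq M0 qM) _; have /integrableP[_ lt1] := if1.
by rewrite lte_mul_pinfty// lee_fin.
Qed.

Lemma mollify_cut_int a p : 0 < a -> int p -> int (mollify a (cut p)).
Proof.
move=> a0 /cut_L1 iP; apply: (@integrableS _ _ _ _ setT) => //.
apply/integrableP; split; first by apply/measurable_EFinP; exact: measurable_conv.
apply: (@le_lt_trans _ _ _ _ _ (conv_contract a0 iP)).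
by have /integrableP[] := iP.
Qed.

Lemma mollify_cut_cvg p q M : int p -> mf q -> 0 <= M ->
  {ae mu, forall x, D x -> `|q x| <= M} ->
  forall e, 0 < e -> exists K, forall k, (K <= k)%N ->
   `|I (fun x => mollify k.+1%:R^-1 (cut p) x * q x) - I (fun x => p x * q x)| <= e.
Proof.
move=> ip mq M0 qM e e0; have [iP HP] := convL1_cut ip.
have M10 : 0 < M + 1 by rewrite ltr_wpDl.
have eM0 : 0 < e / (M + 1) by rewrite divr_gt0.
have [K HK] := HP _ eM0; exists K => k /HK {}HK.
have mg : measurable_fun setT (fun x => mollify k.+1%:R^-1 (cut p) x - cut p x).
  by apply: measurable_funB; [exact: measurable_conv|exact: L1_measurable].
have mgD : mf (fun x => mollify k.+1%:R^-1 (cut p) x - cut p x) by exact: measurable_funTS.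
have ibqi f : int f -> int (fun x => f x * q x) by move=> if1; exact: int_mul_bounded M0 qM.
have icpD := mollify_cut_int (inv0 k) ip.
rewrite -RintegralB//; [|exact: ibqi|exact: ibqi].
rewrite (@eq_Rintegral _ _ _ mu D (fun x => (mollify k.+1%:R^-1 (cut p) x - cut p x) * q x)); last first.
  by move=> x /set_mem Dx; rewrite cut_in// mulrBl.
have ig : int (fun x => mollify k.+1%:R^-1 (cut p) x - cut p x).
  have icD : int (cut p) by exact: integrableS iP.
  exact: (integrableB mD icpD icD).
rewrite -lee_fin EFin_normr_Rintegral//; last exact: ibqi.
apply: le_trans (le_abse_integral _ _ _) _ => //.
  by have /measurable_int := ibqi _ ig.
apply: le_trans (integral_mul_bounded mgD mq M0 qM) _.
apply: (@le_trans _ _ (M%:E * (e / (M + 1))%:E)%E).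
  apply: lee_wpmul2l; first by rewrite lee_fin.
  by apply: le_trans HK; apply: ge0_subset_integral => //; exact: measurable_abse_EFin.
by rewrite -EFinM lee_fin mulrCA ler_piMr ?(ltW e0)// ler_pdivrMr// mul1r lerDl.
Qed.

Lemma measurable_rV_sub : measurable_fun setT (fun z : 'rV[R]_d * 'rV[R]_d => z.1 - z.2).
Proof.
apply: measurable_fun_mx => i j; rewrite (ord1 i).
rewrite (_ : (fun _ => _) = fun z : 'rV[R]_d * 'rV[R]_d => z.1 ord0 j - z.2 ord0 j); last first.
  by apply/funext => z; rewrite !mxE.
apply: measurable_funB.
  exact: (measurableT_comp (measurable_coord j) measurable_fst).
exact: (measurableT_comp (measurable_coord j) measurable_snd).
Qed.

Lemma partial_moll_odd k i (x y : 'rV[R]_d) :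
  partial i (@moll_rV R k.+1%:R^-1 d) (y - x) = - partial i (@moll_rV R k.+1%:R^-1 d) (x - y).
Proof.
rewrite -opprB partial_even//; first exact: Ck_moll_rV.
by move=> z; exact: moll_rVN.
Qed.

(* Integration by parts against [beta * phi], which is not smooth: [p] is
   mollified instead, and the mollifier kernel carries the derivatives from one
   factor to the other by Fubini, so that no smooth approximation of
   [beta * phi] is required. *)
Lemma weak_partial_test_mul (b b' p p' phi : F) i :
  Lp D +oo%E b -> Lp D +oo%E b' -> int p -> int p' ->
  is_weak_partial D i b b' -> is_weak_partial D i p p' -> test_function D phi ->
  I (fun x => p x * (b' x * phi x + b x * partial i phi x)) =
  - I (fun x => p' x * (b x * phi x)).
Proof.
move=> lb lb' ip ip' wb wp tphi.
have [mb _] := lb; have [mb' _] := lb'.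
have cphi := test_continuous tphi; have cdphi := @test_partial_continuous _ _ D phi i tphi.
have [K [cK KD K0 dK0]] := test_supp tphi.
have [k0 Hk0] := compact_ball_subset cK KD.
pose chi x := b x * phi x; pose chi' x := b' x * phi x + b x * partial i phi x.
have [C1 C10 HC1] := continuous_bounded bD cphi.
have [C2 C20 HC2] := continuous_bounded bD cdphi.
have mphi : mf phi by exact: continuous_rV_measurable.
have mdphi : mf (partial i phi) by exact: continuous_rV_measurable.
have mchi : mf chi by exact: measurable_funM.
have mchi' : mf chi' by apply: measurable_funD; exact: measurable_funM.
pose M := normLoo D b' * C1 + normLoo D b * C2; pose M1 := normLoo D b * C1.
have M0 : 0 <= M by rewrite addr_ge0// mulr_ge0// normLoo_ge0.
have M10 : 0 <= M1 by rewrite mulr_ge0// normLoo_ge0.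
have chiM : {ae mu, forall x, D x -> `|chi x| <= M1}.
  apply: filterS (Lpoo_ae lb) => x h Dx; rewrite normrM.
  by rewrite ler_pM//; [exact: h|exact: HC1].
have chi'M : {ae mu, forall x, D x -> `|chi' x| <= M}.
  apply: filterS2 (Lpoo_ae lb) (Lpoo_ae lb') => x h h' Dx.
  apply: le_trans (ler_normD _ _) _; rewrite !normrM.
  by rewrite lerD// ler_pM//; [exact: h'|exact: HC1|exact: h|exact: HC2].
have ichi : int chi.
  apply: (@integrable_le_norm _ _ _ mu D _ (fun x => C1 * b x)) => //.
    exact: (integrableZl mD C1 (sqint_int mD Doo (Lpoo_sqint oD bD lb))).
  by move=> x Dx; rewrite /chi mulrC [leLHS]normrM [leRHS]normrM (ger0_norm C10) ler_wpM2r//; exact: HC1.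
have ichi' : int chi'.
  apply: int_add => //.
    apply: (@integrable_le_norm _ _ _ mu D _ (fun x => C1 * b' x)) => //.
    - exact: measurable_funM.
    - exact: (integrableZl mD C1 (sqint_int mD Doo (Lpoo_sqint oD bD lb'))).
    by move=> x Dx; rewrite mulrC [leLHS]normrM [leRHS]normrM (ger0_norm C10) ler_wpM2r//; exact: HC1.
  apply: (@integrable_le_norm _ _ _ mu D _ (fun x => C2 * b x)) => //.
  - exact: measurable_funM.
  - exact: (integrableZl mD C2 (sqint_int mD Doo (Lpoo_sqint oD bD lb))).
  by move=> x Dx; rewrite mulrC [leLHS]normrM [leRHS]normrM (ger0_norm C20) ler_wpM2r//; exact: HC2.
have lbl := sqint_L1loc oD bD (Lpoo_sqint oD bD lb).
have lbl' := sqint_L1loc oD bD (Lpoo_sqint oD bD lb').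
have key k : (k0 <= k)%N ->
    I (fun x => mollify k.+1%:R^-1 (cut p) x * chi' x) =
    - I (fun x => mollify k.+1%:R^-1 (cut p') x * chi x).
  move=> k0k; set a := k.+1%:R^-1; have a0 : 0 < a by exact: inv0.
  have Crho m := @Ck_moll_rV R a d m.
  have crho' : continuous (partial i (@moll_rV R a d)).
    by have [_ /(_ i) [_ []]] := Crho 1%N.
  rewrite -integral_cutr /mollify.
  rewrite -(@fubini_kernel _ _ (cut p) (cut chi') (fun x y => moll_rV a (x - y)) ((bump1_mass a)^-1 ^+ d)); first last.
  - by move=> x y; apply: norm_mul3_le; rewrite ger0_norm ?moll_rV_ge0// moll_rV_le.
  - by rewrite exprn_ge0// invr_ge0 ltW// bump1_mass_gt0.
  - exact: measurable_moll_rV2.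
  - exact: cut_L1.
  - exact: cut_L1.
  (* For every [x] the product of [phi] and the translated mollifier is a test function, since [phi]
     carries the compact support. Testing the weak derivative of [b] with it moves the derivative
     onto the kernel. *)
  have inner x : \int[mu]_y (moll_rV a (x - y) * cut chi' y) =
      \int[mu]_y (partial i (@moll_rV R a d) (x - y) * cut chi y).
    rewrite !integral_cutr.
    have tpsi : test_function D (fun y => phi y * moll_rV a (y - x)).
      by apply: test_mul => // m; apply: Ck_shift; exact: Crho.
    have Eb := wb _ tpsi.
    have dpsi y : partial i (fun y => phi y * moll_rV a (y - x)) y =
        phi y * partial i (@moll_rV R a d) (y - x) + moll_rV a (y - x) * partial i phi y.
      have Cr : Ck 1 (fun y : 'rV[R]_d => moll_rV a (y - x)) by apply: Ck_shift; exact: Crho.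
      by rewrite (partialM i y (proj1 tphi 1%N) Cr) (partial_shift x y i (Crho 1%N)).
    have i1 := L1loc_int_testT oD bD lbl' tpsi.
    have i2 := L1loc_int_partial oD bD i lbl tpsi.
    have i3 : int (fun y => b y * (phi y * partial i (@moll_rV R a d) (y - x))).
      apply: (L1loc_int_test oD bD lbl).
        move=> y; apply: (@continuousM _ _ phi (fun y => partial i (@moll_rV R a d) (y - x))); first exact: cphi.
        have [_ /(_ i) [_ [h _]]] := Ck_shift x (Crho 1%N).
        move: h; rewrite (_ : partial i _ = fun y => partial i (@moll_rV R a d) (y - x)); first exact.
        by apply/funext => z; rewrite partial_shift.
      by exists K; split => // y /K0 ->; rewrite mul0r.
    have -> : I (fun y => moll_rV a (x - y) * chi' y) =
        I (fun y => b' y * (phi y * moll_rV a (y - x))) +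
        (I (fun y => b y * partial i (fun y => phi y * moll_rV a (y - x)) y) -
         I (fun y => b y * (phi y * partial i (@moll_rV R a d) (y - x)))).
      rewrite -(RintegralB mD i2 i3) -(RintegralD mD i1 (int_sub mD i2 i3)).
      by apply: eq_Rintegral => y _; rewrite dpsi /chi' (moll_rVC a x y); ring.
    rewrite Eb addrA addrN add0r -mulN1r -RintegralZl//.
    by apply: eq_Rintegral => y _; rewrite partial_moll_odd /chi; ring.
  under eq_Rintegral do rewrite inner.
  have [N N0 DN] := bounded_rV_ball bD.
  have [C C0 HC] := continuous_bounded_ball (N + N) crho'.
  rewrite (@fubini_kernel _ _ (cut p) (cut chi) (fun x y => partial i (@moll_rV R a d) (x - y)) C) //; first last.
  - move=> x y; have [Dx|nDx] := pselect (D x); last by rewrite cut_out// !mul0r normr0 mulr0 mul0r.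
    have [Dy|nDy] := pselect (D y); last by rewrite [cut chi y]cut_out// !mulr0 normr0 mulr0.
    apply: norm_mul3_le; apply: HC; apply/ball_rVP; first exact: addr_gt0.
    move=> j; rewrite !mxE sub0r normrN.
    have := (ball_rVP _ _ N0).1 (DN _ Dx) j; have := (ball_rVP _ _ N0).1 (DN _ Dy) j.
    rewrite !mxE !sub0r !normrN => h1 h2.
    by apply: le_lt_trans (ler_normB _ _) _; rewrite ltrD.
  - apply: (@measurableT_comp _ _ _ _ _ _ (partial i (@moll_rV R a d))); last exact: measurable_rV_sub.
    exact: continuous_rV_measurable.
  - exact: cut_L1.
  - exact: cut_L1.
  rewrite integral_cutr -mulN1r -RintegralZl//; last exact: (int_mul_bounded (mollify_cut_int a0 ip') mchi M10 chiM).
  apply: eq_Rintegral => y /set_mem Dy.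
  (* Only points of the support of [phi] matter, and around these the mollifier is a test function
     of [D] because [k0 <= k]; the weak derivative of [p] then applies. *)
  have [Ky|nKy] := pselect (K y); last by rewrite /chi K0// !mulr0.
  rewrite mulrA; congr (_ * _); rewrite integral_cutl.
  have tr : test_function D (fun x => moll_rV a (x - y)).
    apply: (test_moll_rV a0 _ (Hk0 k y k0k Ky)).
    by rewrite -/a ltr_pMl// ltr1n.
  rewrite integral_cutl mulN1r -(wp _ tr); apply: eq_Rintegral => x _.
  by rewrite (partial_shift y x i (Crho 1%N)).
apply/eqP; rewrite -subr_eq0 opprK -normr_eq0 eq_le normr_ge0 andbT.
apply/ler_addgt0Pr => e e0; rewrite add0r.
have e20 : 0 < e / 2 by rewrite divr_gt0.
have [K1 HK1] := mollify_cut_cvg ip mchi' M0 chi'M e20.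
have [K2 HK2] := mollify_cut_cvg ip' mchi M10 chiM e20.
pose k := maxn k0 (maxn K1 K2).
have h1 := HK1 k (leq_trans (leq_maxl _ _) (leq_maxr _ _)).
have h2 := HK2 k (leq_trans (leq_maxr _ _) (leq_maxr _ _)).
have h3 := key k (leq_maxl _ _).
rewrite (splitr e); apply: le_trans (lerD h1 h2).
rewrite -normrN; apply: le_trans (ler_normD _ _).
rewrite h3 le_eqVlt; apply/orP; left; apply/eqP; congr `|_|.
rewrite -/chi' -/chi; ring.
Qed.

End weak_product.

(** * Translation invariance and increments along coordinate lines *)

Section translation.
Context {R : realType} {n : nat}.
Local Notation mu := (lebesgue_rV R n).

Lemma measurable_shift_rV (c : 'rV[R]_n) : measurable_fun setT (fun x : 'rV[R]_n => x + c).
Proof.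
apply: measurable_fun_mx => i j; rewrite (ord1 i).
rewrite (_ : (fun _ => _) = fun x : 'rV[R]_n => x ord0 j + c ord0 j); last first.
  by apply/funext => z; rewrite !mxE.
by apply: measurable_funD => //; exact: measurable_coord.
Qed.

Lemma lebesgue_open_box (a b : 'I_n -> R) :
  mu (open_box a b) = (\prod_(j < n) (if (a j < b j) then b j - a j else 0)%:E)%E.
Proof.
rewrite open_boxE lebesgue_rV_box; last by move=> j; exact: measurable_itv.
apply: eq_bigr => j _; rewrite lebesgue_measure_itv/= lte_fin.
by case: ifPn => // _; rewrite EFinB.
Qed.

Lemma open_box_shift (a b : 'I_n -> R) (c : 'rV[R]_n) :
  (fun x => x + c) @^-1` open_box a b =
  open_box (fun j => a j - c ord0 j) (fun j => b j - c ord0 j).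
Proof.
apply/seteqP; split => x h j; have := h j; rewrite !mxE.
  by rewrite ltrBlDr ltrBrDr.
by rewrite ltrBlDr ltrBrDr.
Qed.

(** Both measures agree on open boxes, which generate the sigma-algebra and exhaust the space with
    finite measure. *)
Lemma lebesgue_rV_shift (c : 'rV[R]_n) (B : set 'rV[R]_n) : measurable B ->
  mu ((fun x => x + c) @^-1` B) = mu B.
Proof.
move=> mB; apply/esym.
pose nu := pushforward mu (fun x : 'rV[R]_n => x + c).
pose G := [set B : set 'rV[R]_n | exists a b, B = open_box a b].
pose g k := open_box (fun _ : 'I_n => - (k%:R : R)) (fun _ => k%:R).
apply: (@measure_unique _ R _ G g measurable_open_boxes _ _ _ mu
  [the measure _ _ of pushforward mu (fun x : 'rV[R]_n => x + c)]).
- by move=> _ _ [a1 [b1 ->]] [a2 [b2 ->]]; rewrite open_boxI; do 2 eexists; reflexivity.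
- by move=> k; do 2 eexists; reflexivity.
- apply/seteqP; split => // x _.
  have [k xk] : exists k : nat, `|x| < k%:R.
    by exists (Num.bound `|x|); rewrite (le_lt_trans _ (archi_boundP _))// normr_ge0.
  have k0 : 0 < k%:R :> R by apply: le_lt_trans xk; exact: normr_ge0.
  exists k => // j; rewrite -ltr_norml.
  have [+ _] := ball_rVP (0 : 'rV[R]_n) x k0.
  rewrite -ball_normE/= sub0r normrN => /(_ xk j).
  by rewrite mxE sub0r normrN.
- exact: measurable_shift_rV.
- by move=> ? _ [a [b ->]]; rewrite /=/pushforward open_box_shift !lebesgue_open_box;
    apply: eq_bigr => j _; rewrite ltrD2r opprB addrA subrK.
- by move=> k; exact: lebesgue_open_box_lty.
- exact: mB.
Qed.

Lemma ge0_integral_rV_shift (g : 'rV[R]_n -> \bar R) (c : 'rV[R]_n) :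
  measurable_fun setT g -> (forall x, 0 <= g x)%E ->
  (\int[mu]_x g (x + c)%R = \int[mu]_x g x)%E.
Proof.
move=> mg g0.
rewrite -(@ge0_integral_pushforward _ _ _ _ _ _ (measurable_shift_rV c) mu setT g)//.
apply: eq_measure_integral; first exact: measurable_shift_rV.
by move=> ? A mA _; rewrite /= /pushforward lebesgue_rV_shift.
Qed.

Lemma integrable_rV_shift (f : 'rV[R]_n -> \bar R) (c : 'rV[R]_n) :
  mu.-integrable setT f -> mu.-integrable setT (fun x => f (x + c)).
Proof.
move=> /integrableP[mf foo]; apply/integrableP; split.
  by apply: (measurableT_comp mf); exact: measurable_shift_rV.
rewrite (ge0_integral_rV_shift c (measurableT_comp (@abse_measurable _ setT) mf))// => x.
exact: abse_ge0.
Qed.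

Lemma integral_rV_shift (f : 'rV[R]_n -> \bar R) (c : 'rV[R]_n) :
  mu.-integrable setT f ->
  (\int[mu]_x f (x + c)%R = \int[mu]_x f x)%E.
Proof.
move=> intf; have mf : measurable_fun setT f by apply: (measurable_int mu).
rewrite integralE [RHS]integralE; congr (_ - _)%E.
  rewrite -(ge0_integral_rV_shift c (measurable_funepos mf) (fun x => funepos_ge0 f x)).
  by apply: eq_integral => x _; rewrite !funeposE.
rewrite -(ge0_integral_rV_shift c (measurable_funeneg mf) (fun x => funeneg_ge0 f x)).
by apply: eq_integral => x _; rewrite !funenegE.
Qed.

Lemma derivable_line (v : 'rV[R]_n -> R) i (x : 'rV[R]_n) (t : R) :
  (forall y, derivable v y (delta_mx ord0 i : 'rV[R]_n)) ->
  is_derive t (1 : R) (fun s : R => v (s *: delta_mx ord0 i + x))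
    (partial i v (t *: delta_mx ord0 i + x)).
Proof.
move=> dv; set e := delta_mx ord0 i : 'rV[R]_n.
have h : is_derive (t *: e + x) e v (partial i v (t *: e + x)) by exact: DeriveDef.
move/is_derive_line : h => h.
apply/is_derive_line; move: h; congr (is_derive _ _ _ _).
by apply/funext => s; rewrite [_%:A]mulr1 scalerDl addrA.
Qed.

Lemma Ck1_increment (v : 'rV[R]_n -> R) i (x : 'rV[R]_n) (t M : R) : Ck 1 v -> 0 < t ->
  (forall y, `|partial i v y| <= M) ->
  `|v (x + t *: delta_mx ord0 i) - v x| <= M * t.
Proof.
move=> Cv t0 hM; set e := delta_mx ord0 i : 'rV[R]_n.
have [_ /(_ i)[dv _]] := Cv.
have := @MVT R (fun s : R => v (s *: e + x)) (fun s => partial i v (s *: e + x)) 0 t t0.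
case=> [s _||s _].
- exact: derivable_line.
- apply: continuous_subspaceT => s.
  have [+ _] := derivable_line x s dv.
  by move=> /derivable1_diffP/differentiable_continuous.
rewrite scale0r add0r subr0 (addrC x) => ->.
by rewrite normrM (gtr0_norm t0) ler_wpM2r// ltW.
Qed.

End translation.

Lemma normr_Rintegral_le dT (T : measurableType dT) (R : realType)
    (mu : {measure set T -> \bar R}) (D : set T) (f : T -> R) (M : R) :
  measurable D -> (mu D < +oo)%E -> mu.-integrable D (EFin \o f) ->
  (forall x, D x -> `|f x| <= M) -> `|\int[mu]_(x in D) f x| <= M * fine (mu D).
Proof.
move=> mD Doo intf fM; apply: le_trans (le_normr_Rintegral mD intf) _.
rewrite -Rintegral_cst//; apply: le_Rintegral => //.
- by have := integrable_norm intf.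
- exact: integrable_cst_fin.
Qed.

(** * Test functions and their weak derivatives *)

Section test_gradient.
Context {R : realType} {d : nat}.
Variable D : set 'rV[R]_d.
Hypothesis oD : open D.
Hypothesis bD : bounded_set D.
Local Notation mu := (lebesgue_rV R d).
Local Notation I f := (Rintegral mu D f).
Let mD : measurable D. Proof. exact: open_rV_measurable. Qed.
Let Doo : (mu D < +oo)%E. Proof. exact: bounded_rV_lty. Qed.

Lemma Ck1_increment2 (v : 'rV[R]_d -> R) i (x : 'rV[R]_d) (t M : R) : Ck 2 v -> 0 < t ->
  (forall y, `|partial i (partial i v) y| <= M) ->
  `|v (x + t *: delta_mx ord0 i) - v x - t * partial i v x| <= M * t ^+ 2.
Proof.
move=> Cv t0 hM; set e := delta_mx ord0 i : 'rV[R]_d.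
have [_ /(_ i)[dv Cp]] := Cv.
have := @MVT R (fun s : R => v (s *: e + x)) (fun s => partial i v (s *: e + x)) 0 t t0.
case=> [s _||s].
- exact: derivable_line.
- apply: continuous_subspaceT => s.
  have [+ _] := derivable_line x s dv.
  by move=> /derivable1_diffP/differentiable_continuous.
rewrite in_itv/= => /andP[s0 st].
rewrite scale0r add0r subr0 (addrC x) => ->.
rewrite (_ : _ - _ = t * (partial i v (x + s *: e) - partial i v x)); last by rewrite (addrC x); ring.
rewrite normrM (gtr0_norm t0).
have := Ck1_increment x Cp s0 hM; rewrite -/e => h.
have M0 : 0 <= M by apply: le_trans (hM 0).
by have := ler_wpM2l (ltW t0) h; have := ler_wpM2l M0 (ltW st); nra.
Qed.

Lemma test_partial phi i : test_function D phi -> test_function D (partial i phi).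
Proof.
move=> tp; have [K [cK KD K0 K1]] := test_supp tp; have [Cp _] := tp; split.
  by move=> k; have [_ /(_ i)[]] := Cp k.+1.
by exists K; split => // x /K1.
Qed.

Lemma test_bounded phi : test_function D phi -> exists2 M, 0 <= M & forall x, `|phi x| <= M.
Proof.
move=> tp; have [M M0 h] := continuous_bounded bD (test_continuous tp).
have [K [_ KD K0 _]] := test_supp tp; exists M => // x.
by have [/KD/h//|/K0->] := pselect (K x); rewrite normr0.
Qed.

Lemma cut_test phi : test_function D phi -> cut D phi = phi.
Proof.
move=> tp; have [K [_ KD K0 _]] := test_supp tp; apply/funext => x.
have [Dx|nDx] := pselect (D x); first by rewrite cut_in.
by rewrite cut_out// K0// => /KD.
Qed.

Lemma int_test phi : test_function D phi -> mu.-integrable setT (EFin \o phi).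
Proof.
move=> tp; rewrite -(cut_test tp); apply: (cut_L1 oD).
exact: (sqint_int mD Doo (sqint_continuous oD bD (test_continuous tp))).
Qed.

Lemma integral_test phi : test_function D phi -> \int[mu]_x phi x = I phi.
Proof.
move=> tp; rewrite -{1}(cut_test tp) /cut.
have := integral_cutr D (cst 1) phi.
rewrite /cut; under eq_Rintegral do rewrite mul1r.
by move=> ->; under eq_Rintegral do rewrite mul1r.
Qed.

(** By translation invariance the increment [chi (x + t e) - chi x] has integral zero, and it
    differs from [t] times the partial derivative by [O(t^2)] on a bounded set; divide by [t] and
    let it tend to [0]. *)
Lemma integral_partial_test chi i : test_function D chi -> I (partial i chi) = 0.
Proof.
move=> tc; have tp := test_partial i tc; have tpp := test_partial i tp.
have [M M0 hM] := test_bounded tpp.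
have [B B0 DB] := bounded_rV_ball bD.
set e := delta_mx ord0 i : 'rV[R]_d.
(* For [t <= 1] the ball of radius [B + 1] contains [D] and its translate, hence everything where
   the integrand is nonzero. *)
pose V := fine (mu (ball (0 : 'rV[R]_d) (B + 1))).
have mB : measurable (ball (0 : 'rV[R]_d) (B + 1)) by exact: measurable_ball_rV.
have Boo := lebesgue_rV_ball_lty (0 : 'rV[R]_d) (B + 1).
have V0 : 0 <= V by rewrite /V fine_ge0.
have key t : 0 < t <= 1 -> `|I (partial i chi)| <= M * V * t.
  move=> /andP[t0 t1]; have ic := int_test tc; have ip := int_test tp.
  have ics : mu.-integrable setT (EFin \o (fun x => chi (x + t *: e))).
    exact: (integrable_rV_shift (t *: e) ic).
  have iw := int_sub measurableT (int_sub measurableT ics ic) (int_scale measurableT t ip).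
  have E : \int[mu]_x (chi (x + t *: e) - chi x - t * partial i chi x) = - t * I (partial i chi).
    rewrite RintegralB//; last exact: (int_scale measurableT t ip).
      2: exact: (int_sub measurableT ics ic).
    rewrite RintegralB// RintegralZl// (integral_test tp).
    rewrite (_ : Rintegral _ _ _ = \int[mu]_x chi x); last first.
      exact: (congr1 fine (integral_rV_shift (t *: e) ic)).
    by rewrite subrr sub0r mulNr.
  have E2 : \int[mu]_x (chi (x + t *: e) - chi x - t * partial i chi x) =
    \int[mu]_(x in ball (0 : 'rV[R]_d) (B + 1)) (chi (x + t *: e) - chi x - t * partial i chi x).
    rewrite [RHS]Rintegral_mkcond; apply: eq_Rintegral => x _; rewrite patchE.
    case: ifPn => //; rewrite notin_setE => nx.
    have B10 : 0 < B + 1 by rewrite addr_gt0.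
    have n0 : ~ D x.
      by move=> /DB h; apply: nx; apply: le_ball h; rewrite lerDl ler01.
    have n1 : ~ D (x + t *: e).
      move=> /DB/(ball_rVP _ _ B0) h; apply: nx; apply/(ball_rVP _ _ B10) => j.
      have := h j; rewrite !mxE !sub0r !normrN /= => hj.
      have -> : x ord0 j = (x ord0 j + t * (j == i)%:R) - t * (j == i)%:R by rewrite addrK.
      apply: le_lt_trans (ler_normB _ _) _; apply: ltr_leD => //.
      by case: (j == i); rewrite ?mulr1 ?mulr0 ?normr0// gtr0_norm.
    have [K [_ KD K0 K1]] := test_supp tc.
    by rewrite K0 ?K0 ?K1 ?mulr0 ?subrr// => /KD.
  have := @normr_Rintegral_le _ _ _ mu _ (fun x => chi (x + t *: e) - chi x - t * partial i chi x) (M * t ^+ 2) mB Boo.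
  rewrite -E2 E normrM normrN (gtr0_norm t0) -/V.
  move=> /(_ _ _)/wrap[].
  - exact: (integrableS measurableT).
  - by move=> x _; apply: Ck1_increment2 => //; have [] := tc.
  by rewrite (_ : M * t ^+ 2 * V = t * (M * V * t)) ?ler_pM2l//; ring.
apply/eqP; rewrite -normr_le0; apply/ler_addgt0Pl => s s0; rewrite addr0.
pose q := M * V + 1.
have q0 : 0 < q by rewrite ltr_pwDr// mulr_ge0.
have h : 0 < Num.min 1 (s / q) <= 1 by rewrite lt_min ltr01 divr_gt0//= ge_min lexx.
apply: le_trans (key _ h) _.
have : Num.min 1 (s / q) <= s / q by rewrite ge_min lexx orbT.
rewrite ler_pdivlMr// /q => h2; have : 0 < Num.min 1 (s / q) by case/andP: h.
rewrite -/q; nra.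
Qed.

Lemma is_weak_partial_test phi i : test_function D phi -> is_weak_partial D i phi (partial i phi).
Proof.
move=> tp psi tq; have tpq := test_mul tp (proj1 tq).
have h := integral_partial_test i tpq.
have C1 := (proj1 tp) 1%N; have C2 := (proj1 tq) 1%N.
have E x : partial i (fun x => phi x * psi x) x = phi x * partial i psi x + partial i phi x * psi x.
  by rewrite (partialM i x C1 C2); ring.
have c1 := test_continuous tp; have c2 := test_continuous tq.
have c3 := test_continuous (test_partial i tp); have c4 := test_continuous (test_partial i tq).
apply/eqP; rewrite -addr_eq0 -RintegralD//.
- by apply/eqP; rewrite -[RHS]h; apply: eq_Rintegral => x _; exact/esym/E.
- by apply: sqint_intM => //; exact: sqint_continuous.
- by apply: sqint_intM => //; exact: sqint_continuous.
Qed.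

End test_gradient.

Lemma ler_of_sqr (R : realDomainType) (x y : R) : 0 <= y -> x ^+ 2 <= y ^+ 2 -> x <= y.
Proof.
move=> y0; have [x0|x0] := lerP 0 x; first by rewrite ler_pXn2r.
by move=> _; apply: le_trans y0; exact: ltW.
Qed.

Lemma sqr_lin_le (R : realDomainType) (x y z p q : R) : 0 <= z -> z <= p * x + q * y ->
  z ^+ 2 <= 2 * p ^+ 2 * x ^+ 2 + 2 * q ^+ 2 * y ^+ 2.
Proof.
move=> z0 zxy; apply: (@le_trans _ _ ((p * x + q * y) ^+ 2)).
  by rewrite ler_pXn2r// nnegrE (le_trans z0).
by have := sqr_ge0 (p * x - q * y); nra.
Qed.

(** The factor [2] comes from [(p + q)^2 <= 2 p^2 + 2 q^2] in each component and again at the end;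
    it replaces Minkowski's inequality, as constants are immaterial here. *)
Lemma sqrt_sum_lin (R : rcfType) (d : nat) (a b x0 y0 z0 : R) (x y z : 'I_d -> R) :
  0 <= a -> 0 <= b -> 0 <= z0 -> (forall j, 0 <= z j) ->
  z0 <= a * x0 + b * y0 -> (forall j, z j <= a * x j + b * y j) ->
  Num.sqrt (z0 ^+ 2 + \sum_(j < d) z j ^+ 2) <=
  2 * (a * Num.sqrt (x0 ^+ 2 + \sum_(j < d) x j ^+ 2) +
       b * Num.sqrt (y0 ^+ 2 + \sum_(j < d) y j ^+ 2)).
Proof.
move=> a0 b0 z00 zj0 h0 hj.
have sq (t : R) (f : 'I_d -> R) : 0 <= t ^+ 2 + \sum_(j < d) f j ^+ 2.
  by rewrite addr_ge0 ?sqr_ge0// sumr_ge0// => j _; exact: sqr_ge0.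
set X := Num.sqrt (x0 ^+ 2 + _); set Y := Num.sqrt (y0 ^+ 2 + _).
have X0 : 0 <= X by exact: sqrtr_ge0.
have Y0 : 0 <= Y by exact: sqrtr_ge0.
have p0 := mulr_ge0 a0 X0; have q0 := mulr_ge0 b0 Y0.
apply: ler_of_sqr; first by rewrite mulr_ge0// addr_ge0.
rewrite sqr_sqrtr//; apply: (@le_trans _ _ (2 * a ^+ 2 * X ^+ 2 + 2 * b ^+ 2 * Y ^+ 2)).
  rewrite !sqr_sqrtr// (_ : 2 * a ^+ 2 * _ + _ = (2 * a ^+ 2 * x0 ^+ 2 + 2 * b ^+ 2 * y0 ^+ 2) +
    \sum_(j < d) (2 * a ^+ 2 * x j ^+ 2 + 2 * b ^+ 2 * y j ^+ 2)); last first.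
    by rewrite big_split/= -!mulr_sumr; ring.
  by apply: lerD; [exact: sqr_lin_le|apply: ler_sum => j _; exact: sqr_lin_le].
rewrite (_ : 2 * a ^+ 2 * _ + _ = 2 * (a * X) ^+ 2 + 2 * (b * Y) ^+ 2); last by ring.
by move: p0 q0; move: (a * X) (b * Y) => p q p0 q0; nra.
Qed.

(** * Sobolev spaces and diffusion forms *)

Section sobolev.
Context {R : realType} {d : nat}.
Variable D : set 'rV[R]_d.
Hypothesis oD : open D.
Hypothesis bD : bounded_set D.
Local Notation F := ('rV[R]_d -> R).
Local Notation mu := (lebesgue_rV R d).
Local Notation I f := (Rintegral mu D f).
Local Notation int f := (mu.-integrable D (EFin \o f)).
Local Notation mf v := (measurable_fun D v).
Local Notation wp i v := (weak_partial D i v).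
Local Notation L2 v := (sqint mu D v).
Local Notation n2 v := (normL2 D v).
Let mD : measurable D. Proof. exact: open_rV_measurable. Qed.
Let Doo : (mu D < +oo)%E. Proof. exact: bounded_rV_lty. Qed.

Lemma weak_partialP i v w : L1loc D w -> is_weak_partial D i v w ->
  [/\ L1loc D (wp i v), is_weak_partial D i v (wp i v) &
      {ae mu, forall x, D x -> w x = wp i v x}].
Proof.
move=> lw hw.
have [h1 h2] : [set w | L1loc D w /\ is_weak_partial D i v w] (wp i v) by exact: (xgetPex (cst 0) (ex_intro _ w (conj lw hw))).
by split => //; exact: (weak_partial_unique oD bD lw h1 hw h2).
Qed.

Lemma weak_partial_sqint i v w : L2 w -> is_weak_partial D i v w ->
  [/\ L2 (wp i v), is_weak_partial D i v (wp i v) &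
      {ae mu, forall x, D x -> w x = wp i v x}].
Proof.
move=> sw hw; have [[mv _] hv wv] := weak_partialP (sqint_L1loc oD bD sw) hw.
by split => //; exact: (ae_eq_sqint mD mv wv sw).
Qed.

Lemma is_weak_partial_lin i v v' w w' a b : L2 v -> L2 v' -> L2 w -> L2 w' ->
  is_weak_partial D i v w -> is_weak_partial D i v' w' ->
  is_weak_partial D i (fun x => a * v x + b * v' x) (fun x => a * w x + b * w' x).
Proof.
move=> sv sv' sw sw' hw hw' phi tp.
have lin f f' g : int (fun x => f x * g x) -> int (fun x => f' x * g x) ->
    I (fun x => (a * f x + b * f' x) * g x) = a * I (fun x => f x * g x) + b * I (fun x => f' x * g x).
  move=> i1 i2; rewrite -RintegralZl// -(RintegralZl b)// -RintegralD//; try exact: int_scale.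
  by apply: eq_Rintegral => x _; ring.
have lo f : L2 f -> L1loc D f := @sqint_L1loc _ _ D oD bD f.
rewrite !lin; try (by apply: L1loc_int_partial => //; exact: lo); try (by apply: L1loc_int_testT => //; exact: lo).
by rewrite hw// hw'//; ring.
Qed.

Lemma ae_eq_is_weak_partial i v v' w : mf v -> mf v' -> {ae mu, forall x, D x -> v x = v' x} ->
  is_weak_partial D i v w -> is_weak_partial D i v' w.
Proof.
move=> mv mv' vv' hw phi tp; rewrite -hw//; apply: ae_eq_Rintegral => //.
- apply: measurable_funM => //; apply: continuous_rV_measurable => //.
  exact: (test_continuous (test_partial i tp)).
- apply: measurable_funM => //; apply: continuous_rV_measurable => //.
  exact: (test_continuous (test_partial i tp)).
- by apply: filterS vv' => x h Dx; rewrite h.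
Qed.

(** Refers to the chosen representatives [weak_partial], the same ones that enter the norms and the
    diffusion forms, instead of asserting that some weak derivatives exist. *)
Definition H1 v := L2 v /\ forall i, L2 (wp i v) /\ is_weak_partial D i v (wp i v).

Lemma Sobolev12P v : Sobolev D 1 2%:E v <-> H1 v.
Proof.
split=> [[/= /Lp2P sv hv]|[sv hv]].
  split => // i; have [w [/Lp2P sw _] hw] := hv i.
  by have [] := weak_partial_sqint sw hw.
split; first exact/Lp2P.
move=> i; have [sw hw] := hv i; exists (wp i v) => //.
by split => //; exact/Lp2P.
Qed.

Lemma H1_sqint v : H1 v -> L2 v. Proof. by case. Qed.
Lemma H1_partial i v : H1 v -> L2 (wp i v). Proof. by case=> _ /(_ i)[]. Qed.

(** Uniqueness of weak derivatives makes the chosen ones linear, but only almost everywhere. *)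
Lemma H1_lin a b v w : H1 v -> H1 w -> H1 (fun x => a * v x + b * w x) /\
  forall i, {ae mu, forall x, D x -> a * wp i v x + b * wp i w x = wp i (fun x => a * v x + b * w x) x}.
Proof.
move=> [sv hv] [sw hw]; have key i := weak_partial_sqint
   (sqintD mD (sqintZ mD a (hv i).1) (sqintZ mD b (hw i).1))
   (is_weak_partial_lin a b sv sw (hv i).1 (hw i).1 (hv i).2 (hw i).2).
split; last by move=> i; have [] := key i.
split; first by apply: sqintD => //; exact: sqintZ.
by move=> i; have [] := key i.
Qed.

Lemma H1_test phi : test_function D phi -> H1 phi /\
  forall i, {ae mu, forall x, D x -> partial i phi x = wp i phi x}.
Proof.
move=> tp; have sc f : continuous f -> L2 f by exact: sqint_continuous.
have key i := weak_partial_sqint (sc _ (test_continuous (test_partial i tp))) (is_weak_partial_test oD bD i tp).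
split; last by move=> i; have [] := key i.
by split; [exact: (sc _ (test_continuous tp))|move=> i; have [] := key i].
Qed.

Lemma normL2_ge0 v : 0 <= n2 v. Proof. by rewrite normL2E norm2_ge0. Qed.

Lemma normH1_ge0 v : 0 <= normH1 D v. Proof. exact: sqrtr_ge0. Qed.

Lemma normH1_sqr v : normH1 D v ^+ 2 = n2 v ^+ 2 + \sum_(i < d) n2 (wp i v) ^+ 2.
Proof. by rewrite sqr_sqrtr// addr_ge0 ?sqr_ge0// sumr_ge0// => i _; exact: sqr_ge0. Qed.

Lemma normL2_le_H1 v : n2 v <= normH1 D v.
Proof.
apply: (ler_of_sqr (normH1_ge0 v)); rewrite normH1_sqr lerDl.
by rewrite sumr_ge0// => i _; exact: sqr_ge0.
Qed.

Lemma normL2_partial_le_H1 i v : n2 (wp i v) <= normH1 D v.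
Proof.
apply: (ler_of_sqr (normH1_ge0 v)); rewrite normH1_sqr.
rewrite (bigD1 i)//= addrCA lerDl addr_ge0 ?sqr_ge0//.
by rewrite sumr_ge0// => j _; exact: sqr_ge0.
Qed.

Lemma normL2_lin a b v w : L2 v -> L2 w ->
  n2 (fun x => a * v x + b * w x) <= `|a| * n2 v + `|b| * n2 w.
Proof.
move=> sv sw; rewrite !normL2E -(norm2Z mD a sv) -(norm2Z mD b sw).
by apply: norm2D => //; exact: sqintZ.
Qed.

Lemma normL2_partial_lin a b v w i : H1 v -> H1 w ->
  n2 (wp i (fun x => a * v x + b * w x)) <= `|a| * n2 (wp i v) + `|b| * n2 (wp i w).
Proof.
move=> hv hw; have [[_ h] /(_ i) e] := H1_lin a b hv hw.
rewrite {1}normL2E -(@ae_eq_norm2 _ _ _ mu D mD (fun x => a * wp i v x + b * wp i w x) _ _ _ e); first last.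
- by have [] := h i => -[].
- by have [] := sqintD mD (sqintZ mD a (H1_partial i hv)) (sqintZ mD b (H1_partial i hw)).
rewrite -normL2E; exact: normL2_lin (H1_partial i hv) (H1_partial i hw).
Qed.

Lemma normH1_lin a b v w : H1 v -> H1 w ->
  normH1 D (fun x => a * v x + b * w x) <= 2 * (`|a| * normH1 D v + `|b| * normH1 D w).
Proof.
move=> hv hw; have av := normr_ge0 a; have bv := normr_ge0 b.
apply: sqrt_sum_lin => //.
- exact: normL2_ge0.
- by move=> i; exact: normL2_ge0.
- exact: (normL2_lin _ _ (H1_sqint hv) (H1_sqint hw)).
- by move=> i; exact: normL2_partial_lin.
Qed.

Lemma test_lin a b phi psi : test_function D phi -> test_function D psi ->
  test_function D (fun x => a * phi x + b * psi x).
Proof.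
move=> [C1 [K1 [cK1 K1D h1]]] [C2 [K2 [cK2 K2D h2]]]; split.
  by move=> k; apply: CkD; apply: CkM => //; exact: Ck_cst.
exists (K1 `|` K2); split; first exact: compactU.
- by move=> x [/K1D|/K2D].
- by move=> x /not_orP[n1 n2]; rewrite h1// h2// !mulr0 addr0.
Qed.

Lemma H10_H1 v : H10 D v -> H1 v. Proof. by case=> /Sobolev12P. Qed.

Lemma H1_test_sub v phi : H1 v -> test_function D phi ->
  v \- phi = (fun x => 1 * v x + (-1) * phi x).
Proof. by move=> _ _; apply/funext => x; rewrite /= mul1r mulN1r. Qed.

Lemma H10_lin a b v w : H10 D v -> H10 D w -> H10 D (fun x => a * v x + b * w x).
Proof.
move=> hv hw; have v1 := H10_H1 hv; have w1 := H10_H1 hw.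
have [h _] := H1_lin a b v1 w1; split; first exact/Sobolev12P.
(* The denominator absorbs the coefficients [a], [b] and the factor [2] of [normH1_lin]; the summand
   [1] keeps it positive. *)
move=> e e0; pose c := e / (4 * (1 + `|a| + `|b|)).
have k0 : 0 < 4 * (1 + `|a| + `|b|) by rewrite mulr_gt0// ltr_pwDl// ?ltr_pwDl.
have c0 : 0 < c by rewrite divr_gt0.
have [_ /(_ _ c0)[phi tp hp]] := hv; have [_ /(_ _ c0)[psi tq hq]] := hw.
exists (fun x => a * phi x + b * psi x); first exact: test_lin.
have p1 := (H1_test tp).1; have q1 := (H1_test tq).1.
rewrite (_ : _ \- _ = fun x => a * (v \- phi) x + b * (w \- psi) x); last first.
  by apply/funext => x /=; ring.
move: hp hq; rewrite (H1_test_sub v1 tp) (H1_test_sub w1 tq) => hp hq.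
apply: le_lt_trans (normH1_lin a b (H1_lin 1 (-1) v1 p1).1 (H1_lin 1 (-1) w1 q1).1) _.
move: (normH1 D _) (normH1 D _) hp hq => p q hp hq.
have : e = c * (4 * (1 + `|a| + `|b|)) by rewrite /c divfK// gt_eqF.
have := normr_ge0 a; have := normr_ge0 b; move: `|a| `|b| => x y y0 x0.
by clearbody c; nra.
Qed.

Lemma H10_cst0 : H10 D (cst 0).
Proof.
have t0 : test_function D (cst 0 : F).
  split; first by move=> k; exact: Ck_cst.
  by exists set0; split => //; exact: compact0.
have h0 := (H1_test t0).1; split; first exact/Sobolev12P.
move=> e e0; exists (cst 0) => //.
rewrite (_ : _ \- _ = fun x => 0 * cst 0 x + 0 * cst 0 x); last by apply/funext => x /=; ring.
by apply: le_lt_trans (normH1_lin 0 0 h0 h0) _; rewrite normr0 !mul0r addr0 mulr0.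
Qed.

Definition W1oo b := Lp D +oo%E b /\ forall i, Lp D +oo%E (wp i b) /\ is_weak_partial D i b (wp i b).

Lemma ae_eq_Lpoo v w : mf w -> {ae mu, forall x, D x -> v x = w x} -> Lp D +oo%E v -> Lp D +oo%E w.
Proof.
move=> mw vw lv; apply: (LpooP (normLoo_ge0 D v)) => //.
by apply: filterS2 vw (Lpoo_ae lv) => x h1 h2 Dx; rewrite -h1// h2.
Qed.

Lemma Sobolev1ooP b : Sobolev D 1 +oo%E b <-> W1oo b.
Proof.
split=> [[/= sb hb]|[sb hb]].
  split => // i; have [w [sw _] hw] := hb i.
  have [[mw _] h wE] := weak_partialP (sqint_L1loc oD bD (Lpoo_sqint oD bD sw)) hw.
  by split => //; exact: (ae_eq_Lpoo mw wE sw).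
by split => // i; have [sw hw] := hb i; exists (wp i b).
Qed.

Lemma normLoo_le_W1oo b : normLoo D b <= normW1oo D b.
Proof. exact: bigmax_ge_id. Qed.

Lemma normLoo_partial_le_W1oo i b : normLoo D (wp i b) <= normW1oo D b.
Proof. exact: (le_bigmax _ (fun i => normLoo D (wp i b)) i). Qed.

Lemma normW1oo_ge0 b : 0 <= normW1oo D b.
Proof. exact: le_trans (normLoo_ge0 D b) (normLoo_le_W1oo b). Qed.

Lemma normLoo_lin x y b c : Lp D +oo%E b -> Lp D +oo%E c ->
  Lp D +oo%E (fun z => x * b z + y * c z) /\
  normLoo D (fun z => x * b z + y * c z) <= `|x| * normLoo D b + `|y| * normLoo D c.
Proof.
move=> lb lc; have M0 : 0 <= `|x| * normLoo D b + `|y| * normLoo D c.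
  by rewrite addr_ge0// mulr_ge0// normLoo_ge0.
have H : {ae mu, forall z, D z -> `|x * b z + y * c z| <= `|x| * normLoo D b + `|y| * normLoo D c}.
  apply: filterS2 (Lpoo_ae lb) (Lpoo_ae lc) => z h1 h2 Dz.
  by apply: le_trans (ler_normD _ _) _; rewrite !normrM lerD// ler_wpM2l// ?h1 ?h2.
split; last exact: (normLoo_le M0 H).
apply: (LpooP M0) => //; have [mb _] := lb; have [mc _] := lc.
by apply: measurable_funD; apply: measurable_funM => //; exact: measurable_cst.
Qed.

Lemma W1oo_lin x y b c : W1oo b -> W1oo c -> W1oo (fun z => x * b z + y * c z) /\
  normW1oo D (fun z => x * b z + y * c z) <= `|x| * normW1oo D b + `|y| * normW1oo D c.
Proof.
move=> [lb hb] [lc hc]; have s f : Lp D +oo%E f -> L2 f := @Lpoo_sqint _ _ D oD bD f.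
have key i := weak_partial_sqint (s _ (normLoo_lin x y (hb i).1 (hc i).1).1)
  (is_weak_partial_lin x y (s _ lb) (s _ lc) (s _ (hb i).1) (s _ (hc i).1) (hb i).2 (hc i).2).
have M0 : 0 <= `|x| * normW1oo D b + `|y| * normW1oo D c.
  by rewrite addr_ge0// mulr_ge0// normW1oo_ge0.
split.
  split; first by case: (normLoo_lin x y lb lc).
  move=> i; have [[mw _] h2 h3] := key i; split => //.
  exact: (ae_eq_Lpoo mw h3 (normLoo_lin x y (hb i).1 (hc i).1).1).
apply: bigmax_le => [|i _].
  apply: le_trans (normLoo_lin x y lb lc).2 _.
  by rewrite lerD// ler_wpM2l// normLoo_le_W1oo.
have [_ _ h3] := key i; rewrite -(ae_eq_normLoo h3).
apply: le_trans (normLoo_lin x y (hb i).1 (hc i).1).2 _.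
by rewrite lerD// ler_wpM2l// normLoo_partial_le_W1oo.
Qed.

Local Notation form := (diffusion_form D).

Lemma form_termE b w v i : Lp D +oo%E b -> H1 w -> H1 v ->
  int (fun x => b x * (wp i w x * wp i v x)).
Proof.
move=> lb hw hv; have := sqint_intM mD (H1_partial i hw) (H1_partial i hv) => h.
have [mb _] := lb.
have := int_mul_bounded oD h mb (normLoo_ge0 D b) (Lpoo_ae lb).
by apply: eq_integrable => // x _ /=; rewrite mulrC.
Qed.

Lemma formE b w v : Lp D +oo%E b -> H1 w -> H1 v ->
  form b w v = \sum_(i < d) I (fun x => b x * (wp i w x * wp i v x)).
Proof.
move=> lb hw hv; rewrite /diffusion_form -Rintegral_sum//.
  by apply: eq_Rintegral => x _; rewrite mulr_sumr.
by move=> i _; exact: form_termE.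
Qed.

Lemma formC b w v : form b w v = form b v w.
Proof.
by apply: eq_Rintegral => x _; congr (_ * _); apply: eq_bigr => i _; rewrite mulrC.
Qed.

Lemma form_linl b x y w w' v : Lp D +oo%E b -> H1 w -> H1 w' -> H1 v ->
  form b (fun z => x * w z + y * w' z) v = x * form b w v + y * form b w' v.
Proof.
move=> lb hw hw' hv; have [h e] := H1_lin x y hw hw'; have [mb _] := lb.
rewrite !formE// !mulr_sumr -big_split/=; apply: eq_bigr => i _.
have i1 := form_termE i lb hw hv; have i2 := form_termE i lb hw' hv.
rewrite -RintegralZl// -(RintegralZl y)// -RintegralD//; try exact: int_scale.
have [m1 _] := H1_partial i h; have [m2 _] := H1_partial i hv.
have [m3 _] := H1_partial i hw; have [m4 _] := H1_partial i hw'.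
apply: ae_eq_Rintegral => //.
- by apply: measurable_funM => //; exact: measurable_funM.
- by apply: measurable_funD; apply: measurable_funM => //;
    apply: measurable_funM => //; apply: measurable_funM.
- by apply: filterS (e i) => z ez Dz; rewrite -ez//; ring.
Qed.

Lemma form_linr b x y w v v' : Lp D +oo%E b -> H1 w -> H1 v -> H1 v' ->
  form b w (fun z => x * v z + y * v' z) = x * form b w v + y * form b w v'.
Proof. by move=> lb hw hv hv'; rewrite (formC b w) (form_linl x y lb hv hv' hw) (formC b v) (formC b v'). Qed.

Lemma form_linc x y b c w v : Lp D +oo%E b -> Lp D +oo%E c -> H1 w -> H1 v ->
  form (fun z => x * b z + y * c z) w v = x * form b w v + y * form c w v.
Proof.
move=> lb lc hw hv; have [lbc _] := normLoo_lin x y lb lc.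
rewrite !formE// !mulr_sumr -big_split/=; apply: eq_bigr => i _.
have i1 := form_termE i lb hw hv; have i2 := form_termE i lc hw hv.
rewrite -RintegralZl// -(RintegralZl y)// -RintegralD//; try exact: int_scale.
by apply: eq_Rintegral => z _; ring.
Qed.

Lemma form_bound b w v : Lp D +oo%E b -> H1 w -> H1 v ->
  `|form b w v| <= d%:R * normLoo D b * normH1 D w * normH1 D v.
Proof.
move=> lb hw hv; rewrite formE//; apply: le_trans (ler_norm_sum _ _ _) _.
apply: (@le_trans _ _ (\sum_(i < d) normLoo D b * normH1 D w * normH1 D v)); last first.
  by rewrite sumr_const card_ord -[leLHS]mulr_natl !mulrA.
apply: ler_sum => i _; have [mb _] := lb.
have [s1 h1] := sqint_mul_bounded mD mb (Lpoo_ae lb) (normLoo_ge0 D b) (H1_partial i hw).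
under eq_Rintegral do rewrite mulrA.
apply: le_trans (cauchy_schwarz mD s1 (H1_partial i hv)) _.
rewrite -!normL2E in h1 *; have := normL2_partial_le_H1 i v; have := normL2_partial_le_H1 i w.
move=> p1 p2; apply: ler_pM => //; rewrite ?normL2_ge0//.
exact: le_trans h1 (ler_wpM2l (normLoo_ge0 D b) p1).
Qed.

Lemma pairing_lin f x y v w : L2 f -> L2 v -> L2 w ->
  pairing D f (fun z => x * v z + y * w z) = x * pairing D f v + y * pairing D f w.
Proof.
move=> sf sv sw; rewrite /pairing.
have i1 := sqint_intM mD sf sv; have i2 := sqint_intM mD sf sw.
rewrite -RintegralZl// -(RintegralZl y)// -RintegralD//; try exact: int_scale.
by apply: eq_Rintegral => z _; ring.
Qed.

Lemma pairing_bound f v : L2 f -> L2 v -> `|pairing D f v| <= n2 f * n2 v.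
Proof. by move=> sf sv; rewrite !normL2E; exact: cauchy_schwarz. Qed.

End sobolev.

(** * Functions in [H^2] and representation of diffusion forms by square-integrable functions *)

Section regularity.
Context {R : realType} {d : nat}.
Variable D : set 'rV[R]_d.
Hypothesis oD : open D.
Hypothesis bD : bounded_set D.
Local Notation F := ('rV[R]_d -> R).
Local Notation mu := (lebesgue_rV R d).
Local Notation I f := (Rintegral mu D f).
Local Notation int f := (mu.-integrable D (EFin \o f)).
Local Notation mf v := (measurable_fun D v).
Local Notation wp i v := (weak_partial D i v).
Local Notation L2 v := (sqint mu D v).
Local Notation n2 v := (normL2 D v).
Local Notation H1 := (@H1 R d D).
Local Notation W1oo := (@W1oo R d D).
Local Notation form := (diffusion_form D).
Let mD : measurable D. Proof. exact: open_rV_measurable. Qed.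
Let Doo : (mu D < +oo)%E. Proof. exact: bounded_rV_lty. Qed.

Lemma ae_eq_weak_partial i v w : mf v -> mf w -> {ae mu, forall x, D x -> v x = w x} ->
  wp i v = wp i w.
Proof.
move=> mv mw vw; rewrite /weak_partial; congr (xget _ _); apply/seteqP; split => z [lz hz]; split => //.
  exact: (ae_eq_is_weak_partial oD mv mw vw hz).
by apply: (ae_eq_is_weak_partial oD mw mv _ hz); apply: filterS vw => x h Dx; rewrite h.
Qed.

Lemma ae_eq_normH1 v w : mf v -> mf w -> {ae mu, forall x, D x -> v x = w x} ->
  normH1 D v = normH1 D w.
Proof.
move=> mv mw vw.
have E i : wp i v = wp i w by exact: (ae_eq_weak_partial i mv mw vw).
have E0 : n2 v = n2 w by rewrite !normL2E; exact: (ae_eq_norm2 mD mv mw vw).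
by rewrite /normH1 E0; congr (Num.sqrt (_ + _)); apply: eq_bigr => i _; rewrite E.
Qed.

Local Opaque weak_partial normL2 normH1.

Definition H2 v := H1 v /\ forall i, H1 (wp i v).

Lemma Sobolev22P v : Sobolev D 2 2%:E v <-> H2 v.
Proof.
split=> [[/= sv hv]|[hv h]].
  have h : H1 v.
    apply/(Sobolev12P oD bD); split => // i; have [w [sw _] hw] := hv i.
    by exists w.
  split; [exact: h|move=> i]; have [w sw0 hw] := hv i.
  have sw : H1 w by apply/(Sobolev12P oD bD); exact: sw0.
  have [[m1 _] _ e] := weak_partial_sqint oD bD (H1_sqint sw) hw.
  have [[m2 i2] hp] := sw.
  have E j : wp j w = wp j (wp i v) by exact: (ae_eq_weak_partial j m2 m1 e).
  split; first exact: (ae_eq_sqint mD m1 e).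
  move=> j; rewrite -E; have [s1 s2] := hp j; split => //.
  exact: (ae_eq_is_weak_partial oD m2 m1 e).
split; first by apply/Lp2P; exact: H1_sqint hv.
move=> i; exists (wp i v); first exact: (proj2 (Sobolev12P oD bD (wp i v)) (h i)).
by have [_ /(_ i)[]] := hv.
Qed.

Let sumsq_ge0 (v : F) : 0 <= \sum_(i < d) \sum_(j < d | (i <= j)%N) n2 (wp j (wp i v)) ^+ 2.
Proof. by apply: sumr_ge0 => i _; apply: sumr_ge0 => j _; exact: sqr_ge0. Qed.

Lemma normH2_ge0 v : 0 <= normH2 D v. Proof. exact: sqrtr_ge0. Qed.

Lemma normH2_sqr v : normH2 D v ^+ 2 = normH1 D v ^+ 2 +
  \sum_(i < d) \sum_(j < d | (i <= j)%N) n2 (wp j (wp i v)) ^+ 2.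
Proof. by rewrite sqr_sqrtr// addr_ge0 ?sqr_ge0// sumsq_ge0. Qed.

Lemma normH1_le_H2 v : normH1 D v <= normH2 D v.
Proof. by apply: (ler_of_sqr (normH2_ge0 v)); rewrite normH2_sqr lerDl sumsq_ge0. Qed.

Lemma normL2_partial2_le_H2 i v : n2 (wp i (wp i v)) <= normH2 D v.
Proof.
apply: (ler_of_sqr (normH2_ge0 v)); rewrite normH2_sqr; apply: ler_wpDl; first exact: sqr_ge0.
pose t (i j : 'I_d) := n2 (wp j (wp i v)) ^+ 2.
have t0 i' j' : 0 <= t i' j' by exact: sqr_ge0.
change (t i i <= \sum_(i < d) \sum_(j < d | (i <= j)%N) t i j).
move: t t0 => t t0; rewrite (bigD1 i erefl)/= (bigD1 i (leqnn i))/= -addrA lerDl addr_ge0//.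
  by apply: sumr_ge0 => j _.
by apply: sumr_ge0 => j _; apply: sumr_ge0 => k _.
Qed.

Lemma H1_null v w : H1 v -> H1 w -> normH1 D (fun x => 1 * v x + (-1) * w x) = 0 ->
  {ae mu, forall x, D x -> w x = v x}.
Proof.
move=> hv hw h0; have [h _] := H1_lin oD bD 1 (-1) hv hw.
have : norm2 mu D (fun x => 1 * v x + (-1) * w x) = 0.
  rewrite -normL2E; apply/eqP; rewrite eq_le normL2_ge0 andbT -h0.
  exact: normL2_le_H1.
move/(norm2_eq0 mD (H1_sqint h)); apply: filterS => x + Dx => /(_ Dx).
by rewrite mul1r mulN1r => /eqP; rewrite subr_eq0 => /eqP.
Qed.

Lemma ae_eq_H2 v w : H1 w -> {ae mu, forall x, D x -> v x = w x} -> H2 v ->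
  H2 w /\ normH2 D w = normH2 D v.
Proof.
move=> hw vw [[sv _] hv]; have [mv _] := sv; have [[mw _] _] := hw.
have E i : wp i v = wp i w by exact: (ae_eq_weak_partial i mv mw vw).
split; first by split; [exact: hw|move=> i; rewrite -E; exact: hv].
have E2 := ae_eq_normH1 mv mw vw.
have E3 : \sum_(i < d) \sum_(j < d | (i <= j)%N) n2 (wp j (wp i v)) ^+ 2 =
    \sum_(i < d) \sum_(j < d | (i <= j)%N) n2 (wp j (wp i w)) ^+ 2.
  by apply: eq_bigr => i _; rewrite (E i).
exact: (congr2 (fun a b => Num.sqrt (a ^+ 2 + b)) (esym E2) (esym E3)).
Qed.

(** This is [- div (b grad z)], expanded by the product rule. *)
Definition dual_coef b z : F :=
  fun x => - \sum_(i < d) (wp i b x * wp i z x + b x * wp i (wp i z) x).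

Lemma dual_term b z i : W1oo b -> H2 z ->
  L2 (fun x => wp i b x * wp i z x + b x * wp i (wp i z) x) /\
  n2 (fun x => wp i b x * wp i z x + b x * wp i (wp i z) x) <= 2 * normW1oo D b * normH2 D z.
Proof.
move=> [lb hb] [hz hzz]; have [lbi _] := hb i; have [mb _] := lb; have [mbi _] := lbi.
have [s1 h1] := sqint_mul_bounded mD mbi (Lpoo_ae lbi) (normLoo_ge0 D _) (H1_partial i hz).
have [s2 h2] := sqint_mul_bounded mD mb (Lpoo_ae lb) (normLoo_ge0 D _) (H1_partial i (hzz i)).
split; first exact: sqintD.
rewrite normL2E; apply: le_trans (norm2D mD s1 s2) _.
rewrite -!normL2E in h1 h2 *; rewrite -mulrA mulr_natl mulr2n; apply: lerD.
  apply: le_trans h1 _; apply: ler_pM; [exact: normLoo_ge0|exact: normL2_ge0|exact: normLoo_partial_le_W1oo|].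
  exact: le_trans (normL2_partial_le_H1 _ _ _) (normH1_le_H2 _).
apply: le_trans h2 _; apply: ler_pM; [exact: normLoo_ge0|exact: normL2_ge0|exact: normLoo_le_W1oo|].
exact: normL2_partial2_le_H2.
Qed.

Lemma sqint_sum n (f : 'I_n -> F) (M : R) : (forall i, L2 (f i) /\ n2 (f i) <= M) ->
  L2 (fun x => \sum_(i < n) f i x) /\ n2 (fun x => \sum_(i < n) f i x) <= n%:R * M.
Proof.
elim: n f => [|n IH] f h.
  rewrite (_ : (fun _ => _) = fun=> 0); last by apply/funext => x; rewrite big_ord0.
  split; first exact: sqint_cst.
  rewrite normL2E mul0r -{1}[X in fun=> X](mul0r 0).
  by rewrite (@norm2Z _ _ _ mu D mD 0 (fun=> 0) (sqint_cst mD Doo 0)) normr0 mul0r.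
rewrite (_ : (fun _ => _) = fun x => f ord0 x + \sum_(i < n) f (lift ord0 i) x); last first.
  by apply/funext => x; rewrite big_ord_recl.
have [s1 h1] := h ord0; have [s2 h2] := IH _ (fun i => h (lift ord0 i)).
split; first exact: sqintD.
rewrite normL2E; apply: le_trans (norm2D mD s1 s2) _; rewrite -!normL2E.
by rewrite -natr1 mulrDl mul1r addrC; exact: lerD.
Qed.

Lemma dual_coefP b z : W1oo b -> H2 z ->
  L2 (dual_coef b z) /\ n2 (dual_coef b z) <= 2 * d%:R * normH2 D z * normW1oo D b.
Proof.
move=> hb hz; have [s h] := sqint_sum (fun i => dual_term i hb hz); split; first exact: sqintN.
rewrite normL2E norm2N -normL2E; apply: le_trans h _.
by rewrite le_eqVlt; apply/orP; left; apply/eqP; ring.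
Qed.

(** In each coordinate, [weak_partial_test_mul] is applied with the first derivative of [z] as the
    mollified factor. *)
Lemma form_test b z phi : W1oo b -> H2 z -> test_function D phi ->
  form b z phi = pairing D (dual_coef b z) phi.
Proof.
move=> [lb hb] [hz hzz] tp; have [p1 pE] := H1_test oD bD tp.
have s := @Lpoo_sqint _ _ D oD bD.
have cp := test_continuous tp; have cd i := test_continuous (test_partial i tp).
have bnd f g : L2 f -> continuous g -> L2 (fun x => f x * g x).
  move=> sf cg; have [C C0 hC] := continuous_bounded bD cg.
  have [] := @sqint_mul_bounded _ _ _ mu D mD g f C (continuous_rV_measurable cg mD) _ C0 sf.
    by apply: aeW => x; exact: hC.
  by rewrite (_ : (fun x => g x * f x) = fun x => f x * g x)//; apply/funext => x; rewrite mulrC.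
have it f g h : L2 f -> L2 g -> continuous h -> int (fun x => f x * g x * h x).
  move=> sf sg ch; have := sqint_intM mD sf (bnd _ _ sg ch).
  by apply: eq_integrable => // x _ /=; rewrite mulrA.
rewrite (formE oD lb hz p1) /pairing.
have i1 i : int (fun x => wp i z x * wp i b x * phi x).
  by apply: it => //; [exact: H1_partial|exact: (s _ (hb i).1)].
have i2 i : int (fun x => wp i (wp i z) x * b x * phi x).
  by apply: it => //; [exact: (H1_partial i (hzz i))|exact: (s _ lb)].
have i3 i : int (fun x => wp i z x * b x * partial i phi x).
  by apply: it => //; [exact: H1_partial|exact: (s _ lb)].
transitivity (\sum_(i < d) - I (fun x => wp i z x * wp i b x * phi x + wp i (wp i z) x * b x * phi x)); last first.
  rewrite sumrN -Rintegral_sum//; last by move=> i _; exact: int_add.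
  rewrite -mulN1r -RintegralZl//; last by apply: int_sum => // i _; exact: int_add.
  apply: eq_Rintegral => x _; rewrite /dual_coef mulN1r mulNr mulr_suml; congr (- _).
  by apply: eq_bigr => i _; ring.
apply: eq_bigr => i _.
have hzi : is_weak_partial D i (wp i z) (wp i (wp i z)) by have [_ /(_ i)[]] := hzz i.
have h := weak_partial_test_mul oD bD lb (hb i).1 (sqint_int mD Doo (H1_partial i hz))
  (sqint_int mD Doo (H1_partial i (hzz i))) (hb i).2 hzi tp.
transitivity (I (fun x => wp i z x * b x * partial i phi x)).
  have [mb _] := lb; have [mp _] := H1_partial i p1; have [mz _] := H1_partial i hz.
  have mc := continuous_rV_measurable (cd i) mD.
  apply: ae_eq_Rintegral; [exact: mD| | |].
  - by apply: measurable_funM; [exact: mb|exact: measurable_funM].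
  - by apply: measurable_funM; [exact: measurable_funM|exact: mc].
  - by apply: filterS (pE i) => x px Dx; rewrite -px//; ring.
rewrite RintegralD//.
rewrite (_ : I (fun x => wp i (wp i z) x * b x * phi x) = I (fun x => wp i (wp i z) x * (b x * phi x))); last first.
  by apply: eq_Rintegral => x _; rewrite mulrA.
apply/eqP; rewrite -[I (fun x => wp i (wp i z) x * (b x * phi x))]opprK -h opprB -RintegralB//; first last.
  by have := int_add mD (i1 i) (i3 i); apply: eq_integrable => // x _ /=; congr EFin; ring.
by apply/eqP; apply: eq_Rintegral => x _; ring.
Qed.

(** Both sides are continuous in the [H^1] norm of [E], and test functions are dense in [H10] by
    definition. *)
Lemma form_dual b z E : W1oo b -> H2 z -> H10 D E ->
  form b z E = pairing D (dual_coef b z) E.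
Proof.
move=> hb hz hE; have E1 := H10_H1 oD bD hE; have [sg _] := dual_coefP hb hz.
have lb := hb.1; have z1 := hz.1.
apply/eqP; rewrite -subr_eq0 -normr_le0; apply/ler_addgt0Pl => e e0; rewrite addr0.
set g := dual_coef b z in sg *.
pose C := d%:R * normLoo D b * normH1 D z + n2 g + 1.
have C0 : 0 < C by rewrite ltr_pwDr// addr_ge0 ?normL2_ge0// !mulr_ge0 ?normLoo_ge0 ?normH1_ge0.
have [_ /(_ _ (divr_gt0 e0 C0))[phi tp hphi]] := hE.
have [p1 _] := H1_test oD bD tp; rewrite (H1_test_sub E1 tp) in hphi.
have [dE1 _] := H1_lin oD bD 1 (-1) E1 p1.
have := form_linr oD bD 1 (-1) lb z1 E1 p1; have := pairing_lin oD 1 (-1) sg (H1_sqint E1) (H1_sqint p1).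
rewrite (form_test hb hz tp) -/g !mul1r !mulN1r => h1 h2.
have -> : form b z E - pairing D g E = form b z (fun x => 1 * E x + (-1) * phi x) -
    pairing D g (fun x => 1 * E x + (-1) * phi x) by rewrite h1 h2; ring.
have k1 := form_bound oD lb z1 dE1; have k2 := pairing_bound oD sg (H1_sqint dE1).
have k3 := normL2_le_H1 D (fun x => 1 * E x + (-1) * phi x).
have k4 := normL2_ge0 D g.
apply: le_trans (ler_normB _ _) _; apply: le_trans (lerD k1 (le_trans k2 (ler_wpM2l k4 k3))) _.
rewrite -mulrDl; have := normH1_ge0 D (fun x => 1 * E x + (-1) * phi x).
move: (normH1 D _) hphi => t; rewrite ltr_pdivlMr// => ht t0.
apply: le_trans _ (ltW ht); rewrite mulrC; apply: ler_wpM2l => //.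
by rewrite lerDl.
Qed.

(** The functional given by [b] and [w] is represented in [L^2] with a norm linear in that of [b].
    Functions in [H^2] have this property, and it passes to linear combinations, so it is available
    for sums of solutions. *)
Definition dual_bound w k := forall b, W1oo b -> exists g, [/\ L2 g,
  n2 g <= k * normW1oo D b & forall v, H10 D v -> form b w v = pairing D g v].

Lemma dual_bound_H2 z k : H2 z -> normH2 D z <= k -> dual_bound z (2 * d%:R * k).
Proof.
move=> hz zk b hb; have [s h] := dual_coefP hb hz; exists (dual_coef b z); split => //.
  apply: le_trans h _; apply: ler_wpM2r; first exact: normW1oo_ge0.
  exact: ler_wpM2l.
by move=> v hv; exact: form_dual.
Qed.

Lemma dual_bound_lin x y v w k l : H1 v -> H1 w -> dual_bound v k -> dual_bound w l ->
  dual_bound (fun z => x * v z + y * w z) (`|x| * k + `|y| * l).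
Proof.
move=> v1 w1 hv hw b hb; have [g [sg hg eg]] := hv b hb; have [g' [sg' hg' eg']] := hw b hb.
exists (fun z => x * g z + y * g' z); split.
- exact: (sqintD mD (sqintZ mD x sg) (sqintZ mD y sg')).
- apply: le_trans (normL2_lin oD x y sg sg') _; rewrite mulrDl -!mulrA.
  by rewrite lerD// ler_wpM2l.
move=> u hu; have u1 := H10_H1 oD bD hu.
rewrite (form_linl oD bD x y hb.1 v1 w1 u1) (eg u hu) (eg' u hu) /pairing.
have i1 := sqint_intM mD sg (H1_sqint u1); have i2 := sqint_intM mD sg' (H1_sqint u1).
rewrite -(RintegralZl x mD i1) -(RintegralZl y mD i2) -(RintegralD mD (int_scale mD x i1) (int_scale mD y i2)).
by apply: eq_Rintegral => z _; ring.
Qed.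

End regularity.

(** If [e <= s] the claim is immediate. Otherwise [q * s <= q * e], and the inequality may be
    divided by [e]. *)
Lemma quadratic_bound (R : realFieldType) (a e p q s : R) : 0 < a -> 0 <= e -> 0 <= p -> 0 <= q ->
  0 <= s -> a * e ^+ 2 <= (p + q) * e + q * s -> e <= s + (p + 2 * q) / a.
Proof.
move=> a0 e0 p0 q0 s0 h; have [es|es] := lerP e s.
  by rewrite ler_wpDr// divr_ge0 ?(ltW a0)// addr_ge0// mulr_ge0.
rewrite ler_wpDl// ler_pdivlMr//.
have e1 : 0 < e by apply: le_lt_trans es.
rewrite -(ler_pM2r e1); have := ler_wpM2l q0 (ltW es); nra.
Qed.

Lemma eq_le2 (R : numDomainType) (x y : R) : x = y -> x <= y. Proof. by move=> ->. Qed.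

(** * Differences of Galerkin errors *)

Section galerkin.
Context {R : realType} {d : nat}.
Variable D : set 'rV[R]_d.
Hypothesis oD : open D.
Hypothesis bD : bounded_set D.
Local Notation F := ('rV[R]_d -> R).
Local Notation mu := (lebesgue_rV R d).
Local Notation L2 v := (sqint mu D v).
Local Notation n2 v := (normL2 D v).
Local Notation nH1 v := (normH1 D v).
Local Notation H1 := (@H1 R d D).
Local Notation H2 := (@H2 R d D).
Local Notation W1oo := (@W1oo R d D).
Local Notation form := (diffusion_form D).
Local Notation V := (H10 D).
Local Notation "v -- w" := (fun x => 1 * v x + (-1) * w x) (at level 50).
Local Notation "v ++ w" := (fun x => 1 * v x + 1 * w x).

Local Opaque weak_partial normL2 normH1 normH2 diffusion_form pairing normLoo normW1oo H10.

Variables (alpha K1 K2 K3 : R).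

Definition elliptic (a : F) :=
  [/\ Lp D +oo%E a,
      forall v, V v -> alpha * nH1 v ^+ 2 <= form a v v,
      forall v w, V v -> V w -> `|form a v w| <= K1 * nH1 v * nH1 w &
      forall g, L2 g -> exists z, [/\ V z, H2 z, normH2 D z <= K2 * n2 g &
        forall v, V v -> form a z v = pairing D g v]].

Definition approx_space (eta : R) (X : set F) :=
  [/\ X `<=` V, X (cst 0), forall a v w, X v -> X w -> X (fun x => a * v x + w x) &
      forall z, V z -> H2 z -> exists2 v, X v & nH1 (z -- v) <= K3 * eta * normH2 D z].

(** The last clause is the [L^2] rate in dual form. It is part of the induction: estimating the next
    difference pairs the present error with a function in [L^2]. *)
Definition error_bound (eta : R) (E : F) (k : R) :=
  [/\ V E, nH1 E <= k * eta & forall g, L2 g -> `|pairing D g E| <= k * eta ^+ 2 * n2 g].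

Hypotheses (alpha0 : 0 < alpha) (K10 : 0 <= K1) (K20 : 0 <= K2) (K30 : 0 <= K3).

Lemma approx_space_sub eta X v w : approx_space eta X -> X v -> X w -> X (v -- w).
Proof.
move=> [_ X0 Xl _] hv hw.
have h : X (fun x => -1 * w x + cst 0 x) by exact: Xl.
rewrite (_ : v -- w = fun x => 1 * v x + (fun x => -1 * w x + cst 0 x) x); first exact: Xl.
by apply/funext => x /=; ring.
Qed.

Lemma form_decomp b u w v v' : Lp D +oo%E b -> H1 w -> H1 v -> H1 v' -> u = v ++ v' ->
  form b w u = form b w v + form b w v'.
Proof.
move=> lb hw hv hv' ->; apply: etrans (form_linr oD bD 1 1 lb hw hv hv') _.
exact: (congr2 +%R (mul1r _) (mul1r _)).
Qed.

Lemma normH1_sub u v w : H1 v -> H1 w -> u = v -- w -> nH1 u <= 2 * (nH1 v + nH1 w).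
Proof.
move=> hv hw ->; apply: le_trans (normH1_lin oD bD 1 (-1) hv hw) _.
apply: eq_le2; rewrite normrN normr1.
exact: (congr1 ( *%R 2) (congr2 +%R (mul1r _) (mul1r _))).
Qed.

(** The bracket [K3 + K1 * K3 / alpha + 4 * d%:R / alpha] is the constant of the energy estimate.
    Duality multiplies it by [K1 * K3 * K2], the [1] retains the energy bound itself, and the last
    two summands come from the form of [b] between [E'] and, respectively, [z] and [z -- u]. *)
Definition step_const : R := (1 + K1 * K3 * K2) * (K3 + K1 * K3 / alpha + 4 * d%:R / alpha)
  + 2 * d%:R * K2 + d%:R * K3 * K2.

Lemma step_const_ge0 : 0 <= step_const.
Proof.
have a0 := ltW alpha0; have n0 : 0 <= d%:R :> R by [].
by rewrite /step_const !addr_ge0 ?mulr_ge0 ?addr_ge0 ?divr_ge0 ?mulr_ge0.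
Qed.

(* [w] is an exact solution or a difference of such, [E] its finite element
   error, and [E'] the error of the difference of lower order. The last
   hypothesis expresses Galerkin orthogonality, and the bound of the functionals
   of [E] is the Aubin-Nitsche duality argument. *)
Lemma error_step eta eps k1 k2 a b (X : set F) w W E E' : E = w -- W ->
  0 <= eta -> 0 <= k1 -> 0 <= k2 ->
  elliptic a -> approx_space eta X -> W1oo b -> normW1oo D b <= eps ->
  V w -> H2 w -> normH2 D w <= k2 -> X W -> error_bound eta E' k1 ->
  (forall v, X v -> form a E v = - form b E' v) ->
  error_bound eta E (step_const * (k2 + eps * k1)).
Proof.
move=> EE eta0 k10 k20 [la coer bnd reg] hX hb beps hw h2w wk2 XW [hE' eE' pE'] orth.
have [XV X0 Xl Xa] := hX.
have a0 := ltW alpha0; have n0 : 0 <= d%:R :> R by [].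
have eps0 : 0 <= eps by apply: le_trans beps; exact: normW1oo_ge0.
have lb := hb.1; have E1' := H10_H1 oD bD hE'.
have V1 v : V v -> H1 v by exact: (H10_H1 oD bD).
have Vs v v' : V v -> V v' -> V (v -- v') by exact: (H10_lin oD bD).
have hE : V E by rewrite EE; exact: (Vs _ _ hw (XV _ XW)).
have bb v u : V v -> V u -> nH1 v <= k1 * eta -> `|form b v u| <= d%:R * (eps * k1) * eta * nH1 u.
  move=> hv hu ev; apply: le_trans (form_bound oD lb (V1 _ hv) (V1 _ hu)) _.
  apply: ler_wpM2r; first exact: normH1_ge0.
  rewrite -!mulrA; apply: ler_wpM2l => //; apply: ler_pM => //; first exact: normLoo_ge0.
    exact: normH1_ge0.
  exact: le_trans (normLoo_le_W1oo D b) beps.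
(* Orthogonality holds on [X] only, so [E] is split through an approximant [v] of [w]. Since
   [v -- W] is itself estimated by [E], a quadratic inequality for the norm of [E] results. *)
have [v Xv ev] := Xa w hw h2w.
have hv := XV _ Xv.
set s := K3 * eta * k2.
have s0 : 0 <= s by rewrite !mulr_ge0.
have evs : nH1 (w -- v) <= s by apply: le_trans ev _; rewrite ler_wpM2l// mulr_ge0.
have XvW : X (v -- W) by exact: (approx_space_sub hX).
have hwv := Vs _ _ hw hv; have hvW := XV _ XvW.
have decE : E = (w -- v) ++ (v -- W) by rewrite EE; apply/funext => x; ring.
have nvW : nH1 (v -- W) <= 2 * (nH1 E + s).
  have h : v -- W = E -- (w -- v) by rewrite EE; apply/funext => x; ring.
  apply: le_trans (normH1_sub (V1 _ hE) (V1 _ hwv) h) _.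
  exact: (ler_wpM2l (ler0n R 2) (lerD (lexx _) evs)).
have e0 : 0 <= nH1 E by exact: normH1_ge0.
pose q := 2 * (d%:R * (eps * k1) * eta).
have q0 : 0 <= q by rewrite !mulr_ge0.
have main1 : nH1 E <= s + (K1 * s + 2 * q) / alpha.
  apply: quadratic_bound => //; first exact: mulr_ge0.
  apply: le_trans (coer _ hE) _.
  rewrite (form_decomp la (V1 _ hE) (V1 _ hwv) (V1 _ hvW) decE).
  rewrite (orth _ XvW); apply: le_trans (ler_norm _) _.
  apply: le_trans (ler_normB _ _) _.
  have h1 := bnd _ _ hE hwv.
  have h2 := bb _ _ hE' hvW eE'.
  have h3 := ler_wpM2l (mulr_ge0 K10 e0) evs.
  have h4 : d%:R * (eps * k1) * eta * nH1 (v -- W) <= q * (nH1 E + s).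
    have m0 : 0 <= d%:R * (eps * k1) * eta by exact: (mulr_ge0 (mulr_ge0 n0 (mulr_ge0 eps0 k10)) eta0).
    by apply: le_trans (ler_wpM2l m0 nvW) _; apply: eq_le2; rewrite /q; ring.
  apply: le_trans (lerD (le_trans h1 h3) (le_trans h2 h4)) _.
  by rewrite le_eqVlt; apply/orP; left; apply/eqP; ring.
pose c := K3 + K1 * K3 / alpha + 4 * d%:R / alpha.
have c0 : 0 <= c by rewrite !addr_ge0 ?divr_ge0 ?mulr_ge0.
have k0 : 0 <= k2 + eps * k1 by rewrite addr_ge0// mulr_ge0.
have main2 : nH1 E <= c * (k2 + eps * k1) * eta.
  apply: le_trans main1 _.
  rewrite -subr_ge0 (_ : _ - _ = eta * (4 * d%:R / alpha * k2 + (K3 + K1 * K3 / alpha) * (eps * k1))); last first.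
    by rewrite /c /s /q; field; exact: lt0r_neq0.
  by rewrite !(mulr_ge0, addr_ge0, invr_ge0).
split => //.
  apply: le_trans main2 _; apply: ler_wpM2r => //; apply: ler_wpM2r => //.
  rewrite /step_const -/c -subr_ge0 (_ : _ - _ = K1 * K3 * K2 * c + 2 * d%:R * K2 + d%:R * K3 * K2); last by ring.
  by rewrite !addr_ge0 ?mulr_ge0.
move=> g sg; have [z [hz h2z nz fz]] := reg g sg.
rewrite -(fz _ hE) formC.
have [u Xu eu] := Xa z hz h2z; have hu := XV _ Xu.
have G0 := normL2_ge0 D g.
have euz : nH1 (z -- u) <= K3 * eta * (K2 * n2 g) by apply: le_trans eu _; rewrite ler_wpM2l// mulr_ge0.
have hzu := Vs _ _ hz hu.
have decz : z = (z -- u) ++ u by apply/funext => x; ring.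
have f1 := form_decomp la (V1 _ hE) (V1 _ hzu) (V1 _ hu) decz.
have f2 := form_decomp lb E1' (V1 _ hzu) (V1 _ hu) decz.
have aux (x y : R) : - y = x - (x + y) by ring.
(* Orthogonality turns the form of [a] at [u] into minus the form of [b] on [E'] and [u]. Writing
   [u] as [z] minus [z -- u] separates a part small by approximation from one controlled by the
   functionals of [E']. *)
have tot : form a E z = form a E (z -- u) + (form b E' (z -- u) - form b E' z).
  apply: etrans f1 (congr1 (+%R _) (etrans (orth _ Xu) _)).
  exact: (etrans (aux (form b E' (z -- u)) _) (congr1 (fun t => form b E' (z -- u) - t) (esym f2))).
rewrite [X in `|X|]tot; clear decz f1 f2 tot decE fz orth.
have [sgam ngam] := dual_coefP oD bD hb h2z.
have t1 := le_trans (bnd _ _ hE hzu) (ler_pM (mulr_ge0 K10 e0) (normH1_ge0 D _) (ler_wpM2l K10 main2) euz).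
have t2 := le_trans (bb _ _ hE' hzu eE') (ler_wpM2l (mulr_ge0 (mulr_ge0 n0 (mulr_ge0 eps0 k10)) eta0) euz).
(* Here the energy bound of [E'] would lose a power of [eta]; as [z] is in [H^2], the form of [b] is
   an [L^2] functional, and the dual clause for [E'] gives [eta ^+ 2]. *)
have t3 : `|form b E' z| <= k1 * eta ^+ 2 * (2 * d%:R * (K2 * n2 g) * eps).
  rewrite formC (form_dual oD bD hb h2z hE'); apply: le_trans (pE' _ sgam) _.
  apply: ler_wpM2l; first by rewrite mulr_ge0 ?sqr_ge0.
  have n20 : 0 <= 2 * d%:R :> R by rewrite mulr_ge0.
  exact: (le_trans ngam (ler_pM (mulr_ge0 n20 (normH2_ge0 D z)) (normW1oo_ge0 D b) (ler_wpM2l n20 nz) beps)).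
apply: le_trans (ler_normD _ _) _; apply: le_trans (lerD t1 (ler_normB _ _)) _.
apply: le_trans (lerD (lexx _) (lerD t2 t3)) _.
rewrite -subr_ge0 /step_const -/c (_ : _ - _ = eta ^+ 2 * n2 g * (c * (k2 + eps * k1) +
  (2 * d%:R * K2 + d%:R * K3 * K2) * k2)); last by ring.
exact: (mulr_ge0 (mulr_ge0 (sqr_ge0 _) G0) (addr_ge0 (mulr_ge0 c0 k0) (mulr_ge0 (addr_ge0 (mulr_ge0 (mulr_ge0 (ler0n R 2) n0) K20) (mulr_ge0 (mulr_ge0 n0 K30) K20)) k20))).
Qed.

End galerkin.

Lemma sub_sub_add (R : zmodType) (p x y : R) : p - x - (p + y) = - (x + y).
Proof. by rewrite !opprD addrACA subrr add0r. Qed.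

Lemma sub_add_sub (R : zmodType) (p x y : R) : (p - x) + (p + y) - (p + p) = - (x - y).
Proof. by rewrite addrACA (addrC (p + p)) addrK opprB addrC. Qed.

(** * First and second differences of solutions and of their finite element errors *)

Section differences.
Context {R : realType} {d : nat}.
Variable D : set 'rV[R]_d.
Hypothesis oD : open D.
Hypothesis bD : bounded_set D.
Local Notation F := ('rV[R]_d -> R).
Local Notation mu := (lebesgue_rV R d).
Local Notation L2 v := (sqint mu D v).
Local Notation n2 v := (normL2 D v).
Local Notation nH1 v := (normH1 D v).
Local Notation H1 := (@H1 R d D).
Local Notation H2 := (@H2 R d D).
Local Notation W1oo := (@W1oo R d D).
Local Notation form := (diffusion_form D).
Local Notation V := (H10 D).
Local Notation "v -- w" := (fun x => 1 * v x + (-1) * w x) (at level 50).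
Local Notation "v ++ w" := (fun x => 1 * v x + 1 * w x).
Local Notation dual_bound := (@dual_bound R d D).
Let mD : measurable D. Proof. exact: open_rV_measurable. Qed.

Lemma formD b v w u : Lp D +oo%E b -> H1 v -> H1 w -> H1 u ->
  form b (v ++ w) u = form b v u + form b w u.
Proof.
move=> lb hv hw hu; apply: etrans (form_linl oD bD 1 1 lb hv hw hu) _.
exact: (congr2 +%R (mul1r _) (mul1r _)).
Qed.

Lemma formB b v w u : Lp D +oo%E b -> H1 v -> H1 w -> H1 u ->
  form b (v -- w) u = form b v u - form b w u.
Proof.
move=> lb hv hw hu; apply: etrans (form_linl oD bD 1 (-1) lb hv hw hu) _.
exact: (congr2 +%R (mul1r _) (mulN1r _)).
Qed.

Lemma dual_boundD v w k l : H1 v -> H1 w -> dual_bound v k -> dual_bound w l ->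
  dual_bound (v ++ w) (k + l).
Proof.
move=> hv hw h1 h2; have := dual_bound_lin oD bD 1 1 hv hw h1 h2.
by rewrite normr1 mul1r mul1r.
Qed.

Lemma dual_boundN v k b : dual_bound v k -> W1oo b -> exists g, [/\ L2 g,
  n2 g <= k * normW1oo D b & forall u, V u -> - form b v u = pairing D g u].
Proof.
move=> h hb; have [g [sg ng eg]] := h b hb; exists (fun x => (-1) * g x); split.
- exact: sqintZ.
- by rewrite normL2E norm2Z// -normL2E normrN normr1 mul1r.
- move=> u hu; rewrite (eg u hu) /pairing -[LHS]mulN1r -RintegralZl//.
    by apply: eq_Rintegral => x _; rewrite mulrA.
  exact: (sqint_intM mD sg (H1_sqint (H10_H1 oD bD hu))).
Qed.

Lemma pairing_cst0 g : pairing D g (cst 0 : F) = 0.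
Proof.
rewrite /pairing (@eq_Rintegral _ _ _ mu D (fun=> 0)); last by move=> x _; rewrite mulr0.
by rewrite Rintegral_cst// mul0r.
Qed.

Variables (alpha K1 K2 K3 : R).
Hypotheses (alpha0 : 0 < alpha) (K10 : 0 <= K1) (K20 : 0 <= K2) (K30 : 0 <= K3).
Local Notation elliptic := (elliptic D alpha K1 K2).
Local Notation approx_space := (approx_space D K3).
Local Notation error_bound := (error_bound D).
Local Notation Kc := (@step_const R d alpha K1 K2 K3).

Lemma error_bound_lin eta x y E E' k k' : error_bound eta E k -> error_bound eta E' k' ->
  error_bound eta (fun z => x * E z + y * E' z) (2 * (`|x| * k + `|y| * k')).
Proof.
move=> [hE e1 p1] [hE' e2 p2]; have h1 := H10_H1 oD bD hE; have h2 := H10_H1 oD bD hE'.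
have X0 := normr_ge0 x; have Y0 := normr_ge0 y.
split.
- exact: (H10_lin oD bD).
- apply: le_trans (normH1_lin oD bD x y h1 h2) _; rewrite -mulrA; apply: ler_wpM2l => //.
  by rewrite mulrDl -!mulrA; apply: lerD; apply: ler_wpM2l.
move=> g sg; rewrite (pairing_lin oD x y sg (H1_sqint h1) (H1_sqint h2)).
apply: le_trans (ler_normD _ _) _; rewrite !normrM.
have t1 := ler_wpM2l X0 (p1 _ sg); have t2 := ler_wpM2l Y0 (p2 _ sg).
apply: le_trans (lerD t1 t2) _; apply: (@le_trans _ _ (1 * (`|x| * k + `|y| * k') * (eta ^+ 2 * n2 g))).
  by apply: eq_le2; ring.
have t0 : 0 <= (`|x| * k + `|y| * k') * (eta ^+ 2 * n2 g).
  have a1 := le_trans (mulr_ge0 X0 (normr_ge0 _)) t1.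
  have a2 := le_trans (mulr_ge0 Y0 (normr_ge0 _)) t2.
  by apply: le_trans (addr_ge0 a1 a2) _; apply: eq_le2; ring.
apply: (@le_trans _ _ (2 * ((`|x| * k + `|y| * k') * (eta ^+ 2 * n2 g)))); last by apply: eq_le2; ring.
by rewrite -mulrA; apply: (ler_wpM2r t0); rewrite ler1n.
Qed.

(** The regularity hypothesis only supplies some regular solution; coercivity makes it agree with
    [w] almost everywhere, and membership in [H^2] is insensitive to that change. *)
Lemma solution_H2 a g w : elliptic a -> L2 g -> galerkin_solution D a g V w ->
  H2 w /\ normH2 D w <= K2 * n2 g.
Proof.
move=> [la coer bnd reg] sg [hw ew]; have [z [hz h2z nz ez]] := reg g sg.
have w1 := H10_H1 oD bD hw; have z1 := H10_H1 oD bD hz.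
have hzw := H10_lin oD bD 1 (-1) hz hw; have zw1 := H10_H1 oD bD hzw.
have f0 : form a (z -- w) (z -- w) = 0.
  by rewrite (formB la z1 w1 zw1) (ez _ hzw) (ew _ hzw) subrr.
have n0 : nH1 (z -- w) = 0.
  have := coer _ hzw; rewrite f0 pmulr_rle0// => h.
  by apply/eqP; rewrite -sqrf_eq0 eq_le h sqr_ge0.
have ae := H1_null oD bD z1 w1 n0.
have ae' : {ae mu, forall x : 'rV[R]_d, D x -> z x = w x}.
  by apply: filterS ae => x h Dx; rewrite h.
by have [h ->] := ae_eq_H2 oD w1 ae' h2z.
Qed.

Lemma galerkin_orth a f (X : set F) u W v : X `<=` V -> Lp D +oo%E a ->
  galerkin_solution D a f V u -> galerkin_solution D a f X W -> X v ->
  form a (u -- W) v = 0.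
Proof.
move=> XV la [hu eu] [hW eW] hv; have V1 v' : V v' -> H1 v' := @H10_H1 _ _ _ oD bD v'.
by rewrite (formB la (V1 _ hu) (V1 _ (XV _ hW)) (V1 _ (XV _ hv))) (eu _ (XV _ hv)) (eW _ hv) subrr.
Qed.

Lemma error_bound_cst0 eta : error_bound eta (cst 0 : F) 0.
Proof.
split; first exact: (H10_cst0 oD bD).
- have h0 := H10_H1 oD bD (H10_cst0 oD bD).
  rewrite (_ : cst 0 = fun x => 0 * cst 0 x + 0 * cst 0 x); last by apply/funext => x /=; ring.
  by apply: le_trans (normH1_lin oD bD 0 0 h0 h0) _; rewrite normr0 !mul0r addr0 mulr0.
- by move=> g _; rewrite pairing_cst0 normr0 !mul0r.
Qed.

(** The case [E' = cst 0], [k1 = 0] of [error_step], that is, the usual energy and Aubin-Nitsche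
    estimates. *)
Lemma first_error eta a b f (X : set F) u W : 0 <= eta -> elliptic a -> approx_space eta X ->
  W1oo b -> L2 f -> galerkin_solution D a f V u -> galerkin_solution D a f X W ->
  error_bound eta (u -- W) (Kc * (K2 * n2 f)).
Proof.
move=> eta0 ea hX hb sf su sW; have [h2u nu] := solution_H2 ea sf su.
have [hu _] := su; have [hW _] := sW; have [XV _ _ _] := hX; have la := let: And4 l _ _ _ := ea in l.
have G0 : 0 <= K2 * n2 f by rewrite mulr_ge0// normL2_ge0.
have := @error_step _ _ D oD bD alpha K1 K2 K3 alpha0 K10 K20 K30 eta (normW1oo D b) 0 (K2 * n2 f)
  a b X u W (u -- W) (cst 0) erefl eta0 (lexx 0) G0 ea hX hb (lexx _) hu h2u nu hW (error_bound_cst0 eta).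
rewrite mulr0 addr0; apply => v hv.
rewrite (galerkin_orth XV la su sW hv) formC.
have v1 := H10_H1 oD bD (XV _ hv); have h0 := H10_H1 oD bD (H10_cst0 oD bD).
rewrite (_ : cst 0 = fun x => 0 * cst 0 x + 0 * cst 0 x); last by apply/funext => x /=; ring.
by rewrite (form_linr oD bD 0 0 hb.1 v1 h0 h0) !mul0r addr0 oppr0.
Qed.

Section second_difference.
Variables (eta eps : R) (a0 ap am b f : F) (X : set F) (u0 up um W0 Wp Wm : F).
Hypotheses (eta0 : 0 <= eta) (ea0 : elliptic a0) (eap : elliptic ap) (eam : elliptic am).
Hypotheses (hX : approx_space eta X) (hb : W1oo b) (beps : normW1oo D b <= eps) (sf : L2 f).
Hypotheses (Ep : ap = a0 ++ b) (Em : am = a0 -- b).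
Hypotheses (su0 : galerkin_solution D a0 f V u0) (sup : galerkin_solution D ap f V up)
  (sum : galerkin_solution D am f V um).
Hypotheses (sW0 : galerkin_solution D a0 f X W0) (sWp : galerkin_solution D ap f X Wp)
  (sWm : galerkin_solution D am f X Wm).

Let la0 : Lp D +oo%E a0. Proof. by case: ea0. Qed.
Let lap : Lp D +oo%E ap. Proof. by case: eap. Qed.
Let lam : Lp D +oo%E am. Proof. by case: eam. Qed.
Let lb : Lp D +oo%E b. Proof. by case: hb. Qed.
Let XV : X `<=` V. Proof. by case: hX. Qed.
Let V1 v : V v -> H1 v. Proof. exact: (H10_H1 oD bD). Qed.

Let form_ap v w : V v -> V w -> form a0 v w = form ap v w - form b v w.
Proof.
move=> hv hw; have h := form_linc oD 1 1 la0 lb (V1 hv) (V1 hw).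
by rewrite Ep h !mul1r addrK.
Qed.

Let form_am v w : V v -> V w -> form a0 v w = form am v w + form b v w.
Proof.
move=> hv hw; have h := form_linc oD 1 (-1) la0 lb (V1 hv) (V1 hw).
by rewrite Em h mul1r mulN1r subrK.
Qed.

Let Vs v w : V v -> V w -> V (v -- w). Proof. exact: (H10_lin oD bD). Qed.
Let Va v w : V v -> V w -> V (v ++ w). Proof. exact: (H10_lin oD bD). Qed.
Let Vu0 : V u0. Proof. by case: su0. Qed.
Let Vup : V up. Proof. by case: sup. Qed.
Let Vum : V um. Proof. by case: sum. Qed.
Let XW0 : X W0. Proof. by case: sW0. Qed.
Let XWp : X Wp. Proof. by case: sWp. Qed.
Let XWm : X Wm. Proof. by case: sWm. Qed.
Let eps0 : 0 <= eps. Proof. by apply: le_trans beps; exact: normW1oo_ge0. Qed.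
Let N : R := n2 f.
Let N0 : 0 <= N. Proof. exact: normL2_ge0. Qed.
Let dn : 0 <= d%:R :> R. Proof. by []. Qed.
Let Kc0 : 0 <= Kc. Proof. exact: step_const_ge0. Qed.

Lemma H2_const_ge0 : 0 <= 2 * d%:R * (K2 * N).
Proof. exact: (mulr_ge0 (mulr_ge0 (ler0n R 2) dn) (mulr_ge0 K20 N0)). Qed.

Let dual_u a u : elliptic a -> galerkin_solution D a f V u -> dual_bound u (2 * d%:R * (K2 * N)).
Proof. by move=> ea su; have [h n] := solution_H2 ea sf su; exact: (dual_bound_H2 oD bD h n). Qed.

Let sol_V a u v : galerkin_solution D a f V u -> V v -> form a u v = pairing D f v.
Proof. by move=> [_ h] /h. Qed.

(** Subtracting the equations for [ap] and [am], written with [a0], leaves minus the form of [b] on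
    [up ++ um]: a right-hand side in [L^2] of order [eps]. *)
Let w1_solution : exists g, [/\ L2 g, n2 g <= 4 * d%:R * K2 * N * eps &
  galerkin_solution D a0 g V (up -- um)].
Proof.
have h := dual_boundD (V1 Vup) (V1 Vum) (dual_u eap sup) (dual_u eam sum).
have [g [sg ng eg]] := dual_boundN h hb; exists g; split; [exact: sg| |].
  apply: le_trans ng _; apply: (@le_trans _ _ ((2 * d%:R * (K2 * N) + 2 * d%:R * (K2 * N)) * eps)).
    exact: (ler_wpM2l (addr_ge0 H2_const_ge0 H2_const_ge0) beps).
  by apply: eq_le2; ring.
split; first exact: Vs.
move=> v hv; rewrite -(eg v hv) (formB la0 (V1 Vup) (V1 Vum) (V1 hv)) (formD lb (V1 Vup) (V1 Vum) (V1 hv)).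
rewrite (form_ap Vup hv) (form_am Vum hv) (sol_V sup hv) (sol_V sum hv); exact: sub_sub_add.
Qed.

(** [error_step] with [E'] the sum of the two first errors. These are not small in [eps]; the gain
    is the factor [eps] in front of [k1]. *)
Lemma first_difference : error_bound eta ((up -- Wp) -- (um -- Wm))
  (Kc * (K2 * (4 * d%:R * K2 * N) + 4 * (Kc * (K2 * N))) * eps).
Proof.
have [g [sg ng sw]] := w1_solution.
have [h2w nw] := solution_H2 ea0 sg sw.
have Bp := first_error eta0 eap hX hb sf sup sWp.
have Bm := first_error eta0 eam hX hb sf sum sWm.
have := error_bound_lin 1 1 Bp Bm; rewrite normr1 !mul1r.
set E' := (fun z => 1 * _ + 1 * _) => BE'.
have EE : (up -- Wp) -- (um -- Wm) = (up -- um) -- (Wp -- Wm) by apply/funext => z; ring.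
have k10 : 0 <= 2 * (Kc * (K2 * n2 f) + Kc * (K2 * n2 f)).
  by have t := mulr_ge0 Kc0 (mulr_ge0 K20 N0); exact: (mulr_ge0 (ler0n R 2) (addr_ge0 t t)).
have k20 : 0 <= K2 * (4 * d%:R * K2 * N * eps).
  by rewrite !mulr_ge0.
have := @error_step _ _ D oD bD alpha K1 K2 K3 alpha0 K10 K20 K30 eta eps
  (2 * (Kc * (K2 * n2 f) + Kc * (K2 * n2 f))) (K2 * (4 * d%:R * K2 * N * eps))
  a0 b X (up -- um) (Wp -- Wm) _ E' EE eta0 k10 k20 ea0 hX hb beps (Vs Vup Vum) h2w
  (le_trans nw (ler_wpM2l K20 ng)) (approx_space_sub hX XWp XWm) BE'.
rewrite (_ : Kc * (_ + eps * _) = Kc * (K2 * (4 * d%:R * K2 * N) + 4 * (Kc * (K2 * N))) * eps); last by rewrite /N; ring.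
apply => v Xv; have hv := XV Xv; have v1 := V1 hv.
have hp := Vs Vup (XV XWp); have hm := Vs Vum (XV XWm).
rewrite (formB la0 (V1 hp) (V1 hm) v1) (formD lb (V1 hp) (V1 hm) v1).
rewrite (form_ap hp hv) (form_am hm hv) (galerkin_orth XV lap sup sWp Xv) (galerkin_orth XV lam sum sWm Xv).
exact: sub_sub_add.
Qed.

(** In [up + um - 2 u0] the common right-hand side cancels and minus the form of [b] on [up -- um]
    remains. As this difference is of order [eps] in [H^2], the new right-hand side is of order
    [eps ^+ 2]. *)
Let w2_solution : exists g, [/\ L2 g, n2 g <= 2 * d%:R * (K2 * (4 * d%:R * K2 * N * eps)) * eps &
  galerkin_solution D a0 g V ((up ++ um) -- (u0 ++ u0))].
Proof.
have [g [sg ng sw]] := w1_solution.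
have [h2w nw] := solution_H2 ea0 sg sw.
have h := dual_bound_H2 oD bD h2w (le_trans nw (ler_wpM2l K20 ng)).
have [g' [sg' ng' eg']] := dual_boundN h hb; exists g'; split; [exact: sg'| |].
  apply: le_trans ng' _; apply: ler_wpM2l beps.
  by rewrite !mulr_ge0.
have hpm := Va Vup Vum; have h00 := Va Vu0 Vu0.
split; first exact: Vs.
move=> v hv; have v1 := V1 hv.
rewrite -(eg' v hv) (formB la0 (V1 hpm) (V1 h00) v1) (formB lb (V1 Vup) (V1 Vum) v1).
rewrite (formD la0 (V1 Vup) (V1 Vum) v1) (formD la0 (V1 Vu0) (V1 Vu0) v1).
rewrite (form_ap Vup hv) (form_am Vum hv) (sol_V sup hv) (sol_V sum hv) (sol_V su0 hv).
exact: sub_add_sub.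
Qed.

(** [error_step] with [E'] the first difference: both its exact part and [eps * k1] are now
    quadratic in [eps]. *)
Lemma second_difference : error_bound eta (((up -- Wp) ++ (um -- Wm)) -- ((u0 -- W0) ++ (u0 -- W0)))
  (Kc * (8 * d%:R ^+ 2 * K2 ^+ 3 + Kc * (4 * d%:R * K2 ^+ 2 + 4 * (Kc * K2))) * eps ^+ 2 * N).
Proof.
have [g [sg ng sw]] := w2_solution.
have [h2w nw] := solution_H2 ea0 sg sw.
have B1 := first_difference.
have hp := Vs Vup (XV XWp); have hm := Vs Vum (XV XWm); have h0 := Vs Vu0 (XV XW0).
have EE : ((up -- Wp) ++ (um -- Wm)) -- ((u0 -- W0) ++ (u0 -- W0)) =
  ((up ++ um) -- (u0 ++ u0)) -- ((Wp ++ Wm) -- (W0 ++ W0)) by apply/funext => z; ring.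
have XWs : X ((Wp ++ Wm) -- (W0 ++ W0)).
  have Xa v w : X v -> X w -> X (v ++ w).
    move=> hv hw; have [_ X0 Xl _] := hX.
    rewrite (_ : v ++ w = fun x => 1 * v x + (fun x => 1 * w x + cst 0 x) x).
      exact: (Xl _ _ _ hv (Xl _ _ _ hw X0)).
    by apply/funext => x /=; rewrite addr0.
  exact: (approx_space_sub hX (Xa _ _ XWp XWm) (Xa _ _ XW0 XW0)).
set k1 := Kc * (_ + _) * eps in B1.
have k10 : 0 <= k1.
  have t1 : 0 <= K2 * (4 * d%:R * K2 * N) by rewrite !mulr_ge0.
  have t2 : 0 <= 4 * (Kc * (K2 * N)) by rewrite !mulr_ge0.
  exact: (mulr_ge0 (mulr_ge0 Kc0 (addr_ge0 t1 t2)) eps0).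
have k20 : 0 <= K2 * (2 * d%:R * (K2 * (4 * d%:R * K2 * N * eps)) * eps) by rewrite !mulr_ge0.
have := @error_step _ _ D oD bD alpha K1 K2 K3 alpha0 K10 K20 K30 eta eps
  k1 (K2 * (2 * d%:R * (K2 * (4 * d%:R * K2 * N * eps)) * eps))
  a0 b X _ _ _ _ EE eta0 k10 k20 ea0 hX hb beps sw.1 h2w
  (le_trans nw (ler_wpM2l K20 ng)) XWs B1.
rewrite (_ : Kc * (_ + eps * _) = Kc * (8 * d%:R ^+ 2 * K2 ^+ 3 + Kc * (4 * d%:R * K2 ^+ 2 + 4 * (Kc * K2))) * eps ^+ 2 * N); last by rewrite /k1; ring.
apply => v Xv; have hv := XV Xv; have v1 := V1 hv.
rewrite (formB la0 (V1 (Va hp hm)) (V1 (Va h0 h0)) v1) (formB lb (V1 hp) (V1 hm) v1).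
rewrite (formD la0 (V1 hp) (V1 hm) v1) (formD la0 (V1 h0) (V1 h0) v1).
rewrite (form_ap hp hv) (form_am hm hv) (galerkin_orth XV lap sup sWp Xv) (galerkin_orth XV lam sum sWm Xv).
rewrite (galerkin_orth XV la0 su0 sW0 Xv); exact: sub_add_sub.
Qed.

End second_difference.
End differences.

(** * Tails of the coefficient series *)

Section powers.
Context {R : realType}.

(** A discrete form of the comparison with an integral. With [s = t + 1] it follows from
    [(s/t)^p >= 1 + p ln (s/t)] and [ln (s/t) >= 1/s]. *)
Lemma powR_telescope (p : R) (j : nat) : 0 < p -> (0 < j)%N ->
  p * j.+1%:R `^ (- (p + 1)) <= j%:R `^ (- p) - j.+1%:R `^ (- p).
Proof.
move=> p0 j0; have jR : 0 < j%:R :> R by rewrite ltr0n.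
have SR : 0 < j.+1%:R :> R by rewrite ltr0n.
set s := j.+1%:R : R; set t := j%:R : R.
have st : s = t + 1 by rewrite /s /t natr1.
have h1 : p / s <= (s / t) `^ p - 1.
  have st0 : 0 < s / t by rewrite divr_gt0.
  rewrite /powR gt_eqF// lerBrDl; apply: le_trans (expR_ge1Dx _).
  rewrite lerD2l; apply: ler_wpM2l; first exact: ltW.
  have : ln (1 + (t / s - 1)) <= t / s - 1.
    by apply: le_ln1Dx; rewrite ltrBrDl subrr divr_gt0.
  rewrite addrC subrK -[t / s]invf_div lnV ?posrE// => h.
  have : s^-1 <= - ((s / t)^-1 - 1).
    by rewrite invf_div opprB st; rewrite le_eqVlt; apply/orP; left; apply/eqP; field; rewrite -st lt0r_neq0.
  by move=> h'; apply: le_trans h' _; rewrite lerNl.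
have sp0 : 0 < s `^ (- p) by exact: powR_gt0.
have E1 : s `^ (- (p + 1)) = s^-1 * s `^ (- p).
  by rewrite opprD powRD ?powR_inv1 ?(ltW SR) ?(mulrC s^-1)//; apply/implyP => _; exact: lt0r_neq0.
have E2 : t `^ (- p) = (s / t) `^ p * s `^ (- p).
  rewrite powRM ?(ltW SR) ?invr_ge0 ?(ltW jR)// mulrAC -powRD ?subrr ?powRr0 ?mul1r//.
    by rewrite -[t^-1]powR_inv1 ?(ltW jR)// -powRrM mulN1r.
  by apply/implyP => _; exact: lt0r_neq0.
rewrite E1 E2 mulrA -[X in _ <= _ - X]mul1r -mulrBl; apply: ler_wpM2r => //; exact: ltW.
Qed.

Lemma sum_powR_tail (p : R) (m n : nat) : 0 < p -> (0 < m)%N ->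
  \sum_(m <= j < n) j.+1%:R `^ (- (p + 1)) <= m%:R `^ (- p) / p.
Proof.
move=> p0 m0; rewrite ler_pdivlMr//.
have [mn|nm] := leqP m n; last by rewrite big_geq ?mul0r ?powR_ge0// ltnW.
apply: (@le_trans _ _ (\sum_(m <= j < n) (j%:R `^ (- p) - j.+1%:R `^ (- p)))).
  rewrite mulr_suml big_nat [leRHS]big_nat; apply: ler_sum => j /andP[mj _].
  by rewrite mulrC; apply: powR_telescope => //; exact: leq_trans mj.
rewrite (eq_bigr (fun j => - (j.+1%:R `^ (- p) - j%:R `^ (- p)))); last by move=> j _; rewrite opprB.
rewrite sumrN (@telescope_sumr _ m n (fun j => j%:R `^ (- p)))// opprB gerBl.
exact: powR_ge0.
Qed.

Lemma dimension_ge (r : R) (nu : int) : 2 `^ (nu%:~R / (r - 1)) <= (dimension r nu)%:R.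
Proof.
rewrite /dimension; set y := 2 `^ _; have y0 : 0 <= y by exact: powR_ge0.
have c0 : 0 <= Num.ceil y by rewrite ceil_ge0// (lt_le_trans _ y0)// oppr_lt0.
by rewrite natr_absz ger0_norm// ceil_ge.
Qed.

Lemma dimension_lt (r : R) (nu : int) : (dimension r nu)%:R < 2 `^ (nu%:~R / (r - 1)) + 1.
Proof.
rewrite /dimension; set y := 2 `^ _; have y0 : 0 <= y by exact: powR_ge0.
have c0 : 0 <= Num.ceil y by rewrite ceil_ge0// (lt_le_trans _ y0)// oppr_lt0.
by rewrite natr_absz ger0_norm// -ltrBlDr; have := gt_pred_ceil y; rewrite intrB.
Qed.

Lemma dimension_gt0 (r : R) (nu : int) : (0 < dimension r nu)%N.
Proof. by rewrite -(ltr0n R); apply: lt_le_trans (dimension_ge r nu); exact: powR_gt0. Qed.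

Lemma dimension_homo (r : R) : 1 < r -> {homo dimension r : m n / (m <= n)%R >-> (m <= n)%N}.
Proof.
move=> r1 m n mn; rewrite -ltnS -(ltr_nat R) -natr1.
apply: lt_le_trans (dimension_lt r m) _; rewrite lerD2r.
apply: le_trans _ (dimension_ge r n); apply: ler_powR; first by rewrite ler1n.
by rewrite ler_wpM2r ?ler_int// invr_ge0 subr_ge0 ltW.
Qed.

(** This is the purpose of the choice of [dimension]: the exponent [1 - r] of the tail of the series
    cancels the denominator [r - 1]. *)
Lemma dimension_powR (r : R) (n : nat) : 1 < r -> (dimension r n%:Z)%:R `^ (1 - r) <= 2 ^- n.
Proof.
move=> r1; have p0 : 0 < r - 1 by rewrite subr_gt0.
rewrite -opprB powRN lef_pV2 ?posrE ?powR_gt0 ?ltr0n ?dimension_gt0 ?exprn_gt0//.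
have := dimension_ge r n%:Z; move: (dimension _ _) => s hs.
have : (2 `^ (n%:~R / (r - 1))) `^ (r - 1) <= s%:R `^ (r - 1).
  by apply: ge0_ler_powR; rewrite ?(ltW p0) ?nnegrE ?powR_ge0.
by rewrite -powRrM divfK ?gt_eqF// powR_mulrn.
Qed.

End powers.

Section coefficients.
Context {R : realType} {d : nat}.
Variable D : set 'rV[R]_d.
Hypothesis oD : open D.
Hypothesis bD : bounded_set D.
Local Notation F := ('rV[R]_d -> R).
Local Notation W1oo := (@W1oo R d D).
Local Notation nW b := (normW1oo D b).
Variables (r Ckl : R) (phi : nat -> F).
Hypothesis r1 : 1 < r.
Hypothesis sphi : forall j, Sobolev D 1 +oo%E (phi j).
Hypothesis phi_decay : forall j, (0 < j)%N -> nW (phi j) <= Ckl * j%:R `^ (- r).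

Definition coef_tail (m n : nat) (w : nat -> R) : F :=
  fun x => \sum_(m <= j < n) w j * phi j.+1 x.

Lemma W1oo_phi j : W1oo (phi j). Proof. exact/(Sobolev1ooP oD bD). Qed.

Lemma W1oo_cst0 : W1oo (fun=> 0) /\ nW (fun=> 0) = 0.
Proof.
have [h n] := W1oo_lin oD bD 0 0 (W1oo_phi 0) (W1oo_phi 0).
have E : (fun z => 0 * phi 0%N z + 0 * phi 0%N z) = (fun=> 0) :> F by apply/funext => z; ring.
rewrite E in h n; split => //; apply/eqP; rewrite eq_le normW1oo_ge0 andbT.
by apply: le_trans n _; rewrite normr0 !mul0r addr0.
Qed.

Lemma Ckl_ge0 : 0 <= Ckl.
Proof. by have := le_trans (normW1oo_ge0 D (phi 1)) (phi_decay (ltnSn 0)); rewrite powR1 mulr1. Qed.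

Lemma coef_tail_sum (m n : nat) (w : nat -> R) :
  W1oo (coef_tail m n w) /\
  nW (coef_tail m n w) <= \sum_(m <= j < n) `|w j| * nW (phi j.+1).
Proof.
elim: n => [|n [IH1 IH2]].
  rewrite (_ : coef_tail m 0 w = fun=> 0); last first.
    by apply/funext => x; rewrite /coef_tail big_geq.
  by have [h1 h2] := W1oo_cst0; rewrite h2 big_geq.
have [mn|nm] := leqP m n; last first.
  rewrite (_ : coef_tail m n.+1 w = fun=> 0); last first.
    by apply/funext => x; rewrite /coef_tail big_geq.
  by have [h1 h2] := W1oo_cst0; rewrite h2 big_geq.
rewrite (_ : coef_tail m n.+1 w = fun x => 1 * coef_tail m n w x + w n * phi n.+1 x); last first.
  by apply/funext => x; rewrite /coef_tail big_nat_recr//= mul1r.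
have [h1 h2] := W1oo_lin oD bD 1 (w n) IH1 (W1oo_phi n.+1); split; first exact: h1.
rewrite big_nat_recr//=; apply: le_trans h2 _; rewrite normr1 mul1r.
exact: (lerD IH2 (lexx _)).
Qed.

Lemma coef_tail_bound (m n : nat) (w : nat -> R) : (0 < m)%N -> (forall j, `|w j| <= 2^-1) ->
  nW (coef_tail m n w) <= Ckl / (r - 1) * m%:R `^ (1 - r).
Proof.
move=> m0 hw; have [_ h] := coef_tail_sum m n w; apply: le_trans h _.
apply: (@le_trans _ _ (\sum_(m <= j < n) Ckl * j.+1%:R `^ (- (r - 1 + 1)))).
  apply: ler_sum => j _; rewrite subrK -[leRHS]mul1r; apply: ler_pM => //.
  - exact: normW1oo_ge0.
  - by apply: le_trans (hw j) _; rewrite invf_le1// ler1n.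
  - exact: phi_decay.
rewrite -mulr_sumr -mulrA; apply: ler_wpM2l; first exact: Ckl_ge0.
have p0 : 0 < r - 1 by rewrite subr_gt0.
by apply: le_trans (sum_powR_tail n p0 m0) _; rewrite opprB mulrC.
Qed.

Lemma partial_coefficientE m n w : (m <= n)%N ->
  partial_coefficient phi n w = (fun x => 1 * partial_coefficient phi m w x + 1 * coef_tail m n w x).
Proof.
move=> mn; apply/funext => x; rewrite /partial_coefficient /coef_tail !mul1r -addrA; congr (_ + _).
rewrite -(big_mkord xpredT (fun j => w j * phi j.+1 x)) -(big_mkord xpredT (fun j => w j * phi j.+1 x)).
by rewrite (@big_cat_nat _ _ _ m).
Qed.

Lemma partial_coefficient0 w : partial_coefficient phi 0 w = phi 0.
Proof. by apply/funext => x; rewrite /partial_coefficient big_ord0 addr0. Qed.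

Lemma W1oo_partial n w : W1oo (partial_coefficient phi n w).
Proof.
rewrite (partial_coefficientE w (leq0n n)) partial_coefficient0.
by have [] := W1oo_lin oD bD 1 1 (W1oo_phi 0) (coef_tail_sum 0 n w).1.
Qed.

(** The summand [1] accounts for [phi 1], which is split off because the tail estimate needs a
    positive starting index. *)
Definition coef_sup : R := nW (phi 0) + Ckl * (1 + (r - 1)^-1).

Lemma coef_partial_bound n w : (forall j, `|w j| <= 2^-1) ->
  nW (partial_coefficient phi n w) <= coef_sup.
Proof.
move=> hw; have C0 := Ckl_ge0; have p0 : 0 < r - 1 by rewrite subr_gt0.
rewrite (partial_coefficientE w (leq0n n)) partial_coefficient0.
have [t1 t2] := coef_tail_sum 0 n w.
have [_ h] := W1oo_lin oD bD 1 1 (W1oo_phi 0) t1.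
apply: le_trans h _; rewrite normr1 !mul1r; apply: lerD => //.
case: n t1 t2 => [|n] t1 t2.
  by apply: le_trans t2 _; rewrite big_geq// mulr_ge0// addr_ge0// invr_ge0 ltW.
rewrite (_ : coef_tail 0 n.+1 w = fun x => w 0%N * phi 1 x + 1 * coef_tail 1 n.+1 w x); last first.
  by apply/funext => x; rewrite /coef_tail big_nat_recl// mul1r big_add1.
have [_ h] := W1oo_lin oD bD (w 0%N) 1 (W1oo_phi 1) (coef_tail_sum 1 n.+1 w).1.
apply: le_trans h _; rewrite mulrDr mulr1 normr1 mul1r; apply: lerD.
  have := phi_decay (ltnSn 0); rewrite powR1 mulr1 => h; rewrite -[leRHS]mul1r.
  apply: ler_pM => //; first exact: normW1oo_ge0.
  by apply: le_trans (hw 0%N) _; rewrite invf_le1// ler1n.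
by have := coef_tail_bound n.+1 (ltnSn 0) hw; rewrite powR1 mulr1.
Qed.

(** Dropping the decay of [phi] gives one constant for all coordinates; this Lipschitz dependence is
    the source of measurability and of the convergence of Riemann sums. *)
Lemma coef_lipschitz n (w w' : nat -> R) :
  exists b, [/\ W1oo b, partial_coefficient phi n w =
     (fun x => 1 * partial_coefficient phi n w' x + 1 * b x) &
     nW b <= Ckl * \sum_(j < n) `|w j - w' j|].
Proof.
exists (coef_tail 0 n (fun j => w j - w' j)); have [t1 t2] := coef_tail_sum 0 n (fun j => w j - w' j).
split => //.
  apply/funext => x; rewrite /partial_coefficient /coef_tail !mul1r big_mkord -addrA; congr (_ + _).
  by rewrite -big_split/=; apply: eq_bigr => j _; rewrite mulrBl addrCA subrr addr0.
apply: le_trans t2 _; rewrite big_mkord mulr_sumr; apply: ler_sum => j _.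
rewrite mulrC; apply: ler_wpM2r => //; apply: le_trans (phi_decay (ltn0Sn j)) _.
rewrite -[leRHS]mulr1; apply: ler_wpM2l; first exact: Ckl_ge0.
rewrite -[leRHS](powRr0 j.+1%:R); apply: ler_powR; first by rewrite ler1n.
by rewrite oppr_le0 ltW// (lt_trans ltr01).
Qed.

End coefficients.

Lemma cancel_sqr (R : realFieldType) (a e k : R) : 0 < a -> 0 <= k -> 0 <= e ->
  a * e ^+ 2 <= k * e -> e <= k / a.
Proof.
move=> a0 k0; rewrite ler_pdivlMr// le_eqVlt => /orP[/eqP <-|e0 h]; first by rewrite mul0r.
by rewrite -(ler_pM2r e0); nra.
Qed.

(** * Dependence of Galerkin solutions on the coefficient *)

Section perturbation.
Context {R : realType} {d : nat}.
Variable D : set 'rV[R]_d.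
Hypothesis oD : open D.
Hypothesis bD : bounded_set D.
Local Notation F := ('rV[R]_d -> R).
Local Notation mu := (lebesgue_rV R d).
Local Notation L2 v := (sqint mu D v).
Local Notation n2 v := (normL2 D v).
Local Notation nH1 v := (normH1 D v).
Local Notation form := (diffusion_form D).
Local Notation V := (H10 D).
Local Notation "v -- w" := (fun x => 1 * v x + (-1) * w x) (at level 50).
Local Notation "v ++ w" := (fun x => 1 * v x + 1 * w x).
Variables (alpha : R).
Hypothesis alpha0 : 0 < alpha.
Let V1 v : V v -> H1 D v. Proof. exact: (H10_H1 oD bD). Qed.

Definition coercive (a : F) := Lp D +oo%E a /\ forall v, V v -> alpha * nH1 v ^+ 2 <= form a v v.

Lemma galerkin_bound a f X W : coercive a -> L2 f -> X `<=` V ->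
  galerkin_solution D a f X W -> nH1 W <= n2 f / alpha.
Proof.
move=> [la coer] sf XV [hW eW]; have VW := XV _ hW.
have := coer _ VW; rewrite (eW _ hW) => h.
have h2 := le_trans (ler_norm _) (pairing_bound oD sf (H1_sqint (V1 VW))).
have h3 := le_trans h (le_trans h2 (ler_wpM2l (normL2_ge0 D f) (normL2_le_H1 D W))).
exact: (cancel_sqr alpha0 (normL2_ge0 D f) (normH1_ge0 D W) h3).
Qed.

(** Equal right-hand sides give [a (W - W', v) = b (W', v)] on [X]; test with the difference itself.
    The space is arbitrary, so the exact problem is included. *)
Lemma galerkin_perturb a a' b f (X : set F) W W' : coercive a -> coercive a' -> L2 f -> X `<=` V ->
  (forall v w, X v -> X w -> X (v -- w)) ->
  Lp D +oo%E b -> a' = a ++ b ->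
  galerkin_solution D a f X W -> galerkin_solution D a' f X W' ->
  nH1 (W -- W') <= d%:R * normLoo D b * (n2 f / alpha) / alpha.
Proof.
move=> ca ca' sf XV Xs lb E sW sW'; have n' := galerkin_bound ca' sf XV sW'.
have [la coer] := ca; have [hW eW] := sW; have [hW' eW'] := sW'.
have Xe := Xs _ _ hW hW'; have Ve := XV _ Xe.
have h1 : form a (W -- W') (W -- W') = form b W' (W -- W').
  rewrite (formB oD bD la (V1 (XV _ hW)) (V1 (XV _ hW')) (V1 Ve)) (eW _ Xe) -(eW' _ Xe).
  have := form_linc oD 1 1 la lb (V1 (XV _ hW')) (V1 Ve); rewrite -E => ->.
  by rewrite !mul1r addrAC subrr add0r.
have h2 := coer _ Ve; rewrite h1 in h2.
have h3 := le_trans h2 (le_trans (ler_norm _) (form_bound oD lb (V1 (XV _ hW')) (V1 Ve))).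
have c0 : 0 <= d%:R * normLoo D b := mulr_ge0 (ler0n _ _) (normLoo_ge0 D b).
have k0 : 0 <= d%:R * normLoo D b * (n2 f / alpha).
  exact: (mulr_ge0 c0 (divr_ge0 (normL2_ge0 D f) (ltW alpha0))).
have h4 := le_trans h3 (ler_wpM2r (normH1_ge0 D _) (ler_wpM2l c0 n')).
exact: (cancel_sqr alpha0 k0 (normH1_ge0 D _) h4).
Qed.

Lemma pairing_sub g v w : L2 g -> V v -> V w -> pairing D g (v -- w) = pairing D g v - pairing D g w.
Proof.
move=> sg hv hw; have := pairing_lin oD 1 (-1) sg (H1_sqint (V1 hv)) (H1_sqint (V1 hw)).
by rewrite mul1r mulN1r.
Qed.

Lemma pairing_perturb a a' b f g (X : set F) W W' : coercive a -> coercive a' -> L2 f -> L2 g -> X `<=` V ->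
  (forall v w, X v -> X w -> X (v -- w)) ->
  Lp D +oo%E b -> a' = a ++ b ->
  galerkin_solution D a f X W -> galerkin_solution D a' f X W' ->
  `|pairing D g W - pairing D g W'| <= d%:R / alpha ^+ 2 * n2 f * n2 g * normLoo D b.
Proof.
move=> ca ca' sf sg XV Xs lb E sW sW'; have := galerkin_perturb ca ca' sf XV Xs lb E sW sW'.
have [hW _] := sW; have [hW' _] := sW'; have VW := XV _ hW; have VW' := XV _ hW'.
rewrite -(pairing_sub sg VW VW') => h.
have Ve := XV _ (Xs _ _ hW hW').
apply: le_trans (pairing_bound oD sg (H1_sqint (V1 Ve))) _.
apply: le_trans (ler_wpM2l (normL2_ge0 D g) (le_trans (normL2_le_H1 D _) h)) _.
by apply: eq_le2; field; exact: lt0r_neq0.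
Qed.

End perturbation.

(** * Expectations as limits of Riemann sums *)

Section cells.
Context {R : realType}.
Variable k : nat.
Local Notation K := (k.+1%:R : R).

(** The minimum with [k] assigns the endpoint [2^-1] to the last cell. Accordingly, in [cell] all
    intervals are half-open except the last one, which is closed. *)
Definition cell_index (y : R) : 'I_k.+1 := inord (minn (Num.truncn ((y + 2^-1) * K)) k).
Definition cell (a : 'I_k.+1) : set R :=
  [set` Interval (BLeft (a%:R / K - 2^-1)) (BSide (a < k)%N (a.+1%:R / K - 2^-1))].
Definition cell_mid (a : 'I_k.+1) : R := (a%:R + 2^-1) / K - 2^-1.

Let K0 : 0 < K. Proof. by rewrite ltr0n. Qed.

Lemma cellP a (y : R) : - 2^-1 <= y <= 2^-1 -> cell a y <-> cell_index y = a.
Proof.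
move=> /andP[y1 y2]; set z := (y + 2^-1) * K.
have z0 : 0 <= z by rewrite mulr_ge0// -lerBlDr sub0r.
have zK : z <= K by rewrite -[leRHS]mul1r ler_wpM2r// -lerBrDr (le_trans y2)//; lra.
have Elo : (a%:R / K - 2^-1 <= y) = (a%:R <= z) by rewrite lerBlDr ler_pdivrMr.
have Ehi : (y < a.+1%:R / K - 2^-1) = (z < a.+1%:R) by rewrite ltrBrDr ltr_pdivlMr.
rewrite /cell /= itv_boundlr /= bnd_simp Elo.
have idx : (cell_index y = a) <-> (minn (Num.truncn z) k = a).
  split=> [/(congr1 val)|h]; first by rewrite /= inordK// ltnS geq_minr.
  by apply: val_inj; rewrite /= inordK -/z ?h.
rewrite idx; have /andP[t1 t2] := truncn_itv z0.
case: (ltnP a k) => ak.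
  rewrite bnd_simp Ehi; split.
    move=> /truncn_def ->; rewrite (minn_idPl (ltnW ak)) //.
  rewrite /minn; case: ifPn => [_ <-|_ h]; first by rewrite t1 t2.
  by move: ak; rewrite -h ltnn.
have {ak}ak : a = k :> nat by apply/eqP; rewrite eqn_leq ak -ltnS ltn_ord.
rewrite bnd_simp ak; split.
  move=> /andP[h _]; apply/minn_idPr; by rewrite truncn_ge_nat.
move=> /minn_idPr; rewrite truncn_ge_nat// => ->/=.
by rewrite divff ?gt_eqF//; lra.
Qed.

Lemma cell_mid_bound a : - 2^-1 <= cell_mid a <= 2^-1.
Proof.
rewrite /cell_mid; apply/andP; split.
  by rewrite lerBrDr addrC subrr divr_ge0// addr_ge0.
have h : (a%:R + 2^-1) / K <= 1.
  rewrite ler_pdivrMr// mul1r; apply: (@le_trans _ _ (a%:R + 1)).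
    by rewrite lerD2l invf_le1// ler1n.
  by rewrite natr1 ler_nat.
by move: (_ / K) h => t h; lra.
Qed.

Lemma cell_mid_close (y : R) : - 2^-1 <= y <= 2^-1 -> `|y - cell_mid (cell_index y)| <= K^-1.
Proof.
move=> hy; have /(cellP _ hy) := erefl (cell_index y); set a := cell_index y.
rewrite /cell/= itv_boundlr/= => /andP[]; rewrite bnd_simp => h1.
have h2 : (BRight y <= BSide (a < k)%N (a.+1%:R / K - 2^-1))%O -> y <= a.+1%:R / K - 2^-1.
  by case: (a < k)%N; rewrite bnd_simp// => /ltW.
move=> /h2 {}h2; rewrite /cell_mid; move: h1 h2; rewrite -(natr1 a) !mulrDl mul1r.
have : 0 < K^-1 by rewrite invr_gt0.
move: (K^-1) (a%:R) => q u q0 h1 h2; rewrite ler_norml; apply/andP; split; nra.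
Qed.

Lemma uniform_half_cell a : uniform_half (cell a) = (K^-1)%:E.
Proof.
rewrite /uniform_half /uniform_prob integral_uniform_pdf.
have sub : cell a `<=` `[- 2^-1, 2^-1]%classic.
  move=> y; rewrite /cell/= itv_boundlr/= => /andP[]; rewrite bnd_simp => h1 h2.
  have {}h2 : y <= a.+1%:R / K - 2^-1.
    by move: h2; case: (a < k)%N; rewrite bnd_simp// => /ltW.
  have h3 : a.+1%:R / K <= 1 by rewrite ler_pdivrMr// mul1r ler_nat.
  have h4 : 0 <= a%:R / K by rewrite divr_ge0.
  rewrite in_itv/=; apply/andP; split; first by apply: le_trans h1; rewrite lerBrDr addrC subrr.
  by apply: le_trans h2 _; rewrite lerBlDr; apply: le_trans h3 _; lra.
rewrite setIidl//.
rewrite (eq_integral (fun=> 1%E)); last first.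
  move=> x /set_mem/sub /=; rewrite in_itv/= /uniform_pdf => ->.
  by congr EFin; field.
rewrite integral_cst ?mul1e; last exact: measurable_itv.
apply: etrans (lebesgue_measure_itv _) _; rewrite /= lte_fin ltrD2r ltr_pM2r ?invr_gt0// ltr_nat ltnSn.
by rewrite -EFinB; congr EFin; rewrite -natr1; field.
Qed.

Lemma cell_mid_rev a : cell_mid (rev_ord a) = - cell_mid a.
Proof.
rewrite /cell_mid /= subSS natrB; last by rewrite -ltnS.
by rewrite -(natr1 k); field; rewrite natr1.
Qed.

End cells.

Section riemann.
Context {R : realType} dT (T : measurableType dT) (P : probability T R) (D : set T).
Hypothesis mD : measurable D.
Hypothesis PD : P D = 1%E.
Variable s : nat.
Local Notation E f := (Rintegral P D f).
Local Notation int f := (P.-integrable D (EFin \o f)).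
Let Doo : (P D < +oo)%E. Proof. by rewrite PD ltry. Qed.

Lemma norm_expectation_le f M : int f -> (forall t, D t -> `|f t| <= M) -> `|E f| <= M.
Proof.
move=> i h; have e : M * fine (P D) <= M by rewrite PD mulr1.
exact: le_trans (normr_Rintegral_le mD Doo i h) e.
Qed.

(** A common interface for the parameter on [Omega] and for one row of sample points on the whole
    sample space. Restricting to [D] ensures that every point considered lies in the cube. *)
Definition uniform_coords (X : nat -> T -> R) :=
  [/\ forall j, measurable_fun D (X j),
      forall t, D t -> Omega (fun j => X j t) &
      forall B : 'I_s -> set R, (forall j, measurable (B j)) ->
        P (D `&` [set t | forall j : 'I_s, B j (X j t)]) = (\prod_(j < s) uniform_half (B j))%E].

(** Summing over the first [s] coordinates also encodes that, on the cube, the function depends on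
    these coordinates alone. *)
Definition lipschitz_cube (L : R) (H : param R -> R) := forall x y, Omega x -> Omega y ->
  `|H x - H y| <= L * \sum_(j < s) `|x j - y j|.

Section approximation.
Variables (k : nat) (X : nat -> T -> R).
Hypothesis uX : uniform_coords X.
Local Notation K := (k.+1%:R : R).
Implicit Types a : {ffun 'I_s -> 'I_k.+1}.

Definition cell_event a : set T := D `&` [set t | forall j : 'I_s, cell (a j) (X j t)].

Definition mid_point a : param R :=
  fun j => if (insub j : option 'I_s) is Some i then cell_mid (a i) else 0.

Definition simple_approx (H : param R -> R) (t : T) : R :=
  \sum_a H (mid_point a) * \1_(cell_event a) t.

(** Free of [P], [D] and [X]: expectations over different probability spaces are compared with this
    common quantity. *)
Definition riemann_sum (H : param R -> R) : R := \sum_a H (mid_point a) * K^-1 ^+ s.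

Lemma mid_point_Omega a : Omega (mid_point a).
Proof.
move=> j; rewrite /mid_point; case: insub => [i|]; first exact: cell_mid_bound.
by rewrite oppr_le0 andbb invr_ge0.
Qed.

Lemma measurable_cell (i : 'I_k.+1) : measurable (@cell R k i).
Proof. exact: measurable_itv. Qed.

Lemma measurable_cell_event a : measurable (cell_event a).
Proof.
have [mX _ _] := uX.
rewrite (_ : cell_event a = D `&` \bigcap_(j in [set: 'I_s]) (D `&` X j @^-1` cell (a j))).
  apply: measurableI => //; apply: fin_bigcap_measurable => // j _.
  by apply: mX => //; exact: measurable_cell.
apply/seteqP; split => [t [Dt h]|t [Dt h]]; split => //.
  by move=> j _; split => //; exact: h.
by move=> j; have [] := h j I.
Qed.

Lemma cell_event_prob a : P (cell_event a) = (K^-1 ^+ s)%:E.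
Proof.
have [_ _ hP] := uX; rewrite /cell_event (hP (fun j => cell (a j))); last by move=> j; exact: measurable_cell.
by under eq_bigr do rewrite uniform_half_cell; rewrite prodEFin prodr_const card_ord.
Qed.

Lemma cell_eventP t a : D t -> cell_event a t <-> a = [ffun j : 'I_s => cell_index k (X j t)].
Proof.
move=> Dt; have [_ bX _] := uX; have h (j : 'I_s) := cellP (a j) (bX t Dt j).
split=> [[_ e]|->]; first by apply/ffunP => j; rewrite ffunE; apply/esym/h/e.
by split => // j; rewrite ffunE; apply/cellP => //; exact: bX.
Qed.

Lemma simple_approxE H t : D t -> simple_approx H t = H (mid_point [ffun j : 'I_s => cell_index k (X j t)]).
Proof.
move=> Dt; rewrite /simple_approx (bigD1 [ffun j : 'I_s => cell_index k (X j t)])//=.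
rewrite indicE mem_set ?mulr1; last exact/cell_eventP.
rewrite big1 ?addr0// => a ane; rewrite indicE memNset ?mulr0// => /(cell_eventP _ Dt) e.
by rewrite e eqxx in ane.
Qed.

Lemma simple_approx_close L H t : 0 <= L -> lipschitz_cube L H -> D t ->
  `|H (fun j => X j t) - simple_approx H t| <= L * (s%:R / K).
Proof.
move=> L0 hH Dt; have [_ bX _] := uX; rewrite simple_approxE//.
apply: le_trans (hH _ _ (bX t Dt) (mid_point_Omega _)) _; apply: ler_wpM2l => //.
apply: (@le_trans _ _ (\sum_(j < s) K^-1)); last by rewrite sumr_const card_ord -[leLHS]mulr_natl.
apply: ler_sum => j _; rewrite /mid_point valK ffunE; exact: cell_mid_close (bX t Dt j).
Qed.

Lemma measurable_simple_approx H : measurable_fun D (simple_approx H).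
Proof.
apply: measurable_sum => a; apply: measurable_funM; first exact: measurable_cst.
by apply: measurable_indic; exact: measurable_cell_event.
Qed.

Lemma int_indic_event a : int (\1_(cell_event a) : T -> R).
Proof.
apply: (@integrable_le_norm _ _ _ P D _ (fun=> 1)) => //.
- by apply: measurable_indic; exact: measurable_cell_event.
- exact: integrable_cst_fin.
by move=> t _; rewrite indicE normr1; case: (_ \in _); rewrite ?normr1 ?normr0.
Qed.

Lemma integral_simple_approx H : E (simple_approx H) = riemann_sum H.
Proof.
rewrite /simple_approx Rintegral_sum//; last by move=> a _; apply: int_scale => //; exact: int_indic_event.
apply: eq_bigr => a _; rewrite RintegralZl//; last exact: int_indic_event.
congr (_ * _); rewrite /Rintegral integral_indic//; last exact: measurable_cell_event.
have sub : cell_event a `<=` D by move=> t [].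
transitivity (fine (P (cell_event a))); first by congr (fine (P _)); exact: setIidl.
by rewrite cell_event_prob.
Qed.

Lemma simple_approx_bound H M t : (forall x, Omega x -> `|H x| <= M) -> D t ->
  `|simple_approx H t| <= M.
Proof. by move=> hM Dt; rewrite simple_approxE//; apply: hM; exact: mid_point_Omega. Qed.

Lemma riemann_sum_bound H M : (forall x, Omega x -> `|H x| <= M) -> `|riemann_sum H| <= M.
Proof.
move=> hM; rewrite -integral_simple_approx.
have i : int (simple_approx H).
  by apply: int_sum => // a _; apply: int_scale => //; exact: int_indic_event.
by apply: norm_expectation_le => // t Dt; exact: simple_approx_bound.
Qed.

End approximation.

Lemma lipschitz_bounded L H : 0 <= L -> lipschitz_cube L H ->
  forall x, Omega x -> `|H x| <= `|H (fun=> 0)| + L * s%:R.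
Proof.
move=> L0 hH x Ox; have O0 : Omega (fun=> 0 : R) by move=> j; rewrite oppr_le0 andbb invr_ge0.
rewrite -[H x](subrK (H (fun=> 0))) addrC; apply: le_trans (ler_normD _ _) _; rewrite lerD2l.
apply: le_trans (hH _ _ Ox O0) _; apply: ler_wpM2l => //.
apply: (@le_trans _ _ (\sum_(j < s) 1)); last by rewrite sumr_const card_ord.
apply: ler_sum => j _; rewrite subr0; have /andP[h1 h2] := Ox j.
rewrite ler_norml; apply/andP; split; lra.
Qed.

Lemma inv_cvg0 (C : R) : 0 <= C -> forall e, 0 < e -> exists k : nat, C / k.+1%:R <= e.
Proof.
move=> C0 e e0; exists (Num.truncn (C / e)); rewrite ler_pdivrMr// mulrC -ler_pdivrMr//.
exact/ltW/truncnS_gt.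
Qed.

Section integrals.
Variables (X : nat -> T -> R).
Hypothesis uX : uniform_coords X.
Variables (L : R) (H : param R -> R).
Hypothesis L0 : 0 <= L.
Hypothesis hH : lipschitz_cube L H.

(** The function is a pointwise limit of its simple approximations, which are measurable because the
    events of the cells are. *)
Lemma measurable_lipschitz : measurable_fun D (fun t => H (fun j => X j t)).
Proof.
apply/measurable_EFinP.
apply: (@emeasurable_fun_cvg _ _ _ D (fun k => EFin \o simple_approx k X H)).
  by move=> k; apply/measurable_EFinP; exact: measurable_simple_approx.
move=> t Dt; apply: cvg_EFin; first by near=> k.
apply/cvgrPdist_le => e e0 /=.
have [k0 hk0] := inv_cvg0 (mulr_ge0 L0 (ler0n R s)) e0.
near=> k; apply: le_trans (simple_approx_close k uX L0 hH Dt) _.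
apply: le_trans _ hk0; rewrite mulrA; apply: ler_wpM2l; first by rewrite mulr_ge0.
rewrite lef_pV2 ?posrE// ler_nat ltnS; near: k; exact: nbhs_infty_ge.
Unshelve. all: by end_near.
Qed.

Lemma int_lipschitz : int (fun t => H (fun j => X j t)).
Proof.
have [_ bX _] := uX; have hb := lipschitz_bounded L0 hH.
apply: (@integrable_le_norm _ _ _ P D _ (fun=> `|H (fun=> 0)| + L * s%:R)) => //.
- exact: measurable_lipschitz.
- exact: integrable_cst_fin.
by move=> t Dt; rewrite [leRHS]ger0_norm ?addr_ge0 ?mulr_ge0// hb//; exact: bX.
Qed.

Lemma riemann_close k : `|E (fun t => H (fun j => X j t)) - riemann_sum k H| <= L * (s%:R / k.+1%:R).
Proof.
have i : int (simple_approx k X H).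
  by apply: int_sum => // a _; apply: int_scale => //; exact: int_indic_event.
rewrite -(integral_simple_approx k uX) -RintegralB//; last exact: int_lipschitz.
apply: (norm_expectation_le (int_sub mD int_lipschitz i)) => t Dt.
exact: (simple_approx_close k uX).
Qed.

End integrals.
End riemann.

Section uniform_expectation.
Context {R : realType}.

Lemma eq_of_close (x y C : R) : 0 <= C -> (forall k, `|x - y| <= C / k.+1%:R) -> x = y.
Proof.
move=> C0 h; apply/eqP; rewrite -subr_eq0 -normr_le0; apply/ler_addgt0Pl => e e0; rewrite addr0.
by have [k hk] := inv_cvg0 C0 e0; exact: le_trans (h k) hk.
Qed.

(** Both integrals lie within [L * s / k.+1] of the same Riemann sum, for every [k]. *)
Lemma uniform_expectation_unique s d1 (T1 : measurableType d1) (P1 : probability T1 R) (D1 : set T1)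
    d2 (T2 : measurableType d2) (P2 : probability T2 R) (D2 : set T2) X1 X2 L H :
  measurable D1 -> P1 D1 = 1%E -> measurable D2 -> P2 D2 = 1%E ->
  uniform_coords P1 D1 s X1 -> uniform_coords P2 D2 s X2 -> 0 <= L -> lipschitz_cube s L H ->
  \int[P1]_(t in D1) H (fun j => X1 j t) = \int[P2]_(t in D2) H (fun j => X2 j t).
Proof.
move=> m1 p1 m2 p2 u1 u2 L0 hH; apply: (@eq_of_close _ _ (2 * (L * s%:R))); first by rewrite !mulr_ge0.
move=> k; have h1 := riemann_close m1 p1 u1 L0 hH k; have h2 := riemann_close m2 p2 u2 L0 hH k.
rewrite -mulrA mulr_natl mulr2n -mulrA; apply: le_trans (ler_distD (riemann_sum s k H) _ _) _.
by apply: lerD => //; rewrite distrC.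
Qed.

(** The grid of midpoints is symmetric about the origin, so flipping coordinates only permutes the
    terms of each Riemann sum. *)
Lemma uniform_coords_flip s s' dT (T : measurableType dT) (P : probability T R) (D : set T) X L H :
  measurable D -> P D = 1%E -> uniform_coords P D s X -> 0 <= L -> lipschitz_cube s L H ->
  \int[P]_(t in D) H (flip s' (fun j => X j t)) = \int[P]_(t in D) H (fun j => X j t).
Proof.
move=> mD pD uX L0 hH; pose H' (x : param R) := H (flip s' x).
have Of (x : param R) : Omega x -> Omega (flip s' x).
  by move=> Ox j; rewrite /flip; case: ifP => // _; rewrite lerN2 lerNl andbC.
have hH' : lipschitz_cube s L H'.
  move=> x y Ox Oy; apply: le_trans (hH _ _ (Of _ Ox) (Of _ Oy)) _; apply: ler_wpM2l => //.
  apply: ler_sum => j _; rewrite /flip; case: ifP => // _.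
  by rewrite -opprD normrN.
apply: (@eq_of_close _ _ (2 * (L * s%:R))); first by rewrite !mulr_ge0.
move=> k; have h1 := riemann_close mD pD uX L0 hH' k; have h2 := riemann_close mD pD uX L0 hH k.
have e : riemann_sum s k H' = riemann_sum s k H.
  (* Reversing the order of the cells in the flipped coordinates maps each midpoint to its negative
     there. *)
  pose rv (a : {ffun 'I_s -> 'I_k.+1}) := [ffun j : 'I_s => if (j < s')%N then a j else rev_ord (a j)].
  have rvK : involutive rv.
    by move=> a; apply/ffunP => j; rewrite !ffunE; case: (j < s')%N; rewrite ?rev_ordK.
  rewrite /riemann_sum [RHS](reindex_inj (inv_inj rvK)); apply: eq_bigr => a _.
  congr (H _ * _); apply/funext => j; rewrite /flip /mid_point.
  case: insubP => [i _ <-|_]; last by rewrite oppr0 if_same.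
  by rewrite ffunE; case: ifP => // _; rewrite cell_mid_rev.
rewrite e in h1; rewrite -mulrA mulr_natl mulr2n -mulrA.
apply: le_trans (ler_distD (riemann_sum s k H) _ _) _.
by apply: lerD => //; rewrite distrC.
Qed.

End uniform_expectation.

(** * Means of products of functions of two independent points *)

Section independent_rows.
Context {R : realType} dT (T : measurableType dT) (P : probability T R) (D : set T).
Hypothesis mD : measurable D.
Hypothesis PD : P D = 1%E.
Variable s : nat.
Local Notation E f := (Rintegral P D f).
Local Notation int f := (P.-integrable D (EFin \o f)).
Let Doo : (P D < +oo)%E. Proof. by rewrite PD ltry. Qed.

Variables (X Y : nat -> T -> R).
Hypotheses (uX : uniform_coords P D s X) (uY : uniform_coords P D s Y).
Hypothesis indep : forall k (a b : {ffun 'I_s -> 'I_k.+1}),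
  P (cell_event D X a `&` cell_event D Y b) = (k.+1%:R^-1 ^+ s * k.+1%:R^-1 ^+ s)%:E.
Variables (L : R) (G H : param R -> R).
Hypothesis L0 : 0 <= L.
Hypotheses (hG : lipschitz_cube s L G) (hH : lipschitz_cube s L H).

Lemma int_bounded (f : T -> R) M : measurable_fun D f -> (forall t, D t -> `|f t| <= M) -> int f.
Proof.
move=> mf fM; apply: (@integrable_le_norm _ _ _ P D _ (fun=> M)) => //; first exact: integrable_cst_fin.
by move=> t Dt; apply: le_trans (fM t Dt) _; exact: ler_norm.
Qed.

Lemma integral_simple_approxM k :
  E (fun t => simple_approx D s k X G t * simple_approx D s k Y H t) =
  riemann_sum s k G * riemann_sum s k H.
Proof.
have mX a := measurable_cell_event mD uX a; have mY b := measurable_cell_event mD uY b.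
have ii (a b : {ffun 'I_s -> 'I_k.+1}) : int (\1_(cell_event D X a `&` cell_event D Y b) : T -> R).
  apply: (@int_bounded _ 1); first by apply: measurable_indic; exact: measurableI.
  by move=> t _; rewrite indicE; case: (_ \in _); rewrite ?normr1 ?normr0.
rewrite (@eq_Rintegral _ _ _ P D (fun t => \sum_(a : {ffun 'I_s -> 'I_k.+1}) \sum_(b : {ffun 'I_s -> 'I_k.+1})
   (G (mid_point a) * H (mid_point b)) * \1_(cell_event D X a `&` cell_event D Y b) t)); last first.
  move=> t _; rewrite /simple_approx mulr_suml; apply: eq_bigr => a _.
  rewrite mulr_sumr; apply: eq_bigr => b _; rewrite indicI /=; ring.
rewrite Rintegral_sum//; last first.
  by move=> a _; apply: int_sum => // b _; apply: int_scale => //; exact: ii.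
rewrite /riemann_sum mulr_suml; apply: eq_bigr => a _.
rewrite Rintegral_sum//; last by move=> b _; apply: int_scale => //; exact: ii.
rewrite mulr_sumr; apply: eq_bigr => b _; rewrite (RintegralZl _ mD (ii a b)).
rewrite (_ : E (\1_(cell_event D X a `&` cell_event D Y b)) = k.+1%:R^-1 ^+ s * k.+1%:R^-1 ^+ s); first by ring.
rewrite /Rintegral integral_indic//; last by apply: measurableI; [exact: mX|exact: mY].
transitivity (fine (P (cell_event D X a `&` cell_event D Y b))); last by rewrite indep.
by congr (fine (P _)); apply: setIidl => t [[]].
Qed.

(** For simple approximations independence of the events of the cells gives the identity at once;
    all functions are bounded by [M], so the products converge too. *)
Lemma independent_mean_mul : E (fun t => G (fun j => X j t) * H (fun j => Y j t)) =
  E (fun t => G (fun j => X j t)) * E (fun t => H (fun j => Y j t)).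
Proof.
pose M := Num.max (`|G (fun=> 0)| + L * s%:R) (`|H (fun=> 0)| + L * s%:R).
have GM x : Omega x -> `|G x| <= M.
  by move=> Ox; apply: le_trans (lipschitz_bounded L0 hG Ox) _; rewrite le_max lexx.
have HM x : Omega x -> `|H x| <= M.
  by move=> Ox; apply: le_trans (lipschitz_bounded L0 hH Ox) _; rewrite le_max lexx orbT.
have M0 : 0 <= M by rewrite le_max addr_ge0 ?mulr_ge0.
have [_ bX _] := uX; have [_ bY _] := uY.
pose C := L * s%:R.
have C0 : 0 <= C by rewrite mulr_ge0.
apply: (@eq_of_close _ _ _ (4 * (M * C))); first by rewrite !mulr_ge0.
move=> k; set q := k.+1%:R : R.
pose eps := C / q.
have e0 : 0 <= eps by rewrite divr_ge0.
have prod_close (x y x' y' : R) : `|x - x'| <= eps -> `|y - y'| <= eps -> `|y| <= M -> `|x'| <= M ->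
    `|x * y - x' * y'| <= 2 * (M * eps).
  move=> h1 h2 h3 h4; rewrite (_ : x * y - x' * y' = (x - x') * y + x' * (y - y')); last by ring.
  apply: le_trans (ler_normD _ _) _; rewrite !normrM mulr_natl mulr2n; apply: lerD.
    by rewrite mulrC; apply: ler_pM.
  by apply: ler_pM.
have i1 : int (fun t => G (fun j => X j t) * H (fun j => Y j t)).
  apply: (@int_bounded _ (M * M)).
    by apply: measurable_funM; [exact: (measurable_lipschitz mD uX L0 hG)|exact: (measurable_lipschitz mD uY L0 hH)].
  by move=> t Dt; rewrite normrM; apply: ler_pM => //; [apply: GM; exact: bX|apply: HM; exact: bY].
have i2 : int (fun t => simple_approx D s k X G t * simple_approx D s k Y H t).
  apply: (@int_bounded _ (M * M)).
    by apply: measurable_funM; [exact: (measurable_simple_approx mD k uX)|exact: (measurable_simple_approx mD k uY)].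
  move=> t Dt; rewrite normrM; apply: ler_pM => //.
    exact: (simple_approx_bound k uX GM Dt).
  exact: (simple_approx_bound k uY HM Dt).
have h1 : `|E (fun t => G (fun j => X j t) * H (fun j => Y j t)) - riemann_sum s k G * riemann_sum s k H| <= 2 * (M * eps).
  rewrite -integral_simple_approxM -RintegralB//.
  apply: (norm_expectation_le mD PD (int_sub mD i1 i2)) => t Dt; apply: prod_close.
  - by have := simple_approx_close k uX L0 hG Dt; rewrite mulrA.
  - by have := simple_approx_close k uY L0 hH Dt; rewrite mulrA.
  - by apply: HM; exact: bY.
  - exact: (simple_approx_bound k uX GM Dt).
have h2 : `|E (fun t => G (fun j => X j t)) * E (fun t => H (fun j => Y j t)) - riemann_sum s k G * riemann_sum s k H| <= 2 * (M * eps).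
  apply: prod_close.
  - by have := riemann_close mD PD uX L0 hG k; rewrite mulrA.
  - by have := riemann_close mD PD uY L0 hH k; rewrite mulrA.
  - apply: (norm_expectation_le mD PD (int_lipschitz mD PD uY L0 hH)) => t Dt; apply: HM; exact: bY.
  - exact: (riemann_sum_bound mD PD k uX GM).
rewrite (_ : 4 * (M * C) / q = 2 * (M * eps) + 2 * (M * eps)); last by rewrite /eps; ring.
apply: le_trans (ler_distD (riemann_sum s k G * riemann_sum s k H) _ _) _.
by apply: lerD => //; rewrite distrC.
Qed.

End independent_rows.

(** * Variance of a Monte Carlo average *)

Section monte_carlo.
Context {R : realType} dT (T : measurableType dT) (P : probability T R).
Variables (M s : nat) (X : nat -> nat -> {RV P >-> R}).
Hypothesis iid : iid_uniform M s X.
Local Notation E f := (Rintegral P setT f).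
Local Notation row i t := (extend s (fun j => X i j t)).

Let PT : P setT = 1%E. Proof. exact: probability_setT. Qed.
Let Poo : (P setT < +oo)%E. Proof. by rewrite PT ltry. Qed.

Lemma uniform_half_setT : uniform_half (setT : set R) = 1%E.
Proof. exact: probability_setT. Qed.

Lemma extend_Omega (x : nat -> R) : (forall j, - 2^-1 <= x j <= 2^-1) -> Omega (extend s x).
Proof.
move=> hx j; rewrite /extend; case: ifP => // _.
by rewrite oppr_le0 andbb invr_ge0.
Qed.

Lemma row_Omega i t : Omega (row i t).
Proof. by apply: extend_Omega => j; have [h _] := iid; exact: h. Qed.

(** Taking the whole line, of probability one, for every coordinate of the rows outside [I]
    marginalises the joint law. *)
Lemma row_prob (I : pred 'I_M) (B : 'I_M -> 'I_s -> set R) : (forall i j, measurable (B i j)) ->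
  P [set t | forall i : 'I_M, I i -> forall j : 'I_s, B i j (row i t j)] =
  (\prod_(i < M | I i) \prod_(j < s) uniform_half (B i j))%E.
Proof.
move=> mB; have [_ h] := iid.
have := h (fun i j => if I i then B i j else setT) _; rewrite [LHS](_ : _ = P [set t | forall i : 'I_M, I i -> forall j : 'I_s, B i j (row i t j)]).
  move=> ->; last by move=> i j; case: ifP.
  rewrite [RHS]big_mkcond/=; apply: eq_bigr => i _; case: (I i) => //.
  by rewrite big1// => j _; exact: uniform_half_setT.
congr (P _); apply/seteqP; split => t /= ht i.
  by move=> Ii j; have := ht i j; rewrite Ii /extend ltn_ord.
by move=> j; case: ifP => // Ii; have := ht i Ii j; rewrite /extend ltn_ord.
Qed.

Lemma uniform_coords_row (i : 'I_M) : uniform_coords P setT s (fun j t => row i t j).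
Proof.
split.
- move=> j; rewrite /extend; case: (j < s)%N; last exact: measurable_cst.
  exact: measurable_funPT.
- by move=> t _; exact: row_Omega.
move=> B mB; rewrite setTI.
have := row_prob (pred1 i) (B := fun _ => B) (fun _ => mB).
rewrite big_pred1_eq => <-; congr (P _); apply/seteqP; split => t /= h.
  by move=> _ /eqP -> j; exact: h.
by move=> j; apply: (h i) => /=.
Qed.

Lemma rows_independent (i i' : 'I_M) k (a b : {ffun 'I_s -> 'I_k.+1}) : i != i' ->
  P (cell_event setT (fun j t => row i t j) a `&` cell_event setT (fun j t => row i' t j) b) =
  (k.+1%:R^-1 ^+ s * k.+1%:R^-1 ^+ s)%:E.
Proof.
move=> ii'; have := row_prob (pred2 i i') (B := fun i0 j => if i0 == i then cell (a j) else cell (b j)) _.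
have -> : (\prod_(i0 < M | pred2 i i' i0) \prod_(j < s) uniform_half (if i0 == i then cell (a j) else cell (b j)))%E =
    (k.+1%:R^-1 ^+ s * k.+1%:R^-1 ^+ s)%:E :> \bar R.
  rewrite (bigD1 i)/=; last by rewrite eqxx.
  rewrite (big_pred1 i'); last first.
    move=> i0 /=; case: (eqVneq i0 i) => [->|] /=; last by rewrite andbT.
    by rewrite (negbTE ii').
  rewrite eqxx (negbTE (_ : i' != i)) 1?eq_sym//.
  have cst (c : {ffun 'I_s -> 'I_k.+1}) : (\prod_(j < s) uniform_half (cell (c j)))%E = (k.+1%:R^-1 ^+ s)%:E :> \bar R.
    by under eq_bigr do rewrite uniform_half_cell; rewrite prodEFin prodr_const card_ord.
  by rewrite !cst -EFinM.
move=> <-; last by move=> i0 j; case: ifP => _; exact: measurable_cell.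
congr (P _); apply/seteqP; split => t /=.
  move=> [[_ h1] [_ h2]] i0 /orP[/eqP ->|/eqP ->] j; first by rewrite eqxx; exact: h1.
  by rewrite (negbTE (_ : i' != i)) 1?eq_sym//; exact: h2.
move=> h; split; split => // j.
  by have := h i _ j; rewrite eqxx/=; apply.
by have := h i' _ j; rewrite (negbTE (_ : i' != i)) 1?eq_sym// eqxx orbT; apply.
Qed.

(** After centring, products of different rows have mean zero. The [M] diagonal terms are at most
    [(2 K)^2] each, and division by [M^2] leaves [4 K^2 / M]. *)
Lemma mc_variance (L K m : R) (F : param R -> R) : (0 < M)%N -> 0 <= L -> lipschitz_cube s L F ->
  (forall x, Omega x -> `|F x| <= K) -> (forall i : 'I_M, E (fun t => F (row i t)) = m) ->
  P.-integrable setT (EFin \o (fun t => (M%:R^-1 * \sum_(i < M) F (row i t) - m) ^+ 2)) /\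
  E (fun t => (M%:R^-1 * \sum_(i < M) F (row i t) - m) ^+ 2) <= 4 * K ^+ 2 / M%:R.
Proof.
move=> M0 L0 hF FK Em; pose G x := F x - m.
have hG : lipschitz_cube s L G.
  by move=> x y Ox Oy; rewrite /G opprB addrA subrK; exact: hF.
have i0 := Ordinal M0.
have mK : `|m| <= K.
  rewrite -(Em i0); apply: (norm_expectation_le measurableT PT).
    exact: (int_lipschitz measurableT PT (uniform_coords_row i0) L0 hF).
  by move=> t _; apply: FK; exact: row_Omega.
have GK x : Omega x -> `|G x| <= 2 * K.
  by move=> Ox; apply: le_trans (ler_normB _ _) _; rewrite mulr_natl mulr2n lerD// FK.
have K0 : 0 <= K by apply: le_trans mK.
have mG (i : 'I_M) := measurable_lipschitz measurableT (uniform_coords_row i) L0 hG.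
have iG (i : 'I_M) := int_lipschitz measurableT PT (uniform_coords_row i) L0 hG.
have EG (i : 'I_M) : E (fun t => G (row i t)) = 0.
  have iF := int_lipschitz measurableT PT (uniform_coords_row i) L0 hF.
  rewrite /G (RintegralB measurableT iF (integrable_cst_fin measurableT Poo m)).
  have e : m * fine (P setT) = m by rewrite PT mulr1.
  by apply/eqP; rewrite Em subr_eq0 Rintegral_cst//; apply/eqP/esym; exact: e.
have iGG (i i' : 'I_M) : P.-integrable setT (EFin \o (fun t => G (row i t) * G (row i' t))).
  apply: (int_bounded measurableT PT (M := 2 * K * (2 * K))); first exact: measurable_funM.
  by move=> t _; rewrite normrM; apply: ler_pM => //; apply: GK; exact: row_Omega.
have MR : 0 < M%:R :> R by rewrite ltr0n.
have eqf t : (M%:R^-1 * \sum_(i < M) F (row i t) - m) ^+ 2 =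
   M%:R ^- 2 * \sum_(i < M) \sum_(i' < M) G (row i t) * G (row i' t).
  rewrite -[\sum_(i < M) \sum_(i' < M) _]/(_) (_ : \sum_(i < M) \sum_(i' < M) _ = (\sum_(i < M) G (row i t)) ^+ 2); last first.
    by rewrite expr2 mulr_suml; apply: eq_bigr => i _; rewrite mulr_sumr.
  rewrite -exprVn -exprMn; congr (_ ^+ 2).
  rewrite /G big_split/= sumr_const card_ord mulrDr; congr (_ + _).
  by rewrite -[- m *+ M]mulr_natr mulrCA mulVf ?mulr1// gt_eqF.
have iS : P.-integrable setT (EFin \o (fun t => M%:R ^- 2 * \sum_(i < M) \sum_(i' < M) G (row i t) * G (row i' t))).
  by apply: int_scale => //; apply: int_sum => // i _; apply: int_sum => // i' _; exact: iGG.
split; first by move: iS; apply: eq_integrable => // t _ /=; rewrite eqf.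
rewrite (@eq_Rintegral _ _ _ P setT (fun t => M%:R ^- 2 * \sum_(i < M) \sum_(i' < M) G (row i t) * G (row i' t))); last first.
  by move=> t _; exact: eqf.
rewrite RintegralZl//; last by apply: int_sum => // i _; apply: int_sum => // i' _; exact: iGG.
rewrite Rintegral_sum//; last by move=> i _; apply: int_sum => // i' _; exact: iGG.
apply: (@le_trans _ _ (M%:R ^- 2 * \sum_(i < M) (2 * K * (2 * K)))); last first.
  rewrite sumr_const card_ord -[_ *+ M]mulr_natl le_eqVlt; apply/orP; left; apply/eqP.
  by field; exact: lt0r_neq0.
rewrite ler_pM2l ?invr_gt0 ?exprn_gt0//; apply: ler_sum => i _.
rewrite Rintegral_sum//; rewrite (bigD1 i)//= big1 ?addr0.
  apply: le_trans (ler_norm _) _; apply: (norm_expectation_le measurableT PT (iGG i i)) => t _.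
  by rewrite normrM; apply: ler_pM => //; apply: GK; exact: row_Omega.
move=> i' i'i; have := independent_mean_mul measurableT PT (uniform_coords_row i) (uniform_coords_row i') _ L0 hG hG.
by rewrite !EG mulr0; apply => k a b; apply: rows_independent; rewrite eq_sym.
Qed.

End monte_carlo.

(** * The cube under the product measure *)

Section product_uniform_facts.
Context {R : realType} (P : probability (param R) R).
Hypothesis PU : product_uniform P.

Lemma measurable_param (j : nat) : measurable_fun setT (fun w : param R => w j).
Proof.
move=> _ B mB; rewrite setTI; apply: sub_sigma_algebra.
by exists j, B.
Qed.

Let box n : set (param R) := [set w | forall j : 'I_n, `[- 2^-1, 2^-1]%classic (w j)].

Let mbox n : measurable (box n).
Proof.
rewrite (_ : box n = \bigcap_(j in [set: 'I_n]) (fun w : param R => w j) @^-1` `[- 2^-1, 2^-1]%classic).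
  apply: fin_bigcap_measurable => // j _; rewrite -[X in measurable X]setTI.
  exact: measurable_param.
by apply/seteqP; split => [w h j _|w h j]; [exact: h|exact: h].
Qed.

Let Omega_box : @Omega R = \bigcap_n box n.
Proof.
apply/seteqP; split => [w h n _ j|w h j]; first by rewrite /= in_itv/=; exact: h.
by have := h j.+1 I ord_max; rewrite /= in_itv.
Qed.

Lemma measurable_Omega : measurable (@Omega R : set (param R)).
Proof. by rewrite Omega_box; apply: bigcapT_measurable => n; exact: mbox. Qed.

Let box1 n : P (box n) = 1%E.
Proof.
rewrite (PU (fun=> measurable_itv _)) big1// => j _.
by rewrite /uniform_half /uniform_prob integral_uniform_pdf1// half_interval.
Qed.

Lemma Omega_prob : P (@Omega R) = 1%E.
Proof.
have : P.-negligible (~` @Omega R).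
  rewrite Omega_box setC_bigcap; apply: negligible_bigcup => n.
  apply/negligibleP; first exact: measurableC.
  by apply: etrans (probability_setC P (mbox n)) _; rewrite box1 subee.
move=> /(negligibleP _ (measurableC measurable_Omega)) h.
have := probability_setC P (measurableC measurable_Omega).
by rewrite setCK h sube0.
Qed.

Lemma Omega_negligible : P (~` @Omega R) = 0%E.
Proof.
apply: etrans (probability_setC P measurable_Omega) _.
by rewrite Omega_prob subee.
Qed.

(** The product formula is given on the whole parameter space; intersecting with [Omega] changes
    nothing because its complement is a null set. *)
Lemma uniform_coords_param s : uniform_coords P (@Omega R) s (fun j w => w j).
Proof.
split=> [j|//|B mB].
  by apply: (@measurable_funS _ _ _ _ setT) => //; exact: measurable_param.
rewrite -(PU mB).
have mA : measurable [set w : param R | forall j : 'I_s, B j (w j)].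
  rewrite (_ : [set _ | _] = \bigcap_(j in [set: 'I_s]) (fun w : param R => w j) @^-1` (B j)).
    apply: fin_bigcap_measurable => // j _; rewrite -[X in measurable X]setTI.
    exact: measurable_param.
  by apply/seteqP; split => [w h j _|w h j]; [exact: h|exact: h].
set A := [set w : param R | _] in mA *.
have mO := measurable_Omega; have mOA : measurable (@Omega R `&` A) by exact: measurableI.
apply/eqP; rewrite eq_le; apply/andP; split.
  by apply: le_measure; rewrite ?inE//; exact: subIsetr.
have sub : A `<=` (@Omega R `&` A) `|` ~` @Omega R.
  by move=> w Aw; have [Ow|nOw] := pselect (Omega w); [left|right].
apply: le_trans (le_measure P _ _ sub) _; rewrite ?inE//.
  by apply: measurableU => //; exact: measurableC.
apply: le_trans (measureU2 _ mOA (measurableC mO)) _.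
by have e : (P (@Omega R `&` A) + P (~` @Omega R) <= P (@Omega R `&` A))%E;
  [rewrite [X in (_ + X)%E]Omega_negligible adde0|exact: e].
Qed.

End product_uniform_facts.

Lemma sum_sqr_le (R : realFieldType) n (p : pred nat) (y : nat -> R) :
  (\sum_(i < n | p i) y i) ^+ 2 <= n%:R * \sum_(i < n | p i) y i ^+ 2.
Proof.
elim: n => [|n IH]; first by rewrite !big_ord0 expr0n mulr0.
have T0 : 0 <= \sum_(i < n | p i) y i ^+ 2 by apply: sumr_ge0 => i _; exact: sqr_ge0.
rewrite (big_mkcond (fun i : 'I_n.+1 => p i)) (big_mkcond (fun i : 'I_n.+1 => p i)) !big_ord_recr/= -!big_mkcond/=.
rewrite -natr1; move: IH T0; set S := \sum_(i < n | p i) y i; set T := \sum_(i < n | p i) _ => IH T0.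
case: ifP => _; last by rewrite !addr0; apply: le_trans IH _; rewrite mulrDl mul1r lerDl.
case: n S T IH T0 => [|n] S T IH T0.
  have S0 : S = 0 by apply/eqP; rewrite -sqrf_eq0 eq_le sqr_ge0 andbT; move: IH; rewrite mul0r.
  by rewrite S0 !add0r mul1r lerDr.
have n0 : 0 < n.+1%:R :> R by rewrite ltr0n.
move: (n.+1%:R) n0 IH => u u0 IH.
(* The new cross term is absorbed by expanding [(S - u * y n.+1)^2 >= 0] and bounding [S ^+ 2] by
   the induction hypothesis. *)
have key : 2 * (S * y n.+1) <= T + u * y n.+1 ^+ 2.
  rewrite -(ler_pM2l u0); have := sqr_ge0 (S - u * y n.+1); nra.
nra.
Qed.

Lemma double_sub (R : pzRingType) (x y : R) : x + x - (y + y) = 2 * (x - y).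
Proof. by rewrite mulr_natl mulr2n opprD addrACA. Qed.

Lemma sub_swap (R : comNzRingType) (a b c e : R) : (a - b) - (c - e) = (a - c) - (b - e).
Proof. by ring. Qed.

Lemma leq_add_sub (N nu l : nat) : (nu <= N)%N -> (l + nu <= N)%N = (l < (N - nu).+1)%N.
Proof. by move=> h; rewrite ltnS -(leq_add2r nu l) subnK. Qed.

Lemma sub_sub_cancel (R : comNzRingType) (a b c e : R) : (a - b) - ((a - c) - (b - e)) = c - e.
Proof. by ring. Qed.

Lemma telescope_identity (R : comNzRingType) (a b c s : R) : (a - b) + (c - a + - s) = c - b - s.
Proof. by ring. Qed.

Lemma sub_decomp (R : zmodType) (e t s : R) : e - t = - (s - e + (t - s)).
Proof. by rewrite opprD !opprB addrA subrK. Qed.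

(** Here [B] is the squared bias, while [8 b^2 n^4 z^2] is the sampling part: [2 n^2] from the
    splitting, at most [n^2] rules, and a variance [4 b^2 z^2] for each. *)
Lemma mean_square_combine (R : realFieldType) (a b n z B : R) : 0 <= a -> 0 <= b -> 1 <= n -> 0 <= z ->
  B <= (a * n * z) ^+ 2 ->
  2 * B + 8 * b ^+ 2 * n ^+ 4 * z ^+ 2 <= (2 * (a + 2 * b + 1) * n ^+ 2 * z) ^+ 2.
Proof.
move=> a0 b0 n1 z0 hB.
have n0 : 0 <= n by exact: le_trans n1.
have w0 : 0 <= n ^+ 4 * z ^+ 2 by rewrite mulr_ge0 ?exprn_ge0.
have nn : (a * n * z) ^+ 2 <= a ^+ 2 * (n ^+ 4 * z ^+ 2).
  rewrite (_ : (a * n * z) ^+ 2 = a ^+ 2 * z ^+ 2 * n ^+ 2); last by ring.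
  rewrite (_ : a ^+ 2 * (_ * _) = a ^+ 2 * z ^+ 2 * n ^+ 4); last by ring.
  by apply: ler_wpM2l; [rewrite mulr_ge0 ?sqr_ge0|rewrite ler_weXn2l].
rewrite (_ : (2 * _ * _ * z) ^+ 2 = 4 * (a + 2 * b + 1) ^+ 2 * (n ^+ 4 * z ^+ 2)); last by ring.
rewrite -(mulrA (8 * b ^+ 2)); move: (n ^+ 4 * z ^+ 2) w0 (le_trans hB nn) => w w0 {}hB.
have : 2 * a ^+ 2 + 8 * b ^+ 2 <= 4 * (a + 2 * b + 1) ^+ 2 by nra.
by move=> /(ler_wpM2r w0); lra.
Qed.

Lemma double_sum_identity (R : comNzRingType) (p q s a b c e f k : R) :
  (p - a - (p - b) - (q - c - (q - k))) + (s - e - (s - f) - (q - c - (q - k))) =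
  b + f - (k + k) - (a + e - (c + c)).
Proof. by ring. Qed.

(** * The multi-index estimator *)

Section model.
Context {R : realType} {d : nat}.
Variable D : set 'rV[R]_d.
Hypothesis oD : open D.
Hypothesis bD : bounded_set D.
Local Notation F := ('rV[R]_d -> R).
Local Notation mu := (lebesgue_rV R d).
Local Notation L2 v := (sqint mu D v).
Local Notation n2 v := (normL2 D v).
Local Notation nH1 v := (normH1 D v).
Local Notation form := (diffusion_form D).
Local Notation V := (H10 D).
Local Notation "v -- w" := (fun x => 1 * v x + (-1) * w x) (at level 50).
Local Notation "v ++ w" := (fun x => 1 * v x + 1 * w x).
Variables (r : R) (phi : nat -> F) (A : param R -> F) (Amin Amax Ckl Creg Capprox : R).
Variables (X : nat -> set F) (h : nat -> R) (c2 : R).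
Local Notation coef n w := (coefficient phi r A (Some n) w).
Hypothesis r1 : 1 < r.
Hypothesis sphi : forall j, Sobolev D 1 +oo%E (phi j).
Hypothesis phi_decay : forall j, (0 < j)%N -> normW1oo D (phi j) <= Ckl * j%:R `^ (- r).
Hypothesis Amin0 : 0 < Amin.
Hypothesis coer : forall nu w v, Omega w -> V v ->
  Amin * nH1 v ^+ 2 <= form (coefficient phi r A nu w) v v.
Hypothesis bnd : forall nu w v v', Omega w -> V v -> V v' ->
  `|form (coefficient phi r A nu w) v v'| <= Amax * nH1 v * nH1 v'.
Hypothesis reg : forall f nu w, Lp D 2%:E f -> Omega w ->
  exists u, [/\ galerkin_solution D (coefficient phi r A nu w) f V u,
    Sobolev D 2 2%:E u &
    normH2 D u <= Creg * Amin ^- 2 * (1 + normW1oo D (coefficient phi r A nu w)) * n2 f].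
Hypothesis XV : forall l, X l `<=` V.
Hypothesis X0 : forall l, X l (cst 0).
Hypothesis Xl : forall l a v w, X l v -> X l w -> X l (fun x => a * v x + w x).
Hypothesis h0 : forall l, 0 < h l.
Hypothesis hle : forall l, h l <= c2 * 2 ^- l.
Hypothesis approx : forall l w, Sobolev D 2 2%:E w -> V w ->
  inf [set nH1 (w \- v) | v in X l] <= Capprox * h l * normH2 D w.

(** Uniform over the parameter and over all truncation levels. The absolute value is taken because
    no sign of [Creg] is given. *)
Definition regularity_const : R := `|Creg| * Amin ^- 2 * (1 + coef_sup D r Ckl phi).
Local Notation K1 := `|Amax|.
Local Notation K2 := regularity_const.
Local Notation K3 := (`|Capprox| + 1).

Lemma coef_sup_ge0 : 0 <= coef_sup D r Ckl phi.
Proof.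
have C0 := Ckl_ge0 phi_decay; rewrite /coef_sup addr_ge0 ?normW1oo_ge0// mulr_ge0// addr_ge0// invr_ge0.
by rewrite subr_ge0 ltW.
Qed.

Lemma regularity_const_ge0 : 0 <= K2.
Proof.
have C0 := coef_sup_ge0.
by rewrite /regularity_const !mulr_ge0 ?invr_ge0 ?exprn_ge0 ?(ltW Amin0)// addr_ge0.
Qed.

Lemma Omega_norm (w : param R) j : Omega w -> `|w j| <= 2^-1.
Proof. by move=> Ow; rewrite ler_norml; exact: Ow. Qed.

Local Opaque weak_partial normL2 normH1 normH2 diffusion_form pairing normLoo normW1oo H10 lebesgue_rV.

Lemma elliptic_coef n w : Omega w -> elliptic D Amin K1 K2 (coef n w).
Proof.
move=> Ow; split.
- exact: (W1oo_partial oD bD sphi _ w).1.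
- move=> v hv; exact: (coer (Some n) Ow hv).
- move=> v v' hv hv'; apply: le_trans (bnd (Some n) Ow hv hv') _.
  apply: ler_wpM2r; first exact: normH1_ge0.
  by apply: ler_wpM2r; [exact: normH1_ge0|exact: ler_norm].
move=> g sg; have [u [[Vu eu] Su nu]] := reg (Some n) ((Lp2P D g).2 sg) Ow.
exists u; split; [exact: Vu|exact: ((Sobolev22P oD bD u).1 Su)| |exact: eu].
apply: le_trans nu _; apply: ler_wpM2r; first exact: normL2_ge0.
have nc := normW1oo_ge0 D (coef n w).
have h1 : 1 + normW1oo D (coef n w) <= 1 + coef_sup D r Ckl phi.
  rewrite lerD2l; apply: (coef_partial_bound oD bD r1 sphi phi_decay) => j; exact: Omega_norm.
have h2 : 0 <= Amin ^- 2 by rewrite invr_ge0 exprn_ge0// ltW.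
apply: le_trans (ler_wpM2r (addr_ge0 ler01 nc) (ler_wpM2r h2 (ler_norm Creg))) _.
by apply: ler_wpM2l h1; exact: mulr_ge0.
Qed.

(* The spaces and mesh sizes are shifted by one, so that the index [0] stands
   for the level [-1] with the trivial space. *)
Definition space (L : nat) : set F := if L is l.+1 then X l else [set cst 0].
Definition mesh (L : nat) : R := if L is l.+1 then h l else 1.
(** The shift of the index costs the factor [2] in [h l <= c2 2^(-l)]; the maximum with [1] covers
    the level [-1]. *)
Definition mesh_const : R := Num.max 1 (2 * c2).

Lemma mesh_ge0 L : 0 <= mesh L.
Proof. by case: L => [|l] //=; exact: ltW. Qed.

Lemma mesh_const_ge0 : 0 <= mesh_const.
Proof. by rewrite le_max ler01. Qed.

Lemma mesh_le L : mesh L <= mesh_const * 2 ^- L.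
Proof.
case: L => [|l] /=; first by rewrite expr0 invr1 mulr1 le_max lexx.
apply: le_trans (hle l) _; rewrite exprS invfM mulrA; apply: ler_wpM2r.
  by rewrite invr_ge0 exprn_ge0.
by rewrite ler_pdivlMr// mulrC le_max lexx orbT.
Qed.

(** The summand [1] in the constant [K3] serves twice: for the trivial space of mesh size [1], and
    as the slack that selects a near-minimiser, since the infimum need not be attained. *)
Lemma approx_mesh L : approx_space D K3 (mesh L) (space L).
Proof.
have V0 := H10_cst0 oD bD; have K30 : 0 <= K3 by rewrite addr_ge0.
have sub0 (z : F) : z -- (cst 0) = z by apply/funext => x /=; ring.
case: L => [|l] /=.
  split.
  - by move=> _ ->.
  - by [].
  - by move=> a v w -> ->; apply/funext => x /=; rewrite mulr0 addr0.
  - move=> z hz h2z; exists (cst 0) => //; rewrite sub0 mulr1.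
    apply: le_trans (normH1_le_H2 D z) _; rewrite -[leLHS]mul1r.
    by apply: ler_wpM2r; [exact: normH2_ge0|rewrite lerDr].
split; [exact: XV|exact: X0|exact: Xl|].
move=> z hz h2z; set n := normH2 D z.
have n0 : 0 <= n := normH2_ge0 D z.
(* Without a positive norm there is no slack, but then the zero function already approximates [z]
   exactly. *)
have [n_eq0|n_ne0] := eqVneq n 0.
  exists (cst 0); first exact: X0.
  rewrite sub0; apply: le_trans (normH1_le_H2 D z) _.
  by rewrite -/n n_eq0 mulr0.
have n_gt0 : 0 < n by rewrite lt0r n_ne0.
set S := [set nH1 (z \- v) | v in X l].
have hS : has_inf S.
  split; first by exists (nH1 (z \- cst 0)); exists (cst 0) => //; exact: X0.
  by exists 0 => _ [v _ <-]; exact: normH1_ge0.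
have [_ [v Xv <-] lt_v] := inf_adherent (mulr_gt0 (h0 l) n_gt0) hS.
exists v => //; rewrite (_ : z -- v = z \- v); last by apply/funext => x /=; ring.
apply: le_trans (ltW lt_v) _.
have h3 := approx l ((Sobolev22P oD bD z).2 h2z) hz.
have h4 : Capprox * h l * n <= `|Capprox| * h l * n.
  exact: (ler_wpM2r n0 (ler_wpM2r (ltW (h0 l)) (ler_norm Capprox))).
have h5 := le_trans h3 h4.
by rewrite (mulrDl `|Capprox|) mul1r mulrDl; apply: lerD h5 (lexx _).
Qed.

Lemma space_sub L v w : space L v -> space L w -> space L (v -- w).
Proof. exact: (approx_space_sub (approx_mesh L)). Qed.

Lemma space_V L : space L `<=` V.
Proof. by case: (approx_mesh L). Qed.

Lemma coercive_coef nu w : Omega w -> Lp D +oo%E (coefficient phi r A nu w) ->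
  coercive D Amin (coefficient phi r A nu w).
Proof. by move=> Ow lc; split; [exact: lc|move=> v hv; exact: (coer nu Ow hv)]. Qed.

Lemma lipschitzB s L1 L2 H1 H2 : lipschitz_cube s L1 H1 -> lipschitz_cube s L2 H2 ->
  lipschitz_cube s (L1 + L2) (fun w : param R => H1 w - H2 w).
Proof.
move=> h1 h2 x y Ox Oy; rewrite (_ : _ - _ = (H1 x - H1 y) - (H2 x - H2 y)); last by ring.
by apply: le_trans (ler_normB _ _) _; rewrite mulrDl; exact: lerD (h1 x y Ox Oy) (h2 x y Ox Oy).
Qed.

Lemma lipschitz_widen s s' L (H : param R -> R) : (s <= s')%N -> 0 <= L ->
  lipschitz_cube s L H -> lipschitz_cube s' L H.
Proof.
move=> ss' L0 hH x y Ox Oy; apply: le_trans (hH x y Ox Oy) _; apply: ler_wpM2l => //.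
rewrite -!(big_mkord xpredT (fun j => `|x j - y j|)) (@big_cat_nat _ _ _ s 0 s')//= lerDl.
by apply: sumr_ge0.
Qed.

(** * Values of the functional for given solutions, and their means *)

Section solutions.
Variables (f g : F) (u : param R -> F) (U : nat -> nat -> param R -> F).
Hypotheses (sf : L2 f) (sg : L2 g).
Hypothesis su : forall w, Omega w -> galerkin_solution D (A w) f V (u w).
Hypothesis sU : forall nu l w, Omega w -> galerkin_solution D (coef nu w) f (X l) (U nu l w).
Local Notation Q := (n2 f * n2 g).

Definition galerkin (nu L : nat) (w : param R) : F := if L is l.+1 then U nu l w else cst 0.
(** The exact solutions for the truncated coefficients are not among the given data; they are chosen
    by means of the regularity hypothesis. *)
Definition exact (nu : nat) (w : param R) : F :=
  xget (cst 0) [set v | galerkin_solution D (coef nu w) f V v].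

Lemma exactP nu w : Omega w -> galerkin_solution D (coef nu w) f V (exact nu w).
Proof.
move=> Ow; have [v [hv _ _]] := reg (Some nu) ((Lp2P D f).2 sf) Ow.
exact: (xgetPex (cst 0) (ex_intro _ v hv)).
Qed.

Lemma galerkinP nu L w : Omega w -> galerkin_solution D (coef nu w) f (space L) (galerkin nu L w).
Proof.
move=> Ow; case: L => [|l] /=; last exact: sU.
split => // v ->; rewrite (pairing_cst0 oD).
have lc : Lp D +oo%E (coef nu w) := (W1oo_partial oD bD sphi _ w).1.
have h00 := H10_H1 oD bD (H10_cst0 oD bD).
rewrite {2}(_ : cst 0 = fun x => 0 * cst 0 x + 0 * cst 0 x); last by apply/funext => x /=; ring.
by rewrite (form_linr oD bD 0 0 lc h00 h00 h00) !mul0r addr0.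
Qed.

Definition exact_value nu w := pairing D g (exact nu w).
Definition galerkin_value nu L w := pairing D g (galerkin nu L w).
Definition error_value nu L w := exact_value nu w - galerkin_value nu L w.
Definition lipschitz_const : R := d%:R / Amin ^+ 2 * n2 f * n2 g * Ckl.

Let Q0 : 0 <= Q. Proof. exact: (mulr_ge0 (normL2_ge0 D f) (normL2_ge0 D g)). Qed.

Let dA0 : 0 <= d%:R / Amin ^+ 2 * n2 f * n2 g.
Proof.
apply: mulr_ge0 (normL2_ge0 D g); apply: mulr_ge0 (normL2_ge0 D f).
by rewrite divr_ge0// exprn_ge0// ltW.
Qed.

Lemma lipschitz_const_ge0 : 0 <= lipschitz_const.
Proof. exact: (mulr_ge0 dA0 (Ckl_ge0 phi_decay)). Qed.

Let solution_lipschitz nu (Y : set F) (W : param R -> F) : Y `<=` V ->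
  (forall v w, Y v -> Y w -> Y (v -- w)) ->
  (forall w, Omega w -> galerkin_solution D (coef nu w) f Y (W w)) ->
  lipschitz_cube (dimension r nu%:Z) lipschitz_const (fun w => pairing D g (W w)).
Proof.
move=> YV Ys sW x y Ox Oy.
have [b [hb E nb]] := coef_lipschitz oD bD r1 sphi phi_decay (dimension r nu%:Z) x y.
have lx := (W1oo_partial oD bD sphi (dimension r nu%:Z) x).1.
have ly := (W1oo_partial oD bD sphi (dimension r nu%:Z) y).1.
have cx := @coercive_coef (Some nu) x Ox lx; have cy := @coercive_coef (Some nu) y Oy ly.
rewrite distrC; apply: le_trans (pairing_perturb oD bD Amin0 cy cx sf sg YV Ys hb.1 E (sW y Oy) (sW x Ox)) _.
rewrite /lipschitz_const -[leRHS]mulrA; apply: ler_wpM2l; first exact: dA0.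
exact: (le_trans (normLoo_le_W1oo D b) nb).
Qed.

Lemma galerkin_value_lipschitz nu L :
  lipschitz_cube (dimension r nu%:Z) lipschitz_const (galerkin_value nu L).
Proof.
apply: (solution_lipschitz (@space_V L) (@space_sub L)) => w Ow; exact: galerkinP.
Qed.

Lemma exact_value_lipschitz nu : lipschitz_cube (dimension r nu%:Z) lipschitz_const (exact_value nu).
Proof.
apply: (solution_lipschitz (Y := V)) => [//||w Ow]; last exact: exactP.
exact: (H10_lin oD bD).
Qed.

Lemma lipschitz_eq s L H (x y : param R) : lipschitz_cube s L H -> Omega x -> Omega y ->
  (forall j, (j < s)%N -> x j = y j) -> H x = H y.
Proof.
move=> hH Ox Oy xy; apply/eqP; rewrite -subr_eq0 -normr_le0; apply: le_trans (hH x y Ox Oy) _.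
by rewrite big1 ?mulr0// => j _; rewrite xy// subrr normr0.
Qed.

Lemma flip_Omega s (x : param R) : Omega x -> Omega (flip s x : param R).
Proof. by move=> Ox j; rewrite /flip; case: ifP => // _; rewrite lerN2 lerNl andbC. Qed.

Local Notation Kc := (@step_const R d Amin K1 K2 K3).
Definition first_const : R := Kc * K2.
(** The constant of [second_difference], with the prefactor of [eps = Ckl / (r - 1) * 2 ^- m]
    squared and included. *)
Definition second_const : R := Kc * (8 * d%:R ^+ 2 * K2 ^+ 3 +
  Kc * (4 * d%:R * K2 ^+ 2 + 4 * (Kc * K2))) * (Ckl / (r - 1)) ^+ 2.

Let K30 : 0 <= K3. Proof. by rewrite addr_ge0. Qed.
Let V1 v : V v -> H1 D v. Proof. exact: (H10_H1 oD bD). Qed.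
Let pairD v w : V v -> V w -> pairing D g (v ++ w) = pairing D g v + pairing D g w.
Proof.
move=> hv hw; apply: etrans (pairing_lin oD 1 1 sg (H1_sqint (V1 hv)) (H1_sqint (V1 hw))) _.
exact: (congr2 +%R (mul1r _) (mul1r _)).
Qed.
Let pairB v w : V v -> V w -> pairing D g (v -- w) = pairing D g v - pairing D g w.
Proof. exact: (pairing_sub oD bD sg). Qed.

Let Vexact nu w : Omega w -> V (exact nu w).
Proof. by move=> Ow; case: (exactP nu Ow). Qed.
Let Vgalerkin nu L w : Omega w -> V (galerkin nu L w).
Proof. by move=> Ow; case: (galerkinP nu L Ow) => /space_V. Qed.
Let Verr nu L w : Omega w -> V (exact nu w -- galerkin nu L w).
Proof. by move=> Ow; exact: (H10_lin oD bD 1 (-1) (Vexact nu Ow) (Vgalerkin nu L Ow)). Qed.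

Let error_valueE nu L w : Omega w -> pairing D g (exact nu w -- galerkin nu L w) = error_value nu L w.
Proof. by move=> Ow; exact: (pairB (Vexact nu Ow) (Vgalerkin nu L Ow)). Qed.

Lemma first_error_value nu L w : Omega w -> `|error_value nu L w| <= first_const * mesh L ^+ 2 * Q.
Proof.
move=> Ow; have [_ _ hE] := first_error oD bD Amin0 (normr_ge0 _) regularity_const_ge0 K30 (mesh_ge0 L)
  (elliptic_coef nu Ow) (approx_mesh L) (W1oo_phi oD bD sphi 0) sf (exactP nu Ow) (galerkinP nu L Ow).
rewrite -(error_valueE nu L Ow); apply: le_trans (hE g sg) _.
by apply: eq_le2; rewrite /first_const; ring.
Qed.

(** Stated for arbitrary levels [m <= n], not only for neighbours: the truncation error of the mean
    is obtained by letting [n] grow with [m] fixed. *)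
Lemma second_error_value m n L w : (m <= n)%N -> Omega w ->
  `|error_value n L w + error_value n L (flip (dimension r m%:Z) w : param R)
    - (error_value m L w + error_value m L w)| <= second_const * (2 ^- m) ^+ 2 * mesh L ^+ 2 * Q.
Proof.
move=> mn Ow; set s' := dimension r m%:Z; set s := dimension r n%:Z.
have ss' : (s' <= s)%N by apply: dimension_homo.
have s'0 : (0 < s')%N by exact: dimension_gt0.
set fw := (flip s' w : param R); have Ofw : Omega fw by exact: flip_Omega.
set b := coef_tail phi s' s w.
have [hb _] := coef_tail_sum oD bD sphi s' s w.
have Ep := partial_coefficientE phi w ss'.
(* The flip fixes the coordinates below [s'] and negates those of the tail, so the coefficient at
   the flipped point is the reflection [a0 - b]. *)
have Em : partial_coefficient phi s fw = (fun x => 1 * partial_coefficient phi s' w x + (-1) * b x).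
  rewrite (partial_coefficientE phi fw ss'); apply/funext => x.
  congr (_ * _ + _).
    rewrite /partial_coefficient; congr (_ + _); apply: eq_bigr => j _.
    by rewrite /fw /flip ltn_ord.
  rewrite mul1r mulN1r /b /coef_tail -sumrN big_nat [RHS]big_nat; apply: eq_bigr => j /andP[js _].
  by rewrite /fw /flip ltnNge js/= mulNr.
have nb : normW1oo D b <= Ckl / (r - 1) * 2 ^- m.
  apply: le_trans (coef_tail_bound oD bD r1 sphi phi_decay s s'0 (fun j => Omega_norm j Ow)) _.
  apply: ler_wpM2l; last exact: dimension_powR.
  by rewrite divr_ge0 ?(Ckl_ge0 phi_decay)// subr_ge0 ltW.
have [_ _ hE] := second_difference oD bD Amin0 (normr_ge0 _) regularity_const_ge0 K30 (mesh_ge0 L)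
  (elliptic_coef m Ow) (elliptic_coef n Ow) (elliptic_coef n Ofw) (approx_mesh L) hb nb sf Ep Em
  (exactP m Ow) (exactP n Ow) (exactP n Ofw) (galerkinP m L Ow) (galerkinP n L Ow) (galerkinP n L Ofw).
have := hE g sg.
have Vp := Verr n L Ow; have Vm := Verr n L Ofw; have V0 := Verr m L Ow.
rewrite (pairB (H10_lin oD bD 1 1 Vp Vm) (H10_lin oD bD 1 1 V0 V0)) (pairD Vp Vm) (pairD V0 V0).
rewrite (error_valueE n L Ow) (error_valueE n L Ofw) (error_valueE m L Ow) => hQ.
by apply: le_trans hQ _; apply: eq_le2; rewrite /second_const; ring.
Qed.

Variables (P : probability (param R) R).
Hypothesis PU : product_uniform P.
Hypothesis hA : forall w, Omega w -> Sobolev D 1 +oo%E (A w) /\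
  (normW1oo D (A w \- partial_coefficient phi n w) @[n --> \oo] --> 0).
Local Notation EP H := (Rintegral P (@Omega R) H).

Let mO := @measurable_Omega R.
Let PO : P (@Omega R) = 1%E := Omega_prob PU.
Let LL0 := lipschitz_const_ge0.

Definition mean_exact nu := EP (exact_value nu).
Definition mean_galerkin nu L := EP (galerkin_value nu L).
Definition mean_error nu L := mean_exact nu - mean_galerkin nu L.

Let int_lip s L H : 0 <= L -> lipschitz_cube s L H -> P.-integrable (@Omega R) (EFin \o H).
Proof. by move=> L0 hH; exact: (int_lipschitz mO PO (uniform_coords_param PU s) L0 hH). Qed.

Lemma error_value_lipschitz nu L :
  lipschitz_cube (dimension r nu%:Z) (lipschitz_const + lipschitz_const) (error_value nu L).
Proof. exact: lipschitzB (exact_value_lipschitz nu) (galerkin_value_lipschitz nu L). Qed.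

Let E2 : 0 <= lipschitz_const + lipschitz_const. Proof. exact: addr_ge0. Qed.

Lemma mean_errorE nu L : mean_error nu L = EP (error_value nu L).
Proof.
rewrite /mean_error /mean_exact /mean_galerkin -(RintegralB mO)//.
  exact: int_lip LL0 (exact_value_lipschitz nu).
exact: int_lip LL0 (galerkin_value_lipschitz nu L).
Qed.

Lemma mean_error0 nu : mean_error nu 0 = mean_exact nu.
Proof.
rewrite /mean_error (_ : mean_galerkin nu 0 = 0) ?subr0//.
rewrite /mean_galerkin (@eq_Rintegral _ _ _ P (@Omega R) (fun=> 0)).
  by rewrite (Rintegral_cst _ mO) mul0r.
by move=> w _; rewrite /galerkin_value /= (pairing_cst0 oD).
Qed.

Lemma galerkin_pairingE nu L w : pairing D g (galerkin nu L w) = exact_value nu w - error_value nu L w.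
Proof. by rewrite /error_value opprB addrC subrK. Qed.

Local Opaque exact_value galerkin_value error_value.

Lemma mean_error_first nu L : `|mean_error nu L| <= first_const * mesh L ^+ 2 * Q.
Proof.
rewrite mean_errorE; apply: (norm_expectation_le mO PO (int_lip E2 (error_value_lipschitz nu L))).
by move=> w Ow; exact: first_error_value.
Qed.

Lemma mean_flip s s' L H : 0 <= L -> lipschitz_cube s L H ->
  EP (fun w => H (flip s' w : param R)) = EP H.
Proof. by move=> L0 hH; exact: (uniform_coords_flip s' mO PO (uniform_coords_param PU s) L0 hH). Qed.

Lemma lipschitz_flip s s' L H : 0 <= L -> lipschitz_cube s L H ->
  lipschitz_cube s L (fun w => H (flip s' w : param R)).
Proof.
move=> L0 hH x y Ox Oy; apply: le_trans (hH _ _ (flip_Omega s' Ox) (flip_Omega s' Oy)) _.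
apply: ler_wpM2l => //; apply: ler_sum => j _; rewrite /flip; case: ifP => // _.
by rewrite -opprD normrN.
Qed.

(* By invariance under the flip, the difference of two means is half the mean of a
   second difference. *)
Lemma mean_error_second m n L : (m <= n)%N ->
  `|mean_error n L - mean_error m L| <= second_const * (2 ^- m) ^+ 2 * mesh L ^+ 2 * Q.
Proof.
move=> mn; set B := _ * Q.
have hn := error_value_lipschitz n L; have hm := error_value_lipschitz m L.
have i1 := int_lip E2 hn; have i2 := int_lip E2 hm.
have i3 := int_lip E2 (lipschitz_flip (dimension r m%:Z) E2 hn).
have e : EP (fun w => error_value n L w + error_value n L (flip (dimension r m%:Z) w : param R)
    - (error_value m L w + error_value m L w)) = 2 * (mean_error n L - mean_error m L).
  rewrite (RintegralB mO (int_add mO i1 i3) (int_add mO i2 i2)) (RintegralD mO i1 i3) (RintegralD mO i2 i2).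
  have e1 := mean_flip (dimension r m%:Z) E2 hn.
  apply: etrans (congr2 (fun a b => a - b) (congr2 +%R (esym (mean_errorE n L)) (etrans e1 (esym (mean_errorE n L))))
    (congr2 +%R (esym (mean_errorE m L)) (esym (mean_errorE m L)))) _.
  exact: double_sub.
have := norm_expectation_le mO PO (int_sub mO (int_add mO i1 i3) (int_add mO i2 i2))
  (fun w Ow => second_error_value L mn Ow).
rewrite [X in `|X|]e -/B normrM ger0_norm// => hB.
have := normr_ge0 (mean_error n L - mean_error m L); move: (`|_|) hB => t; lra.
Qed.

Definition limit_const : R := d%:R / Amin ^+ 2 * n2 f * n2 g * (Ckl / (r - 1)).

(** The coefficient [A w] is approached by partial sums of large index [k], and the tail between [s]
    and [k] is bounded independently of [k]. *)
Lemma coefficient_limit n w : Omega w ->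
  normW1oo D (A w -- partial_coefficient phi (dimension r n%:Z) w) <= Ckl / (r - 1) * 2 ^- n.
Proof.
move=> Ow; have [sA cA] := hA Ow; set s := dimension r n%:Z.
have WA : W1oo D (A w) := (Sobolev1ooP oD bD (A w)).1 sA.
have p0 : 0 <= Ckl / (r - 1) by rewrite divr_ge0 ?(Ckl_ge0 phi_decay)// subr_ge0 ltW.
apply/ler_addgt0Pl => e e0.
have /cvgrPdist_lt/(_ e e0) [K _ hK] := cA.
pose k := maxn K s; have := hK k (leq_maxl _ _); rewrite /= sub0r normrN ger0_norm ?normW1oo_ge0// => hk.
have sk : (s <= k)%N by exact: leq_maxr.
have Wk := W1oo_partial oD bD sphi k w.
have [Wt nt] := coef_tail_sum oD bD sphi s k w.
have [WB _] := W1oo_lin oD bD 1 (-1) WA Wk.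
have := (W1oo_lin oD bD 1 1 WB Wt).2.
have -> : A w -- partial_coefficient phi s w = (A w -- partial_coefficient phi k w) ++ coef_tail phi s k w.
  by apply/funext => z; rewrite (partial_coefficientE phi w sk); ring.
rewrite normr1 !mul1r => hW; apply: le_trans hW _; apply: lerD.
  rewrite (_ : A w -- partial_coefficient phi k w = A w \- partial_coefficient phi k w); first exact: ltW.
  by apply/funext => z /=; ring.
apply: le_trans (coef_tail_bound oD bD r1 sphi phi_decay k (dimension_gt0 r n%:Z) (fun j => Omega_norm j Ow)) _.
exact: (ler_wpM2l p0 (dimension_powR n r1)).
Qed.

(** Only a rate linear in [2 ^- n]. It serves to pass to the limit and for integrability, not for
    the final order. *)
Lemma exact_value_limit n w : Omega w ->
  `|exact_value n w - pairing D g (u w)| <= limit_const * 2 ^- n.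
Proof.
move=> Ow; have [sA _] := hA Ow; have WA : W1oo D (A w) := (Sobolev1ooP oD bD (A w)).1 sA.
have Wn := W1oo_partial oD bD sphi (dimension r n%:Z) w.
have [Wd _] := W1oo_lin oD bD 1 (-1) WA Wn.
have cn := @coercive_coef (Some n) w Ow Wn.1; have cA := @coercive_coef None w Ow WA.1.
have E : A w = coef n w ++ (A w -- partial_coefficient phi (dimension r n%:Z) w).
  by apply/funext => z /=; ring.
apply: le_trans (pairing_perturb oD bD Amin0 cn cA sf sg (fun _ h => h) (H10_lin oD bD 1 (-1)) Wd.1 E
  (exactP n Ow) (su Ow)) _.
rewrite /limit_const -[leRHS]mulrA; apply: ler_wpM2l; first exact: dA0.
exact: (le_trans (normLoo_le_W1oo D _) (coefficient_limit n Ow)).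
Qed.

Lemma limit_const_ge0 : 0 <= limit_const.
Proof. by rewrite mulr_ge0// divr_ge0 ?(Ckl_ge0 phi_decay)// subr_ge0 ltW. Qed.

Let pow2_cvg (C e : R) : 0 <= C -> 0 < e -> exists k : nat, C * 2 ^- k <= e.
Proof.
move=> C0 e0; have [k hk] := inv_cvg0 C0 e0; exists k; apply: le_trans hk; apply: ler_wpM2l => //.
rewrite lef_pV2 ?posrE ?exprn_gt0//.
by rewrite -natrX ler_nat ltn_expl.
Qed.

(** Measurability for the full coefficient, which depends on infinitely many coordinates, is
    inherited from the truncated values by pointwise convergence; boundedness follows from level
    [0]. *)
Lemma int_exact_limit : P.-integrable (@Omega R) (EFin \o (fun w => pairing D g (u w))).
Proof.
have mlim : measurable_fun (@Omega R : set (param R)) (fun w => pairing D g (u w)).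
  apply/measurable_EFinP.
  apply: (@emeasurable_fun_cvg _ _ _ _ (fun n => EFin \o exact_value n)).
    by move=> n; apply/measurable_EFinP;
      exact: (measurable_lipschitz mO (uniform_coords_param PU _) LL0 (exact_value_lipschitz n)).
  move=> w Ow; apply: cvg_EFin; first by near=> k.
  apply/cvgrPdist_le => e e0 /=.
  have [k0 hk0] := pow2_cvg limit_const_ge0 e0.
  near=> k; rewrite distrC; apply: le_trans (exact_value_limit k Ow) _.
  apply: le_trans _ hk0; apply: (ler_wpM2l limit_const_ge0).
  rewrite lef_pV2 ?posrE ?exprn_gt0// ler_eXn2l ?ltr1n//; near: k; exact: nbhs_infty_ge.
have hb := lipschitz_bounded LL0 (exact_value_lipschitz 0).
apply: (int_bounded mO PO mlim) => w Ow.
have h1 := exact_value_limit 0 Ow; have h2 := hb w Ow.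
rewrite -[pairing D g (u w)](subrK (exact_value 0 w)).
by apply: le_trans (ler_normD _ _) _; rewrite distrC; exact: lerD h1 h2.
Unshelve. all: by end_near.
Qed.

Lemma mean_exact_limit n : `|mean_exact n - EP (fun w => pairing D g (u w))| <= limit_const * 2 ^- n.
Proof.
have i := int_lip LL0 (exact_value_lipschitz n).
rewrite /mean_exact -(RintegralB mO i int_exact_limit).
by apply: (norm_expectation_le mO PO (int_sub mO i int_exact_limit)) => w Ow; exact: exact_value_limit.
Qed.

(** The linear rate is invoked at a level [k] far beyond [N], where it is as small as desired. From
    [N] to [k], [mean_error_second] is applied on the trivial space: there the error is the exact
    value itself and the mesh size is [1]. *)
Lemma mean_exact_error N : `|mean_exact N - EP (fun w => pairing D g (u w))| <=
  second_const * (2 ^- N) ^+ 2 * Q.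
Proof.
apply/ler_addgt0Pl => e e0; have [k0 hk0] := pow2_cvg limit_const_ge0 e0.
pose k := maxn k0 N.
have h1 := mean_error_second 0 (leq_maxr k0 N : (N <= k)%N).
rewrite (mean_error0 k) (mean_error0 N) /= expr1n mulr1 in h1.
have h2 := mean_exact_limit k.
apply: le_trans (ler_distD (mean_exact k) _ _) _; rewrite addrC; apply: lerD.
  apply: le_trans h2 _; apply: le_trans _ hk0; apply: (ler_wpM2l limit_const_ge0).
  by rewrite lef_pV2 ?posrE ?exprn_gt0// ler_eXn2l ?ltr1n// leq_maxl.
by rewrite distrC.
Qed.

Definition double_value nu l (w : param R) :=
  pairing D g (double_difference (fun a b => U a b w) nu l).

(** The parameter level is shifted by one as well, so that the index [0] carries the value zero of
    the level [-1]. *)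
Definition shifted_value (a L : nat) (w : param R) : R :=
  if a is nu.+1 then pairing D g (galerkin nu L w) else 0.

Let V0 : V (cst 0). Proof. exact: (H10_cst0 oD bD). Qed.

Let pairBf v w : V v -> V w -> V (v \- w) /\ pairing D g (v \- w) = pairing D g v - pairing D g w.
Proof.
move=> hv hw; have E : v \- w = v -- w by apply/funext => x /=; ring.
by rewrite E; split; [exact: (H10_lin oD bD)|exact: pairB].
Qed.

Lemma double_valueE nu l w : Omega w -> double_value nu l w =
  (shifted_value nu.+1 l.+1 w - shifted_value nu.+1 l w) -
  (shifted_value nu l.+1 w - shifted_value nu l w).
Proof.
move=> Ow.
have [v1 e1] := pairBf (Vgalerkin nu l.+1 Ow) (Vgalerkin nu l Ow).
case: nu v1 e1 => [|nu] v1 e1.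
  have [v2 e2] := pairBf V0 V0; have [_ e3] := pairBf v1 v2.
  by apply: etrans e3 _; rewrite e1 e2 !(pairing_cst0 oD).
have [v2 e2] := pairBf (Vgalerkin nu l.+1 Ow) (Vgalerkin nu l Ow); have [_ e3] := pairBf v1 v2.
by apply: etrans e3 _; rewrite e1 e2.
Qed.

Lemma shifted_value_lipschitz nu L :
  lipschitz_cube (dimension r nu%:Z) lipschitz_const (shifted_value nu.+1 L) /\
  lipschitz_cube (dimension r nu%:Z) lipschitz_const (shifted_value nu L).
Proof.
split; first exact: galerkin_value_lipschitz.
case: nu => [|nu].
  by move=> x y _ _ /=; rewrite subrr normr0 mulr_ge0// sumr_ge0.
apply: (lipschitz_widen _ LL0 (galerkin_value_lipschitz nu L)).
by apply: dimension_homo => //; rewrite lez_nat.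
Qed.

Definition double_lipschitz : R := (lipschitz_const + lipschitz_const) + (lipschitz_const + lipschitz_const).

Lemma double_lipschitz_ge0 : 0 <= double_lipschitz. Proof. exact: addr_ge0. Qed.

Lemma double_value_lipschitz nu l : lipschitz_cube (dimension r nu%:Z) double_lipschitz (double_value nu l).
Proof.
have [a1 a2] := shifted_value_lipschitz nu l; have [b1 b2] := shifted_value_lipschitz nu l.+1.
have h12 := lipschitzB (lipschitzB b1 a1) (lipschitzB b2 a2).
move=> x y Ox Oy; rewrite (double_valueE nu l Ox) (double_valueE nu l Oy); exact: h12.
Qed.

(** The symmetrized integrand: the rule is the plain Monte Carlo average of it. *)
Definition half_sum nu l (w : param R) : R := 2^-1 * (double_value nu l w +
  double_value nu l (flip (dimension r (nu%:Z - 1)) w : param R)).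

Lemma half_sum_lipschitz nu l : lipschitz_cube (dimension r nu%:Z) double_lipschitz (half_sum nu l).
Proof.
have h1 := double_value_lipschitz nu l.
have h2 := lipschitz_flip (dimension r (nu%:Z - 1)) double_lipschitz_ge0 h1.
move=> x y Ox Oy; rewrite /half_sum -mulrBr normrM ger0_norm ?invr_ge0//.
rewrite mulrC ler_pdivrMr// opprD addrACA; apply: le_trans (ler_normD _ _) _.
by rewrite mulr_natr mulr2n; exact: lerD (h1 x y Ox Oy) (h2 x y Ox Oy).
Qed.

(** The factor [4] converts [(2 ^- nu) ^+ 2] at the lower level into that of the next one. The term
    with [first_const] covers [nu = 0], where a first-order finite element estimate is enough. *)
Definition rule_const : R := mesh_const ^+ 2 * (4 * second_const + 2 * first_const).

Let Kc_ge0 : 0 <= Kc.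
Proof. apply: step_const_ge0; [exact: Amin0|exact: normr_ge0|exact: regularity_const_ge0|exact: K30]. Qed.

Lemma first_const_ge0 : 0 <= first_const.
Proof. exact: (mulr_ge0 Kc_ge0 regularity_const_ge0). Qed.

Lemma second_const_ge0 : 0 <= second_const.
Proof.
have k0 := Kc_ge0; have k2 := regularity_const_ge0.
have t1 : 0 <= 8 * d%:R ^+ 2 * K2 ^+ 3 :=
  mulr_ge0 (mulr_ge0 (ler0n _ 8) (sqr_ge0 _)) (exprn_ge0 3 k2).
have t2 : 0 <= 4 * d%:R * K2 ^+ 2 := mulr_ge0 (mulr_ge0 (ler0n _ 4) (ler0n _ d)) (exprn_ge0 2 k2).
have t3 : 0 <= 4 * (Kc * K2) by exact: (mulr_ge0 (ler0n _ 4) (mulr_ge0 k0 k2)).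
exact: (mulr_ge0 (mulr_ge0 k0 (addr_ge0 t1 (mulr_ge0 k0 (addr_ge0 t2 t3)))) (sqr_ge0 _)).
Qed.

Let mesh_sqr L : mesh L ^+ 2 <= mesh_const ^+ 2 * (2 ^- L) ^+ 2.
Proof. by rewrite -exprMn ler_pXn2r ?nnegrE ?mesh_ge0 ?mesh_le// mulr_ge0 ?mesh_const_ge0// invr_ge0 exprn_ge0. Qed.

Let mesh_sqrS l : mesh l.+1 ^+ 2 + mesh l ^+ 2 <= 2 * (mesh_const ^+ 2 * (2 ^- l) ^+ 2).
Proof.
rewrite mulr_natl mulr2n; apply: lerD (mesh_sqr l).
apply: le_trans (mesh_sqr l.+1) _; apply: ler_wpM2l; first exact: sqr_ge0.
rewrite ler_pXn2r ?nnegrE ?invr_ge0 ?exprn_ge0// lef_pV2 ?posrE ?exprn_gt0//.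
by rewrite ler_eXn2l ?ltr1n.
Qed.

Lemma half_sum_bound nu l w : Omega w ->
  `|half_sum nu l w| <= rule_const * (2 ^- nu) ^+ 2 * (2 ^- l) ^+ 2 * Q.
Proof.
move=> Ow; have c1 := first_const_ge0; have c2' := second_const_ge0.
have Ml := mesh_sqrS l; have l0 : 0 <= (2 ^- l : R) ^+ 2 by exact: sqr_ge0.
have mc0 : 0 <= mesh_const ^+ 2 by exact: sqr_ge0.
case: nu => [|k].
  have DDb (x : param R) : Omega x -> `|double_value 0 l x| <= first_const * (2 * (mesh_const ^+ 2 * (2 ^- l) ^+ 2)) * Q.
    move=> Ox; rewrite (double_valueE 0 l Ox) subrr subr0.
    rewrite /shifted_value !galerkin_pairingE (_ : _ - _ = error_value 0 l x - error_value 0 l.+1 x); last by ring.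
    apply: le_trans (ler_normB _ _) _.
    apply: le_trans (lerD (first_error_value 0 l Ox) (first_error_value 0 l.+1 Ox)) _.
    rewrite -mulrDl -mulrDr; apply: (ler_wpM2r Q0); apply: (ler_wpM2l c1).
    by rewrite addrC.
  have h1 := DDb w Ow; have h2 := DDb _ (flip_Omega (dimension r (0%:Z - 1)) Ow).
  rewrite /half_sum normrM ger0_norm ?invr_ge0// mulrC ler_pdivrMr//.
  apply: le_trans (ler_normD _ _) _; apply: le_trans (lerD h1 h2) _.
  rewrite /rule_const expr0 invr1 expr1n mulr1 -subr_ge0.
  rewrite (_ : _ - _ = 8 * (mesh_const ^+ 2 * second_const * (2 ^- l) ^+ 2 * Q)); last by ring.
  exact: (mulr_ge0 (ler0n _ 8) (mulr_ge0 (mulr_ge0 (mulr_ge0 mc0 c2') l0) Q0)).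
set fw := (flip (dimension r k%:Z) w : param R).
have Ofw : Omega fw by exact: flip_Omega.
have e1 : k.+1%:Z - 1 = k%:Z by rewrite -addn1 PoszD addrK.
(* The values of level [k] depend only on coordinates that the flip leaves fixed. *)
have gf L : shifted_value k.+1 L fw = shifted_value k.+1 L w.
  apply: (lipschitz_eq (galerkin_value_lipschitz k L) Ofw Ow) => j jk.
  by rewrite /fw /flip jk.
pose S L := error_value k.+1 L w + error_value k.+1 L fw - (error_value k L w + error_value k L w).
(* On taking the difference of two meshes the exact values cancel, and what is left is the second
   difference [S] of the errors on each of them. *)
have E : double_value k.+1 l w + double_value k.+1 l fw = S l - S l.+1.
  rewrite (double_valueE k.+1 l Ow) (double_valueE k.+1 l Ofw) !gf /S /shifted_value !galerkin_pairingE.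
  exact: double_sum_identity.
rewrite /half_sum e1 -/fw E normrM ger0_norm ?invr_ge0// mulrC ler_pdivrMr//.
apply: le_trans (ler_normB _ _) _.
apply: le_trans (lerD (second_error_value l (leqnSn k) Ow) (second_error_value l.+1 (leqnSn k) Ow)) _.
rewrite -mulrDl -mulrDr; have k0 : 0 <= (2 ^- k : R) ^+ 2 by exact: sqr_ge0.
have ck : 0 <= second_const * (2 ^- k) ^+ 2 by exact: mulr_ge0.
rewrite (addrC (mesh l ^+ 2)).
apply: le_trans (ler_wpM2r Q0 (ler_wpM2l ck Ml)) _.
have ek : (2 ^- k : R) ^+ 2 = 4 * (2 ^- k.+1) ^+ 2.
  rewrite (_ : 2 ^- k.+1 = 2^-1 * 2 ^- k :> R); last by rewrite exprS invfM.
  by move: (2 ^- k : R) => x; field.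
rewrite /rule_const ek -subr_ge0.
rewrite (_ : _ - _ = 4 * (mesh_const ^+ 2 * first_const * (2 ^- k.+1) ^+ 2 * (2 ^- l) ^+ 2 * Q)); last by ring.
exact: (mulr_ge0 (ler0n _ 4) (mulr_ge0 (mulr_ge0 (mulr_ge0 (mulr_ge0 mc0 c1) (sqr_ge0 _)) l0) Q0)).
Qed.

Definition shifted_mean (a L : nat) : R := if a is nu.+1 then mean_galerkin nu L else 0.

Definition double_mean nu l : R :=
  (shifted_mean nu.+1 l.+1 - shifted_mean nu.+1 l) - (shifted_mean nu l.+1 - shifted_mean nu l).

Lemma double_meanE nu l : EP (double_value nu l) = double_mean nu l.
Proof.
have i1 k L : P.-integrable (@Omega R) (EFin \o shifted_value k L).
  have Poo : (P (@Omega R) < +oo)%E by rewrite PO ltry.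
  by case: k => [|k]; [exact: (integrable_cst_fin mO Poo 0)|exact: (int_lip LL0 (galerkin_value_lipschitz k L))].
have e1 k L : EP (shifted_value k L) = shifted_mean k L.
  by case: k => [|k] //; rewrite (Rintegral_cst _ mO) mul0r.
rewrite (@eq_Rintegral _ _ _ P (@Omega R) (fun w => (shifted_value nu.+1 l.+1 w - shifted_value nu.+1 l w) -
  (shifted_value nu l.+1 w - shifted_value nu l w))); last by move=> w /set_mem Ow; exact: double_valueE.
rewrite (RintegralB mO (int_sub mO (i1 _ _) (i1 _ _)) (int_sub mO (i1 _ _) (i1 _ _))).
by rewrite (RintegralB mO (i1 _ _) (i1 _ _)) (RintegralB mO (i1 _ _) (i1 _ _)) !e1.
Qed.

Lemma half_sum_mean nu l : EP (half_sum nu l) = double_mean nu l.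
Proof.
have h1 := double_value_lipschitz nu l; have D0 := double_lipschitz_ge0.
have i1 := int_lip D0 h1; have i2 := int_lip D0 (lipschitz_flip (dimension r (nu%:Z - 1)) D0 h1).
have e := mean_flip (dimension r (nu%:Z - 1)) D0 h1.
rewrite /half_sum (RintegralZl _ mO (int_add mO i1 i2)) (RintegralD mO i1 i2).
apply: etrans (congr1 (fun t => 2^-1 * (_ + t)) e) _.
by rewrite double_meanE; field.
Qed.

Definition bias_const : R := mesh_const ^+ 2 * (first_const + second_const) + second_const.

(** For fixed [nu] the sum over [l] telescopes to the finest admissible mesh. Splitting the result
    into exact means and errors, the exact means telescope in [nu], and the differences of errors
    stay on the diagonal. *)
Lemma sum_double_mean N : \sum_(l < N.+1) \sum_(nu < N.+1 | (l + nu <= N)%N) double_mean nu l =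
  mean_exact N - mean_error 0 N.+1 - \sum_(k < N) (mean_error k.+1 (N - k) - mean_error k (N - k)).
Proof.
pose t nu L := shifted_mean nu.+1 L - shifted_mean nu L.
have t0 nu : t nu 0 = 0.
  have g0 k : mean_galerkin k 0 = 0.
    by have := mean_error0 k; rewrite /mean_error => /eqP; rewrite subr_eq addrC -subr_eq subrr => /eqP.
  by rewrite /t; case: nu => [|nu] /=; rewrite !g0 subrr.
rewrite (exchange_big_dep xpredT)//=.
transitivity (\sum_(nu < N.+1) t nu (N - nu).+1).
  apply: eq_bigr => nu _; have nuN : (nu <= N)%N by rewrite -ltnS.
  rewrite (eq_bigr (fun l : 'I_N.+1 => t nu l.+1 - t nu l)); last first.
    by move=> l _; exact: sub_swap.
  rewrite (eq_bigl (fun l : 'I_N.+1 => (l < (N - nu).+1)%N)); last first.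
    by move=> l; exact: leq_add_sub.
  rewrite -(big_ord_widen N.+1 (fun l => t nu l.+1 - t nu l)); last by rewrite ltnS leq_subr.
  rewrite -(big_mkord xpredT (fun l => t nu l.+1 - t nu l)) telescope_sumr//.
  by rewrite t0 subr0.
have t_0 L : t 0 L = mean_exact 0 - mean_error 0 L by rewrite /mean_error subKr /t subr0.
have t_S k L : t k.+1 L = (mean_exact k.+1 - mean_exact k) - (mean_error k.+1 L - mean_error k L).
  exact: (esym (sub_sub_cancel _ _ _ _)).
(* For the parameter level [k.+1] the finest mesh level is [N - k.+1], whose shifted index is
   [N - k]. *)
rewrite big_ord_recl subn0 t_0 (eq_bigr (fun k : 'I_N => (mean_exact k.+1 - mean_exact k) -
   (mean_error k.+1 (N - k) - mean_error k (N - k)))); last first.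
  by move=> k _; rewrite lift0 t_S subnSK.
rewrite big_split/= sumrN -(big_mkord xpredT (fun k => mean_exact k.+1 - mean_exact k)) telescope_sumr//.
exact: telescope_identity.
Qed.

(** On the diagonal [2^(-2 k) 2^(-2 (N - k)) = 2^(-2 N)], so all [N] differences have the same size;
    this explains the factor [N.+1%:R]. *)
Lemma bias_bound N :
  `|\sum_(l < N.+1) \sum_(nu < N.+1 | (l + nu <= N)%N) double_mean nu l - EP (fun w => pairing D g (u w))|
  <= bias_const * N.+1%:R * (2 ^- N) ^+ 2 * Q.
Proof.
have c1 := first_const_ge0; have c2' := second_const_ge0.
have mc0 : 0 <= mesh_const ^+ 2 by exact: sqr_ge0.
have N0 : 0 <= (2 ^- N : R) ^+ 2 by exact: sqr_ge0.
have q0 := Q0.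
rewrite sum_double_mean.
rewrite (_ : _ - _ - _ - _ = (mean_exact N - EP (fun w => pairing D g (u w))) -
  mean_error 0 N.+1 - \sum_(k < N) (mean_error k.+1 (N - k) - mean_error k (N - k))); last by ring.
apply: le_trans (ler_normB _ _) _; apply: le_trans (lerD (ler_normB _ _) (ler_norm_sum _ _ _)) _.
have b1 := mean_exact_error N.
have b2 : `|mean_error 0 N.+1| <= mesh_const ^+ 2 * first_const * (2 ^- N) ^+ 2 * Q.
  have p2 : (2 ^- N.+1 : R) ^+ 2 <= (2 ^- N) ^+ 2.
    rewrite ler_pXn2r ?nnegrE ?invr_ge0 ?exprn_ge0// lef_pV2 ?posrE ?exprn_gt0//.
    by rewrite ler_eXn2l ?ltr1n.
  apply: le_trans (mean_error_first 0 N.+1) _.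
  apply: le_trans (ler_wpM2r q0 (ler_wpM2l c1 (le_trans (mesh_sqr N.+1) (ler_wpM2l mc0 p2)))) _.
  by apply: eq_le2; ring.
have b3 (k : 'I_N) : `|mean_error k.+1 (N - k) - mean_error k (N - k)| <= mesh_const ^+ 2 * second_const * (2 ^- N) ^+ 2 * Q.
  apply: le_trans (mean_error_second (N - k) (leqnSn k)) _; apply: ler_wpM2r => //.
  have ck : 0 <= second_const * (2 ^- k) ^+ 2 by rewrite mulr_ge0 ?sqr_ge0.
  apply: le_trans (ler_wpM2l ck (mesh_sqr (N - k))) _; apply: eq_le2.
  have -> : (2 ^- N : R) = 2 ^- k * 2 ^- (N - k) by rewrite -invfM -exprD subnKC// ltnW.
  by ring.
apply: le_trans (lerD (lerD b1 b2) (ler_sum _ (fun k _ => b3 k))) _.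
rewrite sumr_const card_ord -[_ *+ N]mulr_natl -natr1 -subr_ge0 /bias_const.
rewrite (_ : _ - _ = ((N%:R * (mesh_const ^+ 2 * first_const + second_const)) + mesh_const ^+ 2 * second_const) * ((2 ^- N) ^+ 2 * Q)); last by ring.
apply: mulr_ge0 (mulr_ge0 N0 q0); apply: addr_ge0 (mulr_ge0 mc0 c2').
exact: (mulr_ge0 (ler0n _ N) (addr_ge0 (mulr_ge0 mc0 c1) c2')).
Qed.

Lemma rule_const_ge0 : 0 <= rule_const.
Proof.
exact: (mulr_ge0 (sqr_ge0 _) (addr_ge0 (mulr_ge0 (ler0n _ 4) second_const_ge0) (mulr_ge0 (ler0n _ 2) first_const_ge0))).
Qed.

Lemma bias_const_ge0 : 0 <= bias_const.
Proof.
exact: (addr_ge0 (mulr_ge0 (sqr_ge0 _) (addr_ge0 first_const_ge0 second_const_ge0)) second_const_ge0).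
Qed.

(** * Sampling error of the multi-index estimator *)

Section monte_carlo_error.
Variables (disp : measure_display) (S : measurableType disp) (Pmc : probability S R).
Variables (x : nat -> nat -> nat -> nat -> {RV Pmc >-> R}) (N : nat).
Hypothesis iid : forall nu m, iid_uniform (2 ^ m) (dimension r nu%:Z) (x nu m).

Local Notation pts l nu := (samples (N - l - nu)).
Local Notation EM H := (Rintegral Pmc setT H).

Definition rule l nu (t : S) : R :=
  symmetrized_rule (dimension r (nu%:Z - 1)) (dimension r nu%:Z) (2 ^ pts l nu)
    (fun i j => x nu (pts l nu) i j t) (double_value nu l).

Let row l nu i t : param R := extend (dimension r nu%:Z) (fun j => x nu (pts l nu) i j t).

(** Extension by zero commutes with the flip, because zero is its own negative. *)
Lemma ruleE l nu t : rule l nu t = ((2 ^ pts l nu)%N%:R)^-1 *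
  \sum_(i < 2 ^ pts l nu) half_sum nu l (row l nu i t).
Proof.
rewrite /rule /symmetrized_rule invfM -mulrA mulrCA; congr (_ * _).
rewrite mulr_sumr; apply: eq_bigr => i _; rewrite /half_sum; congr (_ * (_ + double_value nu l _)).
apply/funext => j; rewrite /row /extend /flip; case: ifP => //.
by rewrite oppr0 if_same.
Qed.

Let PM1 : Pmc setT = 1%E. Proof. exact: probability_setT. Qed.
Let PMoo : (Pmc setT < +oo)%E. Proof. by rewrite PM1 ltry. Qed.

Lemma measurable_rule l nu : measurable_fun setT (rule l nu).
Proof.
rewrite (_ : rule l nu = fun t => ((2 ^ pts l nu)%N%:R)^-1 *
  \sum_(i < 2 ^ pts l nu) half_sum nu l (row l nu i t)); last by apply/funext => t; exact: ruleE.
apply: measurable_funM; first exact: measurable_cst.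
apply: measurable_sum => i.
exact: (measurable_lipschitz measurableT (uniform_coords_row (iid nu (pts l nu)) i) double_lipschitz_ge0
  (half_sum_lipschitz nu l)).
Qed.

Lemma rule_variance l nu : (l + nu <= N)%N ->
  Pmc.-integrable setT (EFin \o (fun t => (rule l nu t - double_mean nu l) ^+ 2)) /\
  EM (fun t => (rule l nu t - double_mean nu l) ^+ 2) <= 4 * (rule_const * Q) ^+ 2 * (2 ^- N) ^+ 4.
Proof.
move=> lnu; set K := rule_const * (2 ^- nu) ^+ 2 * (2 ^- l) ^+ 2 * Q.
have M0 : (0 < 2 ^ pts l nu)%N by rewrite expn_gt0.
have D0 := double_lipschitz_ge0; have hF := half_sum_lipschitz nu l.
have [i1 i2] := mc_variance (K := K) (m := double_mean nu l) (iid nu (pts l nu)) M0 D0 hF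
  (fun y Oy => half_sum_bound nu l Oy)
  (fun i => etrans (uniform_expectation_unique measurableT PM1 mO PO (uniform_coords_row (iid nu (pts l nu)) i)
     (uniform_coords_param PU _) D0 hF) (half_sum_mean nu l)).
have e t : (rule l nu t - double_mean nu l) ^+ 2 = (((2 ^ pts l nu)%N%:R)^-1 *
  \sum_(i < 2 ^ pts l nu) half_sum nu l (row l nu i t) - double_mean nu l) ^+ 2 by rewrite ruleE.
have ef : (fun t => (rule l nu t - double_mean nu l) ^+ 2) = (fun t => (((2 ^ pts l nu)%N%:R)^-1 *
  \sum_(i < 2 ^ pts l nu) half_sum nu l (row l nu i t) - double_mean nu l) ^+ 2) by apply/funext.
rewrite ef; split; first exact: i1.
apply: le_trans i2 _; apply: eq_le2; rewrite natrX /samples exprM.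
(* The inverse number of points is the fourth power of [2 ^- (N - l - nu)], which complements the
   factors [2 ^- nu] and [2 ^- l] of the integrand to [2 ^- N]. *)
rewrite (_ : (2 ^- N : R) = 2 ^- nu * 2 ^- l * 2 ^- (N - l - nu)); last first.
  by rewrite -!invfM -!exprD; congr (2 ^- _); rewrite -subnDA (addnC nu) subnKC.
rewrite (_ : ((2 : R) ^+ 4 ^+ (N - l - nu))^-1 = (2 ^- (N - l - nu)) ^+ 4); last by rewrite exprAC exprVn.
by rewrite /K; ring.
Qed.

Let bias := \sum_(l < N.+1) \sum_(nu < N.+1 | (l + nu <= N)%N) double_mean nu l -
  EP (fun w => pairing D g (u w)).
Let estimator t := \sum_(l < N.+1) \sum_(nu < N.+1 | (l + nu <= N)%N) rule l nu t.
Let spread t := \sum_(l < N.+1) \sum_(nu < N.+1 | (l + nu <= N)%N) (rule l nu t - double_mean nu l) ^+ 2.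

(** Pointwise in the sample: the square is split into bias and spread, and Cauchy-Schwarz over both
    indices gives [N.+1%:R ^+ 2]. No joint law of different rules enters. *)
Lemma estimator_error_sqr t : (EP (fun w => pairing D g (u w)) - estimator t) ^+ 2 <=
  2 * bias ^+ 2 + 2 * N.+1%:R ^+ 2 * spread t.
Proof.
pose y l nu := rule l nu t - double_mean nu l.
pose T := \sum_(l < N.+1) \sum_(nu < N.+1 | (l + nu <= N)%N) y l nu.
have -> : EP (fun w => pairing D g (u w)) - estimator t = - (bias + T).
  have eT : T = estimator t - \sum_(l < N.+1) \sum_(nu < N.+1 | (l + nu <= N)%N) double_mean nu l.
    by rewrite /T /estimator -sumrB; apply: eq_bigr => l _; rewrite -sumrB.
  rewrite eT /bias; exact: sub_decomp.
have T2 : T ^+ 2 <= N.+1%:R ^+ 2 * spread t.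
  have := sum_sqr_le N.+1 xpredT (fun l => \sum_(nu < N.+1 | (l + nu <= N)%N) y l nu).
  move=> hsum; apply: le_trans hsum _; rewrite expr2 -mulrA; apply: ler_wpM2l => //.
  rewrite mulr_sumr; apply: ler_sum => l _.
  exact: (sum_sqr_le N.+1 (fun nu => (l + nu <= N)%N) (fun nu => y l nu)).
rewrite sqrrN; move: T2; set s := spread t; move: (N.+1%:R ^+ 2) => q T2.
by have := sqr_ge0 (bias - T); rewrite -(mulrA 2); nra.
Qed.

Lemma measurable_estimator : measurable_fun setT estimator.
Proof.
apply: measurable_sum => l; rewrite (_ : (fun t => _) = fun t => \sum_(nu < N.+1)
  (if (l + nu <= N)%N then rule l nu t else 0)); last by apply/funext => t; rewrite big_mkcond.
apply: measurable_sum => nu; case: (l + nu <= N)%N; [exact: measurable_rule|exact: measurable_cst].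
Qed.

Definition total_const : R := 2 * (bias_const + 2 * rule_const + 1).

Lemma estimator_mean_square :
  (\int[Pmc]_t ((`|EP (fun w => pairing D g (u w)) - estimator t| ^+ 2)%:E) <=
   ((total_const * N.+1%:R ^+ 2 * 2 ^- (2 * N) * n2 f * n2 g) ^+ 2)%:E)%E.
Proof.
(* Setting the terms off the triangle to zero allows sums over the full ranges of both indices. *)
pose sq l nu t := if (l + nu <= N)%N then (rule l nu t - double_mean nu l) ^+ 2 else 0.
have iv l nu : Pmc.-integrable setT (EFin \o sq l nu).
  by rewrite /sq; case lnu: (l + nu <= N)%N; [exact: (rule_variance lnu).1|exact: (integrable_cst_fin measurableT PMoo 0)].
pose sp l t := \sum_(nu < N.+1) sq l nu t.
have spE : spread = fun t => \sum_(l < N.+1) sp l t.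
  by apply/funext => t; apply: eq_bigr => l _; rewrite big_mkcond.
have isp l : Pmc.-integrable setT (EFin \o sp l) by apply: int_sum => // nu _; exact: iv.
have ispr : Pmc.-integrable setT (EFin \o spread) by rewrite spE; apply: int_sum => // l _; exact: isp.
set V := 4 * (rule_const * Q) ^+ 2 * (2 ^- N) ^+ 4.
have Vpos : 0 <= V.
  have p0 : (0 : R) <= 2 ^- N by rewrite invr_ge0 exprn_ge0.
  exact: (mulr_ge0 (mulr_ge0 (ler0n _ 4) (sqr_ge0 _)) (exprn_ge0 4 p0)).
have emsq l nu : EM (sq l nu) <= V.
  rewrite /sq; case lnu: (l + nu <= N)%N; first exact: (rule_variance lnu).2.
  by rewrite (Rintegral_cst _ measurableT) mul0r.
have emV l : EM (sp l) <= N.+1%:R * V.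
  rewrite (Rintegral_sum measurableT _ (P := xpredT) (fun (nu : 'I_N.+1) _ => iv l nu)).
  apply: (@le_trans _ _ (\sum_(nu < N.+1) V)); last by rewrite sumr_const card_ord -[_ *+ _]mulr_natl.
  by apply: ler_sum => nu _; exact: emsq.
have ib := int_add measurableT (integrable_cst_fin measurableT PMoo (2 * bias ^+ 2))
  (int_scale measurableT (2 * N.+1%:R ^+ 2) ispr).
apply: (@le_trans _ _ (\int[Pmc]_t (2 * bias ^+ 2 + 2 * N.+1%:R ^+ 2 * spread t)%:E)%E).
  apply: ge0_le_integral => //.
  - apply/measurable_EFinP; apply: measurable_funX; apply: measurableT_comp => //.
    by apply: measurable_funB; [exact: measurable_cst|exact: measurable_estimator].
  - exact: (measurable_int Pmc ib).
  - by move=> t _; rewrite lee_fin real_normK ?num_real//; exact: estimator_error_sqr.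
have fin := integrable_fin_num measurableT ib.
have {fin}-> : (\int[Pmc]_t (2 * bias ^+ 2 + 2 * N.+1%:R ^+ 2 * spread t)%:E)%E =
  (EM (fun t => 2 * bias ^+ 2 + 2 * N.+1%:R ^+ 2 * spread t))%:E by rewrite /Rintegral fineK.
rewrite lee_fin.
apply: (@le_trans _ _ (2 * bias ^+ 2 + 2 * N.+1%:R ^+ 2 * (N.+1%:R ^+ 2 * V))).
  rewrite (RintegralD measurableT (integrable_cst_fin measurableT PMoo (2 * bias ^+ 2))
    (int_scale measurableT (2 * N.+1%:R ^+ 2) ispr)) (RintegralZl _ measurableT ispr).
  apply: lerD.
    rewrite (Rintegral_cst _ measurableT).
    have e : 2 * bias ^+ 2 * fine (Pmc setT) = 2 * bias ^+ 2 by rewrite PM1 mulr1.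
    exact: eq_le2 e.
  apply: ler_wpM2l; first by rewrite mulr_ge0 ?sqr_ge0.
  rewrite spE (Rintegral_sum measurableT _ (P := xpredT) (fun (l : 'I_N.+1) _ => isp l)).
  apply: (@le_trans _ _ (\sum_(l < N.+1) N.+1%:R * V)); first by apply: ler_sum => l _; exact: emV.
  by rewrite sumr_const card_ord -[_ *+ _]mulr_natl expr2 mulrA.
have hb : bias ^+ 2 <= (bias_const * N.+1%:R * ((2 ^- N) ^+ 2 * Q)) ^+ 2.
  have bN := bias_bound N; rewrite -/bias in bN.
  rewrite -[leLHS]real_normK ?num_real// ler_pXn2r ?nnegrE//.
    by rewrite mulrA; exact: bN.
  by rewrite mulrA; apply: le_trans bN.
have z0 : 0 <= (2 ^- N) ^+ 2 * Q := mulr_ge0 (sqr_ge0 _) Q0.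
have n1 : 1 <= N.+1%:R :> R by rewrite ler1n.
have hfin := mean_square_combine bias_const_ge0 rule_const_ge0 n1 z0 hb.
apply: le_trans (eq_le2 _) (le_trans hfin (eq_le2 _)).
  by rewrite /V; ring.
rewrite (_ : 2 ^- (2 * N) = (2 ^- N) ^+ 2 :> R); last by rewrite mulnC exprM exprVn.
by rewrite /total_const; ring.
Qed.

End monte_carlo_error.

End solutions.

End model.

(** * Computational cost *)

Section cost.
Context {R : realType}.

Lemma geometric_sum_le (rho : R) n : 0 <= rho < 1 ->
  \sum_(i < n) rho ^+ i <= (1 - rho)^-1.
Proof.
move=> /andP[rho0 rho1]; have r0 : 0 < 1 - rho by rewrite subr_gt0.
rewrite -[leRHS]mul1r ler_pdivlMr//.
have -> : (\sum_(i < n) rho ^+ i) * (1 - rho) = 1 - rho ^+ n.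
  elim: n => [|n IH]; first by rewrite big_ord0 mul0r expr0 subrr.
  by rewrite big_ord_recr/= mulrDl IH exprS; ring.
by rewrite gerBl exprn_ge0.
Qed.

(** For a base of at least [2] a geometric sum is at most twice its last term, here the one of
    exponent [N - p]; if [p] exceeds [N] the sum is empty. *)
Lemma geometric_head_le (a : R) p N : 2 <= a ->
  \sum_(k < N.+1 | (p + k <= N)%N) a ^+ k <= 2 * a ^+ N * a^-1 ^+ p.
Proof.
move=> a2; have a0 : 0 < a by apply: lt_le_trans a2.
have [pN|Np] := leqP p N; last first.
  rewrite big1 ?mulr_ge0 ?exprn_ge0 ?invr_ge0 ?(ltW a0)// => k hk.
  by have := leq_trans Np (leq_trans (leq_addr k p) hk); rewrite ltnn.
have -> : a ^+ N = a ^+ (N - p) * a ^+ p by rewrite -exprD subnK.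
rewrite exprVn -!mulrA divff ?mulr1; last by rewrite expf_neq0// gt_eqF.
rewrite (eq_bigl (fun k : 'I_N.+1 => (k < (N - p).+1)%N)); last first.
  by move=> k; rewrite ltnS leq_subRL.
rewrite -(big_ord_widen N.+1 (fun k => a ^+ k)) ?ltnS ?leq_subr//.
elim: (N - p)%N => [|n IH]; first by rewrite big_ord1 expr0 mulr1 ler1n.
rewrite big_ord_recr/=; apply: le_trans (lerD IH (lexx _)) _.
rewrite exprS; have : 0 <= a ^+ n by rewrite exprn_ge0// ltW.
by move: (a ^+ n) => y y0; nra.
Qed.

(** The index of the dominant base is summed first. The other two indices are then left with the
    ratios [x / a] and [y / a], both less than [1], whose geometric series are bounded in [N]. *)
Lemma simplex_sum_le (a x y : R) N : 2 <= a -> 0 <= x < a -> 0 <= y < a ->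
  \sum_(i < N.+1) \sum_(j < N.+1) \sum_(k < N.+1 | (i + j + k <= N)%N) x ^+ i * y ^+ j * a ^+ k
  <= 2 * (1 - x / a)^-1 * (1 - y / a)^-1 * a ^+ N.
Proof.
move=> a2 /andP[x0 xa] /andP[y0 ya]; have a0 : 0 < a by apply: lt_le_trans a2.
have hx : 0 <= x / a < 1 by rewrite divr_ge0 ?(ltW a0)//= ltr_pdivrMr// mul1r.
have hy : 0 <= y / a < 1 by rewrite divr_ge0 ?(ltW a0)//= ltr_pdivrMr// mul1r.
apply: (@le_trans _ _ (\sum_(i < N.+1) \sum_(j < N.+1) 2 * a ^+ N * ((x / a) ^+ i * (y / a) ^+ j))).
  apply: ler_sum => i _; apply: ler_sum => j _; rewrite -mulr_sumr.
  apply: le_trans (ler_wpM2l _ (geometric_head_le (i + j) N a2)) _.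
    by rewrite mulr_ge0 ?exprn_ge0.
  by rewrite !exprMn exprD; apply: eq_le2; ring.
under eq_bigr do rewrite -mulr_sumr -mulr_sumr.
rewrite -mulr_sumr -mulr_suml.
set s := \sum_(i < _) _; set t := \sum_(i < _) _.
have s0 : 0 <= s by apply: sumr_ge0 => i _; rewrite exprn_ge0//; case/andP: hx.
have t0 : 0 <= t by apply: sumr_ge0 => i _; rewrite exprn_ge0//; case/andP: hy.
have ss := geometric_sum_le N.+1 hx; have tt := geometric_sum_le N.+1 hy.
apply: le_trans (ler_wpM2l _ (ler_pM s0 t0 ss tt)) _; first by rewrite mulr_ge0// exprn_ge0// ltW.
by apply: eq_le2; ring.
Qed.

(** The three bases are [16] for the samples, at most [8] for the mesh, and [q = 2^s] for the
    dimension. As [s != 4], either [16] or [q] dominates strictly, so no factor polynomial in [N]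
    arises. *)
Lemma cost_model_le (d : nat) (r : R) : 1 < r -> (d <= 3)%N -> (r - 1)^-1 != 4 ->
  exists2 C : R, 0 <= C & forall N, cost_model d r N <= C * 2 `^ (Num.max 4 (r - 1)^-1 * N%:R).
Proof.
move=> r1 d3 s4; set s := (r - 1)^-1; pose q : R := 2 `^ s.
have q0 : 0 < q by rewrite powR_gt0.
have qn n : 2 `^ (n%:R / (r - 1)) = q ^+ n by rewrite -powR_mulrn ?powR_ge0// -powRrM mulrC.
have dq n : (dimension r n%:Z)%:R <= 2 * q ^+ n.
  have := dimension_lt r n; rewrite qn => /ltW h1; apply: le_trans h1 _.
  have : 1 <= q ^+ n by rewrite exprn_ege1// -(powRr0 2) ler_powR ?ler1n// invr_ge0 subr_ge0 ltW.
  by move: (q ^+ n) => z; lra.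
have e4 : (2 : R) `^ 4 = 16 by rewrite -[4]/(4%:R) powR_mulrn// -natrX.
have d8 : 2 ^+ d <= (8 : R).
  by rewrite (_ : 8 = 2 ^+ 3 :> R) ?ler_eXn2l ?ltr1n//; rewrite -natrX.
have hm N : cost_model d r N <= 2 * \sum_(j < N.+1) \sum_(l < N.+1) \sum_(nu < N.+1 | (j + l + nu <= N)%N)
    16 ^+ j * 8 ^+ l * q ^+ nu.
  rewrite mulr_sumr; apply: ler_sum => j _; rewrite mulr_sumr; apply: ler_sum => l _.
  rewrite mulr_sumr; apply: ler_sum => nu _.
  rewrite /samples !exprM (_ : (2 : R) ^+ 4 = 16); last by rewrite -natrX.
  rewrite [leRHS]mulrCA; apply: ler_pM => //; rewrite ?mulr_ge0 ?exprn_ge0 ?ler0n//.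
  apply: ler_wpM2l; first exact: exprn_ge0.
  by apply: lerXn2r; rewrite ?nnegrE ?exprn_ge0.
have ltr_powR2 (y z : R) : (2 `^ y < 2 `^ z) = (y < z).
  by rewrite /powR pnatr_eq0/= ltr_expR ltr_pM2r// ln_gt0// ltr1n.
have q16 : (q < 16) = (s < 4) by rewrite -e4 /q ltr_powR2.
have [lt4|le4] := ltP s 4.
- exists (2 * (2 * (1 - 8 / 16)^-1 * (1 - q / 16)^-1)).
    by rewrite !mulr_ge0 ?invr_ge0 ?subr_ge0 ?ler_pdivrMr ?mul1r ?ler_nat// ltW// q16.
  move=> N; apply: le_trans (hm N) _.
  rewrite powRrM e4 powR_mulrn//.
  rewrite -[leRHS]mulrA; apply: ler_wpM2l => //.
  apply: le_trans (@simplex_sum_le 16 8 q N _ _ _); rewrite ?ler_nat ?ltr_nat ?ler0n//=; last by rewrite (ltW q0) q16.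
  (* Here [16] dominates, so the index [j] of the samples has to be moved to the innermost sum. *)
  under eq_bigr do under eq_bigr do rewrite big_mkcond.
  rewrite exchange_big /=; apply: ler_sum => l _; rewrite exchange_big /=; apply: ler_sum => nu _.
  rewrite -big_mkcond /=; apply: eq_le2; apply: eq_big => j.
    by rewrite addnC (addnC j) addnA (addnC nu).
  by move=> _; ring.
have lt4 : 4 < s by rewrite lt_neqAle eq_sym s4.
have q16' : 16 < q by rewrite -e4 /q ltr_powR2.
exists (2 * (2 * (1 - 16 / q)^-1 * (1 - 8 / q)^-1)).
  rewrite !mulr_ge0 ?invr_ge0 ?subr_ge0 ?ler_pdivrMr ?mul1r ?(ltW q16')//.
  by apply: le_trans (ltW q16'); rewrite ler_nat.
move=> N; apply: le_trans (hm N) _.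
rewrite powRrM -/q powR_mulrn ?powR_ge0//.
rewrite -[leRHS]mulrA; apply: ler_wpM2l => //.
apply: simplex_sum_le; rewrite ?ler0n//=.
  by apply: le_trans (ltW q16'); rewrite ler_nat.
by apply: lt_trans q16'; rewrite ltr_nat.
Qed.

End cost.

Theorem mainTheorem2 (R : realType) (d : nat) (D : set 'rV[R]_d) (r : R)
    (phi : nat -> 'rV[R]_d -> R) (A : param R -> 'rV[R]_d -> R)
    (P : probability (param R) R) (Amin Amax Ckl Creg Capprox Cunif : R)
    (T : nat -> seq (set 'rV[R]_d)) (X : nat -> set ('rV[R]_d -> R))
    (h : nat -> R) (cost : nat -> R) :
  (* domain *)
  d = 2%N \/ d = 3%N ->
  bounded_lipschitz_domain D ->
  (* random coefficient *)
  product_uniform P ->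
  (forall j, Sobolev D 1 +oo%E (phi j)) ->
  (0 < ess_inf_on D (phi 0%N))%E ->
  is_coefficient_series D phi A ->
  (ess_sup P (fun w =>
       (normW1oo D (A w \- coefficient phi r A (Some nu) w))%:E)) @[nu --> \oo] --> (0 : \bar R)%E ->
  0 < Amin <= 1 ->
  (forall nu w, Omega w ->
     {ae lebesgue_rV R d, forall x, D x -> Amin <= coefficient phi r A nu w x <= Amax}) ->
  (forall nu w v, Omega w -> H10 D v ->
     Amin * normH1 D v ^+ 2 <= diffusion_form D (coefficient phi r A nu w) v v) ->
  (forall nu w v v', Omega w -> H10 D v -> H10 D v' ->
     `|diffusion_form D (coefficient phi r A nu w) v v'| <= Amax * normH1 D v * normH1 D v') ->
  (* H^2-regularity *)
  (forall f nu w, Lp D 2%:E f -> Omega w ->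
     exists u, [/\ galerkin_solution D (coefficient phi r A nu w) f (H10 D) u,
       Sobolev D 2 2%:E u &
       normH2 D u <=
         Creg * Amin ^- 2 * (1 + normW1oo D (coefficient phi r A nu w)) * normL2 D f]) ->
  (* finite elements *)
  (forall l, triangulation D (T l)) ->
  (forall l, refines (T l.+1) (T l)) ->
  (forall l, finite_element_space D (T l) (X l)) ->
  (forall l, X l `<=` X l.+1) ->
  (forall l, 0 < h l) ->
  {homo h : k l / (k <= l)%N >-> l <= k} ->
  h l @[l --> \oo] --> 0 ->
  0 < Cunif ->
  (forall l, Cunif * h l <= h l.+1) ->
  (forall l w, Sobolev D 2 2%:E w -> H10 D w ->
     inf [set normH1 D (w \- v) | v in X l] <= Capprox * h l * normH2 D w) ->
  (* assumptions of the theorem *)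
  1 < r ->
  (forall j, (0 < j)%N -> normW1oo D (phi j) <= Ckl * j%:R `^ (- r)) ->
  asymp_equiv h (fun l => 2 ^- l) ->
  asymp_equiv (fun l => (size (T l))%:R : R) (fun l => 2 ^+ (d * l)) ->
  asymp_equiv cost (cost_model d r) ->
  exists2 C : R, 0 < C &
    (forall (f g : 'rV[R]_d -> R)
        (u : param R -> 'rV[R]_d -> R)
        (U : nat -> nat -> param R -> 'rV[R]_d -> R)
        (disp : measure_display) (S : measurableType disp)
        (Pmc : probability S R)
        (x : nat -> nat -> nat -> nat -> {RV Pmc >-> R}),
      Lp D 2%:E f -> Lp D 2%:E g ->
      (forall w, Omega w -> galerkin_solution D (A w) f (H10 D) (u w)) ->
      (forall nu l w, Omega w ->
         galerkin_solution D (coefficient phi r A (Some nu) w) f (X l) (U nu l w)) ->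
      (forall nu m, iid_uniform (2 ^ m) (dimension r nu%:Z) (x nu m)) ->
      forall N : nat,
        let EGu := \int[P]_(w in @Omega R) pairing D g (u w) in
        let GN t := multi_index_estimator D r g U
                      (fun nu m i j => x nu m i j t) N in
        let EN := sqrte (\int[Pmc]_t ((`|EGu - GN t| ^+ 2)%:E))%E in
        (EN <= (C * N.+1%:R ^+ 2 * 2 ^- (2 * N) * normL2 D f * normL2 D g)%:E)%E)
    /\
    (* For [(r - 1)^-1 = 4] the sum in the cost model is of exact order
       [N.+1%:R * 2 ^+ (4 * N)] and the bound fails. *)
    ((r - 1)^-1 != 4 ->
     forall N : nat,
       cost N <=
         C * 2 `^ (Num.max (Num.max 4 d%:R) (r - 1)^-1 * N%:R)).
Proof.
move=> dE [_ oD _ bD _] PU sphi _ hA _ /andP[Amin0 _] _ coer bnd reg _ _ fe _ h0 _ _ _ _ approx r1 phi_decay.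
move=> [c1 [c2 [_ _ hle]]] _ [k1 [k2 [_ k20 costle]]].
have d3 : (d <= 3)%N by case: dE => ->.
have {}hle l : h l <= c2 * 2 ^- l by case/andP: (hle l).
have XV l : X l `<=` H10 D by case: (fe l).
have X0 l : X l (cst 0) by case: (fe l).
have Xl l a v w : X l v -> X l w -> X l (fun x => a * v x + w x) by case: (fe l) => _ _ H _; exact: H.
have {}hA w : Omega w -> Sobolev D 1 +oo%E (A w) /\
    normW1oo D (A w \- partial_coefficient phi n w) @[n --> \oo] --> 0.
  by move=> Ow; have [_ H1 H2] := hA w Ow.
pose K := total_const D r phi Amin Amax Ckl Creg Capprox c2.
have K0 : 0 <= K.
  have b0 := bias_const_ge0 Amax Creg Capprox c2 r1 phi_decay Amin0.
  have q0 := rule_const_ge0 Amax Creg Capprox c2 r1 phi_decay Amin0.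
  exact: (mulr_ge0 (ler0n R 2) (addr_ge0 (addr_ge0 b0 (mulr_ge0 (ler0n R 2) q0)) ler01)).
(* The constant [C] is fixed before it is known whether the cost bound is claimed; in the excluded
   case the implication is vacuous and [0] will do. *)
have [B B0 hB] : exists2 B : R, 0 <= B & (r - 1)^-1 != 4 ->
    forall N, cost_model d r N <= B * 2 `^ (Num.max 4 (r - 1)^-1 * N%:R).
  have [e|e] := eqVneq (r - 1)^-1 4; first by exists 0.
  by have [B B0 hB] := cost_model_le r1 d3 e; exists B.
(* [K] is for the error and [k2 * B] for the cost; the [1] makes the constant positive. *)
exists (K + k2 * B + 1); first by rewrite ltr_wpDl// addr_ge0// mulr_ge0// ltW.
split=> [f g u U disp S Pmc x lf lg su sU iid N|s4 N]; last first.
  have /andP[_ cN] := costle N; apply: le_trans cN _.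
  (* In dimension at most [3] the mesh exponent [d] never exceeds the sample exponent [4]. *)
  rewrite (max_l (_ : d%:R <= 4)); last by rewrite ler_nat (leq_trans d3).
  apply: le_trans (ler_wpM2l (ltW k20) (hB s4 N)) _; rewrite mulrA.
  by apply: ler_wpM2r; [exact: powR_ge0|rewrite addrAC lerDr addr_ge0].
cbv zeta; have main := estimator_mean_square oD bD r1 sphi phi_decay Amin0 coer bnd reg XV X0 Xl h0 hle approx
  ((Lp2P D f).1 lf) ((Lp2P D g).1 lg) su sU PU hA N iid.
set Z := K * N.+1%:R ^+ 2 * 2 ^- (2 * N) * normL2 D f * normL2 D g.
have nf := normL2_ge0 D f; have ng := normL2_ge0 D g.
have p0 : (0 : R) <= 2 ^- (2 * N) by rewrite invr_ge0 exprn_ge0.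
have Z0 : 0 <= Z := mulr_ge0 (mulr_ge0 (mulr_ge0 (mulr_ge0 K0 (sqr_ge0 _)) p0) nf) ng.
apply: (@le_trans _ _ Z%:E).
  have -> : Z%:E = sqrte (Z ^+ 2)%:E by rewrite /= sqrtr_sqr ger0_norm.
  by rewrite lee_sqrt; [exact: main|rewrite lee_fin sqr_ge0].
rewrite lee_fin.
apply: (ler_wpM2r ng); apply: (ler_wpM2r nf); apply: (ler_wpM2r p0); apply: (ler_wpM2r (sqr_ge0 _)).
by rewrite -addrA lerDl addr_ge0// mulr_ge0// ltW.
Qed.
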